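(* Let $\mathbf{k}$ be an algebraically closed field of characteristic zero, let $n$ be a positive integer and $d$ a positive square-free integer with $(n,d)=1$. Let $\mathcal{C}$ be a non-degenerate braided fusion category over $\mathbf{k}$ with $\mathrm{FPdim}(\mathcal{C})=nd$. Assume that $\mathcal{C}$ contains a Tannakian subcategory $\mathcal{E}=\mathrm{Rep}(G)$ ($G$ a finite group) such that there is a braided equivalence $\mathcal{C}_G^0\cong\mathcal{C}(\mathbb{Z}_d,q)\boxtimes\mathcal{A}$ for some non-degenerate quadratic form $q$ on $\mathbb{Z}_d$ and some braided fusion category $\mathcal{A}$, and assume moreover that $(\mathrm{FPdim}(V)^2,d)=1$ for every simple object $V$ of $\mathcal{C}$. Then $\mathcal{C}$ contains $\mathcal{C}(\mathbb{Z}_d,q)$ as a braided fusion subcategory and $\mathcal{C}\cong\mathcal{C}(\mathbb{Z}_d,q)\boxtimes\mathcal{C}(\mathbb{Z}_d,q)'_{\mathcal{C}}$ as braided fusion categories.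
   Context: For a fusion subcategory $\mathcal{D}$ of a braided fusion category $\mathcal{C}$ with braiding $c$, the centralizer $\mathcal{D}'_{\mathcal{C}}$ is the fusion subcategory generated by the simple objects $Y$ of $\mathcal{C}$ with $c_{Y,X}c_{X,Y}=\mathrm{id}_{X\otimes Y}$ for all simple $X\in\mathcal{D}$; $\mathcal{C}$ is non-degenerate if $\mathcal{C}'_{\mathcal{C}}=\mathrm{Vec}$. $\mathrm{FPdim}(X)$ is the Frobenius-Perron dimension, and $\mathrm{FPdim}(\mathcal{C})=\sum_X \mathrm{FPdim}(X)^2$ over isomorphism classes of simple objects. Since $\mathrm{FPdim}(\mathcal{C})$ is an integer here, each $\mathrm{FPdim}(V)^2$, $V$ simple, is an integer, and $(a,b)$ denotes the greatest common divisor. A Tannakian subcategory is a fusion subcategory braided equivalent to $\mathrm{Rep}(G)$ (with its standard symmetric braiding) for a finite group $G$. Given $\mathcal{E}=\mathrm{Rep}(G)\subseteq\mathcal{C}$, the de-equivariantization $\mathcal{C}_G$ is the category of modules in $\mathcal{C}$ over the regular algebra $\mathrm{Fun}(G)\in\mathrm{Rep}(G)$; it is a $G$-crossed braided fusion category, whose trivial component $\mathcal{C}_G^0\cong(\mathcal{E}'_{\mathcal{C}})_G$ (the de-equivariantization of the centralizer $\mathcal{E}'_{\mathcal{C}}$ by $\mathcal{E}$) is a braided fusion category. $\mathbb{Z}_d=\mathbb{Z}/d$. For a finite abelian group $B$ with a non-degenerate quadratic form $q:B\to\mathbf{k}^*$ (a metric group), $\mathcal{C}(B,q)$ denotes the corresponding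 pointed non-degenerate braided fusion category (simple objects labelled by $B$, self-braiding of $b$ equal to $q(b)$). $\boxtimes$ is the Deligne tensor product. *)

(* Defs.v *)
From HB Require Import structures.
From Stdlib Require Import ClassicalEpsilon.
From mathcomp Require Import all_boot all_order all_algebra all_fingroup.
From mathcomp Require Import all_solvable all_field all_character.
From mathcomp Require Import mxtens.

Set Implicit Arguments.
Unset Strict Implicit.
Unset Printing Implicit Defensive.

Import Order.TTheory GRing.Theory Num.Theory.
Local Open Scope ring_scope.

(* The operations of a k-linear braided monoidal category with
   finite-dimensional morphism spaces.  The axioms are kept apart, in
   [braided_fusion] below, so that concrete categories can be presented by
   their operations alone. *)
Record bmcat (k : fieldType) : Type := BMCat {
  obj :> Type;
  mor : obj -> obj -> vectType k;
  idm : forall X, mor X X;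
  comp : forall X Y Z, mor Y Z -> mor X Y -> mor X Z;
  one : obj;
  ten : obj -> obj -> obj;
  tenm : forall X X' Y Y', mor X X' -> mor Y Y' -> mor (ten X Y) (ten X' Y');
  assoc : forall X Y Z, mor (ten (ten X Y) Z) (ten X (ten Y Z));
  lunit : forall X, mor (ten one X) X;
  runit : forall X, mor (ten X one) X;
  braid : forall X Y, mor (ten X Y) (ten Y X)
}.

Arguments mor {k} C X Y : rename.
Arguments idm {k C} X : rename.
Arguments comp {k C X Y Z} g f : rename.
Arguments one {k} C : rename.
Arguments ten {k C} X Y : rename.
Arguments tenm {k C X X' Y Y'} f g : rename.
Arguments assoc {k C} X Y Z : rename.
Arguments lunit {k C} X : rename.
Arguments runit {k C} X : rename.
Arguments braid {k C} X Y : rename.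

Declare Scope cat_scope.
Delimit Scope cat_scope with cat.
Notation "g \oc f" := (comp g f) (at level 45, right associativity) : cat_scope.
Notation "X \ox Y" := (ten X Y) (at level 40, left associativity) : cat_scope.
Notation "f \om g" := (tenm f g) (at level 40, left associativity) : cat_scope.
Local Open Scope cat_scope.

Section Linear.
Context (k : fieldType) (C : bmcat k).
Implicit Types X Y Z : C.

Definition inverse_of X Y (f : mor C X Y) (g : mor C Y X) : Prop :=
  g \oc f = idm X /\ f \oc g = idm Y.
Definition is_iso X Y (f : mor C X Y) : Prop := exists g, inverse_of f g.
Definition isomorphic X Y : Prop := exists f : mor C X Y, is_iso f.

Definition is_mono X Y (f : mor C X Y) : Prop :=
  forall Z (u v : mor C Z X), f \oc u = f \oc v -> u = v.
Definition is_epi X Y (f : mor C X Y) : Prop :=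
  forall Z (u v : mor C Y Z), u \oc f = v \oc f -> u = v.

Definition is_kernel X Y K (f : mor C X Y) (i : mor C K X) : Prop :=
  f \oc i = 0 /\
  forall Z (h : mor C Z X), f \oc h = 0 -> exists! g : mor C Z K, i \oc g = h.
Definition is_cokernel X Y Q (f : mor C X Y) (p : mor C Y Q) : Prop :=
  p \oc f = 0 /\
  forall Z (h : mor C Y Z), h \oc f = 0 -> exists! g : mor C Q Z, g \oc p = h.
Definition is_coequalizer X Y Q (u v : mor C X Y) (p : mor C Y Q) : Prop :=
  p \oc u = p \oc v /\
  forall Z (h : mor C Y Z), h \oc u = h \oc v ->
    exists! g : mor C Q Z, g \oc p = h.

(* X is the direct sum of the S a; for n = 0 this says that X is a zero
   object. *)
Definition is_dsum n (S : 'I_n -> C) X : Prop :=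
  exists (i : forall a, mor C (S a) X) (p : forall a, mor C X (S a)),
    [/\ forall a, p a \oc i a = idm (S a),
        forall a b, a != b -> p b \oc i a = 0
      & \sum_a (i a \oc p a) = idm X].

Definition simple_obj X : Prop :=
  idm X <> 0 /\
  forall Y (f : mor C Y X), is_mono f -> f = 0 \/ is_iso f.

Definition simple_enum n (S : 'I_n -> C) : Prop :=
  [/\ forall a, simple_obj (S a),
      forall a b, isomorphic (S a) (S b) -> a = b
    & forall X, simple_obj X -> exists a, isomorphic X (S a)].

(* Y is a left dual of X (equivalently X is a right dual of Y). *)
Definition left_dual X Y : Prop :=
  exists (ev : mor C (Y \ox X) (one C)) (coev : mor C (one C) (X \ox Y))
         (ainv : mor C (Y \ox (X \ox Y)) (Y \ox X \ox Y)),
    [/\ inverse_of (assoc Y X Y) ainv,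
        runit X \oc (idm X \om ev) \oc assoc X Y X \oc (coev \om idm X)
          = lunit X
      & lunit Y \oc (ev \om idm Y) \oc ainv \oc (idm Y \om coev) = runit Y].

Record linear_category : Prop := {
  comp_idl : forall X Y (f : mor C X Y), idm Y \oc f = f;
  comp_idr : forall X Y (f : mor C X Y), f \oc idm X = f;
  comp_assoc : forall X Y Z T (h : mor C Z T) (g : mor C Y Z) (f : mor C X Y),
    (h \oc g) \oc f = h \oc (g \oc f);
  comp_linl : forall X Y Z (a : k) (g g' : mor C Y Z) (f : mor C X Y),
    (a *: g + g') \oc f = a *: (g \oc f) + g' \oc f;
  comp_linr : forall X Y Z (a : k) (g : mor C Y Z) (f f' : mor C X Y),
    g \oc (a *: f + f') = a *: (g \oc f) + g \oc f'
}.

Record abelian_category : Prop := {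
  has_dsums : forall n (S : 'I_n -> C), exists X, is_dsum S X;
  has_kernels : forall X Y (f : mor C X Y), exists K (i : mor C K X),
    is_kernel f i;
  has_cokernels : forall X Y (f : mor C X Y), exists Q (p : mor C Y Q),
    is_cokernel f p;
  mono_normal : forall X Y (f : mor C X Y), is_mono f ->
    exists Z (g : mor C Y Z), is_kernel g f;
  epi_normal : forall X Y (f : mor C X Y), is_epi f ->
    exists Z (g : mor C Z X), is_cokernel g f
}.

Record monoidal : Prop := {
  tenm_id : forall X Y, idm X \om idm Y = idm (X \ox Y);
  tenm_comp : forall X X' X'' Y Y' Y''
    (f' : mor C X' X'') (f : mor C X X') (g' : mor C Y' Y'') (g : mor C Y Y'),
    (f' \oc f) \om (g' \oc g) = (f' \om g') \oc (f \om g);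
  tenm_linl : forall X X' Y Y' (a : k) (f f' : mor C X X') (g : mor C Y Y'),
    (a *: f + f') \om g = a *: (f \om g) + f' \om g;
  tenm_linr : forall X X' Y Y' (a : k) (f : mor C X X') (g g' : mor C Y Y'),
    f \om (a *: g + g') = a *: (f \om g) + f \om g';
  assoc_iso : forall X Y Z, is_iso (assoc X Y Z);
  lunit_iso : forall X, is_iso (lunit X);
  runit_iso : forall X, is_iso (runit X);
  assoc_nat : forall X X' Y Y' Z Z'
    (f : mor C X X') (g : mor C Y Y') (h : mor C Z Z'),
    assoc X' Y' Z' \oc (f \om g \om h) = (f \om (g \om h)) \oc assoc X Y Z;
  lunit_nat : forall X X' (f : mor C X X'),
    lunit X' \oc (idm (one C) \om f) = f \oc lunit X;
  runit_nat : forall X X' (f : mor C X X'),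
    runit X' \oc (f \om idm (one C)) = f \oc runit X;
  pentagon : forall X Y Z T,
    assoc X Y (Z \ox T) \oc assoc (X \ox Y) Z T
      = (idm X \om assoc Y Z T) \oc assoc X (Y \ox Z) T
          \oc (assoc X Y Z \om idm T);
  triangle : forall X Y,
    (idm X \om lunit Y) \oc assoc X (one C) Y = runit X \om idm Y
}.

Record braided : Prop := {
  braid_iso : forall X Y, is_iso (braid X Y);
  braid_nat : forall X X' Y Y' (f : mor C X X') (g : mor C Y Y'),
    braid X' Y' \oc (f \om g) = (g \om f) \oc braid X Y;
  hexagon : forall X Y Z,
    assoc Y Z X \oc braid X (Y \ox Z) \oc assoc X Y Z
      = (idm Y \om braid X Z) \oc assoc Y X Z \oc (braid X Y \om idm Z);
  hexagon_inv : forall X Y Z (ainv : mor C (X \ox (Z \ox Y)) (X \ox Z \ox Y)),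
    inverse_of (assoc X Z Y) ainv ->
    braid (X \ox Y) Z
      = assoc Z X Y \oc (braid X Z \om idm Y) \oc ainv
          \oc (idm X \om braid Y Z) \oc assoc X Y Z
}.

Record braided_fusion : Prop := {
  bf_linear : linear_category;
  bf_abelian : abelian_category;
  bf_monoidal : monoidal;
  bf_braided : braided;
  bf_rigid : forall X,
    (exists Y, left_dual X Y) /\ (exists Y, left_dual Y X);
  bf_semisimple : forall X, exists n (S : 'I_n -> C),
    (forall a, simple_obj (S a)) /\ is_dsum S X;
  bf_finite : exists n (S : 'I_n -> C), simple_enum S;
  bf_one : simple_obj (one C)
}.

(* A chosen complete list of representatives of the simple objects; the value
   is meaningful as soon as there is one. *)
Definition simples : {n & 'I_n -> C} :=
  epsilon (inhabits (existT (fun n => 'I_n -> C) 1%N (fun=> one C)))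
          (fun s => simple_enum (projT2 s)).
Definition nsimples : nat := projT1 simples.
Definition simp : 'I_nsimples -> C := projT2 simples.

(* Matrix of left multiplication by X on the Grothendieck ring, in the basis
   of simple objects: S occurs in Y with multiplicity dim Hom(S, Y), the field
   k being algebraically closed in all uses. *)
Definition fusion_mx X : 'M[algC]_nsimples :=
  \matrix_(a, b) (\dim {: mor C (simp a) (X \ox simp b)})%:R.

(* The largest nonnegative real eigenvalue of the fusion matrix; in algC,
   0 <= z means that z is real and nonnegative. *)
Definition FPdim X : algC :=
  \big[Num.max/0]_(z <- sval (closed_field_poly_normal
                               (char_poly (fusion_mx X))) | 0 <= z) z.
Definition FPdim_cat : algC := \sum_a FPdim (simp a) ^+ 2.

Record is_fusion_subcat (S : C -> Prop) : Prop := {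
  fsub_one : S (one C);
  fsub_ten : forall X Y, S X -> S Y -> S (X \ox Y);
  fsub_dsum : forall n (T : 'I_n -> C) X,
    (forall a, S (T a)) -> is_dsum T X -> S X;
  fsub_retract : forall X Y (i : mor C Y X) (p : mor C X Y),
    p \oc i = idm Y -> S X -> S Y;
  fsub_dual : forall X Y, left_dual X Y -> (S X <-> S Y)
}.

(* Fusion subcategories are full and replete, hence given by their objects. *)
Record fusion_subcat : Type := FusionSubcat {
  fsub_mem :> C -> Prop;
  fsubP : is_fusion_subcat fsub_mem
}.

Definition generated_mem (P : C -> Prop) X : Prop :=
  forall S : fusion_subcat, (forall Y, P Y -> S Y) -> S X.

Lemma generatedP (P : C -> Prop) : is_fusion_subcat (generated_mem P).
Proof.
split=> [S _|X Y gX gY S PS|n T X gT dT S PS|X Y i p pi gX S PS|X Y XY].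
- exact: fsub_one (fsubP S).
- by apply: (fsub_ten (fsubP S)); [apply: gX | apply: gY].
- by apply: (fsub_dsum (fsubP S)) dT => a; apply: gT.
- by apply: (fsub_retract (fsubP S) pi); apply: gX.
- by split=> gX S PS; have := gX S PS; have [] := fsub_dual (fsubP S) XY; auto.
Qed.

Definition generated (P : C -> Prop) : fusion_subcat :=
  FusionSubcat (generatedP P).

Definition centralizes X Y : Prop := braid Y X \oc braid X Y = idm (X \ox Y).

Definition centralizer (D : fusion_subcat) : fusion_subcat :=
  generated (fun Y => simple_obj Y /\
                      forall X, D X -> simple_obj X -> centralizes X Y).

Definition whole : fusion_subcat :=
  @FusionSubcat (fun=> True)
    (Build_is_fusion_subcat I (fun _ _ _ _ => I) (fun _ _ _ _ _ => I)
       (fun _ _ _ _ _ _ => I) (fun _ _ _ => conj (fun=> I) (fun=> I))).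

(* The finite direct sums of copies of the unit object, that is, Vec. *)
Definition in_Vec X : Prop := exists n, is_dsum (fun _ : 'I_n => one C) X.

Definition nondegenerate_cat : Prop := forall X, centralizer whole X <-> in_Vec X.

End Linear.

Definition subcat (k : fieldType) (C : bmcat k) (D : fusion_subcat C) : bmcat k := {|
  obj := {X : C | D X};
  mor := fun X Y => mor C (sval X) (sval Y);
  idm := fun X => idm (sval X);
  comp := fun X Y Z g f => @comp k C (sval X) (sval Y) (sval Z) g f;
  one := exist _ (one C) (fsub_one (fsubP D));
  ten := fun X Y => exist _ (sval X \ox sval Y)
                      (fsub_ten (fsubP D) (svalP X) (svalP Y));
  tenm := fun X X' Y Y' f g =>
    @tenm k C (sval X) (sval X') (sval Y) (sval Y') f g;
  assoc := fun X Y Z => assoc (sval X) (sval Y) (sval Z);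
  lunit := fun X => lunit (sval X);
  runit := fun X => runit (sval X);
  braid := fun X Y => braid (sval X) (sval Y)
|}.

Record bfunctor (k : fieldType) (C D : bmcat k) : Type := BFunctor {
  fob :> C -> D;
  fmap : forall X Y, mor C X Y -> mor D (fob X) (fob Y);
  fmu : forall X Y, mor D (fob X \ox fob Y) (fob (X \ox Y));
  feps : mor D (one D) (fob (one C));
  fmap_linear : forall X Y (a : k) (f g : mor C X Y),
    fmap (a *: f + g) = a *: fmap f + fmap g;
  fmap_id : forall X, fmap (idm X) = idm (fob X);
  fmap_comp : forall X Y Z (g : mor C Y Z) (f : mor C X Y),
    fmap (g \oc f) = fmap g \oc fmap f;
  fmu_iso : forall X Y, is_iso (fmu X Y);
  feps_iso : is_iso feps;
  fmu_nat : forall X X' Y Y' (f : mor C X X') (g : mor C Y Y'),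
    fmap (f \om g) \oc fmu X Y = fmu X' Y' \oc (fmap f \om fmap g);
  fmu_assoc : forall X Y Z,
    fmap (assoc X Y Z) \oc fmu (X \ox Y) Z \oc (fmu X Y \om idm (fob Z))
      = fmu X (Y \ox Z) \oc (idm (fob X) \om fmu Y Z)
          \oc assoc (fob X) (fob Y) (fob Z);
  fmu_lunit : forall X,
    fmap (lunit X) \oc fmu (one C) X \oc (feps \om idm (fob X))
      = lunit (fob X);
  fmu_runit : forall X,
    fmap (runit X) \oc fmu X (one C) \oc (idm (fob X) \om feps)
      = runit (fob X);
  fmu_braid : forall X Y,
    fmap (braid X Y) \oc fmu X Y = fmu Y X \oc braid (fob X) (fob Y)
}.

Arguments fmap {k C D} F {X Y} f : rename.
Arguments fmu {k C D} F X Y : rename.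
Arguments feps {k C D} F : rename.

Definition is_equivalence (k : fieldType) (C D : bmcat k)
    (F : bfunctor C D) : Prop :=
  (forall X Y : C, bijective (@fmap k C D F X Y)) /\
  (forall Y : D, exists X : C, isomorphic (F X) Y).

Definition braided_equivalent (k : fieldType) (C D : bmcat k) : Prop :=
  exists F : bfunctor C D, is_equivalence F.

Section RepG.
Context (k : fieldType) (gT : finGroupType) (G : {group gT}).

(* Representations act on row vectors on the right, so the composite of
   f : 'M_(m, n) followed by g : 'M_(n, p) is f *m g. *)
Record rep := Rep { rdim : nat; rmx :> mx_representation k G rdim }.

Definition intertw (V W : rep) : {vspace 'M[k]_(rdim V, rdim W)} :=
  (\bigcap_(g in G) lker (linfun (mulmx (V g) \- mulmxr (W g))))%VS.

Lemma intertwP (V W : rep) (f : 'M[k]_(rdim V, rdim W)) :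
  reflect {in G, forall g, V g *m f = f *m W g} (f \in intertw V W).
Proof.
apply: (iffP idP) => [fI g Gg | fI].
  have sub: (intertw V W <= lker (linfun (mulmx (V g) \- mulmxr (W g))))%VS.
    by apply: (bigcapv_inf g Gg); apply: subvv.
  by have := subvP sub f fI; rewrite memv_ker lfunE /= subr_eq0 => /eqP.
rewrite memvE; apply/subv_bigcapP => g Gg; rewrite -memvE memv_ker lfunE /=.
by rewrite fI ?subrr.
Qed.

Lemma rep_one_subproof : mx_repr G (fun _ : gT => 1%:M : 'M[k]_1).
Proof. by split=> // x y _ _; rewrite mulmx1. Qed.
Definition rep_one : rep := Rep (MxRepresentation rep_one_subproof).

Lemma rep_ten_subproof (V W : rep) :
  mx_repr G (fun g => V g *t W g).
Proof.
split=> [|x y Gx Gy]; last by rewrite !repr_mxM // tensmx_mul.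
rewrite !repr_mx1; apply/matrixP=> i j; rewrite !mxE -natrM mulnb.
by rewrite -xpair_eqE -!surjective_pairing (can_eq (@mxtens_unindexK _ _)).
Qed.
Definition rep_ten (V W : rep) : rep :=
  Rep (MxRepresentation (rep_ten_subproof V W)).

Local Notation ui := (@mxtens_unindex _ _).

(* The matrices of the maps (u * v) * w |-> u * (v * w), 1 * v |-> v,
   v * 1 |-> v and u * v |-> v * u on basis vectors. *)
Definition assoc_mx a b c : 'M[k]_(a * b * c, a * (b * c)) :=
  \matrix_(i, j) ((ui (ui i).1, (ui i).2)
    == ((ui j).1, (ui (ui j).2).1, (ui (ui j).2).2))%:R.
Definition lunit_mx a : 'M[k]_(1 * a, a) := \matrix_(i, j) ((ui i).2 == j)%:R.
Definition runit_mx a : 'M[k]_(a * 1, a) := \matrix_(i, j) ((ui i).1 == j)%:R.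
Definition braid_mx a b : 'M[k]_(a * b, b * a) :=
  \matrix_(i, j) (ui i == ((ui j).2, (ui j).1))%:R.

Definition mul_mx n : 'M[k]_(n * n, n) :=
  \matrix_(i, j) (ui i == (j, j))%:R.

(* [vsproj] is the identity here: each matrix below is an intertwiner, see the
   [..._mxP] lemmas. *)
Definition RepG : bmcat k := {|
  obj := rep;
  mor := fun V W => subvs_of (intertw V W);
  idm := fun V => vsproj (intertw V V) 1%:M;
  comp := fun U V W g f => vsproj (intertw U W) (vsval f *m vsval g);
  one := rep_one;
  ten := rep_ten;
  tenm := fun V V' W W' f g =>
    vsproj (intertw (rep_ten V W) (rep_ten V' W')) (vsval f *t vsval g);
  assoc := fun U V W =>
    vsproj (intertw (rep_ten (rep_ten U V) W) (rep_ten U (rep_ten V W)))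
           (assoc_mx _ _ _);
  lunit := fun V => vsproj (intertw (rep_ten rep_one V) V) (lunit_mx _);
  runit := fun V => vsproj (intertw (rep_ten V rep_one) V) (runit_mx _);
  braid := fun V W => vsproj (intertw (rep_ten V W) (rep_ten W V)) (braid_mx _ _)
|}.

(* The regular algebra Fun(G): the basis vector of index i is the indicator
   function of the i-th element of G, and G acts by translation. *)
Definition FunG : RepG := Rep (regular_repr k G).
Definition FunG_mul : mor RepG (FunG \ox FunG) FunG :=
  vsproj (intertw (rep_ten FunG FunG) FunG) (mul_mx _).
Definition FunG_unit : mor RepG (one RepG) FunG :=
  vsproj (intertw rep_one FunG) (const_mx 1).
End RepG.

Section RepGTheory.
Context (k : fieldType) (gT : finGroupType) (G : {group gT}).
Local Notation ix a b := (mxtens_index (a, b)).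
Local Notation d a b := (((a == b)%:R) : k).


Lemma ui1 m n (a : 'I_m) (b : 'I_n) : (mxtens_unindex (ix a b)).1 = a.
Proof. by rewrite mxtens_indexK. Qed.
Lemma ui2 m n (a : 'I_m) (b : 'I_n) : (mxtens_unindex (ix a b)).2 = b.
Proof. by rewrite mxtens_indexK. Qed.
Definition uiE := (ui1, ui2, mxtens_indexK).

Lemma sum_mxtens m n (F : 'I_(m * n) -> k) :
  \sum_i F i = \sum_a \sum_b F (ix a b).
Proof.
rewrite pair_big (reindex (@mxtens_index m n)) /=; first by apply: eq_bigr; case.
by exists (@mxtens_unindex m n) => i _; rewrite ?mxtens_unindexK ?mxtens_indexK.
Qed.

Lemma sum_deltal n (x : 'I_n) (F : 'I_n -> k) : \sum_a d x a * F a = F x.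
Proof.
rewrite (bigD1 x) //= eqxx mul1r big1 ?addr0 // => a /negPf.
by rewrite eq_sym => ->; rewrite mul0r.
Qed.

Lemma sum_deltar n (x : 'I_n) (F : 'I_n -> k) : \sum_a F a * d a x = F x.
Proof. by under eq_bigr do rewrite mulrC eq_sym; rewrite sum_deltal. Qed.

Lemma bij_mx m n (f : 'M[k]_(m, n)) phi psi :
    cancel psi phi -> (forall i j, f i j = d i (phi j)) -> cancel phi psi ->
  (forall p (A : 'M_(p, m)) i j, (A *m f) i j = A i (phi j)) /\
  (forall p (B : 'M_(n, p)) i j, (f *m B) i j = B (psi i) j).
Proof.
move=> psiK fE phiK; split=> p A i j; rewrite mxE.
  by under eq_bigr do rewrite fE; rewrite sum_deltar.
under eq_bigr do rewrite fE -(can_eq psiK) phiK.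
by rewrite sum_deltal.
Qed.

Lemma assoc_mx_bij a b c :
  (forall p (A : 'M_(p, a * b * c)) i x y z,
     (A *m assoc_mx k a b c) i (ix x (ix y z)) = A i (ix (ix x y) z)) /\
  (forall p (B : 'M_(a * (b * c), p)) x y z j,
     (assoc_mx k a b c *m B) (ix (ix x y) z) j = B (ix x (ix y z)) j).
Proof.
pose phi (j : 'I_(a * (b * c))) : 'I_(a * b * c) :=
  let p := mxtens_unindex j in let q := mxtens_unindex p.2 in ix (ix p.1 q.1) q.2.
pose psi (i : 'I_(a * b * c)) : 'I_(a * (b * c)) :=
  let p := mxtens_unindex i in let q := mxtens_unindex p.1 in ix q.1 (ix q.2 p.2).
have phiK : cancel phi psi.
  move=> j; case: j / (mxtens_indexP j) => x j; case: j / (mxtens_indexP j) => y z.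
  by rewrite /phi /psi !uiE.
have psiK : cancel psi phi.
  move=> j; case: j / (mxtens_indexP j) => j z; case: j / (mxtens_indexP j) => x y.
  by rewrite /phi /psi !uiE.
have [i j|Ar Bl] := bij_mx psiK _ phiK (f := assoc_mx k a b c).
  rewrite mxE; congr (_%:R); rewrite -(can_eq psiK) phiK.
  case: i / (mxtens_indexP i) => i z; case: i / (mxtens_indexP i) => x y.
  case: j / (mxtens_indexP j) => x' j; case: j / (mxtens_indexP j) => y' z'.
  rewrite /psi !uiE !(can_eq (@mxtens_indexK _ _)) !xpair_eqE.
  by rewrite (can_eq (@mxtens_indexK _ _)) xpair_eqE andbA.
split=> [p A i x y z | p B x y z j]; rewrite ?Ar ?Bl; congr (_ _ _).
  by rewrite /phi !uiE.
by rewrite /psi !uiE.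
Qed.

Lemma assoc_mxP (U V W : rep k G) :
  assoc_mx k _ _ _
    \in intertw (rep_ten (rep_ten U V) W) (rep_ten U (rep_ten V W)).
Proof.
apply/intertwP => g _; apply/matrixP => i j.
case: i / (mxtens_indexP i) => i z; case: i / (mxtens_indexP i) => x y.
case: j / (mxtens_indexP j) => x' j; case: j / (mxtens_indexP j) => y' z'.
have [Ar Bl] := assoc_mx_bij (rdim U) (rdim V) (rdim W).
by rewrite Ar Bl /= !tensmxE mulrA.
Qed.

Lemma lunit_mxr a p (A : 'M_(p, 1 * a)) i x :
  (A *m lunit_mx k a) i x = A i (ix ord0 x).
Proof.
rewrite mxE sum_mxtens big_ord1.
by under eq_bigr do rewrite [lunit_mx _ _ _ _]mxE uiE; rewrite sum_deltar.
Qed.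
Lemma lunit_mxl a p (B : 'M_(a, p)) o x j :
  (lunit_mx k a *m B) (ix o x) j = B x j.
Proof.
by rewrite mxE; under eq_bigr do rewrite [lunit_mx _ _ _ _]mxE uiE;
   rewrite sum_deltal.
Qed.

Lemma lunit_mxP (V : rep k G) :
  lunit_mx k _ \in intertw (rep_ten (rep_one k G) V) V.
Proof.
apply/intertwP => g _; apply/matrixP => i j.
case: i / (mxtens_indexP i) => o x.
by rewrite lunit_mxr lunit_mxl /= tensmxE !ord1 !mxE mul1r.
Qed.

Lemma runit_mxE a (x : 'I_a) o x' : runit_mx k a (ix x o) x' = d x x'.
Proof. by rewrite mxE uiE. Qed.

Lemma runit_mxP (V : rep k G) :
  runit_mx k _ \in intertw (rep_ten V (rep_one k G)) V.
Proof.
apply/intertwP => g _; apply/matrixP => i j.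
case: i / (mxtens_indexP i) => x o; rewrite !mxE sum_mxtens.
under eq_bigr => a _ do rewrite big_ord1 runit_mxE.
under [RHS]eq_bigr => a _ do rewrite runit_mxE.
by rewrite sum_deltar sum_deltal /= tensmxE !ord1 !mxE mulr1.
Qed.

Lemma braid_mx_bij a b :
  (forall p (A : 'M_(p, a * b)) i x y,
     (A *m braid_mx k a b) i (ix y x) = A i (ix x y)) /\
  (forall p (B : 'M_(b * a, p)) x y j,
     (braid_mx k a b *m B) (ix x y) j = B (ix y x) j).
Proof.
pose phi a b (j : 'I_(b * a)) : 'I_(a * b) :=
  let p := mxtens_unindex j in ix p.2 p.1.
have phiK c e : cancel (phi c e) (phi e c).
  by move=> j; case: j / (mxtens_indexP j) => x y; rewrite /phi !uiE.
have [i j|Ar Bl] := bij_mx (phiK b a) _ (phiK a b) (f := braid_mx k a b).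
  rewrite mxE; congr (_%:R).
  case: i / (mxtens_indexP i) => x y; case: j / (mxtens_indexP j) => y' x'.
  by rewrite /phi !uiE (can_eq (@mxtens_indexK _ _)).
split=> [p A i x y | p B x y j]; rewrite ?Ar ?Bl; congr (_ _ _);
  by rewrite /phi !uiE.
Qed.

Lemma braid_mxP (V W : rep k G) :
  braid_mx k _ _ \in intertw (rep_ten V W) (rep_ten W V).
Proof.
apply/intertwP => g _; apply/matrixP => i j.
case: i / (mxtens_indexP i) => x y; case: j / (mxtens_indexP j) => y' x'.
have [Ar Bl] := braid_mx_bij (rdim V) (rdim W).
by rewrite Ar Bl /= !tensmxE mulrC.
Qed.

Lemma idm_mxP (V : rep k G) : 1%:M \in intertw V V.
Proof. by apply/intertwP => g _; rewrite mulmx1 mul1mx. Qed.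

Lemma comp_mxP (U V W : rep k G) f g :
  f \in intertw U V -> g \in intertw V W -> f *m g \in intertw U W.
Proof.
move=> /intertwP fP /intertwP gP; apply/intertwP => x Gx.
by rewrite mulmxA fP // -!mulmxA gP.
Qed.

Lemma tens_mxP (V V' W W' : rep k G) f g :
  f \in intertw V V' -> g \in intertw W W' ->
  f *t g \in intertw (rep_ten V W) (rep_ten V' W').
Proof.
by move=> /intertwP fP /intertwP gP; apply/intertwP => x Gx;
   rewrite /= !tensmx_mul fP ?gP //.
Qed.

Lemma tens_mx11 a b : (1%:M : 'M[k]_a) *t (1%:M : 'M_b) = 1%:M.
Proof.
apply/matrixP => i j; rewrite !mxE -natrM mulnb -xpair_eqE.
by rewrite -!surjective_pairing (can_eq (@mxtens_unindexK _ _)).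
Qed.

Lemma vsval_id (V : RepG k G) : vsval (idm V) = 1%:M.
Proof. exact: vsprojK (idm_mxP V). Qed.
Lemma vsval_comp (U V W : RepG k G) (g : mor _ V W) (f : mor _ U V) :
  vsval (g \oc f) = vsval f *m vsval g.
Proof. exact: vsprojK (comp_mxP (subvsP f) (subvsP g)). Qed.
Lemma vsval_tenm (V V' W W' : RepG k G) (f : mor _ V V') (g : mor _ W W') :
  vsval (f \om g) = vsval f *t vsval g.
Proof. exact: vsprojK (tens_mxP (subvsP f) (subvsP g)). Qed.
Lemma vsval_assoc (U V W : RepG k G) : vsval (assoc U V W) = assoc_mx _ _ _ _.
Proof. exact: vsprojK (assoc_mxP U V W). Qed.
Lemma vsval_lunit (V : RepG k G) : vsval (lunit V) = lunit_mx _ _.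
Proof. exact: vsprojK (lunit_mxP V). Qed.
Lemma vsval_braid (V W : RepG k G) : vsval (braid V W) = braid_mx _ _ _.
Proof. exact: vsprojK (braid_mxP V W). Qed.

Lemma RepG_symmetric (V W : RepG k G) : centralizes V W.
Proof.
apply: val_inj; rewrite [LHS]vsval_comp [RHS]vsval_id !vsval_braid.
apply/matrixP => i j; have [Ar _] := braid_mx_bij (rdim W) (rdim V).
case: j / (mxtens_indexP j) => x' y'; rewrite Ar mxE [RHS]mxE.
case: i / (mxtens_indexP i) => x y.
by rewrite !uiE !(can_eq (@mxtens_indexK _ _)) !xpair_eqE.
Qed.

Lemma mul_mxE n (a b j : 'I_n) : mul_mx k n (ix a b) j = d a j * d b j.
Proof. by rewrite mxE uiE xpair_eqE -natrM mulnb. Qed.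

Lemma mul_mxl n p (B : 'M_(n, p)) a b j :
  (mul_mx k n *m B) (ix a b) j = d a b * B a j.
Proof.
rewrite mxE; under eq_bigr do rewrite mul_mxE -mulrA.
by rewrite sum_deltal eq_sym.
Qed.

Lemma mul_mxr n p (A : 'M_(p, n * n)) i j :
  (A *m mul_mx k n) i j = A i (ix j j).
Proof.
rewrite mxE sum_mxtens.
under eq_bigr => a _ do under eq_bigr => b _ do rewrite mul_mxE mulrA.
by under eq_bigr do rewrite sum_deltar; rewrite sum_deltar.
Qed.

Local Notation reg := (regular_repr k G).

Lemma FunG_mulP : mul_mx k _ \in intertw (rep_ten (FunG k G) (FunG k G)) (FunG k G).
Proof.
apply/intertwP => g Gg; apply/matrixP => i j.
case: i / (mxtens_indexP i) => a b; rewrite mul_mxl mul_mxr /= tensmxE !mxE !eqxx.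
have inj : injective (fun a : 'I_#|G| => gring_index G (enum_val a * g)%g).
  move=> x y /(congr1 enum_val); rewrite !gring_indexK ?groupM ?enum_valP //.
  by move/mulIg/enum_val_inj.
rewrite /= -natrM mulnb -natrM mulnb; congr (_%:R).
case: (j =P _) => [->|_] /=; first by rewrite (inj_eq inj) andbT.
by rewrite andbF.
Qed.

Lemma FunG_unitP : const_mx 1 \in intertw (rep_one k G) (FunG k G).
Proof.
apply/intertwP => g Gg; apply/matrixP => i j; rewrite !mxE big_ord1 !mxE ord1 eqxx.
rewrite mulr1 (bigD1 (gring_index G (enum_val j * g^-1)%g)) //= !mxE mul1r.
rewrite gring_indexK ?groupM ?groupV ?enum_valP // mulgKV gring_valK !eqxx.
rewrite big1 ?addr0 // => x nx; rewrite !mxE /= mul1r.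
case: eqP => //= jE; case/eqP: nx.
by rewrite jE gring_indexK ?groupM ?enum_valP // mulgK gring_valK.
Qed.

Lemma vsval_mul : vsval (FunG_mul k G) = mul_mx k _.
Proof. exact: vsprojK FunG_mulP. Qed.
Lemma vsval_unit : vsval (FunG_unit k G) = const_mx 1.
Proof. exact: vsprojK FunG_unitP. Qed.

Lemma FunG_assoc :
  FunG_mul k G \oc (idm _ \om FunG_mul k G) \oc assoc _ _ _
    = FunG_mul k G \oc (FunG_mul k G \om idm _).
Proof.
apply: val_inj; rewrite [LHS]vsval_comp [RHS]vsval_comp !vsval_comp !vsval_tenm.
rewrite vsval_assoc vsval_id vsval_mul; apply/matrixP => i j.
case: i / (mxtens_indexP i) => i c; case: i / (mxtens_indexP i) => a b.
rewrite !mul_mxr; have [_ ->] := assoc_mx_bij #|G| #|G| #|G|.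
rewrite !tensmxE !mul_mxE !mxE -!natrM !mulnb; congr (_%:R).
by rewrite andbA.
Qed.

Lemma FunG_lunit :
  FunG_mul k G \oc (FunG_unit k G \om idm _) = lunit _.
Proof.
apply: val_inj; rewrite [LHS]vsval_comp vsval_tenm.
rewrite [RHS]vsval_lunit vsval_id vsval_mul vsval_unit; apply/matrixP => i j.
case: i / (mxtens_indexP i) => o b.
by rewrite mul_mxr tensmxE !mxE uiE mul1r.
Qed.
End RepGTheory.

(* V (x) W in coordinates with respect to the bases [vbasis {:V}] and
   [vbasis {:W}]. *)
Definition tsp (k : fieldType) (V W : vectType k) : vectType k :=
  'M[k]_(\dim {:V}, \dim {:W}).

Definition bvec (k : fieldType) (V : vectType k) (a : 'I_(\dim {:V})) : V :=
  (vbasis {:V})`_a.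

Definition tpure (k : fieldType) (V W : vectType k) (v : V) (w : W) : tsp V W :=
  \matrix_(a, b) (coord (vbasis {:V}) a v * coord (vbasis {:W}) b w).

(* The bilinear extension of (v1 (x) w1, v2 (x) w2) |-> f v1 v2 (x) g w1 w2. *)
Definition tbil (k : fieldType) (V1 V2 V3 W1 W2 W3 : vectType k)
    (f : V1 -> V2 -> V3) (g : W1 -> W2 -> W3) (s : tsp V1 W1) (t : tsp V2 W2) :
    tsp V3 W3 :=
  \sum_a \sum_b \sum_c \sum_e (s a b * t c e)
    *: tpure (f (bvec a) (bvec c)) (g (bvec b) (bvec e)).

Section DepProd.
Context (k : fieldType) (I : finType) (V : I -> vectType k).

Definition dprod : Type := {dffun forall i, V i}.
HB.instance Definition _ := Choice.on dprod.
Implicit Types f g h : dprod.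

Definition dp_zero : dprod := [ffun i => 0 : V i].
Definition dp_opp f : dprod := [ffun i => - f i].
Definition dp_add f g : dprod := [ffun i => f i + g i].
Definition dp_scale (a : k) f : dprod := [ffun i => a *: f i].

Fact dp_addA : associative dp_add.
Proof. by move=> f g h; apply/ffunP=> i; rewrite !ffunE addrA. Qed.
Fact dp_addC : commutative dp_add.
Proof. by move=> f g; apply/ffunP=> i; rewrite !ffunE addrC. Qed.
Fact dp_add0 : left_id dp_zero dp_add.
Proof. by move=> f; apply/ffunP=> i; rewrite !ffunE add0r. Qed.
Fact dp_addN : left_inverse dp_zero dp_opp dp_add.
Proof. by move=> f; apply/ffunP=> i; rewrite !ffunE addNr. Qed.
HB.instance Definition _ :=
  GRing.isZmodule.Build dprod dp_addA dp_addC dp_add0 dp_addN.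

Fact dp_scaleA a b f : dp_scale a (dp_scale b f) = dp_scale (a * b) f.
Proof. by apply/ffunP=> i; rewrite !ffunE scalerA. Qed.
Fact dp_scale1 : left_id 1 dp_scale.
Proof. by move=> f; apply/ffunP=> i; rewrite !ffunE scale1r. Qed.
Fact dp_scaleDr : right_distributive dp_scale +%R.
Proof. by move=> a f g; apply/ffunP=> i; rewrite !ffunE scalerDr. Qed.
Fact dp_scaleDl f : {morph dp_scale^~ f : a b / a + b}.
Proof. by move=> a b; apply/ffunP=> i; rewrite !ffunE scalerDl. Qed.
HB.instance Definition _ := GRing.Zmodule_isLmodule.Build k dprod
  dp_scaleA dp_scale1 dp_scaleDr dp_scaleDl.

Let index := {i : I & 'I_(\dim {:V i})}.

Fact dp_vect : Vector.axiom #|{: index}| dprod.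
Proof.
pose v2r (f : dprod) : 'rV[k]_#|{: index}| :=
  \row_a let s := enum_val a in coord (vbasis {:V (tag s)}) (tagged s) (f (tag s)).
pose r2v (r : 'rV[k]_#|{: index}|) : dprod :=
  [ffun i => \sum_(j < \dim {:V i}) r 0 (enum_rank (Tagged (fun i => 'I_(\dim {:V i})) j))
                       *: (vbasis {:V i})`_j].
exists v2r.
  move=> a f g; apply/rowP=> x; rewrite !mxE; case: (enum_val x) => i j /=.
  by rewrite -[a *: f + g]/(dp_add (dp_scale a f) g) !ffunE linearP.
exists r2v => [f | r].
  apply/ffunP=> i; rewrite /r2v ffunE [RHS](coord_vbasis (memvf _)).
  by apply: eq_bigr => j _; rewrite mxE enum_rankK.
apply/rowP=> x; rewrite mxE /r2v.
case E: (enum_val x) => [i j] /=; rewrite ffunE coord_sum_free ?(basis_free (vbasisP _)) //.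
by rewrite -[RHS](congr1 (r 0) (enum_valK x)) E.
Qed.
HB.instance Definition _ := Lmodule_hasFinDim.Build k dprod dp_vect.
End DepProd.

Section Deligne.
Context (k : fieldType) (C D : bmcat k).

(* The formal finite direct sum of the objects dl i (x) dr i.  For fusion
   categories over an algebraically closed field, the external products of
   simple objects are simple with pairwise orthogonal classes, so that these
   sums already form an abelian category, which is the Deligne product. *)
Record dobj := DObj { didx : finType; dl : didx -> C; dr : didx -> D }.

Definition dentry (U V : dobj) (i : didx U) (j : didx V) : vectType k :=
  tsp (mor C (dl i) (dl j)) (mor D (dr i) (dr j)).
Definition dmor (U V : dobj) : vectType k :=
  dprod (fun p : didx U * didx V => dentry p.1 p.2).

(* The matrix with entries t i in position (i, s i) and 0 elsewhere. *)
Definition dgraph (U V : dobj) (s : didx U -> didx V)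
    (t : forall i, dentry i (s i)) : dmor U V :=
  [ffun p => match s p.1 =P p.2 with
             | ReflectT e => ecast j (dentry p.1 j) e (t p.1)
             | ReflectF _ => 0
             end].

Definition dcomp (U V W : dobj) (g : dmor V W) (f : dmor U V) : dmor U W :=
  [ffun p => \sum_(j : didx V)
     tbil (@comp k C _ _ _) (@comp k D _ _ _)
          (g (j, p.2) : dentry j p.2) (f (p.1, j) : dentry p.1 j)].

Definition done : dobj := @DObj unit (fun=> one C) (fun=> one D).
Definition dten (U V : dobj) : dobj :=
  @DObj (didx U * didx V)%type
    (fun p => dl p.1 \ox dl p.2) (fun p => dr p.1 \ox dr p.2).
Definition dtenm (U U' V V' : dobj) (f : dmor U U') (g : dmor V V') :
    dmor (dten U V) (dten U' V') :=
  [ffun p => tbil (@tenm k C _ _ _ _) (@tenm k D _ _ _ _)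
     (f (p.1.1, p.2.1) : dentry p.1.1 p.2.1)
     (g (p.1.2, p.2.2) : dentry p.1.2 p.2.2)].

Definition deligne : bmcat k := {|
  obj := dobj;
  mor := dmor;
  idm := fun U => @dgraph U U id (fun i => tpure (idm (dl i)) (idm (dr i)));
  comp := dcomp;
  one := done;
  ten := dten;
  tenm := dtenm;
  assoc := fun U V W =>
    @dgraph (dten (dten U V) W) (dten U (dten V W))
      (fun p => (p.1.1, (p.1.2, p.2)))
      (fun p => tpure (assoc (dl p.1.1) (dl p.1.2) (dl p.2))
                      (assoc (dr p.1.1) (dr p.1.2) (dr p.2)));
  lunit := fun U =>
    @dgraph (dten done U) U (fun p => p.2)
      (fun p => tpure (lunit (dl p.2)) (lunit (dr p.2)));
  runit := fun U =>
    @dgraph (dten U done) U (fun p => p.1)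
      (fun p => tpure (runit (dl p.1)) (runit (dr p.1)));
  braid := fun U V =>
    @dgraph (dten U V) (dten V U) (fun p => (p.2, p.1))
      (fun p => tpure (braid (dl p.1) (dl p.2)) (braid (dr p.1) (dr p.2)))
|}.
End Deligne.

Section Modules.
Context (k : fieldType) (C : bmcat k) (S : fusion_subcat C).
Context (A : C) (m : mor C (A \ox A) A) (u : mor C (one C) A).

Definition is_module (M : C) (a : mor C (A \ox M) M) : Prop :=
  a \oc (idm A \om a) \oc assoc A A M = a \oc (m \om idm M) /\
  a \oc (u \om idm M) = lunit M.

Record amod := AMod {
  mcar :> C;
  mact : mor C (A \ox mcar) mcar;
  mcar_in : S mcar;
  mactP : is_module mact
}.

Definition amor (M N : amod) : {vspace mor C M N} :=
  lker (linfun (fun f : mor C M N => f \oc mact M - mact N \oc (idm A \om f))).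

Lemma amorP (hL : linear_category C) (hM : monoidal C) (M N : amod)
    (f : mor C M N) :
  reflect (f \oc mact M = mact N \oc (idm A \om f)) (f \in amor M N).
Proof.
pose phi (f : mor C M N) := f \oc mact M - mact N \oc (idm A \om f).
have phiL : linear phi.
  move=> a g h; rewrite /phi (comp_linl hL) (tenm_linr hM) (comp_linr hL).
  by rewrite scalerBr opprD addrACA.
pose phiM := GRing.isLinear.Build k _ _ _ phi phiL.
pose L : {linear mor C M N -> mor C (A \ox M) N} := HB.pack phi phiM.
rewrite /amor -/phi -[phi]/(L : _ -> _) memv_ker lfunE /= /phi subr_eq0.
exact: eqP.
Qed.

(* The right action obtained from the left one through the braiding. *)
Definition ract (M : amod) : mor C (M \ox A) M := mact M \oc braid M A.

(* p : M * N -> T exhibits T as the tensor product of M and N over A: it is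
   the coequalizer of the actions of A on the two factors, and A acts on T
   through M. *)
Definition is_tensor_over (M N T : amod) (p : mor C (M \ox N) T) : Prop :=
  is_coequalizer (ract M \om idm N) ((idm M \om mact N) \oc assoc M A N) p /\
  mact T \oc (idm A \om p) \oc assoc A M N = p \oc (mact M \om idm N).

(* Under the hypotheses of use below, the objects and morphisms selected by
   [epsilon] exist and are unique (up to unique isomorphism for [aten]). *)
Definition aten_data (M N : amod) : {T : amod & mor C (M \ox N) T} :=
  epsilon (inhabits (existT (fun T : amod => mor C (M \ox N) T) M 0))
          (fun T => is_tensor_over (projT2 T)).
Definition aten (M N : amod) : amod := projT1 (aten_data M N).
Definition aproj (M N : amod) : mor C (M \ox N) (aten M N) :=
  projT2 (aten_data M N).

Definition the_amor (M N : amod) (P : mor C M N -> Prop) : subvs_of (amor M N) :=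
  epsilon (inhabits 0) (fun f => P (vsval f)).

Context (A_in : S A) (A_mod : is_module m).
Definition aone : amod := AMod A_in A_mod.

(* [vsproj] is again applied to elements of the subspace only, by [amorP]. *)
Definition modcat : bmcat k := {|
  obj := amod;
  mor := fun M N => subvs_of (amor M N);
  idm := fun M => vsproj (amor M M) (idm (mcar M));
  comp := fun M N P g f => vsproj (amor M P) (vsval g \oc vsval f);
  one := aone;
  ten := aten;
  tenm := fun M M' N N' f g =>
    the_amor (fun h : mor C (aten M N) (aten M' N') =>
      h \oc aproj M N = aproj M' N' \oc (vsval f \om vsval g));
  assoc := fun M N P =>
    the_amor (fun h : mor C (aten (aten M N) P) (aten M (aten N P)) =>
      h \oc aproj (aten M N) P \oc (aproj M N \om idm (mcar P))
        = aproj M (aten N P) \oc (idm (mcar M) \om aproj N P)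
            \oc assoc (mcar M) (mcar N) (mcar P));
  lunit := fun M =>
    the_amor (fun h : mor C (aten aone M) M => h \oc aproj aone M = mact M);
  runit := fun M =>
    the_amor (fun h : mor C (aten M aone) M => h \oc aproj M aone = ract M);
  braid := fun M N =>
    the_amor (fun h : mor C (aten M N) (aten N M) =>
      h \oc aproj M N = aproj N M \oc braid (mcar M) (mcar N))
|}.
End Modules.

Section FunctorTheory.
Context (k : fieldType) (C D : bmcat k) (F : bfunctor C D).
Context (hL : linear_category D) (hM : monoidal D).

Lemma whiskl X (Y Y' Y'' : D) (g : mor D Y' Y'') (f : mor D Y Y') :
  idm X \om (g \oc f) = (idm X \om g) \oc (idm X \om f).
Proof. by rewrite -(tenm_comp hM) (comp_idl hL). Qed.

Lemma whiskr X (Y Y' Y'' : D) (g : mor D Y' Y'') (f : mor D Y Y') :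
  (g \oc f) \om idm X = (g \om idm X) \oc (f \om idm X).
Proof. by rewrite -(tenm_comp hM) (comp_idl hL). Qed.

Lemma functor_algebra (A : C) (m : mor C (A \ox A) A) (u : mor C (one C) A) :
    m \oc (idm A \om m) \oc assoc A A A = m \oc (m \om idm A) ->
    m \oc (u \om idm A) = lunit A ->
  is_module (fmap F m \oc fmu F A A) (fmap F u \oc feps F)
            (fmap F m \oc fmu F A A).
Proof.
move=> mA mu; pose cA := comp_assoc hL.
have E1 Z (h : mor D Z _) : fmu F A A \oc (idm (F A) \om fmap F m) \oc h
    = fmap F (idm A \om m) \oc fmu F A (A \ox A) \oc h.
  by rewrite -!cA -(fmap_id F) -(fmu_nat F).
have E2 Z (h : mor D Z _) : fmu F A A \oc (fmap F m \om idm (F A)) \oc h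
    = fmap F (m \om idm A) \oc fmu F (A \ox A) A \oc h.
  by rewrite -!cA -(fmap_id F) -(fmu_nat F).
have E3 Z (h : mor D Z _) : fmu F A A \oc (fmap F u \om idm (F A)) \oc h
    = fmap F (u \om idm A) \oc fmu F (one C) A \oc h.
  by rewrite -!cA -(fmap_id F) -(fmu_nat F).
split; last first.
  by rewrite whiskr !cA E3 -[RHS](fmu_lunit F) -mu (fmap_comp F) !cA.
have E4 Z (h : mor D Z _) :
    fmap F m \oc fmap F (idm A \om m) \oc fmap F (assoc A A A) \oc h
    = fmap F m \oc fmap F (m \om idm A) \oc h.
  by have /(congr1 (fun f => f \oc h)) := congr1 (fmap F) mA;
     rewrite !(fmap_comp F) !cA.
by rewrite whiskl whiskr !cA E1 E2 -(fmu_assoc F) E4.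
Qed.
End FunctorTheory.

Lemma subcat_linear (k : fieldType) (C : bmcat k) (E : fusion_subcat C) :
  linear_category C -> linear_category (subcat E).
Proof.
move=> hL; split=> *.
- exact: (comp_idl hL).
- exact: (comp_idr hL).
- exact: (comp_assoc hL).
- exact: (comp_linl hL).
- exact: (comp_linr hL).
Qed.

Lemma subcat_monoidal (k : fieldType) (C : bmcat k) (E : fusion_subcat C) :
  monoidal C -> monoidal (subcat E).
Proof.
move=> hM; split=> *.
- exact: (tenm_id hM).
- exact: (tenm_comp hM).
- exact: (tenm_linl hM).
- exact: (tenm_linr hM).
- exact: (assoc_iso hM).
- exact: (lunit_iso hM).
- exact: (runit_iso hM).
- exact: (assoc_nat hM).
- exact: (lunit_nat hM).
- exact: (runit_nat hM).
- exact: (pentagon hM).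
- exact: (triangle hM).
Qed.

Section DeEquivariantization.
Context (k : fieldType) (C : bmcat k) (gT : finGroupType) (G : {group gT}).
Context (E : fusion_subcat C) (F : bfunctor (RepG k G) (subcat E)).
Context (hC : braided_fusion C) (hF : is_equivalence F).

Definition regA : C := sval (F (FunG k G)).
Definition regA_mul : mor C (regA \ox regA) regA :=
  fmap F (FunG_mul k G) \oc fmu F (FunG k G) (FunG k G).
Definition regA_unit : mor C (one C) regA :=
  fmap F (FunG_unit k G) \oc feps F.

Lemma regA_module : is_module regA_mul regA_unit regA_mul.
Proof.
apply: (functor_algebra (D := subcat E)).
- exact: subcat_linear (bf_linear hC).
- exact: subcat_monoidal (bf_monoidal hC).
- exact: FunG_assoc.
- exact: FunG_lunit.
Qed.

Lemma E_symmetric (X Y : C) : E X -> E Y -> centralizes X Y.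
Proof.
move=> EX EY; have [cA c1l c1r] := And3 (comp_assoc (bf_linear hC))
  (comp_idl (bf_linear hC)) (comp_idr (bf_linear hC)).
have hM := bf_monoidal hC; have hB := bf_braided hC.
have [V [f [f' [f'f ff']]]] := hF.2 (exist _ X EX).
have [W [g [g' [g'g gg']]]] := hF.2 (exist _ Y EY).
rewrite /= in f f' f'f ff' g g' g'g gg'.
have sym : @centralizes k (subcat E) (F V) (F W).
  have hL := subcat_linear E (bf_linear hC).
  have [n [nm mn]] := fmu_iso F V W.
  rewrite /centralizes -[LHS](comp_idl hL) -nm.
  rewrite !(comp_assoc hL) -[fmu F V W \oc _ \oc _](comp_assoc hL).
  rewrite -(fmu_braid F) (comp_assoc hL) -(fmu_braid F).
  rewrite -[_ \oc _ \oc fmu F V W](comp_assoc hL) -(fmap_comp F).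
  by rewrite [braid W V \oc _]RepG_symmetric (fmap_id F) (comp_idl hL).
rewrite /centralizes -[LHS]c1r -(tenm_id hM) -ff' -gg' (tenm_comp hM).
rewrite cA -[braid X Y \oc _ \oc _]cA (braid_nat hB) cA.
rewrite -[braid Y X \oc _ \oc _]cA (braid_nat hB) cA.
rewrite -[X in _ \oc X]cA.
rewrite [braid _ _ \oc braid _ _]sym.
by rewrite c1l -(tenm_comp hM) ff' gg' (tenm_id hM).
Qed.

Lemma regA_in : centralizer E regA.
Proof.
have [n [S [Ssimple dS]]] := bf_semisimple hC regA.
apply: (fsub_dsum (fsubP (centralizer E))) (dS) => a S' S'P; apply: S'P.
split=> // X EX _; apply: E_symmetric => //.
have [i [p [pi _ _]]] := dS.
exact: (fsub_retract (fsubP E) (pi a) (svalP (F (FunG k G)))).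
Qed.

(* The trivial component of C_G, that is, the de-equivariantization of the
   centralizer of E by E = Rep(G). *)
Definition CG0 : bmcat k := modcat regA_in regA_module.
End DeEquivariantization.

Section Metric.
Context (k : fieldType) (B : finZmodType).
Implicit Types (q : B -> k) (x y z : B).

Definition bichar q x y : k := q (x + y) / (q x * q y).

Record nondeg_quadratic q : Prop := {
  quad_neq0 : forall x, q x != 0;
  quad_opp : forall x, q (- x) = q x;
  quad_bichar : forall x y z, bichar q (x + y) z = bichar q x z * bichar q y z;
  quad_nondeg : forall x, (forall y, bichar q x y = 1) -> x = 0
}.

(* P is C(B, q); this determines P up to braided equivalence. *)
Definition is_CBq q (P : bmcat k) : Prop :=
  braided_fusion P /\
  exists L : B -> P,
    [/\ forall b, simple_obj (L b),
        forall b b', isomorphic (L b) (L b') -> b = b',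
        forall X, simple_obj X -> exists b, isomorphic X (L b),
        forall b b', isomorphic (L b \ox L b') (L (b + b'))
      & forall b, braid (L b) (L b) = q b *: idm (L b \ox L b)].
End Metric.

Definition square_free (d : nat) : Prop :=
  forall m : nat, (m ^ 2 %| d)%N -> m = 1%N.

(* Z/dZ for d > 0, the case d = 1 included (which 'Z_d does not cover). *)
Definition Zmod (d : nat) : finZmodType := 'I_d.-1.+1.

(* Main.v *)
From HB Require Import structures.
From Stdlib Require Import ClassicalEpsilon.
From mathcomp Require Import all_boot all_order all_algebra all_fingroup all_field.
From mathcomp Require Import mxtens spectral sesquilinear mxrepresentation ring zify.
Require Import Defs.

(* Let R = Fun(G).  The pointed factor of C_G^0 contains an invertible local
   R-module M of order d with self-braiding q(1).  As the squared dimensions of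
   the simple objects of C are prime to d, the braiding of M with a conjugate M^g
   equals its braiding with M, for otherwise the order of the quotient of the two
   scalars would divide a product of dimensions.  Hence the product L of the
   conjugates of M is G-invariant with self-braiding a power of q(1) prime to d.
   The obstruction to an equivariant structure on L is killed by the dimension of
   a simple constituent of L in C, again prime to d, so that a power of L descends
   to an invertible object of C.  The scalars by which this object braids with the
   simple objects form a cyclic group of order dividing nd, and because
   (n, d) = 1 a suitable power X of it satisfies X^d = 1 and c_{X,X} = q(1).  The
   powers of X form a copy of C(Z_d, q).  Since q(1)^2 is a primitive d-th root of
   unity, every simple object is X^j (x) r with r centralizing X, and the braiding
   of powers of X past such r gives the equivalence with the Deligne product. *)

Set Implicit Arguments.
Unset Strict Implicit.
Unset Printing Implicit Defensive.

Import Order.TTheory GRing.Theory Num.Theory.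
Local Open Scope ring_scope.
Local Open Scope sesquilinear_scope.

(** * Linear categories *)

(** R-modules form a linear category with split idempotents and von Neumann regular morphisms; both
    properties come from C, the second by averaging over R, and the dimension of a module is that of
    its underlying object divided by that of R. The braiding of M with a module is a scalar only on
    local modules, whereas a conjugate M^g appears by passing M across a module N of degree g. Hence
    N is multiplied by some N' of degree g^-1, and non-degeneracy is what supplies modules of every
    degree. If M and M^g braid with M by different scalars, their ratio permutes the pieces of N N'
    on which M braids by a fixed scalar without changing dimensions, and a prime divisor of d
    divides the dimension. Exponents of q(1) stay squares N^2 throughout: a product of r objects
    that braid alike has self-braiding exponent r^2. This is why inverting N modulo d at the end
    restores q(1) itself. For even d one has q(1)^d = -1, so the identification of X^n with X^(n+d)
    is not compatible with tensoring on both sides. The powers of X are therefore labelled by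
    natural numbers, not by residues, and the functors are built on these labels. *)

Section VectLemmas.
Context (k : fieldType).

Lemma dim_le_inj (V W : vectType k) (f : V -> W) :
  linear f -> injective f -> (\dim {:V} <= \dim {:W})%N.
Proof.
move=> fL fI.
pose fM := GRing.isLinear.Build k _ _ _ f fL.
pose L : {linear V -> W} := HB.pack f fM.
have <- : \dim (limg (linfun L)) = \dim {:V}.
  apply: limg_dim_eq; apply/eqP; rewrite -subv0; apply/subvP => v.
  rewrite memv_cap memv_ker lfunE /= => /andP[_ /eqP Lv].
  have L0 : f 0 = 0 := linear0 L.
  by rewrite memv0; apply/eqP/fI; rewrite Lv L0.
exact/dimvS/subvf.
Qed.

Lemma dim_eq_bij (V W : vectType k) (f : V -> W) :
  linear f -> bijective f -> \dim {:V} = \dim {:W}.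
Proof.
move=> fL [g gK fK]; apply/eqP; rewrite eqn_leq; apply/andP; split.
  exact: (dim_le_inj fL (can_inj gK)).
apply: (dim_le_inj (f := g)) (can_inj fK) => a x y.
by apply: (can_inj gK); rewrite fL !fK.
Qed.

Lemma dim0P (V : vectType k) : reflect (forall v : V, v = 0) (\dim {:V} == 0%N).
Proof.
apply: (iffP idP) => [|V0].
  by rewrite dimv_eq0 => /eqP V0 v; apply/eqP; rewrite -memv0 -V0 memvf.
by rewrite dimv_eq0 -subv0; apply/subvP => v _; rewrite (V0 v) mem0v.
Qed.

(** The images of the [i a] span by the last hypothesis, and applying [p a] to a vanishing sum shows
    that they are independent. *)
Lemma dim_sum_proj (V : vectType k) (I : finType) (W : I -> vectType k)
    (i : forall a, W a -> V) (p : forall a, V -> W a) :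
    (forall a, linear (i a)) -> (forall a, linear (p a)) ->
    (forall a, cancel (i a) (p a)) ->
    (forall a b w, a != b -> p b (i a w) = 0) ->
    (forall v, v = \sum_a i a (p a v)) ->
  \dim {:V} = (\sum_a \dim {:W a})%N.
Proof.
move=> iL pL ip pi0 vE.
pose iM a : {linear W a -> V} := HB.pack (i a) (GRing.isLinear.Build k _ _ _ (i a) (iL a)).
pose pM a : {linear V -> W a} := HB.pack (p a) (GRing.isLinear.Build k _ _ _ (p a) (pL a)).
have p0 a : p a 0 = 0 := linear0 (pM a).
have i0 a : i a 0 = 0 := linear0 (iM a).
pose U a := limg (linfun (iM a)).
have dimU a : \dim (U a) = \dim {:W a}.
  apply: limg_dim_eq; apply/eqP; rewrite -subv0; apply/subvP => v.
  rewrite memv_cap memv_ker lfunE /= => /andP[_ /eqP Lv].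
  by rewrite memv0 -(ip a v) Lv p0.
have fE : fullv = (\sum_a U a)%VS :> {vspace V}.
  apply/eqP; rewrite eqEsubv subvf andbT; apply/subvP => v _.
  rewrite (vE v); apply: memv_sumr => a _.
  by rewrite -[i a _]/(iM a _) -(lfunE (iM a)) memv_img ?memvf.
rewrite fE; have dU : directv (\sum_a U a)%VS.
  apply/directv_sum_independent => u uU sum0 a _.
  have [w wE] : exists w : forall a, W a, forall a, u a = i a (w a).
    exists (fun a => p a (u a)) => b; have /memv_imgP[x _ ->] := uU b isT.
    by rewrite lfunE /= ip.
  have := congr1 (p a) sum0; rewrite p0 => /(etrans (esym (linear_sum (pM a) _ _ _))) /=; rewrite (bigD1 a) //=.
  rewrite big1 ?addr0; first by move=> pa0; rewrite wE -[w a]ip -wE pa0 i0.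
  by move=> b ba; rewrite wE pi0.
by rewrite (directvP dU) /=; apply: eq_bigr => a _; apply: dimU.
Qed.

Lemma vect_line (V : vectType k) (v : V) :
  v != 0 -> (forall w, exists a, w = a *: v) -> \dim {:V} = 1%N.
Proof.
move=> v0 vP; have -> : fullv = <[v]>%VS; last by rewrite dim_vline v0.
apply/eqP; rewrite eqEsubv subvf andbT; apply/subvP => w _.
by have [a ->] := vP w; rewrite memvZ ?memv_line.
Qed.

Lemma dim1_line (V : vectType k) (v : V) :
  \dim {:V} = 1%N -> v != 0 -> forall w, exists a, w = a *: v.
Proof.
move=> V1 v0 w; have /vlineP[a ->] : w \in <[v]>%VS; last by exists a.
have -> : (<[v]> = fullv)%VS; last exact: memvf.
by apply/eqP; rewrite eqEdim subvf V1 dim_vline v0.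
Qed.
End VectLemmas.

Section LinCat.
Local Open Scope cat_scope.
Context (k : fieldType) (C : bmcat k) (hL : linear_category C).
Implicit Types X Y Z W : C.

Let cA := comp_assoc hL.
Let c1l := comp_idl hL.
Let c1r := comp_idr hL.

(** Composites are kept nested to the right, so an equation between short composites does not occur
    literally inside a longer one; [post2], [post3] and [post4] give it a tail [h]. *)
Lemma post2 X Y Z (a : mor C Y Z) (b : mor C X Y) g :
  a \oc b = g -> forall W (h : mor C W X), a \oc b \oc h = g \oc h.
Proof. by move=> <- W h; rewrite cA. Qed.
Lemma post3 X Y Y' Z (a : mor C Y' Z) (a' : mor C Y Y') (b : mor C X Y) g :
  a \oc a' \oc b = g -> forall W (h : mor C W X), a \oc a' \oc b \oc h = g \oc h.
Proof. by move=> <- W h; rewrite !cA. Qed.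
Lemma post4 X Y Y' Y'' Z (a : mor C Y' Z) (a' : mor C Y'' Y') (a'' : mor C Y Y'')
   (b : mor C X Y) g :
  a \oc a' \oc a'' \oc b = g ->
  forall W (h : mor C W X), a \oc a' \oc a'' \oc b \oc h = g \oc h.
Proof. by move=> <- W h; rewrite !cA. Qed.

Lemma compDl X Y Z (g g' : mor C Y Z) (f : mor C X Y) :
  (g + g') \oc f = g \oc f + g' \oc f.
Proof. by have := comp_linl hL 1 g g' f; rewrite !scale1r. Qed.
Lemma compDr X Y Z (g : mor C Y Z) (f f' : mor C X Y) :
  g \oc (f + f') = g \oc f + g \oc f'.
Proof. by have := comp_linr hL 1 g f f'; rewrite !scale1r. Qed.
Lemma comp0l X Y Z (f : mor C X Y) : (0 : mor C Y Z) \oc f = 0.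
Proof. by apply: (addrI (0 \oc f)); rewrite -compDl !addr0. Qed.
Lemma comp0r X Y Z (g : mor C Y Z) : g \oc (0 : mor C X Y) = 0.
Proof. by apply: (addrI (g \oc 0)); rewrite -compDr !addr0. Qed.
Lemma compZl X Y Z a (g : mor C Y Z) (f : mor C X Y) :
  (a *: g) \oc f = a *: (g \oc f).
Proof. by have := comp_linl hL a g 0 f; rewrite comp0l !addr0. Qed.
Lemma compZr X Y Z a (g : mor C Y Z) (f : mor C X Y) :
  g \oc (a *: f) = a *: (g \oc f).
Proof. by have := comp_linr hL a g f 0; rewrite comp0r !addr0. Qed.
Lemma compNl X Y Z (g : mor C Y Z) (f : mor C X Y) : (- g) \oc f = - (g \oc f).
Proof. by rewrite -scaleN1r compZl scaleN1r. Qed.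
Lemma compNr X Y Z (g : mor C Y Z) (f : mor C X Y) : g \oc (- f) = - (g \oc f).
Proof. by rewrite -scaleN1r compZr scaleN1r. Qed.
Lemma compBl X Y Z (g g' : mor C Y Z) (f : mor C X Y) :
  (g - g') \oc f = g \oc f - g' \oc f.
Proof. by rewrite compDl compNl. Qed.
Lemma compBr X Y Z (g : mor C Y Z) (f f' : mor C X Y) :
  g \oc (f - f') = g \oc f - g \oc f'.
Proof. by rewrite compDr compNr. Qed.
Lemma comp_suml X Y Z I (r : seq I) (P : pred I) (g : I -> mor C Y Z) (f : mor C X Y) :
  (\sum_(i <- r | P i) g i) \oc f = \sum_(i <- r | P i) (g i \oc f).
Proof.
elim/big_rec2: _ => [|i _ x _ <-]; by rewrite ?comp0l ?compDl.
Qed.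
Lemma comp_sumr X Y Z I (r : seq I) (P : pred I) (g : mor C Y Z) (f : I -> mor C X Y) :
  g \oc (\sum_(i <- r | P i) f i) = \sum_(i <- r | P i) (g \oc f i).
Proof.
elim/big_rec2: _ => [|i _ x _ <-]; by rewrite ?comp0r ?compDr.
Qed.

Lemma inverse_uniq X Y (f : mor C X Y) g g' :
  inverse_of f g -> inverse_of f g' -> g = g'.
Proof. by move=> [gf _] [_ fg']; rewrite -[g]c1r -fg' -cA gf c1l. Qed.

Lemma is_iso_id X : is_iso (idm X).
Proof. by exists (idm X); split; rewrite c1l. Qed.
Lemma is_iso_comp X Y Z (g : mor C Y Z) (f : mor C X Y) :
  is_iso g -> is_iso f -> is_iso (g \oc f).
Proof.
move=> [g' [g'g gg']] [f' [f'f ff']]; exists (f' \oc g'); split.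
  by rewrite cA (post2 g'g) c1l.
by rewrite cA (post2 ff') c1l.
Qed.
Lemma isomorphic_refl X : isomorphic X X.
Proof. by exists (idm X); apply: is_iso_id. Qed.
Lemma isomorphic_sym X Y : isomorphic X Y -> isomorphic Y X.
Proof. by move=> [f [g [gf fg]]]; exists g, f. Qed.
Lemma isomorphic_trans X Y Z : isomorphic X Y -> isomorphic Y Z -> isomorphic X Z.
Proof. by move=> [f fi] [g gi]; exists (g \oc f); apply: is_iso_comp. Qed.

Lemma iso_cancel_l X Y Z (f : mor C Y Z) (u v : mor C X Y) :
  is_iso f -> f \oc u = f \oc v -> u = v.
Proof.
move=> [g [gf _]] /(congr1 (fun h => g \oc h)).
by rewrite -!cA gf !c1l.
Qed.
Lemma iso_cancel_r X Y Z (f : mor C X Y) (u v : mor C Y Z) :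
  is_iso f -> u \oc f = v \oc f -> u = v.
Proof. by move=> [g [_ fg]] /(congr1 (fun h => h \oc g)); rewrite !cA fg !c1r. Qed.

Lemma sec_inj X Y Z (f : mor C Y Z) g (u v : mor C X Y) :
  g \oc f = idm Y -> f \oc u = f \oc v -> u = v.
Proof. by move=> gf /(congr1 (fun h => g \oc h)); rewrite -!cA gf !c1l. Qed.
Lemma ret_inj X Y Z (f : mor C X Y) g (u v : mor C Y Z) :
  f \oc g = idm Y -> u \oc f = v \oc f -> u = v.
Proof. by move=> fg /(congr1 (fun h => h \oc g)); rewrite !cA fg !c1r. Qed.

(** The data behind [is_dsum] over an arbitrary finite type of indices, so that a sum of sums can be
    indexed by a sigma type ([fsum_sigma]). *)
Record fdsum (I : finType) (S : I -> C) X
    (i : forall a, mor C (S a) X) (p : forall a, mor C X (S a)) : Prop := {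
  fds_id : forall a, p a \oc i a = idm (S a);
  fds_0 : forall a b, a != b -> p b \oc i a = 0;
  fds_sum : \sum_a (i a \oc p a) = idm X
}.
Definition fsum (I : finType) (S : I -> C) X := exists i p, @fdsum I S X i p.

Lemma dsum_fsum n (S : 'I_n -> C) X : is_dsum S X <-> fsum S X.
Proof.
split=> [[i [p [h1 h2 h3]]]|[i [p [h1 h2 h3]]]]; exists i, p; first by split.
by split.
Qed.

Lemma fsum_reindex (I J : finType) (f : J -> I) (S : I -> C) X :
  bijective f -> fsum S X -> fsum (S \o f) X.
Proof.
move=> [g gK fK] [i [p [h1 h2 h3]]]; exists (fun a => i (f a)), (fun a => p (f a)).
split=> [a|a b ab|]; first exact: h1.
  by apply: h2; apply: contra_neq ab => /(can_inj gK).
by rewrite -h3 [RHS](reindex f) //=; exists g => x _; rewrite ?gK ?fK.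
Qed.

Lemma fsum_dsum (I : finType) (S : I -> C) X :
  fsum S X -> is_dsum (fun a : 'I_#|I| => S (enum_val a)) X.
Proof.
move=> XS; apply/dsum_fsum; apply: (fsum_reindex _ XS).
by exists enum_rank; [apply: enum_valK | apply: enum_rankK].
Qed.

Lemma fsum_iso (I : finType) (S : I -> C) X X' :
  fsum S X -> isomorphic X X' -> fsum S X'.
Proof.
move=> [i [p [h1 h2 h3]]] [f [g [gf fg]]].
exists (fun a => f \oc i a), (fun a => p a \oc g); split=> [a|a b ab|].
- by rewrite cA (post2 gf) c1l h1.
- by rewrite cA (post2 gf) c1l h2.
under eq_bigr => a _ do rewrite cA -(cA (i a)).
by rewrite -comp_sumr -comp_suml h3 c1l.
Qed.

Lemma fsum_map (I : finType) (S S' : I -> C) X :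
  (forall a, isomorphic (S a) (S' a)) -> fsum S X -> fsum S' X.
Proof.
move=> SS' [i [p [h1 h2 h3]]].
have [f] : exists f : (forall a, mor C (S a) (S' a)), forall a, is_iso (f a).
  exists (fun a => proj1_sig (constructive_indefinite_description _ (SS' a))) => a.
  exact: proj2_sig (constructive_indefinite_description _ (SS' a)).
move=> fi; have [g gP] : exists g : (forall a, mor C (S' a) (S a)), forall a, inverse_of (f a) (g a).
  exists (fun a => proj1_sig (constructive_indefinite_description _ (fi a))) => a.
  exact: proj2_sig (constructive_indefinite_description _ (fi a)).
exists (fun a => i a \oc g a), (fun a => f a \oc p a); split=> [a|a b ab|].
- by rewrite cA -(cA (p a)) h1 c1l (gP a).2.
- by rewrite cA -(cA (p b)) h2 // comp0l comp0r.
by rewrite -h3; apply: eq_bigr => a _; rewrite cA (post2 (gP a).1) c1l.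
Qed.

Lemma fsum_sigma (I : finType) (J : I -> finType) (S : forall a, J a -> C) (X : I -> C) Y :
  (forall a, fsum (S a) (X a)) -> fsum X Y ->
  fsum (fun s : {a : I & J a} => S (tag s) (tagged s)) Y.
Proof.
move=> XS [i [p [h1 h2 h3]]].
have [i' i'P] : exists i' : (forall a b, mor C (S a b) (X a)), forall a, exists p, fdsum (i' a) p.
  exists (fun a => proj1_sig (constructive_indefinite_description _ (XS a))) => a.
  exact: proj2_sig (constructive_indefinite_description _ (XS a)).
have [p' p'P] : exists p' : (forall a b, mor C (X a) (S a b)), forall a, fdsum (i' a) (p' a).
  exists (fun a => proj1_sig (constructive_indefinite_description _ (i'P a))) => a.
  exact: proj2_sig (constructive_indefinite_description _ (i'P a)).
exists (fun s => i (tag s) \oc i' (tag s) (tagged s)),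
       (fun s => p' (tag s) (tagged s) \oc p (tag s)); split=> [[a b]|[a b] [a' b']|] /=.
- by rewrite cA (post2 (h1 a)) c1l (fds_id (p'P a)).
- have [aa'|aa' _] := eqVneq a a'; last by rewrite cA (post2 (h2 _ _ aa')) comp0l comp0r.
  subst a'.
  move=> bb'; rewrite cA (post2 (h1 a)) c1l (fds_0 (p'P a)) //.
  by apply: contra_neq bb' => ->.
rewrite (eq_bigr (fun s : {a : I & J a} => i (tag s) \oc (i' (tag s) (tagged s) \oc p' (tag s) (tagged s)) \oc p (tag s))); last first.
  by case=> a b _ /=; rewrite !cA.
rewrite -(sig_big_dep xpredT (fun _ => xpredT) (fun a b => i a \oc (i' a b \oc p' a b) \oc p a)) /=.
rewrite -h3; apply: eq_bigr => a _.
by rewrite -comp_sumr -comp_suml (fds_sum (p'P a)) c1l.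
Qed.

Lemma fsum1 X : fsum (fun _ : unit => X) X.
Proof.
exists (fun _ => idm X), (fun _ => idm X); split=> [[]|[] []|//]; rewrite ?c1l //.
by rewrite (bigD1 tt) //= big1 ?addr0 ?c1l //; case.
Qed.

Definition hdim X Y : nat := \dim {: mor C X Y}.

Lemma comp_linearr X Y Z (g : mor C Y Z) : linear (fun f : mor C X Y => g \oc f).
Proof. by move=> a f f'; rewrite (comp_linr hL). Qed.
Lemma comp_linearl X Y Z (f : mor C X Y) : linear (fun g : mor C Y Z => g \oc f).
Proof. by move=> a g g'; rewrite (comp_linl hL). Qed.

Lemma hdim_sumr (I : finType) (S : I -> C) X Z :
  fsum S X -> hdim Z X = (\sum_a hdim Z (S a))%N.
Proof.
move=> [i [p [h1 h2 h3]]].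
apply: (dim_sum_proj (i := fun a w => i a \oc w) (p := fun a v => p a \oc v)).
- by move=> a; apply: comp_linearr.
- by move=> a; apply: comp_linearr.
- by move=> a w; rewrite -cA h1 c1l.
- by move=> a b w ab; rewrite -cA h2 // comp0l.
move=> v; under eq_bigr do rewrite -cA.
by rewrite -comp_suml h3 c1l.
Qed.

Lemma hdim_suml (I : finType) (S : I -> C) X Z :
  fsum S X -> hdim X Z = (\sum_a hdim (S a) Z)%N.
Proof.
move=> [i [p [h1 h2 h3]]].
apply: (dim_sum_proj (i := fun a w => w \oc p a) (p := fun a v => v \oc i a)).
- by move=> a; apply: comp_linearl.
- by move=> a; apply: comp_linearl.
- by move=> a w; rewrite cA h1 c1r.
- by move=> a b w ab; rewrite cA h2 1?eq_sym // comp0r.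
move=> v; under eq_bigr do rewrite cA.
by rewrite -comp_sumr h3 c1r.
Qed.

Lemma hdim_isor X X' Z : isomorphic X X' -> hdim Z X = hdim Z X'.
Proof.
move=> [f [g [gf fg]]]; apply: (dim_eq_bij (f := fun w => f \oc w)).
  exact: comp_linearr.
by exists (fun w => g \oc w) => w; rewrite -cA ?gf ?fg c1l.
Qed.
Lemma hdim_isol X X' Z : isomorphic X X' -> hdim X Z = hdim X' Z.
Proof.
move=> [f [g [gf fg]]]; apply: (dim_eq_bij (f := fun w => w \oc g)).
  exact: comp_linearl.
by exists (fun w => w \oc f) => w; rewrite cA ?gf ?fg c1r.
Qed.

Lemma hdim_gt0 X Y (f : mor C X Y) : f <> 0 -> (0 < hdim X Y)%N.
Proof. by rewrite lt0n => f0; apply/dim0P => /(_ f). Qed.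
Lemma hdim0 X Y (f : mor C X Y) : hdim X Y = 0%N -> f = 0.
Proof. by move/eqP/dim0P. Qed.
Lemma hdim_ex X Y : (0 < hdim X Y)%N -> exists f : mor C X Y, f <> 0.
Proof.
rewrite lt0n dimv_eq0 => /eqP n0; exists (vpick {:mor C X Y}); apply/eqP.
by rewrite vpick0; apply/eqP.
Qed.
End LinCat.

Lemma eigenvector_exists (k : closedFieldType) (V : vectType k) (f : V -> V) :
  linear f -> (0 < \dim {:V})%N -> exists a v, v != 0 /\ f v = a *: v.
Proof.
move=> fL V0; pose L : {linear V -> V} := HB.pack f (GRing.isLinear.Build k _ _ _ f fL).
pose e := vbasis {:V}; pose M := passmx.mxof e e (linfun L).
have eb : basis_of {:V} e := vbasisP _.
have [a] : exists a, root (char_poly M) a.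
  by apply/closed_rootP; rewrite size_char_poly; case: (\dim {:V}) V0.
rewrite -eigenvalue_root_char => /eigenvalueP[w wM w0].
exists a, (passmx.vecof e w); split; first by rewrite passmx.vecof_eq0.
rewrite -[f _]/(L _) -lfunE -(passmx.mxofK eb eb (linfun L)) -/M.
rewrite -passmx.vecof_mul // wM /passmx.vecof scaler_sumr.
by apply: eq_bigr => i _; rewrite mxE scalerA.
Qed.

(** * Semisimplicity from regular morphisms and split idempotents *)

Section Bricks.
Local Open Scope cat_scope.
Context (k : closedFieldType) (C : bmcat k) (hL : linear_category C).
Implicit Types X Y Z W : C.

Let cA := comp_assoc hL.
Let c1l := comp_idl hL.
Let c1r := comp_idr hL.

(** Having only scalar endomorphisms is a condition that makes sense for R-modules before any kernel
    of module maps has been constructed; in a fusion category it agrees with simplicity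
    ([simpleE]). *)
Definition brick X := idm X <> 0 /\ forall f : mor C X X, exists a, f = a *: idm X.
(** Von Neumann regularity, the form of semisimplicity that passes from C to R-modules: a
    quasi-inverse can be averaged into an R-linear one ([T_regular]). *)
Definition regular_cat := forall X Y (f : mor C X Y), exists g, f \oc g \oc f = f.
Definition idem_split := forall X (e : mor C X X), e \oc e = e ->
  exists Y (i : mor C Y X) (p : mor C X Y), p \oc i = idm Y /\ i \oc p = e.
Definition brick_schur := forall X Y (f : mor C X Y),
  brick X -> brick Y -> f <> 0 -> is_iso f.

Lemma brick_hdim X : brick X -> hdim X X = 1%N.
Proof. by move=> [/eqP X0 XP]; apply: (vect_line X0). Qed.
Lemma hdim_brick X : hdim X X = 1%N -> brick X.
Proof.
move=> X1; have X0 : idm X <> 0.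
  move=> i0; have [|f []] := @hdim_ex _ C X X; first by rewrite X1.
  by rewrite -[f]c1l i0 (comp0l hL).
by split=> //; apply: dim1_line => //; apply/eqP.
Qed.
Lemma brick_iso X Y : brick X -> isomorphic X Y -> brick Y.
Proof.
move=> /brick_hdim X1 XY; apply: hdim_brick.
by rewrite -(hdim_isor hL _ XY) -(hdim_isol hL _ XY).
Qed.

(** With a quasi-inverse g, both [g f] and [f g] are scalars, and [f g f = f] forces these scalars
    to be 1. *)
Lemma regular_schur : regular_cat -> brick_schur.
Proof.
move=> reg X Y f [X0 XP] [Y0 YP] f0; have [g fgf] := reg _ _ f.
have one (V : vectType k) (x : V) a : x <> 0 -> a *: x = x -> a = 1.
  move=> /eqP x0 /eqP; rewrite -subr_eq0 -{2}[x]scale1r -scalerBl scaler_eq0 (negPf x0) orbF.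
  by rewrite subr_eq0 => /eqP.
exists g; split.
  have [a gf] := XP (g \oc f); rewrite gf.
  have : f \oc (g \oc f) = f by [].
  by rewrite gf (compZr hL) c1r => /one -> //; rewrite scale1r.
have [a fg] := YP (f \oc g); rewrite fg.
have : (f \oc g) \oc f = f by rewrite cA.
by rewrite fg (compZl hL) c1l => /one -> //; rewrite scale1r.
Qed.

Lemma idem_fsum X (e : mor C X X) : idem_split -> e \oc e = e ->
  exists X1 X2, [/\ fsum (fun b : bool => if b then X1 else X2) X,
    e <> 0 -> idm X1 <> 0 & e <> idm X -> idm X2 <> 0].
Proof.
move=> sp ee; have [X1 [i1 [p1 [pi1 ip1]]]] := sp _ _ ee.
have ee' : (idm X - e) \oc (idm X - e) = idm X - e.
  by rewrite (compBr hL) !(compBl hL) !c1l !c1r ee subrr subr0.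
have [X2 [i2 [p2 [pi2 ip2]]]] := sp _ _ ee'.
exists X1, X2; split.
- exists (fun b => if b return mor C (if b then X1 else X2) X then i1 else i2).
  exists (fun b => if b return mor C X (if b then X1 else X2) then p1 else p2).
  split=> [[]|[] [] //= _|] //=.
  + rewrite -[i1]c1r -pi1 -(cA i1) ip1 -[p2]c1l -pi2 (cA p2) ip2 cA.
    by rewrite -(cA (idm X - e)) (compBl hL) c1l ee subrr (comp0l hL) (comp0r hL).
  + rewrite -[i2]c1r -pi2 -(cA i2) ip2 -[p1]c1l -pi1 (cA p1) ip1 cA.
    by rewrite -(cA e) (compBr hL) c1r ee subrr (comp0l hL) (comp0r hL).
  by rewrite big_bool /= ip1 ip2 addrC subrK.
- by move=> e0 X10; apply: e0; rewrite -ip1 -[i1]c1r X10 (comp0r hL) (comp0l hL).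
move=> e1 X20; apply: e1; apply/eqP; rewrite eq_sym -subr_eq0 -ip2 -[i2]c1r X20.
by rewrite (comp0r hL) (comp0l hL).
Qed.

Lemma idm_hdim X : idm X <> 0 -> (0 < hdim X X)%N.
Proof. exact: hdim_gt0. Qed.
Lemma hdim_idm X : (0 < hdim X X)%N -> idm X <> 0.
Proof. by case/hdim_ex => f f0 X0; apply: f0; rewrite -[f]c1l X0 (comp0l hL). Qed.

(** Take a non-scalar f and an eigenvalue a of composition with f. Then h = f - a is non-zero but
    kills some non-zero g, and for a quasi-inverse t of h the idempotent [t h] is neither 0 nor the
    identity. *)
Lemma nonscalar_idem X : regular_cat -> (1 < hdim X X)%N ->
  exists e : mor C X X, [/\ e \oc e = e, e <> 0 & e <> idm X].
Proof.
move=> reg X1; have X0 : idm X <> 0 by apply: hdim_idm; apply: ltnW.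
have [f fns] : exists f : mor C X X, forall a, f <> a *: idm X.
  apply: NNPP => nf; have /brick_hdim X1' : brick X; last by rewrite X1' in X1.
  split=> // f; apply: NNPP => nfa; apply: nf; exists f => a fa; apply: nfa; by exists a.
have [a [g [/eqP g0 fg]]] := eigenvector_exists (comp_linearr hL (X:=X) f) (ltnW X1).
pose h := f - a *: idm X.
have h0 : h <> 0 by move=> /eqP; rewrite subr_eq0 => /eqP /fns.
have hg : h \oc g = 0 by rewrite (compBl hL) (compZl hL) c1l fg subrr.
have [t hth] := reg _ _ h.
exists (t \oc h); split.
- by rewrite cA hth.
- by move=> th; apply: h0; rewrite -hth th (comp0r hL).
by move=> th; apply: g0; rewrite -[g]c1l -th cA hg (comp0r hL).
Qed.

(** Induction on the dimension of End X: a proper idempotent cuts X into two non-zero summands,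
    whose endomorphism rings are both smaller. *)
Lemma bricks_decomp : regular_cat -> idem_split ->
  forall X, exists (I : finType) (S : I -> C), (forall a, brick (S a)) /\ fsum S X.
Proof.
move=> reg sp X; have [n] := ubnP (hdim X X); elim: n X => // n IHn X.
rewrite ltnS => Xn; have [|X1] := ltnP 1 (hdim X X); last first.
  have [X0|X0] := posnP (hdim X X).
    pose S0 (x : void) : C := match x with end.
    exists void, S0; split; first by case.
    exists (fun x : void => match x as y return mor C (S0 y) X with end).
    exists (fun x : void => match x as y return mor C X (S0 y) with end).
    by split; try by [case]; rewrite big_pred0 => [|[]]; apply/esym/hdim0.
  exists unit, (fun _ => X); split=> [_|]; last exact: fsum1.
  by apply: hdim_brick; apply/eqP; rewrite eqn_leq X1.
move=> /(nonscalar_idem reg)[e [ee e0 e1]].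
have [X1 [X2 [XS /(_ e0) X10 /(_ e1) X20]]] := idem_fsum sp ee.
have le : (hdim X1 X1 + hdim X2 X2 <= hdim X X)%N.
  rewrite (hdim_sumr hL _ XS) big_bool !(hdim_suml hL _ XS) !big_bool /=.
  by apply: leq_add; rewrite ?leq_addr ?leq_addl.
have h1 := idm_hdim X10; have h2 := idm_hdim X20.
have [I1 [S1 [b1 s1]]] : exists (I : finType) (S : I -> C), (forall a, brick (S a)) /\ fsum S X1.
  apply: IHn; apply: leq_trans Xn; apply: leq_trans le.
  by rewrite -addn1 leq_add2l.
have [I2 [S2 [b2 s2]]] : exists (I : finType) (S : I -> C), (forall a, brick (S a)) /\ fsum S X2.
  apply: IHn; apply: leq_trans Xn; apply: leq_trans le.
  by rewrite -add1n leq_add2r.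
pose J (b : bool) : finType := if b then I1 else I2.
pose S b : J b -> C := if b return (if b then I1 else I2) -> C then S1 else S2.
exists {b : bool & J b}, (fun s => S (tag s) (tagged s)); split.
  by case=> [[] a] /=.
by apply: (fsum_sigma hL) XS => -[].
Qed.

(** Gaussian elimination. By Schur a non-zero matrix entry of f is an invertible pivot, and
    subtracting [f i v f] clears the column of the pivot. *)
Lemma bricks_regular : brick_schur ->
  (forall X, exists (I : finType) (S : I -> C), (forall a, brick (S a)) /\ fsum S X) ->
  regular_cat.
Proof.
move=> schur dec X Y f.
have [I [S [Sb [i [p [h1 h2 h3]]]]]] := dec X.
have [J [T [Tb [j [q [e1 e2 e3]]]]]] := dec Y.
(* The induction runs over the list of summands of X on which f may still be non-zero. *)
suff reg r : forall f : mor C X Y, f = f \oc (\sum_(a <- r) (i a \oc p a)) ->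
    exists g, f \oc g \oc f = f.
  by apply: (reg (index_enum I)); rewrite h3 c1r.
elim: r => [|a r IHr] {}f; first by rewrite big_nil (comp0r hL) => ->; exists 0; rewrite !(comp0l hL).
rewrite big_cons => fE.
have [fa0|fa0] := eqVneq (f \oc i a) 0.
  by apply: IHr; rewrite {1}fE (compDr hL) -(cA f) fa0 (comp0l hL) add0r.
have [b fab0] : exists b, q b \oc f \oc i a <> 0.
  apply: NNPP => nb; case/eqP: fa0; rewrite -[f \oc i a]c1l -e3 (comp_suml hL) big1 // => b _.
  rewrite cA; suff -> : q b \oc f \oc i a = 0 by rewrite (comp0r hL).
  by apply: NNPP => nb'; apply: nb; exists b.
have [w [w1 w2]] := schur _ _ _ (Sb a) (Tb b) fab0.
have [v vfu] : exists v : mor C Y (S a), v \oc f \oc i a = idm _.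
  by exists (w \oc q b); rewrite !cA.
pose f' := f - f \oc i a \oc v \oc f.
have f'a : f' \oc i a = 0 by rewrite (compBl hL) !cA vfu c1r subrr.
have [g' fgf'] : exists g', f' \oc g' \oc f' = f'.
  apply: IHr; rewrite {1}/f' {1}fE.
  have -> : f \oc i a \oc v \oc f = (f \oc i a \oc v \oc f) \oc (i a \oc p a + \sum_(a0 <- r) (i a0 \oc p a0)).
    by rewrite !cA -fE.
  by rewrite -(compBl hL) (compDr hL) -cA f'a (comp0l hL) add0r.
(* Quasi-inverse of a block matrix, put together from the pivot and the quasi-inverse g' of the
   Schur complement f'. *)
exists (i a \oc v + (idm X - i a \oc v \oc f) \oc g' \oc (idm Y - f \oc i a \oc v)).
rewrite (compDl hL) (compDr hL) !cA.
have -> : (idm Y - f \oc i a \oc v) \oc f = f' by rewrite (compBl hL) c1l !cA.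
rewrite -(cA f (_ - _)).
have -> : f \oc (idm X - i a \oc v \oc f) = f' by rewrite (compBr hL) c1r.
by rewrite fgf' addrC subrK.
Qed.
End Bricks.

(** * Simple objects of a fusion category *)

Section Fusion.
Local Open Scope cat_scope.
Context (k : closedFieldType) (C : bmcat k) (hL : linear_category C).
Implicit Types X Y Z W : C.

Let cA := comp_assoc hL.
Let c1l := comp_idl hL.
Let c1r := comp_idr hL.

(** An idempotent e splits through the kernel of 1 - e. *)
Lemma kernel_split : abelian_category C -> idem_split C.
Proof.
move=> hA X e ee; have [K [i [i0 iP]]] := has_kernels hA (idm X - e).
have [|p [pe _]] := iP _ e; first by rewrite (compBl hL) c1l ee subrr.
exists K, i, p; split=> //.
have ei : e \oc i = i.
  by apply/eqP; rewrite eq_sym -subr_eq0 -{1}[i]c1l -(compBl hL) i0.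
have [u [_ uP]] := iP _ i i0.
by rewrite -(uP (p \oc i)) ?(uP (idm K)) ?c1r // -cA pe.
Qed.

Lemma mono_of_kernel0 X Y K (f : mor C X Y) (i : mor C K X) :
  is_kernel f i -> i = 0 -> is_mono f.
Proof.
move=> [_ iP] i0 Z u v fuv; apply/eqP; rewrite -subr_eq0; apply/eqP.
have [|g [<- _]] := iP _ (u - v); first by rewrite (compBr hL) fuv subrr.
by rewrite i0 (comp0l hL).
Qed.

Lemma kernel_mono X Y K (f : mor C X Y) (i : mor C K X) : is_kernel f i -> is_mono i.
Proof.
move=> [fi iP] Z u v iuv.
have [|g [_ gP]] := iP _ (i \oc v); first by rewrite -cA fi (comp0l hL).
by rewrite -(gP v erefl) -(gP u iuv).
Qed.

Lemma simple_hom_iso X Y (f : mor C X Y) : abelian_category C ->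
  simple_obj X -> simple_obj Y -> f <> 0 -> is_iso f.
Proof.
move=> hA [X0 XP] [Y0 YP] f0; have [K [i iK]] := has_kernels hA f.
have [i0|ii] := XP _ _ (kernel_mono iK).
  by have [//|] := YP _ f (mono_of_kernel0 iK i0).
case: f0; apply: (iso_cancel_r hL ii); rewrite (comp0l hL); exact: iK.1.
Qed.

(** As k is algebraically closed, composition with f has an eigenvector g. Then f - a kills g, so it
    is not invertible and vanishes by Schur. *)
Lemma simple_brick X : abelian_category C -> simple_obj X -> brick X.
Proof.
move=> hA [X0 XP]; split=> // f.
have [a [g [/eqP g0 fg]]] := eigenvector_exists (comp_linearr hL (X:=X) f) (hdim_gt0 X0).
exists a; apply: NNPP => fa; apply: g0.
have /(simple_hom_iso hA (conj X0 XP) (conj X0 XP)) h : f - a *: idm X <> 0.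
  by move=> /eqP; rewrite subr_eq0 => /eqP.
by apply: (iso_cancel_l hL h); rewrite (compBl hL) (compZl hL) c1l fg subrr (comp0r hL).
Qed.
End Fusion.

Section FusionCat.
Local Open Scope cat_scope.
Context (k : closedFieldType) (C : bmcat k) (hC : braided_fusion C).
Implicit Types X Y Z W : C.
Let hL := bf_linear hC.
Let hA := bf_abelian hC.
Let cA := comp_assoc hL.

Lemma fus_split : idem_split C. Proof. exact: (kernel_split hL hA). Qed.

(** A brick coincides with one of its simple summands: for a summand receiving a non-zero map,
    [i a p a] is a scalar and a non-zero idempotent, hence the identity. *)
Lemma brick_simple X : brick X -> simple_obj X.
Proof.
move=> Xb; have [n [S [Ss /dsum_fsum XS]]] := bf_semisimple hC X.
have := brick_hdim Xb; rewrite (hdim_sumr hL _ XS) => h1.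
have [a X0] : exists a, (0 < hdim X (S a))%N.
  apply: NNPP => na; move: h1; rewrite big1 // => a _; apply/eqP; rewrite eqn0Ngt.
  by apply/negP => h; apply: na; exists a.
have [i [p [e1 e2 e3]]] := XS.
have ia0 : i a \oc p a <> 0.
  have [f f0] := hdim_ex X0; move=> ip0.
  have : p a \oc (i a \oc p a) = p a by rewrite -(comp_assoc hL) e1 (comp_idl hL).
  rewrite ip0 (comp0r hL) => pa0; have [Sa0 _] := Ss a; apply: Sa0.
  by rewrite -e1 -pa0 (comp0l hL).
have [c ce] := Xb.2 (i a \oc p a).
have c1 : c = 1.
  have ci : c *: i a = 1 *: i a.
    by rewrite scale1r -{1}[i a](comp_idl hL) -(compZl hL) -ce cA e1 (comp_idr hL).
  apply: NNPP => cn.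
  apply: ia0; suff -> : i a = 0 by rewrite (comp0l hL).
  have : (c - 1) *: i a == 0 by rewrite scalerBl ci subrr.
  by rewrite scaler_eq0 subr_eq0 => /orP[/eqP|/eqP].
have inv : inverse_of (i a) (p a) by split=> //; rewrite ce c1 scale1r.
have [S0 SP] := Ss a; split=> [|Y f fm]; first exact: Xb.1.
have [] := SP _ (p a \oc f).
- move=> Z u v; rewrite !(comp_assoc hL).
  by move=> /(congr1 (fun h => i a \oc h)); rewrite -!(comp_assoc hL) inv.2 !(comp_idl hL) => /fm.
- move=> h; left; rewrite -[f](comp_idl hL) -inv.2 (comp_assoc hL) h; exact: comp0r.
move=> h; right; rewrite -[f](comp_idl hL) -inv.2 (comp_assoc hL).
by apply: (is_iso_comp hL _ h); exists (p a).
Qed.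

Lemma simpleE X : simple_obj X <-> brick X.
Proof. by split; [apply: (simple_brick hL hA) | apply: brick_simple]. Qed.

Lemma fus_schur : brick_schur C.
Proof. by move=> X Y f /simpleE Xs /simpleE Ys; apply: (simple_hom_iso hL hA). Qed.

Lemma fus_decomp X : exists (I : finType) (S : I -> C), (forall a, brick (S a)) /\ fsum S X.
Proof.
have [n [S [Ss /dsum_fsum XS]]] := bf_semisimple hC X.
by exists 'I_n, S; split=> // a; apply/simpleE.
Qed.

Lemma fus_regular : regular_cat C.
Proof. by apply: (bricks_regular hL); [apply: fus_schur | apply: fus_decomp]. Qed.

Lemma simplesP : simple_enum (@simp k C).
Proof.
have [n [S SE]] := bf_finite hC.
exact: (epsilon_spec (inhabits (existT (fun n => 'I_n -> C) 1%N (fun=> one C)))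
          (fun s => simple_enum (projT2 s)) (ex_intro _ (existT _ n S) SE)).
Qed.

Lemma simp_brick a : brick (simp (C := C) a).
Proof. by apply/simpleE; case: simplesP. Qed.
End FusionCat.

Section Semisimple.
Local Open Scope cat_scope.
Context (k : closedFieldType) (C : bmcat k) (hL : linear_category C).
Context (schur : brick_schur C).
Implicit Types X Y Z W : C.

Lemma brick_hom X Y : brick X -> brick Y -> (isomorphic X Y /\ hdim X Y = 1%N)
  \/ (~ isomorphic X Y /\ hdim X Y = 0%N).
Proof.
move=> Xb Yb; have [h0|h0] := posnP (hdim X Y).
  right; split=> // -[f [g [gf fg]]]; apply: Xb.1.
  by rewrite -gf (hdim0 f h0) (comp0r hL).
left; have [f f0] := hdim_ex h0; have XY : isomorphic X Y.
  by exists f; apply: schur.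
by split=> //; rewrite (hdim_isol hL _ XY) brick_hdim.
Qed.

Lemma brick_hdimE X Y : brick X -> brick Y -> (0 < hdim X Y)%N -> isomorphic X Y.
Proof. by move=> Xb Yb; have [[]|[_ ->]] := brick_hom Xb Yb. Qed.

Lemma hdim_sym X Y : 
  (forall X, exists (I : finType) (S : I -> C), (forall a, brick (S a)) /\ fsum S X) ->
  hdim X Y = hdim Y X.
Proof.
move=> dec; have [I [S [Sb XS]]] := dec X; have [J [T [Tb YT]]] := dec Y.
rewrite (hdim_suml hL _ XS) (hdim_sumr hL _ XS); apply: eq_bigr => a _.
rewrite (hdim_suml hL _ YT) (hdim_sumr hL _ YT); apply: eq_bigr => b _.
have [[i ->]|[i ->]] := brick_hom (Sb a) (Tb b);
  have [[i' ->]|[i' ->]] := brick_hom (Tb b) (Sb a) => //.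
  by case: i'; apply: isomorphic_sym.
by case: i; apply: isomorphic_sym.
Qed.
End Semisimple.

(** * Calculus in braided monoidal categories *)

Section Inv.
Local Open Scope cat_scope.
Context (k : fieldType) (C : bmcat k) (hL : linear_category C).
Definition inv (X Y : C) (f : mor C X Y) : mor C Y X :=
  epsilon (inhabits 0) (inverse_of f).
Lemma invP (X Y : C) (f : mor C X Y) : is_iso f -> inverse_of f (inv f).
Proof. exact: epsilon_spec. Qed.
Lemma inv_iso (X Y : C) (f : mor C X Y) : is_iso f -> is_iso (inv f).
Proof. by move=> /invP[h1 h2]; exists f. Qed.
Lemma invE (X Y : C) (f : mor C X Y) g : inverse_of f g -> inv f = g.
Proof. by move=> fg; apply: (inverse_uniq hL _ fg); apply: invP; exists g. Qed.
End Inv.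

Section Hats.
Local Open Scope cat_scope.
Context (k : fieldType) (C : bmcat k) (hL : linear_category C) (hM : monoidal C).
Implicit Types X Y Z W T A : C.

Let cA := comp_assoc hL.
Let c1l := comp_idl hL.
Let c1r := comp_idr hL.

Definition ai X Y Z := inv (assoc X Y Z).
Definition li X := inv (lunit X).
Definition ri X := inv (runit X).
Lemma aiP X Y Z : inverse_of (assoc X Y Z) (ai X Y Z).
Proof. exact/invP/assoc_iso. Qed.
Lemma liP X : inverse_of (lunit X) (li X).
Proof. exact/invP/lunit_iso. Qed.
Lemma riP X : inverse_of (runit X) (ri X).
Proof. exact/invP/runit_iso. Qed.
Lemma ai_as X Y Z : ai X Y Z \oc assoc X Y Z = idm _. Proof. exact: (aiP _ _ _).1. Qed.
Lemma as_ai X Y Z : assoc X Y Z \oc ai X Y Z = idm _. Proof. exact: (aiP _ _ _).2. Qed.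
Lemma li_lu X : li X \oc lunit X = idm _. Proof. exact: (liP _).1. Qed.
Lemma lu_li X : lunit X \oc li X = idm _. Proof. exact: (liP _).2. Qed.
Lemma ru_ri X : runit X \oc ri X = idm _. Proof. exact: (riP _).2. Qed.
Lemma ai_iso X Y Z : is_iso (ai X Y Z). Proof. exact/inv_iso/assoc_iso. Qed.

Lemma wl_id X Y : idm X \om idm Y = idm (X \ox Y). Proof. exact: tenm_id. Qed.
Lemma wlM X Y Y' Y'' (g : mor C Y' Y'') (f : mor C Y Y') :
  idm X \om (g \oc f) = (idm X \om g) \oc (idm X \om f).
Proof. exact: whiskl. Qed.
Lemma wrM X Y Y' Y'' (g : mor C Y' Y'') (f : mor C Y Y') :
  (g \oc f) \om idm X = (g \om idm X) \oc (f \om idm X).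
Proof. exact: whiskr. Qed.
Lemma tenm_wlr X X' Y Y' (f : mor C X X') (g : mor C Y Y') :
  f \om g = (idm X' \om g) \oc (f \om idm Y).
Proof. by rewrite -(tenm_comp hM) c1l c1r. Qed.
Lemma tenm_wrl X X' Y Y' (f : mor C X X') (g : mor C Y Y') :
  f \om g = (f \om idm Y') \oc (idm X \om g).
Proof. by rewrite -(tenm_comp hM) c1l c1r. Qed.
Lemma xch X X' Y Y' (f : mor C X X') (g : mor C Y Y') :
  (f \om idm Y') \oc (idm X \om g) = (idm X' \om g) \oc (f \om idm Y).
Proof. by rewrite -tenm_wlr -tenm_wrl. Qed.

Lemma tenmDl X X' Y Y' (f f' : mor C X X') (g : mor C Y Y') :
  (f + f') \om g = f \om g + f' \om g.
Proof. by have := tenm_linl hM 1 f f' g; rewrite !scale1r. Qed.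
Lemma tenmDr X X' Y Y' (f : mor C X X') (g g' : mor C Y Y') :
  f \om (g + g') = f \om g + f \om g'.
Proof. by have := tenm_linr hM 1 f g g'; rewrite !scale1r. Qed.
Lemma tenm0l X X' Y Y' (g : mor C Y Y') : (0 : mor C X X') \om g = 0.
Proof. by apply: (addrI (0 \om g)); rewrite -tenmDl !addr0. Qed.
Lemma tenm0r X X' Y Y' (f : mor C X X') : f \om (0 : mor C Y Y') = 0.
Proof. by apply: (addrI (f \om 0)); rewrite -tenmDr !addr0. Qed.
Lemma tenmZl X X' Y Y' a (f : mor C X X') (g : mor C Y Y') :
  (a *: f) \om g = a *: (f \om g).
Proof. by have := tenm_linl hM a f 0 g; rewrite tenm0l !addr0. Qed.
Lemma tenmZr X X' Y Y' a (f : mor C X X') (g : mor C Y Y') :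
  f \om (a *: g) = a *: (f \om g).
Proof. by have := tenm_linr hM a f g 0; rewrite tenm0r !addr0. Qed.
Lemma tenm_suml X X' Y Y' I (r : seq I) (P : pred I) (f : I -> mor C X X') (g : mor C Y Y') :
  (\sum_(i <- r | P i) f i) \om g = \sum_(i <- r | P i) (f i \om g).
Proof. elim/big_rec2: _ => [|i _ x _ <-]; by rewrite ?tenm0l ?tenmDl. Qed.
Lemma tenm_sumr X X' Y Y' I (r : seq I) (P : pred I) (f : mor C X X') (g : I -> mor C Y Y') :
  f \om (\sum_(i <- r | P i) g i) = \sum_(i <- r | P i) (f \om g i).
Proof. elim/big_rec2: _ => [|i _ x _ <-]; by rewrite ?tenm0r ?tenmDr. Qed.

Lemma tenm_inv X X' Y Y' (f : mor C X X') f' (g : mor C Y Y') g' :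
  inverse_of f f' -> inverse_of g g' -> inverse_of (f \om g) (f' \om g').
Proof. by move=> [h1 h2] [e1 e2]; split; rewrite -(tenm_comp hM) ?h1 ?h2 ?e1 ?e2 wl_id. Qed.
Lemma tenm_iso X X' Y Y' (f : mor C X X') (g : mor C Y Y') :
  is_iso f -> is_iso g -> is_iso (f \om g).
Proof. by move=> [f' fi] [g' gi]; exists (f' \om g'); apply: tenm_inv. Qed.
Lemma wl_iso X Y Y' (g : mor C Y Y') : is_iso g -> is_iso (idm X \om g).
Proof. by apply: tenm_iso; apply: is_iso_id. Qed.
Lemma wr_iso X Y Y' (g : mor C Y Y') : is_iso g -> is_iso (g \om idm X).
Proof. by move=> gi; apply: tenm_iso => //; apply: is_iso_id. Qed.
Lemma isomorphic_ten X X' Y Y' :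
  isomorphic X X' -> isomorphic Y Y' -> isomorphic (X \ox Y) (X' \ox Y').
Proof. by move=> [f fi] [g gi]; exists (f \om g); apply: tenm_iso. Qed.

Lemma ai_nat X X' Y Y' Z Z' (f : mor C X X') (g : mor C Y Y') (h : mor C Z Z') :
  ai X' Y' Z' \oc (f \om (g \om h)) = ((f \om g) \om h) \oc ai X Y Z.
Proof.
apply: (iso_cancel_l hL (assoc_iso hM X' Y' Z')).
by rewrite -cA as_ai c1l -cA (assoc_nat hM) cA as_ai c1r.
Qed.
Lemma li_nat X X' (f : mor C X X') : li X' \oc f = (idm (one C) \om f) \oc li X.
Proof.
apply: (iso_cancel_l hL (lunit_iso hM X')).
by rewrite -cA lu_li c1l -cA (lunit_nat hM) cA lu_li c1r.
Qed.

Lemma wl1_inj X Y (f g : mor C X Y) : idm (one C) \om f = idm (one C) \om g -> f = g.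
Proof.
move=> fg; apply: (iso_cancel_r hL (lunit_iso hM X)).
by rewrite -!(lunit_nat hM) fg.
Qed.
Lemma wr1_inj X Y (f g : mor C X Y) : f \om idm (one C) = g \om idm (one C) -> f = g.
Proof.
move=> fg; apply: (iso_cancel_r hL (runit_iso hM X)).
by rewrite -!(runit_nat hM) fg.
Qed.

(* Kelly: the remaining unit triangles follow from the pentagon and the triangle. *)
Lemma lunit_ten X Y : lunit (X \ox Y) \oc assoc (one C) X Y = lunit X \om idm Y.
Proof.
apply: wl1_inj; rewrite wlM.
apply: (iso_cancel_r hL (is_iso_comp hL (assoc_iso hM _ (one C \ox X) _)
   (wr_iso Y (assoc_iso hM (one C) (one C) X)))).
rewrite cA -(pentagon hM) -cA (triangle hM).
rewrite -[in RHS]cA -(assoc_nat hM) cA -wrM (triangle hM).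
by rewrite -wl_id -(assoc_nat hM).
Qed.
Lemma runit_ten X Y : (idm X \om runit Y) \oc assoc X Y (one C) = runit (X \ox Y).
Proof.
apply: wr1_inj; rewrite wrM.
apply: (iso_cancel_l hL (assoc_iso hM _ _ _)).
rewrite -cA (assoc_nat hM) -(triangle hM) wlM !cA -(pentagon hM).
by rewrite -cA -(assoc_nat hM) wl_id cA (triangle hM).
Qed.
Lemma lunit_lunit X : lunit (one C \ox X) = idm (one C) \om lunit X.
Proof. by apply: (iso_cancel_l hL (lunit_iso hM X)); rewrite (lunit_nat hM). Qed.
Lemma lunit1_runit1 : lunit (one C) = runit (one C).
Proof.
apply: wr1_inj; rewrite -lunit_ten -(triangle hM) lunit_lunit //.
Qed.

(* Composites are written with right-nested tensor products: h1, h2, h0, hd, he,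
   hc, ch and dbl apply a map with one, two or no factors in its source and
   target, the braiding and the double braiding to the leftmost factors of
   X (x) (Y (x) ... Z).  Associators then disappear from most calculations. *)
Definition h1 X T (f : mor C X T) Z := f \om idm Z.
Definition h2 X Y T (f : mor C (X \ox Y) T) Z := locked ((f \om idm Z) \oc ai X Y Z).
Definition h0 T (f : mor C (one C) T) Z := locked ((f \om idm Z) \oc li Z).
Definition hd X T T' (f : mor C X (T \ox T')) Z := locked (assoc T T' Z \oc (f \om idm Z)).
Definition he X Y (f : mor C (X \ox Y) (one C)) Z := locked (lunit Z \oc h2 f Z).
Definition hc T T' (f : mor C (one C) (T \ox T')) Z := locked (hd f Z \oc li Z).
Definition ch X Y Z := locked (assoc Y X Z \oc h2 (braid X Y) Z).
Definition dbl X Y Z := locked (ch Y X Z \oc ch X Y Z).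
Lemma h2E X Y T (f : mor C (X \ox Y) T) Z : h2 f Z = (f \om idm Z) \oc ai X Y Z.
Proof. by rewrite /h2 -lock. Qed.
Lemma h0E T (f : mor C (one C) T) Z : h0 f Z = (f \om idm Z) \oc li Z.
Proof. by rewrite /h0 -lock. Qed.
Lemma hdE X T T' (f : mor C X (T \ox T')) Z : hd f Z = assoc T T' Z \oc (f \om idm Z).
Proof. by rewrite /hd -lock. Qed.
Lemma heE X Y (f : mor C (X \ox Y) (one C)) Z : he f Z = lunit Z \oc h2 f Z.
Proof. by rewrite /he -lock. Qed.
Lemma hcE T T' (f : mor C (one C) (T \ox T')) Z : hc f Z = hd f Z \oc li Z.
Proof. by rewrite /hc -lock. Qed.
Lemma chE X Y Z : ch X Y Z = assoc Y X Z \oc h2 (braid X Y) Z.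
Proof. by rewrite /ch -lock. Qed.
Lemma dblE X Y Z : dbl X Y Z = ch Y X Z \oc ch X Y Z.
Proof. by rewrite /dbl -lock. Qed.

Lemma h1_inj X T (f g : mor C X T) : h1 f (one C) = h1 g (one C) -> f = g.
Proof. exact: wr1_inj. Qed.
Lemma h2_inj X Y T (f g : mor C (X \ox Y) T) : h2 f (one C) = h2 g (one C) -> f = g.
Proof. by rewrite !h2E => /(iso_cancel_r hL (ai_iso _ _ _))/wr1_inj. Qed.
Lemma h1_id X Z : h1 (idm X) Z = idm _. Proof. exact: wl_id. Qed.
Lemma h1M X Y T (g : mor C Y T) (f : mor C X Y) Z : h1 (g \oc f) Z = h1 g Z \oc h1 f Z.
Proof. exact: wrM. Qed.
Lemma h2M X Y T T' (g : mor C T T') (f : mor C (X \ox Y) T) Z :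
  h2 (g \oc f) Z = h1 g Z \oc h2 f Z.
Proof. by rewrite ?h2E wrM cA. Qed.
Lemma h2_tenl X X' Y T (f : mor C (X' \ox Y) T) (g : mor C X X') Z :
  h2 (f \oc (g \om idm Y)) Z = h2 f Z \oc h1 g (Y \ox Z).
Proof. by rewrite ?h2E /h1 wrM !cA -wl_id ai_nat. Qed.
Lemma h2_tenr X Y Y' T (f : mor C (X \ox Y') T) (g : mor C Y Y') Z :
  h2 (f \oc (idm X \om g)) Z = h2 f Z \oc (idm X \om h1 g Z).
Proof. by rewrite ?h2E /h1 wrM !cA ai_nat. Qed.

Lemma h1n X T (f : mor C X T) Z Z' (g : mor C Z Z') :
  h1 f Z' \oc (idm X \om g) = (idm T \om g) \oc h1 f Z.
Proof. exact: xch. Qed.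
Lemma h2n X Y T (f : mor C (X \ox Y) T) Z Z' (g : mor C Z Z') :
  h2 f Z' \oc (idm X \om (idm Y \om g)) = (idm T \om g) \oc h2 f Z.
Proof. by rewrite ?h2E cA ai_nat -cA wl_id xch cA. Qed.
Lemma h0n T (f : mor C (one C) T) Z Z' (g : mor C Z Z') :
  h0 f Z' \oc g = (idm T \om g) \oc h0 f Z.
Proof. by rewrite ?h0E cA li_nat -cA xch cA. Qed.
Lemma hdn X T T' (f : mor C X (T \ox T')) Z Z' (g : mor C Z Z') :
  hd f Z' \oc (idm X \om g) = (idm T \om (idm T' \om g)) \oc hd f Z.
Proof. by rewrite ?hdE cA xch -cA -wl_id (assoc_nat hM) cA. Qed.
Lemma hen X Y (f : mor C (X \ox Y) (one C)) Z Z' (g : mor C Z Z') :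
  he f Z' \oc (idm X \om (idm Y \om g)) = g \oc he f Z.
Proof. by rewrite ?heE cA h2n -cA (lunit_nat hM) cA. Qed.
Lemma hcn T T' (f : mor C (one C) (T \ox T')) Z Z' (g : mor C Z Z') :
  hc f Z' \oc g = (idm T \om (idm T' \om g)) \oc hc f Z.
Proof. by rewrite ?hcE cA li_nat -cA hdn cA. Qed.

(** Rebrackets A (X (Y Z)) as ((A X) Y) Z. Precomposition with it turns an equation between maps out
    of (A X) Y into one between nested composites; [hat_l] and [hat_r] treat the two orders in which
    binary maps can be applied. *)
Definition J3 A X Y Z := locked (ai (A \ox X) Y Z \oc ai A X (Y \ox Z)).
Lemma J3E A X Y Z : J3 A X Y Z = ai (A \ox X) Y Z \oc ai A X (Y \ox Z).
Proof. by rewrite /J3 -lock. Qed.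
Lemma J3_iso A X Y Z : is_iso (J3 A X Y Z).
Proof. by rewrite J3E; apply: is_iso_comp => //; apply: ai_iso. Qed.

Lemma hat_l A X Y T W (f : mor C (T \ox Y) W) (g : mor C (A \ox X) T) Z :
  h1 (f \oc (g \om idm Y)) Z \oc J3 A X Y Z = h2 f Z \oc h2 g (Y \ox Z).
Proof. by rewrite h1M ?h2E ?J3E /h1 !cA -(wl_id Y Z) (post2 hL (ai_nat _ _ _)) !cA. Qed.

Lemma pent_ai A X Y Z :
  (idm A \om ai X Y Z) = (assoc A (X \ox Y) Z \oc (assoc A X Y \om idm Z)) \oc J3 A X Y Z.
Proof.
apply: (iso_cancel_l hL (wl_iso A (assoc_iso hM X Y Z))).
rewrite -wlM as_ai wl_id ?J3E -!cA (cA _ (assoc A _ Z)) -(pentagon hM).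
by rewrite cA (cA (assoc A X _)) -(cA (assoc (A \ox X) Y Z)) as_ai c1l as_ai.
Qed.

Lemma hat_r A X Y T W (f : mor C (A \ox T) W) (g : mor C (X \ox Y) T) Z :
  h1 (f \oc (idm A \om g) \oc assoc A X Y) Z \oc J3 A X Y Z = h2 f Z \oc (idm A \om h2 g Z).
Proof.
rewrite ?h2E wlM pent_ai h1M [h1 _ Z](_ : _ = (f \om idm Z)) // h1M /h1 !cA.
rewrite (post2 hL (ai_nat _ _ _)) !cA; congr (_ \oc (_ \oc _)).
by rewrite -(cA (ai _ _ _)) ai_as c1l.
Qed.

Lemma hat_u M T (a : mor C (T \ox M) M) (u : mor C (one C) T) Z :
  a \oc (u \om idm M) = lunit M -> h2 a Z \oc h0 u (M \ox Z) = idm _.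
Proof.
move=> au; have -> : h0 u (M \ox Z) = h1 u _ \oc li (M \ox Z) by rewrite h0E.
rewrite -cA -h2_tenl au ?h2E -lunit_ten !cA -(cA (assoc _ _ _)) as_ai c1l lu_li //.
Qed.
End Hats.

(** * Sliding morphisms past a strand of the braiding *)

Section BraidHats.
Local Open Scope cat_scope.
Context (k : fieldType) (C : bmcat k) (hL : linear_category C) (hM : monoidal C) (hB : braided C).
Implicit Types X Y Z W T A : C.

Let cA := comp_assoc hL.
Let c1l := comp_idl hL.
Let c1r := comp_idr hL.

Lemma ch_iso X Y Z : is_iso (ch X Y Z).
Proof.
rewrite chE h2E; apply: is_iso_comp => //; first exact: assoc_iso.
apply: is_iso_comp => //; last exact: ai_iso.
by apply: wr_iso => //; apply: braid_iso.
Qed.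
Lemma chn X Y Z Z' (g : mor C Z Z') :
  ch X Y Z' \oc (idm X \om (idm Y \om g)) = (idm Y \om (idm X \om g)) \oc ch X Y Z.
Proof. by rewrite ?chE cA (h2n hL hM) -cA -(wl_id hM) (assoc_nat hM) cA. Qed.
Lemma ch_l X X' Y Z (f : mor C X X') :
  ch X' Y Z \oc h1 f (Y \ox Z) = (idm Y \om h1 f Z) \oc ch X Y Z.
Proof.
rewrite ?chE cA -(h2_tenl hL hM) (braid_nat hB) (h2M hL hM) -?cA; congr (_ \oc _).
by rewrite /h1 (assoc_nat hM).
Qed.
Lemma ch_r X Y Y' Z (f : mor C Y Y') :
  ch X Y' Z \oc (idm X \om h1 f Z) = h1 f (X \ox Z) \oc ch X Y Z.
Proof.
rewrite ?chE cA -(h2_tenr hL hM) (braid_nat hB) (h2M hL hM) -?cA; congr (_ \oc _).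
by rewrite /h1 (assoc_nat hM) (wl_id hM).
Qed.

(** One hexagon in nested form; [ch_tenl] is the other. *)
Lemma ch_tenr A X Y Z :
  assoc X Y (A \ox Z) \oc ch A (X \ox Y) Z \oc (idm A \om ai X Y Z)
    = (idm X \om ch A Y Z) \oc ch A X (Y \ox Z).
Proof.
apply: (iso_cancel_r hL (is_iso_comp hL (assoc_iso hM A X (Y \ox Z))
  (assoc_iso hM (A \ox X) Y Z))).
rewrite [in LHS](pentagon hM) ?cA -(cA (idm A \om ai _ _ _)) -(wlM hL hM) (ai_as hM) (wl_id hM) c1l.
rewrite ?chE ?h2E ?cA -(cA (ai A _ Z)) (ai_as hM) c1l.
rewrite -(cA (assoc X Y _)) (pentagon hM) ?cA -!(wrM hL hM) (hexagon hB) !(wrM hL hM).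
rewrite !(wlM hL hM) ?cA -(cA (ai A X _)) (ai_as hM) c1l.
congr (_ \oc _); rewrite -(wl_id hM Y Z) -(assoc_nat hM).
rewrite -(cA (assoc X A _)) (pentagon hM) ?cA.
rewrite -(cA (idm X \om ai _ _ _)) -(wlM hL hM) (ai_as hM) (wl_id hM) c1l.
by rewrite -(cA (idm X \om _)) -(assoc_nat hM) cA.
Qed.

Lemma ch_tenl A X Y Z :
  ch (X \ox Y) A Z \oc ai X Y (A \ox Z)
    = (idm A \om ai X Y Z) \oc ch X A (Y \ox Z) \oc (idm X \om ch Y A Z).
Proof.
apply: (iso_cancel_r hL (is_iso_comp hL (assoc_iso hM X Y (A \ox Z))
  (assoc_iso hM (X \ox Y) A Z))).
rewrite ?cA -(cA (ai X Y _)) (ai_as hM) c1l ?chE ?h2E ?cA (ai_as hM) c1r.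
rewrite (hexagon_inv hB (aiP hM X A Y)) !(wrM hL hM) (pentagon hM) !(wlM hL hM) ?cA.
rewrite -(cA (idm X \om ai Y A Z)) -(wlM hL hM) (ai_as hM) (wl_id hM) c1l.
rewrite -(cA (idm X \om (braid Y A \om idm Z))) -(assoc_nat hM) ?cA.
have P : (idm X \om assoc A Y Z) \oc assoc X (A \ox Y) Z
  = assoc X A (Y \ox Z) \oc assoc (X \ox A) Y Z \oc (ai X A Y \om idm Z).
  rewrite -cA (pentagon hM) ?cA -(wrM hL hM) (as_ai hM) (wl_id hM) c1r //.
rewrite (post2 hL P) ?cA -(cA (ai X A _)) (ai_as hM) c1l.
rewrite -(wl_id hM Y Z) -(cA (braid X A \om _)) -(assoc_nat hM) ?cA.
rewrite -(cA (assoc A X _)) (pentagon hM) ?cA -(cA (idm A \om ai _ _ _)).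
by rewrite -(wlM hL hM) (ai_as hM) (wl_id hM) c1l.
Qed.

Lemma dbl_hd X Y Z : dbl X Y Z = hd (braid Y X \oc braid X Y) Z \oc ai X Y Z.
Proof.
rewrite ?dblE ?chE ?hdE ?h2E ?(wrM hL hM) ?cA -(cA (ai Y X Z)) (ai_as hM) c1l //.
Qed.

(** The sliding rules are named after the side and the shape of the map: in [chR] the strand A
    starts on the left of the map and travels to its right, in [chL] the other way. The suffix 2
    means two inputs, 0 no input, d two outputs, c a coevaluation, e an evaluation. *)
Lemma chR2 A X Y T (p : mor C (X \ox Y) T) Z :
  ch A T Z \oc (idm A \om h2 p Z)
    = h2 p (A \ox Z) \oc (idm X \om ch A Y Z) \oc ch A X (Y \ox Z).
Proof.
rewrite -ch_tenr ?h2E (wlM hL hM) -cA ch_r ?cA.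
by rewrite -(cA (ai _ _ _)) (ai_as hM) c1l.
Qed.
Lemma chL2 A X Y T (p : mor C (X \ox Y) T) Z :
  ch T A Z \oc h2 p (A \ox Z)
    = (idm A \om h2 p Z) \oc ch X A (Y \ox Z) \oc (idm X \om ch Y A Z).
Proof.
rewrite ?h2E -cA ch_l (cA (idm A \om _) (ch _ _ _)) ch_tenl (wlM hL hM).
by rewrite (cA (idm A \om _) (idm A \om _)).
Qed.

(** Compatibility of the braiding with the unit is a consequence of the hexagon: slide A past the
    map 1 (x) 1 -> 1 and cancel one crossing of A with the unit. *)
Lemma chR_lunit A Z : lunit (A \ox Z) \oc ch A (one C) Z = idm A \om lunit Z.
Proof.
apply: (wl1_inj hL hM); apply: (iso_cancel_r hL (ch_iso A (one C) (one C \ox Z))).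
have E W : h2 (lunit (one C)) W = idm (one C) \om lunit W :> mor C (_ \ox (_ \ox W)) _.
  by rewrite ?h2E -(lunit_ten hL hM) cA (as_ai hM) c1r (lunit_lunit hL hM).
by rewrite (wlM hL hM) cA -[in LHS]E -chR2 E chn.
Qed.
Lemma chL_lunit A Z : (idm A \om lunit Z) \oc ch (one C) A Z = lunit (A \ox Z).
Proof.
have E W : h2 (lunit (one C)) W = lunit (one C \ox W) :> mor C (_ \ox (_ \ox W)) _.
  by rewrite ?h2E -(lunit_ten hL hM) cA (as_ai hM) c1r.
have F : (idm A \om lunit (one C \ox Z)) \oc ch (one C) A (one C \ox Z) = lunit (A \ox (one C \ox Z)).
  have := chL2 A (lunit (one C)) Z; rewrite E -(lunit_nat hM) -cA => /(iso_cancel_r hL).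
  by rewrite E => ->//; apply: (wl_iso hL hM); apply: ch_iso.
apply: (iso_cancel_r hL (wl_iso hL hM (one C) (wl_iso hL hM A (lunit_iso hM Z)))).
by rewrite cA chn -(lunit_lunit hL hM) F (lunit_nat hM).
Qed.
Lemma chR0 A T (u : mor C (one C) T) Z :
  ch A T Z \oc (idm A \om h0 u Z) = h0 u (A \ox Z).
Proof.
rewrite ?h0E (wlM hL hM) -cA ch_r ?cA; congr (_ \oc _).
apply: (iso_cancel_l hL (lunit_iso hM _)).
by rewrite (lu_li hM) -cA chR_lunit -(wlM hL hM) (lu_li hM) (wl_id hM).
Qed.
Lemma chL0 A T (u : mor C (one C) T) Z :
  ch T A Z \oc h0 u (A \ox Z) = idm A \om h0 u Z.
Proof.
rewrite ?h0E (wlM hL hM) -cA ch_l ?cA; congr (_ \oc _).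
apply: (iso_cancel_l hL (wl_iso hL hM A (lunit_iso hM _))).
by rewrite -cA chL_lunit (lu_li hM) -(wlM hL hM) (lu_li hM) (wl_id hM).
Qed.
Lemma chRd A X T T' (f : mor C X (T \ox T')) Z :
  (idm T \om ch A T' Z) \oc ch A T (T' \ox Z) \oc (idm A \om hd f Z)
    = hd f (A \ox Z) \oc ch A X Z.
Proof.
rewrite -cA -ch_tenr ?hdE (wlM hL hM) ?cA -(cA (idm A \om ai _ _ _)) -(wlM hL hM) (ai_as hM).
by rewrite (wl_id hM) c1l ch_r.
Qed.
Lemma chLd A X T T' (f : mor C X (T \ox T')) Z :
  ch T A (T' \ox Z) \oc (idm T \om ch T' A Z) \oc hd f (A \ox Z)
    = (idm A \om hd f Z) \oc ch X A Z.
Proof.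
apply: (iso_cancel_l hL (wl_iso hL hM A (ai_iso hM T T' Z))).
rewrite -cA -?cA (cA (idm A \om ai _ _ _)) -ch_tenl ?hdE (wlM hL hM) ?cA.
rewrite -(cA (idm A \om ai _ _ _)) -(wlM hL hM) (ai_as hM) (wl_id hM) c1l -ch_l.
by rewrite -(cA (ai _ _ _)) (ai_as hM) c1l.
Qed.
Lemma chRc A T T' (f : mor C (one C) (T \ox T')) Z :
  (idm T \om ch A T' Z) \oc ch A T (T' \ox Z) \oc (idm A \om hc f Z) = hc f (A \ox Z).
Proof.
rewrite ?hcE (wlM hL hM) -?cA (cA (idm T \om _)) chRd cA; congr (_ \oc _).
apply: (iso_cancel_l hL (lunit_iso hM _)).
by rewrite (lu_li hM) -cA chR_lunit -(wlM hL hM) (lu_li hM) (wl_id hM).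
Qed.
Lemma chLc A T T' (f : mor C (one C) (T \ox T')) Z :
  ch T A (T' \ox Z) \oc (idm T \om ch T' A Z) \oc hc f (A \ox Z) = idm A \om hc f Z.
Proof.
rewrite ?hcE (wlM hL hM) -?cA (cA (ch T A _)) chLd cA; congr (_ \oc _).
apply: (iso_cancel_l hL (wl_iso hL hM A (lunit_iso hM _))).
by rewrite -cA chL_lunit (lu_li hM) -(wlM hL hM) (lu_li hM) (wl_id hM).
Qed.
Lemma chRe A X Y (f : mor C (X \ox Y) (one C)) Z :
  he f (A \ox Z) \oc (idm X \om ch A Y Z) \oc ch A X (Y \ox Z) = idm A \om he f Z.
Proof. by rewrite ?heE ?cA -chR2 -cA chR_lunit -(wlM hL hM). Qed.
Lemma chLe A X Y (f : mor C (X \ox Y) (one C)) Z :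
  (idm A \om he f Z) \oc ch X A (Y \ox Z) \oc (idm X \om ch Y A Z) = he f (A \ox Z).
Proof. by rewrite ?heE (wlM hL hM) ?cA -chL2 -cA chL_lunit. Qed.

Lemma dbl_centralizes X Y Z : centralizes X Y -> dbl X Y Z = idm _.
Proof. by move=> XY; rewrite dbl_hd XY ?hdE (wl_id hM) c1r (as_ai hM). Qed.
Lemma centralizes_dbl X Y : dbl X Y (one C) = idm _ -> centralizes X Y.
Proof.
rewrite dbl_hd ?hdE cA => h; apply: (wr1_inj hL hM).
apply: (iso_cancel_l hL (assoc_iso hM _ _ _)).
apply: (iso_cancel_r hL (ai_iso hM _ _ _)).
by rewrite cA h (wl_id hM) c1r (as_ai hM).
Qed.
End BraidHats.

(** * Modules over the algebra of functions on a finite group *)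

(* Fun(H) with its algebra structure (m, u), the translations tau and the map
   s : delta_x |-> delta_x (x) delta_x splitting the multiplication. *)
Record galois_alg (k : fieldType) (C : bmcat k) (H : finGroupType) (R : C)
    (m : mor C (ten R R) R) (u : mor C (one C) R) (tau : H -> mor C R R)
    (s : mor C R (ten R R)) : Prop := {
  ga_assoc : comp m (comp (tenm (idm R) m) (assoc R R R)) = comp m (tenm m (idm R));
  ga_unit : comp m (tenm u (idm R)) = lunit R;
  ga_comm : comp m (braid R R) = m;
  ga_sym : centralizes R R;
  ga_tau1 : tau 1%g = idm R;
  ga_tauM : forall g h, comp (tau g) (tau h) = tau (g * h)%g;
  ga_tau_m : forall g, comp (tau g) m = comp m (tenm (tau g) (tau g));
  ga_tau_u : forall g, comp (tau g) u = u;
  ga_ms : comp m s = idm R;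
  ga_cs : comp (braid R R) s = s;
  ga_sm : comp s m = comp (tenm (idm R) m) (comp (assoc R R R) (tenm s (idm R)));
  ga_stau : forall g, comp s (tau g) = comp (tenm (tau g) (tau g)) s;
  ga_orth : forall g, g != 1%g -> comp m (comp (tenm (tau g) (idm R)) s) = 0;
  ga_sum : comp (\sum_g comp (tenm (idm R) (tau g)) s) (runit R) = tenm (idm R) u;
  ga_dim : hdim (one C) R = 1%N
}.

Section Galois.
Local Open Scope cat_scope.
Context (k : closedFieldType) (C : bmcat k) (hL : linear_category C) (hM : monoidal C) (hB : braided C).
Context (H : finGroupType) (R : C) (m : mor C (R \ox R) R) (u : mor C (one C) R)
  (tau : H -> mor C R R) (s : mor C R (R \ox R)) (hG : galois_alg m u tau s).
Implicit Types X Y Z W T A K N : C.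

Let cA := comp_assoc hL.
Let c1l := comp_idl hL.
Let c1r := comp_idr hL.
Let wM := wlM hL hM.
Let p2 := post2 hL.
Local Notation "''R' f" := (idm R \om f) (at level 30, f at level 30).
Local Notation mu := (h2 m).
Local Notation eta := (h0 u).
Local Notation sg := (hd s).
Local Notation tu g := (h1 (tau g)).
Local Notation ep := (hc (s \oc u)).
Local Notation cc := (ch R R).

Lemma mu_etal Z : mu Z \oc eta (R \ox Z) = idm _.
Proof. exact: (hat_u hL hM Z (ga_unit hG)). Qed.
Lemma h2_braid X Y T (f : mor C (Y \ox X) T) Z : h2 (f \oc braid X Y) Z = h2 f Z \oc ch X Y Z.
Proof.
by rewrite (h2M hL hM) chE [h2 f Z]h2E cA -(cA (ai _ _ _)) (ai_as hM) c1l.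
Qed.
Lemma mu_cc Z : mu Z \oc cc Z = mu Z.
Proof. by rewrite -h2_braid (ga_comm hG). Qed.
Lemma cc_cc Z : cc Z \oc cc Z = idm _.
Proof. by rewrite -dblE (dbl_centralizes hL hM Z (ga_sym hG)). Qed.
Lemma mu_etar Z : mu Z \oc 'R (eta Z) = idm _.
Proof. by rewrite -mu_cc cA (chR0 hL hM hB) mu_etal. Qed.
Lemma tu1 Z : tu 1%g Z = idm _.
Proof. by rewrite (ga_tau1 hG) (h1_id hM). Qed.
Lemma tuM g h Z : tu g Z \oc tu h Z = tu (g * h)%g Z.
Proof. by rewrite -(h1M hL hM) (ga_tauM hG). Qed.
Lemma tuVK g Z : tu g^-1%g Z \oc tu g Z = idm _.
Proof. by rewrite tuM mulVg tu1. Qed.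
Lemma tuKV g Z : tu g Z \oc tu g^-1%g Z = idm _.
Proof. by rewrite tuM mulgV tu1. Qed.
Lemma tu_mu g Z : tu g Z \oc mu Z = mu Z \oc tu g (R \ox Z) \oc 'R (tu g Z).
Proof.
rewrite -(h2M hL hM) (ga_tau_m hG) (tenm_wrl hL hM) -cA (h2_tenr hL hM).
by rewrite (h2_tenl hL hM) cA.
Qed.
Lemma tu_eta g Z : tu g Z \oc eta Z = eta Z.
Proof. by rewrite !h0E /h1 -cA -(wrM hL hM) (ga_tau_u hG). Qed.
Lemma mu_sg Z : mu Z \oc sg Z = idm _.
Proof.
by rewrite h2E hdE cA -(cA (ai _ _ _)) (ai_as hM) c1l -(wrM hL hM) (ga_ms hG) (wl_id hM).
Qed.
Lemma cc_sg Z : cc Z \oc sg Z = sg Z.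
Proof.
rewrite chE h2E hdE !cA -(cA (ai _ _ _)) (ai_as hM) c1l -(wrM hL hM).
by rewrite (ga_cs hG).
Qed.
Lemma sg_mu Z : sg Z \oc mu Z = 'R (mu Z) \oc sg (R \ox Z).
Proof.
apply: (iso_cancel_r hL (assoc_iso hM R R Z)).
rewrite h2E !hdE wM !cA (ai_as hM) c1r -(wrM hL hM) (ga_sm hG) !(wrM hL hM).
rewrite -[idm (R \ox Z)](wl_id hM) -(assoc_nat hM).
rewrite -!cA; congr (_ \oc _); rewrite !cA.
rewrite (pentagon hM) -(cA ('R (ai _ _ _))) -wM (ai_as hM) (wl_id hM) c1l.
by rewrite -cA (assoc_nat hM) cA.
Qed.
(** The Frobenius relation of [sg_mu] from the other side. It follows because the multiplication and
    its splitting are both unchanged by the self-braiding of R, whose square is the identity. *)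
Lemma mu_sgr Z : mu (R \ox Z) \oc 'R (sg Z) = sg Z \oc mu Z.
Proof.
have E1 : 'R (cc Z) \oc sg (R \ox Z) = cc (R \ox Z) \oc 'R (sg Z) \oc cc Z.
  rewrite -[sg _]c1r -(cc_cc Z) -(cA (sg _)) -(chRd hL hM hB) !cA.
  by rewrite -(cA ('R (cc Z))) -wM cc_cc (wl_id hM) c1l.
have E2 : sg Z \oc mu Z = mu (R \ox Z) \oc 'R (sg Z) \oc cc Z.
  rewrite -{1}cc_sg cA sg_mu -cA (chR2 hL hM hB) !cA cc_sg E1.
  by rewrite -(cA (mu _)) mu_cc.
apply: (iso_cancel_r hL (ch_iso hL hM hB R R Z)).
by rewrite cA -E2 cA mu_cc.
Qed.
Lemma sg_tu g Z : sg Z \oc tu g Z = tu g (R \ox Z) \oc 'R (tu g Z) \oc sg Z.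
Proof.
have : hd (s \oc tau g) Z = hd ((tau g \om tau g) \oc s) Z by rewrite (ga_stau hG).
rewrite !hdE !(wrM hL hM) => E; rewrite cA E.
rewrite (tenm_wrl hL hM (tau g)) (wrM hL hM) cA.
have e1 := assoc_nat hM (tau g) (idm R) (idm Z); rewrite (wl_id hM) in e1.
by rewrite (post2 hL e1) cA (post2 hL (assoc_nat hM _ _ _)) cA.
Qed.

Lemma orth g Z : g != 1%g -> mu Z \oc tu g (R \ox Z) \oc sg Z = 0.
Proof.
move=> g1; rewrite -cA -(h2_tenl hL hM) h2E hdE cA -(cA (ai _ _ _)) (ai_as hM) c1l.
by rewrite -(wrM hL hM) cA (ga_orth hG) // (tenm0l hM).
Qed.
(** For functions on H: the translates of delta_x sum to the constant function 1. *)
Lemma sum_tu Z : \sum_g ('R (tu g Z) \oc sg Z) = 'R (eta Z).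
Proof.
have : hd ((\sum_g ('R (tau g) \oc s)) \oc runit R) Z = hd (idm R \om u) Z.
  by rewrite (ga_sum hG).
rewrite !hdE (assoc_nat hM) => E.
transitivity ('R (u \om idm Z) \oc assoc R (one C) Z \oc (ri R \om idm Z)).
  rewrite -cA -E cA -(wrM hL hM) cA (ru_ri hM) c1r (tenm_suml hM) (comp_sumr hL).
  by apply: eq_bigr => g _; rewrite (wrM hL hM) -[RHS]cA (assoc_nat hM) cA.
rewrite h0E wM; congr (_ \oc _).
apply: (iso_cancel_l hL (wl_iso hL hM R (lunit_iso hM Z))).
by rewrite -cA (triangle hM) -(wrM hL hM) (ru_ri hM) -wM (lu_li hM) !(wl_id hM).
Qed.

(** [ep] inserts the sum of all delta_x (x) delta_x, the separability element of R, which is behind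
    every averaging argument below. *)
Lemma epE Z : ep Z = sg Z \oc eta Z.
Proof. by rewrite hcE !hdE h0E (wrM hL hM) !cA. Qed.
Lemma mu_ep Z : mu Z \oc ep Z = eta Z.
Proof. by rewrite epE -cA mu_sg c1l. Qed.
Lemma E1 Z : mu (R \ox Z) \oc 'R (ep Z) = sg Z.
Proof. by rewrite epE wM -cA mu_sgr cA mu_etar c1r. Qed.
Lemma E2 Z : 'R (mu Z) \oc ep (R \ox Z) = sg Z.
Proof. by rewrite epE -cA -sg_mu cA mu_etal c1r. Qed.
Lemma E3 Z : 'R (cc Z) \oc ep (R \ox Z) = cc (R \ox Z) \oc 'R (ep Z).
Proof.
by rewrite -(chRc hL hM hB) -!cA -wM cc_cc (wl_id hM) c1l.
Qed.

Definition is_act Y (nu : mor C (R \ox Y) Y) : Prop :=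
  nu \oc 'R nu = nu \oc mu Y /\ nu \oc eta Y = idm Y.

Lemma is_actP Y (nu : mor C (R \ox Y) Y) : is_module m u nu <-> is_act nu.
Proof.
split=> -[e1 e2]; split.
- by rewrite h2E -cA -e1 !cA (as_ai hM) c1r.
- by rewrite h0E -cA e2 (lu_li hM).
- by rewrite -cA e1 h2E !cA (ai_as hM) c1r.
transitivity ((nu \oc eta Y) \oc lunit Y); last by rewrite e2 c1l.
by rewrite h0E !cA (li_lu hM) c1r.
Qed.

Section Biact.
Context (Y : C) (n1 n2 : mor C (R \ox Y) Y) (a1 : is_act n1) (a2 : is_act n2).
Context (n12 : n1 \oc 'R n2 = n2 \oc 'R n1 \oc cc Y).

Let t := n1 \oc 'R n2.
(** One leg of the separability element acts through [n1], the other through [n2]. The result is an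
    idempotent onto the coequalizer of the two commuting actions, so that a tensor product over R
    only requires splitting an idempotent. *)
Definition bipi := locked (n1 \oc 'R n2 \oc ep Y).
Lemma bipiE : bipi = n1 \oc 'R n2 \oc ep Y.
Proof. by rewrite /bipi -lock. Qed.

Lemma bipi_id Z (f : mor C Y Z) : f \oc n1 = f \oc n2 -> f \oc bipi = f.
Proof. by move=> f12; rewrite bipiE -cA f12 cA (p2 a2.1) !cA mu_ep a2.2 c1r. Qed.

Lemma bipi_comm : [/\ n1 \oc 'R bipi = n1 \oc 'R n2 \oc sg Y, n2 \oc 'R bipi = n1 \oc 'R n2 \oc sg Y,
  bipi \oc n1 = n1 \oc 'R n2 \oc sg Y & bipi \oc n2 = n1 \oc 'R n2 \oc sg Y].
Proof.
rewrite bipiE !wM; split.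
- by rewrite (p2 a1.1) cA (p2 (h2n hL hM _ _)) cA E1.
- have n21 : n2 \oc 'R n1 = n1 \oc 'R n2 \oc cc Y by rewrite -(cA n1) n12 !cA cc_cc c1r.
  rewrite (p2 n21) !cA -(cA (cc _)) (chn hL hM) cA -(cA ('R n2)) -wM a2.1 wM !cA.
  rewrite -E3 -(cA ('R (mu Y))) -wM mu_cc.
  by rewrite E2.
- rewrite !cA; have -> : ep Y \oc n1 = 'R ('R n1) \oc ep (R \ox Y) by rewrite (hcn hL hM).
  rewrite -(cA ('R n2)) -wM.
  have n21 : n2 \oc 'R n1 = n1 \oc 'R n2 \oc cc Y by rewrite -(cA n1) n12 !cA cc_cc c1r.
  rewrite n21 !wM !cA (p2 a1.1) !cA -(cA (mu Y)) (h2n hL hM) !cA E3.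
  by rewrite -(cA (mu _)) mu_cc E1.
rewrite !cA; have -> : ep Y \oc n2 = 'R ('R n2) \oc ep (R \ox Y) by rewrite (hcn hL hM).
by rewrite -(cA ('R n2)) -wM a2.1 wM !cA E2.
Qed.

Lemma bipi_idem : bipi \oc bipi = bipi.
Proof. by apply: bipi_id; have [_ _ -> ->] := bipi_comm. Qed.

Record is_quot T (nu : mor C (R \ox T) T) (p : mor C Y T) (i : mor C T Y) : Prop := {
  q_act : is_act nu;
  q_pi : p \oc i = idm T;
  q_ip : i \oc p = bipi;
  q_p1 : nu \oc 'R p = p \oc n1;
  q_p2 : nu \oc 'R p = p \oc n2;
  q_i1 : i \oc nu = n1 \oc 'R i;
  q_i2 : i \oc nu = n2 \oc 'R i
}.

Lemma quot_exists : idem_split C -> exists T nu p i, @is_quot T nu p i.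
Proof.
move=> sp; have [T [i [p [pi ip]]]] := sp _ _ bipi_idem.
have [b1 b2 b3 b4] := bipi_comm.
have b34 : bipi \oc n1 = bipi \oc n2 by rewrite b3 b4.
have pbi : p \oc bipi = p by rewrite -ip -cA pi c1l.
have bii : bipi \oc i = i by rewrite -ip cA pi c1r.
exists T, (p \oc n1 \oc 'R i), p, i.
have qp1 : (p \oc n1 \oc 'R i) \oc 'R p = p \oc n1.
  by rewrite !cA -wM ip b1 -b3 -cA pbi.
have p12 : p \oc n1 = p \oc n2 by rewrite -{1}pbi cA b34 -cA pbi.
have qi1 : i \oc (p \oc n1 \oc 'R i) = n1 \oc 'R i.
  by rewrite -cA ip -cA b3 -b1 cA -wM bii.
split=> //; last 2 first.
- by rewrite qp1 p12.
- by rewrite qi1 -bii wM -!cA b1 b2.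
split; last by rewrite !cA -(h0n hL hM) -(cA n1) a1.2 c1l pi.
rewrite wM -(cA _ ('R p)) qp1.
by rewrite wM cA (p2 a1.1) !cA (h2n hL hM).
Qed.
End Biact.

(** Maschke's averaging: v is sent to the sum of delta_x g(delta_x v), which is R-linear in v and
    returns g when g is already R-linear. *)
Definition avg K N (nK : mor C (R \ox K) K) (nN : mor C (R \ox N) N) (g : mor C K N) : mor C K N :=
  nN \oc 'R (g \oc nK) \oc ep K.
Definition rlin K N (nK : mor C (R \ox K) K) (nN : mor C (R \ox N) N) (f : mor C K N) :=
  f \oc nK = nN \oc 'R f.

Lemma avg_rlin K N nK nN (g : mor C K N) : is_act nK -> is_act nN -> rlin nK nN (avg nK nN g).
Proof.
move=> [k1 k2] [e1 e2]; rewrite /rlin /avg !wM !cA.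
have -> : ep K \oc nK = 'R ('R nK) \oc ep (R \ox K) by rewrite (hcn hL hM).
rewrite -(cA ('R nK)) -wM k1 wM !cA E2.
by rewrite (p2 e1) !cA -(cA (mu N)) (h2n hL hM) cA -(cA (mu _)) (h2n hL hM) cA E1.
Qed.

Lemma avg_comp K N L nK nN nL (f : mor C N L) (g : mor C K N) :
  rlin nN nL f -> f \oc avg nK nN g = avg nK nL (f \oc g).
Proof. by move=> fl; rewrite /avg !wM -!cA fl. Qed.
Lemma avg_compr K N L nK nN nL (f : mor C K N) (g : mor C N L) :
  rlin nK nN f -> avg nN nL g \oc f = avg nK nL (g \oc f).
Proof.
move=> fl; rewrite /avg !wM !cA (hcn hL hM) -(cA ('R nN)) -wM.
by rewrite -fl wM !cA.
Qed.
Lemma avg_id K N nK nN (f : mor C K N) : is_act nK -> is_act nN -> rlin nK nN f -> avg nK nN f = f.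
Proof.
move=> [k1 k2] [e1 e2] fl; rewrite /avg fl wM cA (p2 e1) !cA -(cA (mu N)) (h2n hL hM) cA mu_ep.
by rewrite -(h0n hL hM) -cA e2 c1l.
Qed.
End Galois.

Section HatPair.
Local Open Scope cat_scope.
Context (k : fieldType) (C : bmcat k) (hL : linear_category C) (hM : monoidal C) (hB : braided C).
Implicit Types X Y Z W T A : C.
Let cA := comp_assoc hL.
Let c1l := comp_idl hL.
Let wM := wlM hL hM.

Definition hp X Y X' Y' (f : mor C (X \ox Y) (X' \ox Y')) Z :=
  locked (assoc X' Y' Z \oc h2 f Z).
Lemma hpE X Y X' Y' (f : mor C (X \ox Y) (X' \ox Y')) Z : hp f Z = assoc X' Y' Z \oc h2 f Z.
Proof. by rewrite /hp -lock. Qed.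
Lemma hp_braid X Y Z : hp (braid X Y) Z = ch X Y Z.
Proof. by rewrite hpE chE. Qed.
Lemma h2_hp X Y X' Y' T (f : mor C (X \ox Y) (X' \ox Y')) (g : mor C (X' \ox Y') T) Z :
  h2 (g \oc f) Z = h2 g Z \oc hp f Z.
Proof. by rewrite (h2M hL hM) hpE [h2 g Z]h2E cA -(cA (ai _ _ _)) (ai_as hM) c1l. Qed.
Lemma hpM X Y X' Y' X'' Y'' (f : mor C (X \ox Y) (X' \ox Y')) (g : mor C (X' \ox Y') (X'' \ox Y'')) Z :
  hp (g \oc f) Z = hp g Z \oc hp f Z.
Proof. by rewrite hpE h2_hp -cA -hpE. Qed.
Lemma hp_id X Y Z : hp (idm (X \ox Y)) Z = idm _.
Proof. by rewrite hpE h2E (wl_id hM) c1l (as_ai hM). Qed.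
Lemma hp_dbl X Y Z : hp (braid Y X \oc braid X Y) Z = dbl X Y Z.
Proof. by rewrite hpM !hp_braid dblE. Qed.
Lemma hp_inj X Y X' Y' (f g : mor C (X \ox Y) (X' \ox Y')) :
  hp f (one C) = hp g (one C) -> f = g.
Proof. by rewrite !hpE => /(iso_cancel_l hL (assoc_iso hM _ _ _))/(h2_inj hL hM). Qed.
Lemma chRp A X Y X' Y' (f : mor C (X \ox Y) (X' \ox Y')) Z :
  (idm X' \om ch A Y' Z) \oc ch A X' (Y' \ox Z) \oc (idm A \om hp f Z)
    = hp f (A \ox Z) \oc (idm X \om ch A Y Z) \oc ch A X (Y \ox Z).
Proof.
rewrite !hpE wM -(cA (idm X' \om _)) -(ch_tenr hL hM hB) !cA.
rewrite -(cA (idm A \om ai _ _ _)) -wM (ai_as hM) (wl_id hM) c1l (chR2 hL hM hB).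
by [].
Qed.
Lemma dbl_l X X' Y Z (f : mor C X X') : dbl X' Y Z \oc h1 f (Y \ox Z) = h1 f (Y \ox Z) \oc dbl X Y Z.
Proof. by rewrite !dblE cA (ch_l hL hM hB) -cA (ch_r hL hM hB) cA. Qed.
Lemma dbl_r X Y Y' Z (f : mor C Y Y') :
  dbl X Y' Z \oc (idm X \om h1 f Z) = (idm X \om h1 f Z) \oc dbl X Y Z.
Proof. by rewrite !dblE cA (ch_r hL hM hB) -cA (ch_l hL hM hB) cA. Qed.
Lemma dbln X Y Z Z' (g : mor C Z Z') :
  dbl X Y Z' \oc (idm X \om (idm Y \om g)) = (idm X \om (idm Y \om g)) \oc dbl X Y Z.
Proof. by rewrite !dblE cA (chn hL hM) -cA (chn hL hM) cA. Qed.
Lemma dblR2 A X Y T (p : mor C (X \ox Y) T) Z :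
  dbl A T Z \oc (idm A \om h2 p Z)
    = (idm A \om h2 p Z) \oc ch X A (Y \ox Z) \oc (idm X \om dbl A Y Z) \oc ch A X (Y \ox Z).
Proof.
rewrite !dblE cA (chR2 hL hM hB) -cA (chL2 hL hM hB) wM !cA //.
Qed.
Lemma dblL2 A X Y T (p : mor C (X \ox Y) T) Z :
  dbl T A Z \oc h2 p (A \ox Z)
    = h2 p (A \ox Z) \oc (idm X \om ch A Y Z) \oc dbl X A (Y \ox Z) \oc (idm X \om ch Y A Z).
Proof.
by rewrite !dblE cA (chL2 hL hM hB) -cA (chR2 hL hM hB) !cA.
Qed.
End HatPair.

Section RModules.
Local Open Scope cat_scope.
Context (k : closedFieldType) (C : bmcat k) (hL : linear_category C) (hM : monoidal C) (hB : braided C).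
Context (H : finGroupType) (R : C) (m : mor C (R \ox R) R) (u : mor C (one C) R)
  (tau : H -> mor C R R) (s : mor C R (R \ox R)) (hG : galois_alg m u tau s).

Let cA := comp_assoc hL.
Let c1l := comp_idl hL.
Let c1r := comp_idr hL.
Let wM := wlM hL hM.
Let p2 := post2 hL.
Local Notation "''R' f" := (idm R \om f) (at level 30, f at level 30).
Local Notation mu := (h2 m).
Local Notation eta := (h0 u).
Local Notation is_act := (is_act m u).

(** All modules in C, with no condition on the underlying object: conjugation and the components of
    the G-crossed category live here, and the objects of C_G^0 are embedded by [toT] later. *)
Definition rmod := amod (whole C) m u.
Implicit Types K N L M : rmod.
Definition rcar (N : rmod) : C := mcar N.
Coercion rcar : rmod >-> obj.
Definition mkrmod (Y : C) (nu : mor C (R \ox Y) Y) (a : is_act nu) : rmod :=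
  @AMod k C (whole C) R m u Y nu Logic.I ((is_actP hL hM m u nu).2 a).
Lemma ractP N : is_act (mact N).
Proof. exact/(is_actP hL hM)/mactP. Qed.
Definition rl K N (f : mor C K N) := f \oc mact K = mact N \oc 'R f.

Lemma rl_id N : rl (idm N). Proof. by rewrite /rl c1l (wl_id hM) c1r. Qed.
Lemma rl_comp K N L (g : mor C N L) (f : mor C K N) : rl g -> rl f -> rl (g \oc f).
Proof. by rewrite /rl => gl fl; rewrite wM cA fl -cA gl cA. Qed.
Lemma rl_inv K N (f : mor C K N) g : inverse_of f g -> rl f -> rl g.
Proof.
rewrite /rl => -[gf fg] fl; apply: (iso_cancel_r hL (wl_iso hL hM R (ex_intro _ g (conj gf fg)))).
by rewrite !cA -fl -wM gf (wl_id hM) c1r -cA gf c1l.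
Qed.

Lemma unit_module : is_module m u m.
Proof. by split; [apply: (ga_assoc hG) | apply: (ga_unit hG)]. Qed.
Definition T : bmcat k := @modcat k C (whole C) R m u Logic.I unit_module.

Definition tof K N (f : mor C K N) : mor T K N := vsproj (amor K N) f.
Definition tval K N (f : mor T K N) : mor C K N := vsval f.
Lemma tofK K N (f : mor C K N) : rl f -> tval (tof f) = f.
Proof. by move=> fl; apply: vsprojK; apply/(amorP hL hM). Qed.
Lemma tvalP K N (f : mor T K N) : rl (tval f).
Proof. exact/(amorP hL hM)/subvsP. Qed.
Lemma tval_inj K N (f g : mor T K N) : tval f = tval g -> f = g.
Proof. exact: val_inj. Qed.
Lemma tval_id N : tval (idm (N : T)) = idm (N : C).
Proof. exact/tofK/rl_id. Qed.
Lemma tval_comp K N L (g : mor T N L) (f : mor T K N) :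
  tval (g \oc f) = tval g \oc tval f.
Proof. by apply: tofK; apply: rl_comp; apply: tvalP. Qed.
Lemma tval_lin K N (a : k) (f g : mor T K N) : tval (a *: f + g) = a *: tval f + tval g.
Proof. by []. Qed.
Lemma tval0 K N : tval (0 : mor T K N) = 0. Proof. by []. Qed.

Lemma T_linear : linear_category T.
Proof.
split=> *; apply: tval_inj; rewrite ?(tval_comp, tval_id, tval_lin) //.
all: by rewrite ?(c1l, c1r, cA) ?(comp_linl hL) ?(comp_linr hL).
Qed.

Lemma T_iso K N : @isomorphic k T K N <->
  exists (f : mor C K N) g, [/\ rl f, rl g & inverse_of f g].
Proof.
split=> [[f [g [gf fg]]]|[f [g [fl gl [gf fg]]]]].
  exists (tval f), (tval g); split; try exact: tvalP.
  by split; rewrite -tval_comp ?gf ?fg tval_id.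
exists (tof f), (tof g); split; apply: tval_inj; rewrite tval_comp !tofK //; exact: rl_id.
Qed.

(** Averaging commutes with composition by linear maps, so for a linear f with quasi-inverse g one
    gets f avg(g) f = avg(f g f) = avg(f) = f. *)
Lemma T_regular : regular_cat C -> regular_cat T.
Proof.
move=> reg K N f; have [g fgf] := reg _ _ (tval f).
have [aK aN] := (ractP K, ractP N).
have gl := avg_rlin hL hM hB hG g aN aK.
exists (tof (avg u s (mact N) (mact K) g)); apply: tval_inj.
rewrite !tval_comp tofK // -cA.
rewrite (avg_comp hL hM _ _ _ _ (tvalP f)) (avg_compr hL hM _ _ _ _ (tvalP f)).
by rewrite cA fgf (avg_id hL hM hG aK aN (tvalP f)).
Qed.

Lemma T_split : idem_split C -> idem_split T.
Proof.
move=> sp N e ee; have ee' : tval e \oc tval e = tval e by rewrite -tval_comp ee.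
have [Y [i [p [pi ip]]]] := sp _ _ ee'.
have [e1 e2] := ractP N.
have el : rl (tval e) := tvalP e.
have pe : p \oc tval e = p by rewrite -ip -cA pi c1l.
have ei : tval e \oc i = i by rewrite -ip cA pi c1r.
have [nu [nup inu]] : exists nu : mor C (R \ox Y) Y,
    nu \oc 'R p = p \oc mact N /\ i \oc nu = mact N \oc 'R i.
  exists (p \oc mact N \oc 'R i); split; first by rewrite !cA -wM ip -el -cA pe.
  by rewrite -cA ip -cA el cA -wM ei.
have a : is_act nu.
  split; apply: (sec_inj hL pi).
    by rewrite -cA inu cA -wM inu wM (p2 e1) cA (h2n hL hM) -!cA -inu.
  by rewrite -cA inu cA -(h0n hL hM) -cA e2 c1l c1r.
have pl : @rl N (mkrmod a) p by rewrite /rl /= nup.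
have il : @rl (mkrmod a) N i by rewrite /rl /= inu.
exists (mkrmod a), (tof (K := mkrmod a) i), (tof (N := mkrmod a) p).
by split; apply: tval_inj; rewrite tval_comp !tofK //; apply: rl_id.
Qed.

Lemma act_hat N Z : h2 (mact N) Z \oc 'R (h2 (mact N) Z) = h2 (mact N) Z \oc mu (N \ox Z).
Proof. by rewrite -(hat_r hL hM) -(hat_l hL hM) (mactP N).1. Qed.
Lemma act_hatu N Z : h2 (mact N) Z \oc eta (N \ox Z) = idm _.
Proof. exact: (hat_u hL hM Z (mactP N).2). Qed.

Lemma rl_hat K N (f : mor C K N) Z : rl f -> h1 f Z \oc h2 (mact K) Z = h2 (mact N) Z \oc 'R (h1 f Z).
Proof. by move=> fl; rewrite -(h2M hL hM) fl (h2_tenr hL hM). Qed.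
End RModules.

(** * The tensor product over R *)

Section Tens.
Local Open Scope cat_scope.
Context (k : closedFieldType) (C : bmcat k) (hL : linear_category C) (hM : monoidal C) (hB : braided C).
Context (H : finGroupType) (R : C) (m : mor C (R \ox R) R) (u : mor C (one C) R)
  (tau : H -> mor C R R) (s : mor C R (R \ox R)) (hG : galois_alg m u tau s).
Context (sp : idem_split C).

Let cA := comp_assoc hL.
Let c1l := comp_idl hL.
Let c1r := comp_idr hL.
Let wM := wlM hL hM.
Let wR := wrM hL hM.
Local Notation "''R' f" := (idm R \om f) (at level 30, f at level 30).
Local Notation mu := (h2 m).
Local Notation eta := (h0 u).
Local Notation cc := (ch R R).
Local Notation is_act := (is_act m u).
Local Notation rmod := (rmod m u).
Local Notation na N := (h2 (mact N)).
Implicit Types K N L M : rmod.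
Local Notation bipi := (bipi u s).
Local Notation mkrmod := (mkrmod hL hM).

Lemma act_h2 N Z : is_act (na N Z).
Proof. by split; [apply: act_hat | apply: act_hatu]. Qed.
Definition rten N (S : C) : rmod := mkrmod (act_h2 N S).

Definition n2 K N := locked ((idm K \om mact N) \oc ch R K N).
Lemma n2D K N : n2 K N = (idm K \om mact N) \oc ch R K N.
Proof. by rewrite /n2 -lock. Qed.
Lemma act_n2 K N : is_act (n2 K N).
Proof.
have [e1 e2] := ractP hL hM N; rewrite n2D; split.
  rewrite wM cA -(cA (ch R K N)) (chn hL hM) !cA -(cA (idm K \om mact N)) -wM e1 wM !cA.
  by rewrite -(chL2 hL hM hB).
by rewrite cA (chL0 hL hM hB) -wM e2 (wl_id hM).
Qed.
Lemma n12 K N : na K N \oc 'R (n2 K N) = n2 K N \oc 'R (na K N) \oc cc (K \ox N).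
Proof.
rewrite n2D wM -cA (h2n hL hM) !cA; congr (_ \oc _).
by rewrite -(cA (ch R K N)) (chR2 hL hM hB) !cA (cc_cc hL hM hG) c1r.
Qed.

Lemma tens_ex K N : exists x : {T : rmod & (mor C (K \ox N) T * mor C T (K \ox N))%type},
  is_quot m u s (na K N) (n2 K N) (mact (projT1 x)) (projT2 x).1 (projT2 x).2.
Proof.
have [T [nu [p [i q]]]] := quot_exists hL hM hB hG (act_h2 K N) (act_n2 K N) (n12 K N) sp.
by exists (existT _ (mkrmod (q_act q)) (p, i)).
Qed.
(* The tensor product over R is the image of an idempotent of K (x) N, with
   projection tp and inclusion ti. *)
Definition tens_data K N := proj1_sig (constructive_indefinite_description _ (tens_ex K N)).
Definition tens K N : rmod := projT1 (tens_data K N).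
Definition tp K N : mor C (K \ox N) (tens K N) := (projT2 (tens_data K N)).1.
Definition ti K N : mor C (tens K N) (K \ox N) := (projT2 (tens_data K N)).2.
Lemma tensP K N : is_quot m u s (na K N) (n2 K N) (mact (tens K N)) (tp K N) (ti K N).
Proof. exact: proj2_sig (constructive_indefinite_description _ (tens_ex K N)). Qed.

Lemma tp_ti K N : tp K N \oc ti K N = idm _. Proof. exact: q_pi (tensP K N). Qed.
Lemma tp_n12 K N : tp K N \oc na K N = tp K N \oc n2 K N.
Proof. by rewrite -(q_p1 (tensP K N)) (q_p2 (tensP K N)). Qed.
Lemma tp_n1 K N : mact (tens K N) \oc 'R (tp K N) = tp K N \oc na K N.
Proof. exact: q_p1 (tensP K N). Qed.
Lemma ti_n1 K N : ti K N \oc mact (tens K N) = na K N \oc 'R (ti K N).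
Proof. exact: q_i1 (tensP K N). Qed.
Lemma tip_id K N (W : C) (f : mor C (K \ox N) W) : f \oc na K N = f \oc n2 K N ->
  f \oc ti K N \oc tp K N = f.
Proof.
move=> fb; rewrite (q_ip (tensP K N)).
exact: (bipi_id hL hM hG (act_n2 K N)).
Qed.
Lemma tp_epi K N (W : C) (f g : mor C (tens K N) W) : f \oc tp K N = g \oc tp K N -> f = g.
Proof. exact: ret_inj (tp_ti K N). Qed.

Lemma tens_ind K N L (f : mor C (K \ox N) L) :
  f \oc na K N = f \oc n2 K N -> mact L \oc 'R f = f \oc na K N ->
  exists f' : mor C (tens K N) L, rl f' /\ f' \oc tp K N = f.
Proof.
move=> fb fl; exists (f \oc ti K N); rewrite !cA tip_id //; split=> //.
by rewrite /rl !cA ti_n1 -cA -fl wM !cA.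
Qed.

Lemma J3_ch K (Y : C) Z : J3 K R Y Z \oc ch R K (Y \ox Z) = h1 (braid R K \om idm Y) Z \oc J3 R K Y Z.
Proof.
rewrite ?J3E chE h2E !cA -(cA (ai K R _)) (ai_as hM) c1l -!cA; congr (_ \oc _).
by rewrite /h1 -(wl_id hM Y Z) (ai_nat hL hM).
Qed.
Lemma n1E K (Y : C) : na K Y = (mact K \om idm Y) \oc ai R K Y.
Proof. exact: h2E. Qed.
Lemma n2E K N : n2 K N = ((idm K \om mact N) \oc assoc K R N \oc (braid R K \om idm N)) \oc ai R K N.
Proof. by rewrite n2D chE h2E !cA. Qed.
(** Being balanced or linear over R is proved in nested form with a spectator Z; [bal_plain] and
    [lin_plain] lead back to the plain statements that [tens_ind] takes. *)
Lemma bal_hat K N (W : C) (f : mor C (K \ox N) W) Z : f \oc na K N = f \oc n2 K N ->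
  h2 f Z \oc na K (N \ox Z) = h2 f Z \oc (idm K \om na N Z) \oc ch R K (N \ox Z).
Proof.
rewrite n1E n2E -!cA => /(iso_cancel_r hL (ai_iso hM _ _ _)) e.
rewrite -(hat_l hL hM) -(hat_r hL hM) e (cA (h1 _ _) (J3 _ _ _ _)) J3_ch -(cA (h1 _ _)).
by rewrite -(h1M hL hM) !cA.
Qed.
Lemma bal_plain K N (W : C) (f : mor C (K \ox N) W) :
  (forall Z, h2 f Z \oc na K (N \ox Z) = h2 f Z \oc (idm K \om na N Z) \oc ch R K (N \ox Z)) ->
  f \oc na K N = f \oc n2 K N.
Proof.
move=> e; rewrite n1E n2E -!cA; congr (_ \oc _); apply: (h1_inj hL hM).
apply: (iso_cancel_r hL (J3_iso hL hM _ _ _ _)).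
rewrite (hat_l hL hM) e -(cA (h2 _ _)) -(hat_r hL hM) (cA (h1 _ _) (J3 _ _ _ _)) J3_ch.
by rewrite -(cA (h1 _ _)) -(h1M hL hM) !cA.
Qed.
Lemma lin_hat K (Y : C) L (f : mor C (K \ox Y) L) Z : mact L \oc 'R f = f \oc na K Y ->
  na L Z \oc 'R (h2 f Z) = h2 f Z \oc na K (Y \ox Z).
Proof.
move=> e; rewrite -(hat_r hL hM) -(hat_l hL hM); congr (h1 _ _ \oc _).
by rewrite -cA e n1E !cA (ai_as hM) c1r.
Qed.
Lemma lin_plain K (Y : C) L (f : mor C (K \ox Y) L) :
  (forall Z, na L Z \oc 'R (h2 f Z) = h2 f Z \oc na K (Y \ox Z)) -> mact L \oc 'R f = f \oc na K Y.
Proof.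
move=> e; rewrite n1E; apply: (iso_cancel_r hL (assoc_iso hM R K Y)).
rewrite !cA (ai_as hM) c1r; apply: (h1_inj hL hM).
apply: (iso_cancel_r hL (J3_iso hL hM _ _ _ (one C))).
by rewrite (hat_l hL hM) -e -(hat_r hL hM).
Qed.
Lemma tp_bal K N Z : h2 (tp K N) Z \oc na K (N \ox Z)
  = h2 (tp K N) Z \oc (idm K \om na N Z) \oc ch R K (N \ox Z).
Proof. exact/bal_hat/tp_n12. Qed.
Lemma tp_lin K N Z : na (tens K N) Z \oc 'R (h2 (tp K N) Z) = h2 (tp K N) Z \oc na K (N \ox Z).
Proof. exact/lin_hat/tp_n1. Qed.
Lemma h2_epi (X Y T W : C) (p : mor C (X \ox Y) T) i Z (f g : mor C (T \ox Z) W) :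
  p \oc i = idm T -> f \oc h2 p Z = g \oc h2 p Z -> f = g.
Proof.
move=> pi; apply: (ret_inj hL (g := assoc X Y Z \oc (i \om idm Z))).
by rewrite h2E !cA -(cA (ai _ _ _)) (ai_as hM) c1l -wR pi (wl_id hM).
Qed.

Lemma bipi_wl (W W' Y : C) (a1 a2 : mor C (R \ox Y) Y) (f : mor C (W \ox Y) W') : is_act a2 ->
  f \oc (idm W \om a1) = f \oc (idm W \om a2) -> f \oc (idm W \om bipi a1 a2) = f.
Proof.
move=> [e1 e2] e; rewrite bipiE !wM -cA e cA -!wM -(cA a2) e1 !cA.
by rewrite (mu_ep hL hM hG) e2 (wl_id hM) c1r.
Qed.
Lemma bipi_wr (W W' Y : C) (a1 a2 : mor C (R \ox Y) Y) (f : mor C (Y \ox W) W') : is_act a2 ->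
  f \oc (a1 \om idm W) = f \oc (a2 \om idm W) -> f \oc (bipi a1 a2 \om idm W) = f.
Proof.
move=> [e1 e2] e; rewrite bipiE !wR -cA e cA -!wR -(cA a2) e1 !cA.
by rewrite (mu_ep hL hM hG) e2 (wl_id hM) c1r.
Qed.

Lemma tens_ind3 (A B N L : rmod) (f : mor C (A \ox (B \ox N)) L) :
  f \oc (idm (A : C) \om na B N) = f \oc (idm (A : C) \om n2 B N) ->
  f \oc na A (B \ox N) = f \oc (idm (A : C) \om na B N) \oc ch R A (B \ox N) ->
  mact L \oc 'R f = f \oc na A (B \ox N) ->
  exists f' : mor C (tens A (tens B N)) L,
    rl f' /\ f' \oc tp A (tens B N) \oc (idm (A : C) \om tp B N) = f.
Proof.
move=> e1 e2 e3; have [f1 f1p] : exists f1, f1 \oc (idm (A : C) \om tp B N) = f.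
  exists (f \oc (idm (A : C) \om ti B N)); rewrite cA -wM (q_ip (tensP B N)); apply: bipi_wl e1; exact: act_n2.
have epi W (g h : mor C (R \ox (A \ox tens B N)) W) :
    g \oc 'R (idm (A : C) \om tp B N) = h \oc 'R (idm (A : C) \om tp B N) -> g = h.
  apply: (ret_inj hL (g := 'R (idm (A : C) \om ti B N))).
  by rewrite -!wM tp_ti !(wl_id hM).
have [f' [f'l f'p]] : exists f' : mor C (tens A (tens B N)) L, rl f' /\ f' \oc tp A (tens B N) = f1.
  apply: tens_ind; apply: epi.
    rewrite !cA (h2n hL hM) -(cA f1) f1p e2 n2D !cA (chn hL hM) -(cA (idm (A : C) \om mact _)).
    by rewrite -wM tp_n1 wM !cA -(cA f1) f1p.
  by rewrite cA -wM f1p e3 cA (h2n hL hM) -cA f1p.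
by exists f'; split=> //; rewrite -cA f'p.
Qed.

Lemma pent_J3 (X Y Z W : C) :
  (ai X Y Z \om idm W) \oc ai X (Y \ox Z) W \oc (idm X \om ai Y Z W) = J3 X Y Z W.
Proof.
rewrite (pent_ai hL hM) !cA -(cA (ai X _ W)) (ai_as hM) c1l -cA -wR (ai_as hM) (wl_id hM).
by rewrite c1l.
Qed.

(** An object S of C tensored on the right can be pulled out of a tensor product over R. This is
    what makes the defect [rho] multiplicative in the proof of [weight_tens]. *)
Lemma tens_rten K N (S : C) : @isomorphic k (T hG) (tens K (rten N S)) (rten (tens K N) S).
Proof.
have [f [fl fp]] : exists f : mor C (tens K (rten N S)) (rten (tens K N) S),
    rl f /\ f \oc tp K (rten N S) = h2 (tp K N) S.
  apply: tens_ind; last exact: tp_lin.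
  by rewrite n2D; apply: tp_bal.
have [g gp] : exists g, g \oc h2 (tp K N) S = tp K (rten N S).
  exists (tp K (rten N S) \oc assoc K N S \oc (ti K N \om idm S)).
  rewrite h2E; apply: (iso_cancel_r hL (assoc_iso hM K N S)).
  rewrite !cA (ai_as hM) c1r -wR (q_ip (tensP K N)) -cA.
  apply: bipi_wr; first exact: act_n2.
  apply: (iso_cancel_r hL (is_iso_comp hL (ai_iso hM R (K \ox N) S) (wl_iso hL hM R (ai_iso hM K N S)))).
  have E1 : assoc K N S \oc (na K N \om idm S) \oc ai R (K \ox N) S \oc 'R (ai K N S) = na K (N \ox S).
    rewrite n1E wR !cA pent_J3 -!cA (assoc_nat hM) cA (wl_id hM) n1E.
    by rewrite ?J3E -(cA (assoc _ _ _)) (as_ai hM) c1l.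
  have E2 : assoc K N S \oc (n2 K N \om idm S) \oc ai R (K \ox N) S \oc 'R (ai K N S)
      = n2 K (rten N S).
    rewrite n2E !wR !cA pent_J3 -[(braid R K \om _) \om _]/(h1 _ S) -J3_ch.
    rewrite -(cA (assoc K N S)) (assoc_nat hM) n2D !cA -(cA (idm K \om (_ \om _))).
    by rewrite -[mact (rten N S)]/(na N S) (h2E (mact N)) wM !cA (pent_ai hL hM) !cA.
  by rewrite !cA E1 E2 -!(tp_n12 K (rten N S)).
have gl : @rl _ _ _ m u (rten (tens K N) S) (tens K (rten N S)) g.
  apply: (ret_inj hL (f := 'R (h2 (tp K N) S)) (g := 'R (assoc K N S \oc (ti K N \om idm S)))).
    rewrite -wM h2E !cA -(cA (ai K N S)) (ai_as hM) c1l -wR tp_ti !(wl_id hM) //.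
  rewrite !cA -wM gp (tp_n1 K (rten N S)).
  rewrite -[mact (rten (tens K N) S)]/(na (tens K N) S) tp_lin -cA gp //.
apply/(T_iso hL hM); exists f, g; split=> //; split.
  by apply: tp_epi; rewrite cA fp gp c1l.
apply: (h2_epi (tp_ti K N)); by rewrite cA gp fp c1l.
Qed.

Definition Rm : rmod := mkrmod ((is_actP hL hM m u m).1 (unit_module hG)).

Lemma tens_unitl N : @isomorphic k (T hG) (tens Rm N) N.
Proof.
have [e1 e2] := ractP hL hM N.
have [f [fl fp]] : exists f : mor C (tens Rm N) N, rl f /\ f \oc tp Rm N = mact N.
  apply: tens_ind; last by rewrite e1.
  by rewrite n2D -cA e1 cA (mu_cc hL hM hG).
pose g := tp Rm N \oc eta N.
have gm : g \oc mact N = tp Rm N.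
  rewrite /g cA (h0n hL hM).
  transitivity (tp Rm N \oc n2 Rm N \oc cc N \oc eta (R \ox N)).
    by rewrite n2D !cA -(cA (cc N)) (cc_cc hL hM hG) c1l.
  rewrite -(cA (tp _ _)) -tp_n12 /= cA -(cA (mu N)) (mu_cc hL hM hG) (mu_etal hL hM hG) c1r //.
have gf : g \oc f = idm _ by apply: tp_epi; rewrite cA fp gm c1l.
have fg : f \oc g = idm _ by rewrite /g -cA fp e2.
have fgi : inverse_of f g by split.
apply/(T_iso hL hM); exists f, g; split=> //; by apply: rl_inv fgi fl.
Qed.

Lemma tens_map (K1 K2 N1 N2 : rmod) (f : mor C K1 K2) (g : mor C N1 N2) : rl f -> rl g ->
  exists h : mor C (tens K1 N1) (tens K2 N2), rl h /\ h \oc tp K1 N1 = tp K2 N2 \oc (f \om g).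
Proof.
move=> fl gl; apply: tens_ind.
  apply: bal_plain => Z; rewrite (tenm_wrl hL hM) -cA.
  rewrite (h2_tenr hL hM) (h2_tenl hL hM) !cA -(h2n hL hM) -(cA (h1 f _)) (rl_hat hL hM _ fl).
  rewrite !cA -(cA (h2 _ _) (na _ _)) tp_bal !cA.
  rewrite -(cA (idm (K1 : C) \om h1 g Z)) -[in RHS]wM (rl_hat hL hM _ gl) wM !cA.
  rewrite -(cA (h1 f _) (idm _ \om _)) (h1n hL hM) !cA -(chn hL hM).
  by rewrite -(cA (h1 f _) (ch _ _ _)) -(ch_r hL hM hB) !cA.
apply: lin_plain => Z; rewrite (tenm_wrl hL hM f g) -(cA (tp _ _)) (h2_tenr hL hM) (h2_tenl hL hM).
rewrite !wM !cA -(cA (na _ _)) tp_lin !cA -(cA (na K2 _)) -(rl_hat hL hM _ fl) !cA.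
by rewrite (h2n hL hM).
Qed.

Lemma tens_iso K K' N N' : @isomorphic k (T hG) K K' -> @isomorphic k (T hG) N N' ->
  @isomorphic k (T hG) (tens K N) (tens K' N').
Proof.
move=> /(T_iso hL hM) [f [f' [fl f'l [ff' f'f]]]] /(T_iso hL hM)[g [g' [gl g'l [gg' g'g]]]].
have [h [hl hp]] := tens_map fl gl; have [h' [h'l h'p]] := tens_map f'l g'l.
apply/(T_iso hL hM); exists h, h'; split=> //; split; apply: tp_epi.
  by rewrite cA hp -cA h'p cA -(tenm_comp hM) ff' gg' (wl_id hM) c1r c1l.
by rewrite cA h'p -cA hp cA -(tenm_comp hM) f'f g'g (wl_id hM) c1r c1l.
Qed.
End Tens.

(** * Frobenius-Perron dimensions *)

Section Perron.
Local Notation norm_mx := (map_mx (fun z : algC => `|z|)).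

Lemma exists_max (I : finType) (F : I -> algC) (i0 : I) :
  (forall i, F i \is Num.real) -> exists i, forall j, F j <= F i.
Proof.
move=> Fr; have [|i _ iP] := @real_arg_maxP _ I i0 xpredT F isT; first by [].
by exists i => j; apply: iP.
Qed.

Lemma norm_mx_ge0 n (v : 'rV[algC]_n) i : 0 <= norm_mx v 0 i.
Proof. by rewrite mxE. Qed.

(** Perron's theorem from the spectral theorem. Let lam be the largest modulus of an eigenvalue. If
    v has an eigenvalue of modulus lam, then |v| H >= lam |v| entrywise, while the quadratic form of
    H is at most lam; this forces |v| to be an eigenvector, and positivity of H makes its entries
    positive. *)
Lemma pf_matrix n (H : 'M[algC]_n.+1) : (forall i j, 0 < H i j) -> H^T = H ->
  exists (x : 'rV_n.+1) (lam : algC), [/\ forall i, 0 < x 0 i, x *m H = lam *: x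
    & forall v, v *m H = lam *: v -> exists c, v = c *: x].
Proof.
move=> H0 Hsym; have Hreal i j : H i j \is Num.real by rewrite realE ltW.
have Hh : H \is hermsymmx.
  by apply: realsym_hermsym; [apply/is_hermitianmxP; rewrite expr0 scale1r map_mx_id // Hsym | apply/mxOverP].
have := hermitian_spectral_diag_real Hh; have /hermitian_normalmx/orthomx_spectralP := Hh.
set P := spectralmx H; set D := spectral_diag H => HE /mxOverP Dr.
have Pu : P \is unitarymx := spectral_unitarymx H.
have PU := unitarymx_unit Pu.
have PH : P *m H = diag_mx D *m P by rewrite {1}HE !mulmxA mulmxV // mul1mx.
have [i0 i0P] := exists_max ord0 (fun i => normr_real (D 0 i)).
pose lam := `|D 0 i0|.
have Dlam j : D 0 j <= lam := le_trans (real_ler_norm (Dr 0 j)) (i0P j).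
have absE (v : 'rV[algC]_n.+1) mu : v *m H = mu *: v -> `|mu| = lam -> norm_mx v *m H = lam *: norm_mx v.
  move=> vH muE; set a := norm_mx v.
  have a0 j : 0 <= a 0 j by rewrite mxE.
  have ge j : 0 <= (a *m H) 0 j - lam * a 0 j.
    rewrite subr_ge0 -muE !mxE -normrM.
    have -> : mu * v 0 j = (v *m H) 0 j by rewrite vH !mxE.
    rewrite mxE; apply: le_trans (ler_norm_sum _ _ _) _; apply: ler_sum => i _.
    by rewrite normrM mxE (ger0_norm (ltW (H0 i j))).
  have [y yP] : exists y, y *m P = a.
    by exists (a *m P^t*); rewrite -mulmxA -invmx_unitary // mulVmx // mulmx1.
  have yE : P^t* *m y^t* = a^t*.
    by rewrite -yP trmx_mul map_mxM.
  have aE : a^t* = a^T.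
    by apply/matrixP => i j; rewrite !mxE ord1 conj_normC.
  have sum2 (B : 'rV_n.+1) : \sum_j B 0 j * (y 0 j)^* = (B *m P *m a^T) 0 0.
    rewrite -aE -yE -!mulmxA [P *m _]mulmxA (unitarymxP Pu) mul1mx mxE.
    by apply: eq_bigr => j _; rewrite !mxE.
  (* In the eigenbasis the left side is a sum of nonnegative terms; the right side is minus such a
     sum. Hence every term vanishes. *)
  have S0 : \sum_j (lam - D 0 j) * (y 0 j * (y 0 j)^*) = - \sum_j ((a *m H) 0 j - lam * a 0 j) * a 0 j.
    rewrite (eq_bigr (fun j => (lam *: y - y *m diag_mx D) 0 j * (y 0 j)^*)); last first.
      by move=> j _; rewrite mul_mx_diag !mxE mulrA mulrBl [y 0 j * D 0 j]mulrC.
    rewrite sum2 mulmxBl -scalemxAl yP -mulmxA -PH mulmxA yP mulmxBl mxE -sumrN mxE [X in _ + X]mxE mxE -sumrB.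
    by apply: eq_bigr => j _; rewrite !mxE; ring.
  have S1 : \sum_j (lam - D 0 j) * (y 0 j * (y 0 j)^*) = 0.
    apply/eqP; rewrite eq_le; apply/andP; split; last first.
      by apply: sumr_ge0 => j _; rewrite mulr_ge0 ?subr_ge0 ?mul_conjC_ge0.
    by rewrite S0 oppr_le0; apply: sumr_ge0 => j _; rewrite mulr_ge0.
  have yD : y *m diag_mx D = lam *: y.
    apply/rowP => j; rewrite mul_mx_diag !mxE.
    have /orP[] : (lam - D 0 j == 0) || (y 0 j * (y 0 j)^* == 0).
      rewrite -mulf_eq0; apply/eqP/(psumr_eq0P _ S1) => // i _.
      by rewrite mulr_ge0 ?subr_ge0 ?mul_conjC_ge0.
    - by rewrite subr_eq0 => /eqP->; rewrite mulrC.
    by rewrite mul_conjC_eq0 => /eqP->; rewrite mul0r mulr0.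
  by rewrite -{1}yP -mulmxA PH mulmxA yD -scalemxAl yP.
have pos (v : 'rV[algC]_n.+1) : v != 0 -> v *m H = lam *: v -> (forall i, 0 <= v 0 i) -> 0 < lam /\ forall i, 0 < v 0 i.
  move=> v0 vH vge; have gt j : 0 < lam * v 0 j.
    have -> : lam * v 0 j = (v *m H) 0 j by rewrite vH mxE.
    have [i vi] : exists i, v 0 i != 0.
      by apply/existsP; apply: contraR v0 => /existsPn h; apply/eqP/rowP => i; rewrite mxE; apply/eqP; rewrite -[_ == _]negbK h.
    rewrite mxE (bigD1 i) //= ltr_wpDr //.
      by apply: sumr_ge0 => l _; rewrite mulr_ge0 // ltW.
    by rewrite mulr_gt0 // lt0r vi vge.
  have lam0 : 0 < lam by rewrite lt0r normr_ge0 andbT; apply: contraTneq (gt ord0) => ->; rewrite mul0r ltxx.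
  by split=> // i; have := gt i; rewrite pmulr_rgt0.
pose x := norm_mx (row i0 P).
have rH : row i0 P *m H = D 0 i0 *: row i0 P.
  by rewrite -row_mul PH row_mul row_diag_mx -scalemxAl -rowE.
have xH : x *m H = lam *: x by apply: absE rH _.
have nz (v : 'rV_n.+1) : v != 0 -> norm_mx v != 0.
  apply: contra_neq => /rowP v0; apply/rowP => j; have := v0 j; rewrite !mxE.
  by move/eqP; rewrite normr_eq0 => /eqP.
have x0 : x != 0.
  apply: nz; apply/negP => /eqP r0; have := congr1 (fun A => row i0 A) (unitarymxP Pu).
  rewrite row_mul r0 mul0mx => /rowP/(_ i0); rewrite !mxE eqxx => /eqP.
  by rewrite eq_sym oner_eq0.
have [lam0 xpos] := pos x x0 xH (norm_mx_ge0 _); clearbody x.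
(* The multiple of x with the same first entry as v: the difference w has first entry 0, whereas |w|
   would be strictly positive if w were non-zero. *)
exists x, lam; split=> // v vH; exists (v 0 ord0 / x 0 ord0).
apply/eqP; rewrite -subr_eq0; apply/negPn/negP => w0.
set w := v - _ in w0; have wH : w *m H = lam *: w.
  by rewrite /w mulmxBl vH -scalemxAl xH scalerBr !scalerA mulrC.
have [_ /(_ ord0)] := pos _ (nz _ w0) (absE _ _ wH (ger0_norm (ltW lam0))) (norm_mx_ge0 _).
by rewrite mxE /w 3!mxE divfK ?subrr ?normr0 ?ltxx // gt_eqF.
Qed.

Lemma pf_matrix_nonempty n (H : 'M[algC]_n) (i0 : 'I_n) : (forall i j, 0 < H i j) -> H^T = H ->
  exists (x : 'rV_n) (lam : algC), [/\ forall i, 0 < x 0 i, x *m H = lam *: x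
    & forall v, v *m H = lam *: v -> exists c, v = c *: x].
Proof. by case: n H i0 => [? []|n] // H _; apply: pf_matrix. Qed.

Lemma bigmax_eq (s : seq algC) (f : algC) :
  f \in s -> 0 <= f -> (forall z, z \in s -> 0 <= z -> z <= f) ->
  \big[Num.max/0]_(z <- s | 0 <= z) z = f.
Proof.
move=> fs f0 le; have ub (s' : seq algC) : {subset s' <= s} ->
    \big[Num.max/0]_(z <- s' | 0 <= z) z <= f /\ 0 <= \big[Num.max/0]_(z <- s' | 0 <= z) z.
  elim: s' => [|z s' IH] sub; first by rewrite big_nil.
  have [|IH1 IH2] := IH; first by move=> y ys; apply: sub; rewrite inE ys orbT.
  rewrite big_cons; case: ifP => // z0; rewrite maxEle.
  by case: ifP => _ //; split=> //; apply: le => //; apply: sub; rewrite inE eqxx.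
elim: s fs le ub => // z s IH; rewrite inE big_cons => fs le ub.
have [|u1 u2] := ub s; first by move=> y ys; rewrite inE ys orbT.
have [<-|nf] := eqVneq f z.
  by rewrite f0 maxEle; case: ifP => // fm; apply/eqP; rewrite eq_le u1.
have sf : f \in s by move: fs; rewrite (negPf nf).
rewrite IH //; first by case: ifP => // z0; rewrite maxEle le ?inE ?eqxx.
  by move=> y ys; apply: le; rewrite inE ys orbT.
by move=> s' sub; apply: ub => y ys; rewrite inE sub ?orbT.
Qed.

(* [mu v v^T - v A v^T = 1/2 sum_ab A_ab x_a x_b (v_a / x_a - v_b / x_b)^2] *)
Lemma sym_form_le n (A : 'M[algC]_n) (x v : 'rV[algC]_n) mu :
  A^T = A -> (forall a b, 0 <= A a b) -> (forall a, 0 < x 0 a) -> x *m A = mu *: x ->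
  (forall a, v 0 a \is Num.real) ->
  (v *m A *m v^T) 0 0 <= mu * (v *m v^T) 0 0.
Proof.
move=> Asym A0 x0 xA vr; rewrite -subr_ge0.
have [w vE] : exists w : 'I_n -> algC, forall a, v 0 a = x 0 a * w a.
  by exists (fun a => v 0 a / x 0 a) => a; rewrite mulrC divfK // gt_eqF.
have wr a : w a \is Num.real.
  have -> : w a = v 0 a / x 0 a by rewrite vE mulrC mulKf // gt_eqF.
  by rewrite rpredM ?rpredV // realE ltW.
have Ax b : \sum_a A a b * x 0 a = mu * x 0 b.
  have /rowP/(_ b) := xA; rewrite !mxE => <-; apply: eq_bigr => a _; exact: mulrC.
have S : forall a b, A a b = A b a by move=> a b; rewrite -{1}Asym mxE.
have E1 : mu * (v *m v^T) 0 0 = \sum_a \sum_b A a b * x 0 a * x 0 b * w b ^+ 2.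
  rewrite exchange_big mxE mulr_sumr; apply: eq_bigr => b _ /=.
  rewrite -!mulr_suml Ax mxE vE; ring.
have E2 : (v *m A *m v^T) 0 0 = \sum_a \sum_b A a b * x 0 a * x 0 b * (w a * w b).
  rewrite exchange_big mxE; apply: eq_bigr => b _ /=.
  rewrite !mxE mulr_suml; apply: eq_bigr => a _; rewrite !vE; ring.
have E3 : mu * (v *m v^T) 0 0 = \sum_a \sum_b A a b * x 0 a * x 0 b * w a ^+ 2.
  rewrite E1 exchange_big; apply: eq_bigr => b _; apply: eq_bigr => a _; rewrite S; ring.
rewrite -(pmulr_rge0 _ (ltr0Sn _ 1)) mulr_natl mulr2n.
have -> : mu * (v *m v^T) 0 0 - (v *m A *m v^T) 0 0 + (mu * (v *m v^T) 0 0 - (v *m A *m v^T) 0 0)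
    = \sum_a \sum_b A a b * x 0 a * x 0 b * (w a - w b) ^+ 2.
  rewrite {1}E1 E3 E2 -!sumrB -big_split; apply: eq_bigr => a _ /=.
  rewrite -!sumrB -big_split; apply: eq_bigr => b _ /=; ring.
apply: sumr_ge0 => a _; apply: sumr_ge0 => b _.
by rewrite mulr_ge0 ?real_exprn_even_ge0 ?rpredB // !mulr_ge0 // ltW.
Qed.
End Perron.

(** * Duality in nested form *)

Section Duals.
Local Open Scope cat_scope.
Context (k : fieldType) (C : bmcat k) (hL : linear_category C) (hM : monoidal C).
Implicit Types X Y Z W : C.
Let cA := comp_assoc hL.
Let c1l := comp_idl hL.
Let c1r := comp_idr hL.

(** The snake identities with an arbitrary tail Z, so that they apply inside longer composites. *)
Definition zigzag X Y (ev : mor C (Y \ox X) (one C)) (coev : mor C (one C) (X \ox Y)) :=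
  (forall Z, (idm X \om he ev Z) \oc hc coev (X \ox Z) = idm _) /\
  (forall Z, he ev (Y \ox Z) \oc (idm Y \om hc coev Z) = idm _).

Lemma dual_zigzag X Y : left_dual X Y -> exists ev coev, @zigzag X Y ev coev.
Proof.
case=> ev [coev [a' [aP z1 z2]]]; exists ev, coev; split=> Z.
  rewrite heE h2E hcE hdE !(wlM hL hM) !cA.
  have -> : li (X \ox Z) = assoc (one C) X Z \oc (li X \om idm Z).
    apply: (iso_cancel_l hL (lunit_iso hM (X \ox Z))); rewrite lu_li // (post2 hL (lunit_ten hL hM X Z)).
    by rewrite -(wrM hL hM) lu_li // (wl_id hM).
  have e1 := assoc_nat hM coev (idm X) (idm Z); rewrite (wl_id hM) in e1.
  rewrite (post2 hL (esym e1)) cA (post2 hL (pentagon hM X Y X Z)) !cA.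
  have e2 : (idm X \om ai Y X Z) \oc (idm X \om assoc Y X Z) = idm _.
    by rewrite -(wlM hL hM) ai_as // (wl_id hM).
  rewrite (post2 hL e2) c1l.
  have e3 := assoc_nat hM (idm X) ev (idm Z).
  rewrite (post2 hL (esym e3)) cA (post2 hL (triangle hM X Z)) -!(wrM hL hM) (post4 hL z1).
  by rewrite lu_li // (wl_id hM).
rewrite heE h2E hcE hdE !(wlM hL hM) !cA.
have e1 : ai Y X (Y \ox Z) \oc (idm Y \om assoc X Y Z)
    = assoc (Y \ox X) Y Z \oc (ai Y X Y \om idm Z) \oc ai Y (X \ox Y) Z.
  apply: (iso_cancel_l hL (assoc_iso hM Y X (Y \ox Z))).
  rewrite (post2 hL (as_ai hM _ _ _)) c1l (post2 hL (pentagon hM Y X Y Z)) !cA.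
  rewrite (post2 hL (a := assoc Y X Y \om idm Z)  (g := idm _)) ?c1l ?as_ai ?c1r //.
  by rewrite -(wrM hL hM) as_ai // (wl_id hM).
rewrite (post2 hL e1) !cA (post2 hL (ai_nat hL hM (idm Y) coev (idm Z))) cA.
have e2 : ai Y (one C) Z \oc (idm Y \om li Z) = ri Y \om idm Z.
  apply: (iso_cancel_l hL (wr_iso hL hM Z (runit_iso hM Y))).
  rewrite -(wrM hL hM) ru_ri // (wl_id hM) -(triangle hM) cA (post2 hL (as_ai hM _ _ _)) c1l.
  by rewrite -(wlM hL hM) lu_li // (wl_id hM).
rewrite e2; have e3 := assoc_nat hM ev (idm Y) (idm Z); rewrite (wl_id hM) in e3.
rewrite (post2 hL (esym e3)) cA (post2 hL (lunit_ten hL hM Y Z)) -!(wrM hL hM).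
have -> : ai Y X Y = a' by apply: invE.
by rewrite (post4 hL z2) ru_ri // (wl_id hM).
Qed.

Lemma hdim_adj X Y A B : left_dual X Y -> hdim (Y \ox A) B = hdim A (X \ox B).
Proof.
move=> /dual_zigzag[ev [coev [z1 z2]]].
apply: (@dim_eq_bij _ _ _ (fun f : mor C (Y \ox A) B => (idm X \om f) \oc hc coev A)).
  by move=> a f g; rewrite (tenmDr hM) (tenmZr hM) (compDl hL) (compZl hL).
exists (fun g => he ev B \oc (idm Y \om g)) => f.
  by rewrite (wlM hL hM) -cA (hen hL hM) cA z2 c1r.
by rewrite (wlM hL hM) cA -(hcn hL hM) -cA z1 c1l.
Qed.

Lemma fsum_ten (I : finType) (S : I -> C) X Y : fsum S Y -> fsum (fun a => X \ox S a) (X \ox Y).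
Proof.
case=> i [p [pi p0 ip]]; exists (fun a => idm X \om i a), (fun a => idm X \om p a); split.
- by move=> a; rewrite -(wlM hL hM) pi (wl_id hM).
- by move=> a b ab; rewrite -(wlM hL hM) p0 // (tenm0r hM).
by rewrite -(wl_id hM) -ip (tenm_sumr hM); apply: eq_bigr => a _; rewrite (wlM hL hM).
Qed.

Lemma fsum_tenl (I : finType) (S : I -> C) X Y : fsum S X -> fsum (fun a => S a \ox Y) (X \ox Y).
Proof.
case=> i [p [pi p0 ip]]; exists (fun a => i a \om idm Y), (fun a => p a \om idm Y); split.
- by move=> a; rewrite -(wrM hL hM) pi (wl_id hM).
- by move=> a b ab; rewrite -(wrM hL hM) p0 // (tenm0l hM).
by rewrite -(wl_id hM) -ip (tenm_suml hM); apply: eq_bigr => a _; rewrite (wrM hL hM).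
Qed.
End Duals.

(** * The fusion ring and the Frobenius-Perron dimension *)

Section FPdimTheory.
Local Open Scope cat_scope.
Context (k : closedFieldType) (C : bmcat k) (hC : braided_fusion C).
Implicit Types X Y Z W V : C.
Let hL := bf_linear hC.
Let hM := bf_monoidal hC.
Let hB := bf_braided hC.
Let hA := bf_abelian hC.
Let cA := comp_assoc hL.
Let c1l := comp_idl hL.
Let c1r := comp_idr hL.
Local Notation n := (nsimples C).
Local Notation N X := (fusion_mx X).
Local Notation mult a X := (hdim (simp a) X).

Lemma isomorphic_braid X Y : isomorphic (X \ox Y) (Y \ox X).
Proof. by exists (braid X Y); apply: braid_iso. Qed.
Lemma isomorphic_assoc X Y Z : isomorphic (X \ox Y \ox Z) (X \ox (Y \ox Z)).
Proof. by exists (assoc X Y Z); apply: assoc_iso. Qed.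

Lemma fsum_exists (I : finType) (S : I -> C) : exists X, fsum S X.
Proof.
have [X dX] := has_dsums hA (fun a : 'I_#|I| => S (enum_val a)).
exists X; move/dsum_fsum: dX => /(fsum_reindex (f := @enum_rank I)) [].
  by exists enum_val; [apply: enum_rankK | apply: enum_valK].
move=> i ip; have e : (fun a => S (enum_val a)) \o enum_rank =1 S by move=> a /=; rewrite enum_rankK.
apply: (@fsum_map _ _ hL _ _ _ _ (fun a => _)); last by exists i; apply: ip.
by move=> a /=; rewrite enum_rankK; apply: isomorphic_refl.
Qed.

Lemma simp_of X : brick X -> exists a, isomorphic X (simp a).
Proof. by move/(simpleE hC)=> X1; have [_ _ h] := simplesP hC; apply: h. Qed.

Lemma simp_hdim (a b : 'I_n) : hdim (simp a) (simp b) = (a == b).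
Proof.
have [[iab ->]|[nab ->]] := brick_hom hL (fus_schur hC) (simp_brick hC a) (simp_brick hC b).
  by have [_ h _] := simplesP hC; rewrite (h _ _ iab) eqxx.
by case: eqP => // ab; case: nab; rewrite ab; apply: isomorphic_refl.
Qed.

Lemma additive_expand (phi : C -> algC) :
  (forall X X', isomorphic X X' -> phi X = phi X') ->
  (forall (I : finType) (S : I -> C) X, fsum S X -> phi X = \sum_i phi (S i)) ->
  forall X, phi X = \sum_a (mult a X)%:R * phi (simp a).
Proof.
move=> phiI phiS X; have [I [S [Sb dX]]] := fus_decomp hC X; rewrite (phiS _ _ _ dX).
have /choice [c cP] := fun i => simp_of (Sb i).
under [RHS]eq_bigr => a _ do rewrite (hdim_sumr hL (simp a) dX) natr_sum mulr_suml.
rewrite exchange_big; apply: eq_bigr => i _ /=; rewrite (phiI _ _ (cP i)).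
rewrite (bigD1 (c i)) //= (hdim_isor hL _ (cP i)) simp_hdim eqxx mul1r big1 ?addr0 // => a.
by rewrite (hdim_isor hL _ (cP i)) simp_hdim => /negPf->; rewrite mul0r.
Qed.

Lemma hdim_fusion X Y b : (mult b (X \ox Y))%:R = \sum_a N X b a * (mult a Y)%:R.
Proof.
rewrite (additive_expand (phi := fun Y => (mult b (X \ox Y))%:R) _ _ Y) => [|Z Z' i|I S Z dZ].
- by apply: eq_bigr => a _; rewrite mxE mulrC.
- by rewrite (hdim_isor hL _ (isomorphic_ten hM (isomorphic_refl hL X) i)).
by rewrite (hdim_sumr hL _ (fsum_ten hL hM X dZ)) natr_sum.
Qed.

Lemma hdim_pair X Y : (hdim X Y)%:R = \sum_a (mult a X)%:R * (mult a Y)%:R :> algC.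
Proof.
rewrite (additive_expand (phi := fun X => (hdim X Y)%:R) _ _ X) // => [Z Z' i|I S Z dZ].
  by rewrite (hdim_isol hL _ i).
by rewrite (hdim_suml hL _ dZ) natr_sum.
Qed.

Lemma fusion_isom X X' : isomorphic X X' -> N X = N X'.
Proof.
move=> i; apply/matrixP=> a b; rewrite !mxE.
by congr (_ %:R); apply: (hdim_isor hL); exact: (isomorphic_ten hM i (isomorphic_refl hL _)).
Qed.

Lemma fusion_ten X Y : N (X \ox Y) = N X *m N Y.
Proof.
apply/matrixP=> a b; rewrite !mxE -/(hdim _ _) (hdim_isor hL _ (isomorphic_assoc X Y (simp b))) hdim_fusion.
by apply: eq_bigr => c _; rewrite [N Y _ _]mxE.
Qed.

Lemma fusion_comm X Y : N X *m N Y = N Y *m N X.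
Proof. by rewrite -!fusion_ten; apply/fusion_isom/isomorphic_braid. Qed.

Lemma fusion_fsum (I : finType) (S : I -> C) X : fsum S X -> N X = \sum_i N (S i).
Proof.
move=> dX; apply/matrixP=> a b; rewrite summxE mxE -/(hdim _ _).
by rewrite (hdim_sumr hL _ (fsum_tenl hL hM _ dX)) natr_sum; apply: eq_bigr => i _; rewrite mxE.
Qed.

Lemma fusion_dual X Y : left_dual X Y -> N Y = (N X)^T.
Proof.
move=> XY; apply/matrixP=> a b; rewrite !mxE -!/(hdim _ _) -(hdim_adj hL hM _ _ XY).
by rewrite (hdim_sym hL (fus_schur hC)) //; apply: fus_decomp.
Qed.

Lemma fusion_one : N (one C) = 1%:M.
Proof.
apply/matrixP=> a b; rewrite !mxE -!/(hdim _ _).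
have i : isomorphic (one C \ox simp b) (simp b) by exists (lunit _); apply: lunit_iso.
by rewrite (hdim_isor hL _ i) simp_hdim.
Qed.

Lemma coev_nz X Y ev coev : idm X <> 0 -> @zigzag k C X Y ev coev -> coev <> 0.
Proof.
move=> X0 [z1 _] c0; apply: X0; have := z1 (one C).
rewrite c0 hcE hdE (tenm0l hM) (comp0r hL) (comp0l hL) (comp0r hL) -(wl_id hM) => /esym h.
by apply: (wr1_inj hL hM); rewrite h (tenm0l hM).
Qed.

(** The coevaluation is non-zero, so its composite with a quasi-inverse is an endomorphism of the
    unit, hence a scalar, and regularity makes this scalar 1. *)
Lemma one_retract X Y : left_dual X Y -> idm X <> 0 ->
  exists (c : mor C (one C) (X \ox Y)) (g : mor C (X \ox Y) (one C)), g \oc c = idm _.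
Proof.
move=> XY X0; have [ev [coev z]] := dual_zigzag hL hM XY.
have c0 := coev_nz X0 z; have [g gE] := fus_regular hC coev.
have [_ b1] := simple_brick hL hA (bf_one hC); have [a aE] := b1 (g \oc coev).
exists coev, g; rewrite aE; have : (a - 1) *: coev = 0.
  by rewrite scalerBl scale1r -{2}gE aE (compZr hL) c1r subrr.
by move/eqP; rewrite scaler_eq0 subr_eq0 => /orP[/eqP->|/eqP/c0//]; rewrite scale1r.
Qed.

Lemma idm_retract X Y (i : mor C Y X) (p : mor C X Y) : p \oc i = idm Y -> idm X = 0 -> idm Y = 0.
Proof. by move=> <- X0; rewrite -(c1l i) X0 (comp0l hL) (comp0r hL). Qed.

(** Y is a retract of Z (x) X (x) Y for a dual Z of X, so X (x) Y cannot vanish. *)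
Lemma ten_nz X Y : idm X <> 0 -> idm Y <> 0 -> idm (X \ox Y) <> 0.
Proof.
move=> X0 Y0 XY0; have [[Z XZ] _] := bf_rigid hC X.
have [c [g gc]] := one_retract XZ X0; have [b [bb _]] := braid_iso hB X Z.
have E1 : (lunit Y \oc ((g \oc b) \om idm Y) \oc ai Z X Y)
    \oc (assoc Z X Y \oc ((braid X Z \oc c) \om idm Y) \oc li Y) = idm Y.
  rewrite !cA (post2 hL (ai_as hM _ _ _)) c1l (post2 hL (esym (wrM hL hM _ _ _))) cA.
  by rewrite (post2 hL bb) c1l gc (wl_id hM) c1l lu_li.
apply: Y0; apply: (idm_retract E1).
by rewrite -(wl_id hM) XY0 (tenm0r hM).
Qed.

Lemma mult_ex Y : idm Y <> 0 -> exists a, (0 < mult a Y)%N.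
Proof.
move=> Y0; apply/existsP; apply: contra_notT Y0 => /existsPn h.
apply: (hdim0 (C := C)); apply/eqP; rewrite -(eqr_nat algC) hdim_pair big1 // => a _.
by have := h a; rewrite lt0n negbK => /eqP->; rewrite mul0r.
Qed.

(* The Frobenius-Perron vector: a common eigenvector of the commuting fusion
   matrices, obtained from the strictly positive symmetric one N N^T where N is
   the matrix of the sum of all simple objects. *)
Lemma fusion_pf : exists x : 'rV[algC]_n, (forall a, 0 < x 0 a) /\
  forall X, x *m N X = FPdim X *: x.
Proof.
have [O dO] := fsum_exists (@simp k C); have [[O' OO'] _] := bf_rigid hC O.
have [e _] := simp_of (simple_brick hL hA (bf_one hC)).
have NO : N O = \sum_a N (simp a) by apply: fusion_fsum.
(* The simple object a occurs in c (x) b for any simple summand c of b' (x) a, where b' is dual to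
   b; such a c exists as this product is non-zero. *)
have N1 a b : 1 <= N O a b.
  have [[b' bb'] _] := bf_rigid hC (simp b).
  have b0 := (simp_brick hC b).1; have a0 := (simp_brick hC a).1.
  have b'0 : idm b' <> 0.
    have [c [g gc]] := one_retract bb' b0 => b'0; apply: (bf_one hC).1.
    by apply: (idm_retract gc); rewrite -(wl_id hM) b'0 (tenm0r hM).
  have [c cP] := mult_ex (ten_nz b'0 a0); rewrite NO summxE (bigD1 c) //=.
  rewrite ler_wpDr ?sumr_ge0 // => [i _|]; first by rewrite mxE.
  rewrite mxE -/(hdim _ _) ler1n (hdim_isor hL _ (isomorphic_braid _ _)) -(hdim_adj hL hM _ _ bb').
  by rewrite (hdim_sym hL (fus_schur hC)) //; apply: fus_decomp.
pose H := N O *m (N O)^T.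
have H0 i j : 0 < H i j.
  rewrite mxE (bigD1 e) //= ltr_wpDr // ?sumr_ge0 // => [l _|].
    by rewrite mulr_ge0 // !mxE.
  by rewrite mulr_gt0 // ?[_^T _ _]mxE (lt_le_trans ltr01).
have Hs : H^T = H by rewrite /H trmx_mul trmxK.
have [x [lam [x0 xH xu]]] := pf_matrix_nonempty e H0 Hs.
(* H is the product of the matrices of O and its dual, so it commutes with every fusion matrix, and
   its one-dimensional eigenspace for lam is stable under all of them. *)
have HN X : H *m N X = N X *m H.
  by rewrite /H -(fusion_dual OO') -mulmxA [N O' *m _]fusion_comm mulmxA fusion_comm mulmxA.
have xN X : {f | x *m N X = f *: x}.
  by apply/constructive_indefinite_description/xu; rewrite -mulmxA -HN mulmxA xH scalemxAl.
pose f X := sval (xN X); have fP X : x *m N X = f X *: x by rewrite /f; case: (xN X).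
exists x; split=> // X; rewrite fP; congr (_ *: _); apply/esym.
have f0 Y : 0 <= f Y.
  have /rowP/(_ e) := fP Y; rewrite !mxE => h; rewrite -(pmulr_lge0 _ (x0 e)) -h.
  by apply: sumr_ge0 => i _; rewrite mulr_ge0 ?(ltW (x0 _)) // mxE.
have [[Y XY] _] := bf_rigid hC X.
have xx : 0 < (x *m x^T) 0 0.
  by rewrite mxE (bigD1 e) //= ltr_wpDr ?sumr_ge0 // => [i _|]; rewrite mxE ?mulr_ge0 ?mulr_gt0 // ltW.
(* The transpose is the matrix of the dual Y; pairing with x on both sides shows that X and Y have
   the same eigenvalue. *)
have xT : N X *m x^T = f X *: x^T.
  have -> : N X *m x^T = f Y *: x^T by rewrite -[N X]trmxK -(fusion_dual XY) -trmx_mul fP linearZ.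
  congr (_ *: _); have : x *m N X *m x^T = f Y *: (x *m x^T).
    by rewrite -mulmxA -[N X]trmxK -(fusion_dual XY) -trmx_mul fP linearZ -scalemxAr.
  rewrite fP -scalemxAl => /matrixP/(_ 0 0); rewrite mxE [RHS]mxE => /mulIf-> //.
  by rewrite gt_eqF.
rewrite /FPdim; case: closed_field_poly_normal => s /= sP.
rewrite (monicP (char_poly_monic _)) scale1r in sP.
have rts z : (z \in s) = eigenvalue (N X) z.
  by rewrite eigenvalue_root_char sP root_prod_XsubC.
apply: bigmax_eq => // [|z].
  rewrite rts; apply/eigenvalueP; exists x => //; apply/eqP => x00.
  by have := x0 e; rewrite x00 mxE ltxx.
rewrite rts => /eigenvalueP[v vE v0] z0.
pose w := map_mx (fun c : algC => `|c|) v.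
have w0 a : 0 <= w 0 a := norm_mx_ge0 v a.
have wx : 0 < (w *m x^T) 0 0.
  have [a va] : exists a, v 0 a != 0.
    by apply/existsP; apply: contraR v0 => /existsPn h; apply/eqP/rowP => i;
       rewrite [RHS]mxE; apply/eqP; rewrite -[_ == _]negbK h.
  rewrite mxE (bigD1 a) //= ltr_wpDr ?sumr_ge0 // => [i _|].
    by rewrite [x^T _ _]mxE mulr_ge0 // ltW.
  by rewrite [x^T _ _]mxE mulr_gt0 // mxE normr_gt0.
(* For any other eigenvalue z >= 0 the vector |v| N X dominates z |v| entrywise; pairing with x
   bounds z by f X. *)
rewrite -(ler_pM2r wx).
have -> : f X * (w *m x^T) 0 0 = (w *m N X *m x^T) 0 0.
  by rewrite -mulmxA xT -scalemxAr [RHS]mxE.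
rewrite mxE mulr_sumr mxE; apply: ler_sum => b _.
rewrite mulrA [x^T _ _]mxE; apply: ler_wpM2r; first exact: ltW.
rewrite mxE -{1}(ger0_norm z0) -normrM.
have -> : z * v 0 b = (v *m N X) 0 b by rewrite vE mxE.
rewrite mxE [X in _ <= X]mxE; apply: le_trans (ler_norm_sum _ _ _) _; apply: ler_sum => a _.
by rewrite normrM [w _ _]mxE [`|N X a b|]ger0_norm // mxE.
Qed.

(** All rules for [FPdim] are read off on the common eigenvector: an identity between fusion
    matrices becomes one between eigenvalues. *)
Lemma FPdim_unique X f : (forall x : 'rV[algC]_n, (forall X, x *m N X = FPdim X *: x) ->
  x *m N X = f *: x) -> FPdim X = f.
Proof.
have [x [x0 xN]] := fusion_pf => /(_ x xN); rewrite xN => /rowP h.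
have [e _] := simp_of (simple_brick hL hA (bf_one hC)).
by have := h e; rewrite !mxE => /mulIf-> //; rewrite gt_eqF.
Qed.

Lemma FPdim_iso X Y : isomorphic X Y -> FPdim X = FPdim Y.
Proof. by move=> i; apply: FPdim_unique => x xN; rewrite (fusion_isom i) xN. Qed.

Lemma FPdim_ten X Y : FPdim (X \ox Y) = FPdim X * FPdim Y.
Proof.
by apply: FPdim_unique => x xN; rewrite fusion_ten mulmxA xN -scalemxAl xN scalerA.
Qed.

Lemma FPdim_one : FPdim (one C) = 1.
Proof. by apply: FPdim_unique => x xN; rewrite fusion_one mulmx1 scale1r. Qed.

Lemma FPdim_fsum (I : finType) (S : I -> C) X : fsum S X -> FPdim X = \sum_i FPdim (S i).
Proof.
move=> dX; apply: FPdim_unique => x xN; rewrite (fusion_fsum dX) mulmx_sumr scaler_suml.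
by apply: eq_bigr => i _; rewrite xN.
Qed.

Lemma FPdim_ge0 X : 0 <= FPdim X.
Proof.
have [x [x0 xN]] := fusion_pf.
have [e _] := simp_of (simple_brick hL hA (bf_one hC)).
have /rowP/(_ e) := xN X; rewrite !mxE => h; rewrite -(pmulr_lge0 _ (x0 e)) -h.
by apply: sumr_ge0 => i _; rewrite mulr_ge0 ?(ltW (x0 _)) // mxE.
Qed.

Lemma FPdim_expand X : FPdim X = \sum_a (mult a X)%:R * FPdim (simp (C := C) a).
Proof.
by apply: (additive_expand (phi := fun X => FPdim X)) => [? ?|? ? ?]; [apply: FPdim_iso | apply: FPdim_fsum].
Qed.

Lemma FPdim_dual X Y : left_dual X Y -> FPdim Y = FPdim X.
Proof.
move=> XY; have [x [x0 xN]] := fusion_pf.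
have [e _] := simp_of (simple_brick hL hA (bf_one hC)).
have xx : 0 < (x *m x^T) 0 0.
  by rewrite mxE (bigD1 e) //= ltr_wpDr ?sumr_ge0 // => [i _|]; rewrite mxE ?mulr_ge0 ?mulr_gt0 // ltW.
have : x *m N X *m x^T = FPdim Y *: (x *m x^T).
  by rewrite -mulmxA -[N X]trmxK -(fusion_dual XY) -trmx_mul xN linearZ -scalemxAr.
rewrite xN -scalemxAl => /matrixP/(_ 0 0); rewrite mxE [RHS]mxE => /mulIf-> //.
by rewrite gt_eqF.
Qed.

Lemma FPdim_retract X Y (i : mor C Y X) (p : mor C X Y) : p \oc i = idm Y -> FPdim Y <= FPdim X.
Proof.
move=> pi; rewrite (FPdim_expand X) (FPdim_expand Y); apply: ler_sum => a _.
rewrite ler_wpM2r ?FPdim_ge0 // ler_nat; apply: (dim_le_inj (f := fun f : mor C (simp a) Y => i \oc f)).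
  exact: comp_linearr.
by move=> f g /=; apply: (sec_inj hL pi).
Qed.

(** X (x) Y contains the unit for a dual Y of the same dimension, so the square of the dimension is
    at least 1. *)
Lemma FPdim_ge1 X : idm X <> 0 -> 1 <= FPdim X.
Proof.
move=> X0; have [[Y XY] _] := bf_rigid hC X; have [c [g gc]] := one_retract XY X0.
have := FPdim_retract gc; rewrite FPdim_one FPdim_ten (FPdim_dual XY) -expr2.
by rewrite -{1}(expr1n _ 2) ler_pXn2r // ?nnegrE ?FPdim_ge0 // ler01.
Qed.

Lemma FPdim_gt0 X : idm X <> 0 -> 0 < FPdim X.
Proof. by move/FPdim_ge1; apply: lt_le_trans ltr01. Qed.

Lemma FPdim_Aint X : FPdim X \in Aint.
Proof.
have [x [x0 xN]] := fusion_pf.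
have [e _] := simp_of (simple_brick hL hA (bf_one hC)).
apply: (root_monic_Aint (p := char_poly (N X))); last 2 first.
- exact: char_poly_monic.
- apply/polyOverP=> i.
  pose M : 'M[int]_n := \matrix_(a, b) (mult a (X \ox simp b))%:Z.
  have -> : N X = map_mx intr M by apply/matrixP=> a b; rewrite !mxE.
  by rewrite -map_char_poly coef_map intr_int.
rewrite -eigenvalue_root_char; apply/eigenvalueP; exists x => //; apply/eqP => x00.
by have := x0 e; rewrite x00 mxE ltxx.
Qed.

(* A rational eigenvector v of B = sum_V N_V N_V^T for the rational eigenvalue
   FPdim C must satisfy |v N_V|^2 = FPdim(V)^2 |v|^2 for every simple V. *)
Lemma FPdim_sq_nat (D : nat) V : FPdim_cat C = D%:R -> simple_obj V ->
  exists m : nat, FPdim V ^+ 2 = m%:R.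
Proof.
move=> CD; move/(simpleE hC)/simp_of => [a0 /FPdim_iso ->].
have [x [x0 xN]] := fusion_pf.
pose A a := N (simp (C := C) a) *m (N (simp a))^T.
have AE a : exists Y, N Y = A a /\ FPdim Y = FPdim (simp (C := C) a) ^+ 2.
  have [[Y XY] _] := bf_rigid hC (simp (C := C) a); exists (simp a \ox Y).
  by rewrite fusion_ten (fusion_dual XY) FPdim_ten (FPdim_dual XY) expr2.
have xA a : x *m A a = FPdim (simp a) ^+ 2 *: x by have [Y [<- <-]] := AE a.
pose B := \sum_a A a.
have xB : x *m B = D%:R *: x.
  by rewrite mulmx_sumr (eq_bigr _ (fun a _ => xA a)) -scaler_suml -CD.
pose Bq : 'M[rat]_n := \sum_c (\matrix_(a, b) (mult a (simp c \ox simp b))%:R *m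
   (\matrix_(a, b) (mult a (simp c \ox simp b))%:R)^T).
have BE : B = map_mx ratr Bq.
  rewrite /B raddf_sum; apply: eq_bigr => c _ /=; rewrite map_mxM -map_trmx /A.
  by have -> : N (simp c) = map_mx ratr (\matrix_(a, b) (mult a (simp c \ox simp b))%:R);
     [apply/matrixP=> a b; rewrite !mxE ratr_nat | ].
have /eqP dq : \det (Bq - D%:R%:M) == 0.
  rewrite -(fmorph_eq0 (ratr : {rmorphism rat -> algC})) -det_map_mx map_mxB map_scalar_mx /= ratr_nat -BE.
  apply/det0P; exists x; last by rewrite mulmxBr xB mul_mx_scalar subrr.
  by apply/eqP => x00; have := x0 a0; rewrite x00 mxE ltxx.
have /det0P[vq vq0 vqB] : \det (Bq - D%:R%:M) == 0 by rewrite dq.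
pose v := map_mx ratr vq : 'rV[algC]_n.
have vr a : v 0 a \is Num.real by rewrite mxE; apply: Creal_Crat; apply: Crat_rat.
have v0 : v != 0 by rewrite map_mx_eq0.
have vB : v *m B = D%:R *: v.
  apply/eqP; rewrite -subr_eq0 -mul_mx_scalar -mulmxBr BE.
  by rewrite -(ratr_nat _ D) -map_scalar_mx -map_mxB -map_mxM vqB map_mx0.
have le a : (v *m A a *m v^T) 0 0 <= FPdim (simp (C := C) a) ^+ 2 * (v *m v^T) 0 0.
  apply: (sym_form_le _ _ x0) => // [|i j].
    by rewrite trmx_mul trmxK.
  by rewrite mxE sumr_ge0 // => l _; rewrite !mxE mulr_ge0.
have eq : (v *m A a0 *m v^T) 0 0 = FPdim (simp (C := C) a0) ^+ 2 * (v *m v^T) 0 0.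
  apply/eqP; rewrite eq_sym -subr_eq0; apply/eqP.
  apply: (psumr_eq0P (P := xpredT) (F := fun a => FPdim (simp (C := C) a) ^+ 2 * (v *m v^T) 0 0
     - (v *m A a *m v^T) 0 0)) => // [a _|]; first by rewrite subr_ge0.
  rewrite sumrB -mulr_suml -/(FPdim_cat C) CD.
  have -> : \sum_i (v *m A i *m v^T) 0 0 = (v *m B *m v^T) 0 0.
    by rewrite mulmx_sumr mulmx_suml summxE.
  by rewrite vB -scalemxAl [X in _ - X]mxE subrr.
have vv0 : (v *m v^T) 0 0 != 0.
  have [a va] : exists a, v 0 a != 0.
    by apply/existsP; apply: contraR v0 => /existsPn h; apply/eqP/rowP => i;
       rewrite [RHS]mxE; apply/eqP; rewrite -[_ == _]negbK h.
  rewrite gt_eqF // mxE (bigD1 a) //= [v^T _ _]mxE -expr2 ltr_wpDr ?sumr_ge0 // => [i _|].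
    by rewrite [v^T _ _]mxE -expr2 real_exprn_even_ge0.
  by rewrite lt0r sqrf_eq0 va real_exprn_even_ge0.
have q : FPdim (simp (C := C) a0) ^+ 2 \in Crat.
  have -> : FPdim (simp (C := C) a0) ^+ 2 = (v *m A a0 *m v^T) 0 0 / (v *m v^T) 0 0 by rewrite eq mulfK.
  have rat1 (w : 'rV[algC]_n) (u : 'cV[algC]_n) : (forall i, w 0 i \in Crat) ->
      (forall i, u i 0 \in Crat) -> (w *m u) 0 0 \in Crat.
    by move=> wr ur; rewrite mxE rpred_sum // => i _; rewrite rpredM.
  have vrat i : v 0 i \in Crat by rewrite mxE Crat_rat.
  have vTrat i : v^T i 0 \in Crat by rewrite mxE.
  rewrite rpred_div // rat1 // => i; rewrite mxE rpred_sum // => j _; rewrite rpredM //.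
  by rewrite mxE rpred_sum // => l _; rewrite !mxE rpredM // rpred_nat.
have : FPdim (simp (C := C) a0) ^+ 2 \is a Num.nat.
  by rewrite natrEint Cint_rat_Aint ?exprn_ge0 ?FPdim_ge0 // rpredX // FPdim_Aint.
by move/natrP => [l ->]; exists l.
Qed.
End FPdimTheory.

(** * Weights, conjugates and components of modules *)

Section Weights.
Local Open Scope cat_scope.
Context (k : closedFieldType) (C : bmcat k) (hC : braided_fusion C).
Local Notation hL := (bf_linear hC).
Local Notation hM := (bf_monoidal hC).
Local Notation hB := (bf_braided hC).
Local Notation sp := (fus_split hC).
Context (H : finGroupType) (R : C) (m : mor C (R \ox R) R) (u : mor C (one C) R)
  (tau : H -> mor C R R) (s : mor C R (R \ox R)) (hG : galois_alg m u tau s).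
Let cA := comp_assoc hL.
Let c1l := comp_idl hL.
Let c1r := comp_idr hL.
Let wM := wlM hL hM.
Let p2 := post2 hL.
Local Notation "''R' f" := (idm R \om f) (at level 30, f at level 30).
Local Notation eta := (h0 u).
Local Notation sg := (hd s).
Local Notation tu g := (h1 (tau g)).
Local Notation ep := (hc (s \oc u)).
Local Notation is_act := (is_act m u).
Local Notation rmod := (rmod m u).
Local Notation na N := (h2 (mact N)).
Local Notation mkrmod := (mkrmod hL hM).
Local Notation T := (T hG).
Local Notation Rm := (Rm hL hM hG).
Local Notation rten := (rten hL hM).
Local Notation tens := (tens hL hM hB hG sp).
Local Notation tp := (tp hL hM hB hG sp).
Local Notation ti := (ti hL hM hB hG sp).
Local Notation "K ~= N" := (@isomorphic k T K N) (at level 70).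
Local Notation rbrick N := (@brick k T N).
Local Notation rhdim := (@hdim k T).
Local Notation rfsum := (@fsum k T).
Implicit Types K N L M : rmod.

(** The dimension of N as an R-module is [weight N / FPdim R]; [weight_tens] shows that this
    quotient is multiplicative. *)
Definition weight N : algC := FPdim (rcar N).
Local Notation W := weight.
Local Notation gam := (FPdim R).

Lemma TL : linear_category T. Proof. exact: (T_linear hL hM hG). Qed.
Lemma TS : brick_schur T.
Proof. exact: (regular_schur TL (T_regular hL hM hB (fus_regular hC))). Qed.
Lemma TD N : exists (I : finType) (S : I -> rmod), (forall a, rbrick (S a)) /\ rfsum S N.
Proof.
exact: (bricks_decomp TL (T_regular hL hM hB (fus_regular hC)) (T_split hL hM sp)).
Qed.
Lemma TH K N : rhdim K N = rhdim N K. Proof. exact: (hdim_sym TL TS K N TD). Qed.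

Lemma riso K N (f : mor C K N) : rl f -> is_iso f -> K ~= N.
Proof. by move=> fl [g gf]; apply/(T_iso hL hM hG); exists f, g; split=> //; apply: (rl_inv hL hM gf). Qed.

Lemma rbrickP N : rbrick N <-> idm (N : C) <> 0 /\
  forall f : mor C N N, rl f -> exists a, f = a *: idm (N : C).
Proof.
split=> [[N0 Nb]|[N0 Nb]]; split.
- by move=> e; apply: N0; apply: tval_inj; rewrite (tval_id hL hM).
- move=> f fl; have [a aE] := Nb (tof hG f); exists a.
  rewrite -(tofK hL hM hG fl) aE -[a *: _]addr0 tval_lin tval0 addr0.
  by rewrite (tval_id hL hM).
- by move=> e; apply: N0; rewrite -(tval_id hL hM hG) e.
move=> f; have [a aE] := Nb _ (tvalP hL hM f); exists a; apply: tval_inj.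
by rewrite aE -[X in tval X]addr0 tval_lin tval0 addr0 (tval_id hL hM).
Qed.

Lemma tval_sum K N (I : finType) (F : I -> mor T K N) : tval (\sum_a F a) = \sum_a tval (F a).
Proof.
exact: (big_morph (@tval k C H R m u tau s hG K N)).
Qed.

Lemma weight_iso K N : K ~= N -> W K = W N.
Proof.
move/(T_iso hL hM hG) => [f [g [_ _ fg]]]; apply: (FPdim_iso hC).
by exists f; exists g.
Qed.

Lemma rfsum_fsum (I : finType) (S : I -> rmod) N : rfsum S N -> fsum (fun a => S a : C) (N : C).
Proof.
case=> i [p [pi p0 ip]]; exists (fun a => tval (i a)), (fun a => tval (p a)); split.
- by move=> a; rewrite -(tval_comp hL hM) pi (tval_id hL hM).
- by move=> a b ab; rewrite -(tval_comp hL hM) p0.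
rewrite -(tval_id hL hM hG) -ip.
rewrite tval_sum; by apply: eq_bigr => a _; rewrite (tval_comp hL hM).
Qed.

Lemma weight_fsum (I : finType) (S : I -> rmod) N : rfsum S N -> W N = \sum_a W (S a).
Proof. by move/rfsum_fsum/(FPdim_fsum hC). Qed.

Lemma weight_ge0 N : 0 <= W N. Proof. exact: FPdim_ge0. Qed.
Lemma weight_gt0 N : rbrick N -> 0 < W N.
Proof. by move/rbrickP=> [N0 _]; apply: FPdim_gt0. Qed.

Lemma weight_rten N (S : C) : W (rten N S) = W N * FPdim S.
Proof. exact: (FPdim_ten hC). Qed.

Lemma R_nz : idm R <> 0.
Proof.
move=> R0; have /hdim_ex[f] : (0 < hdim (one C) R)%N by rewrite (ga_dim hG).
by apply; rewrite -(c1l f) R0 (comp0l hL).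
Qed.
Lemma gam_gt0 : 0 < gam. Proof. exact: FPdim_gt0 R_nz. Qed.

(** The adjunction between free modules and the forgetful functor. *)
Lemma hdim_free (S : C) N : rhdim (rten Rm S) N = hdim S N.
Proof.
have rlf (g : mor C S N) : @rl _ _ _ _ _ (rten Rm S) N (mact N \oc 'R g).
  rewrite /rl /= cA -(h2n hL hM) -(cA (mact N)) -(ractP hL hM N).1 cA -wM.
  by [].
apply: (@dim_eq_bij _ _ _ (fun f : mor T (rten Rm S) N => tval f \oc eta S)).
  by move=> a f g; rewrite tval_lin (compDl hL) (compZl hL).
exists (fun g => @tof _ _ _ _ _ _ _ _ hG (rten Rm S) N (mact N \oc 'R g)) => f.
  apply: tval_inj; rewrite (tofK hL hM) // wM -cA -(tvalP hL hM f) cA.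
  by rewrite (mu_etar hL hM hB hG) c1r.
by rewrite (tofK hL hM) // cA -(h0n hL hM) -cA (ractP hL hM N).2 c1l.
Qed.

Lemma rten_one N : rten N (one C) ~= N.
Proof.
apply: (@riso (rten N (one C)) N (runit N)); last exact: (runit_iso hM N).
rewrite /rl /= h2E -cA (runit_nat hM) cA -(runit_ten hL hM) cA (as_ai hM) c1r.
by [].
Qed.

(** By the adjunction the endomorphisms of the module R are Hom(1, R), a line by [ga_dim]. *)
Lemma Rm_brick : rbrick Rm.
Proof.
apply: (hdim_brick TL); rewrite -(hdim_isol TL _ (rten_one Rm)) hdim_free.
exact: ga_dim hG.
Qed.

Lemma cj_act g N : is_act (mact N \oc tu g N).
Proof.
have [a1 a2] := ractP hL hM N; split; last by rewrite cA (tu_eta hL hM hG) a2.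
by rewrite wM !cA (p2 (h1n hL hM _ _)) !cA (p2 a1) !cA (tu_mu hL hM hG).
Qed.
(* N^g: the action of R is precomposed with the translation by g. *)
Definition cj g N : rmod := mkrmod (cj_act g N).

Lemma na_cj g N Z : na (cj g N) Z = na N Z \oc tu g (N \ox Z).
Proof. by rewrite -(h2_tenl hL hM). Qed.

Lemma na_cjV g N Z : na N Z = na (cj g N) Z \oc tu g^-1%g (N \ox Z).
Proof. by rewrite na_cj cA (tuM hL hM hG) mulgV (tu1 hM hG) c1r. Qed.

Lemma rl_cj g K N (f : mor C K N) : @rl _ _ _ _ _ K N f <-> @rl _ _ _ _ _ (cj g K) (cj g N) f.
Proof.
rewrite /rl /=; split=> E; first by rewrite -cA E !cA (h1n hL hM).
apply: (ret_inj hL (f := tu g K) (g := tu g^-1%g K)); first exact: (tuKV hL hM hG).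
by rewrite !cA E cA (h1n hL hM).
Qed.

Lemma cj_brick g N : rbrick N -> rbrick (cj g N).
Proof.
move/rbrickP=> [N0 Nb]; apply/rbrickP; split=> // f fl; apply: Nb.
exact/(rl_cj g).
Qed.

Lemma cj_iso g K N : K ~= N -> cj g K ~= cj g N.
Proof.
move/(T_iso hL hM hG) => [f [f' [fl fl' ff]]]; apply/(T_iso hL hM hG); exists f, f'.
by split=> //; [apply: (proj1 (rl_cj g f) fl) | apply: (proj1 (rl_cj g f') fl')].
Qed.

Lemma cj1 N : cj 1%g N ~= N.
Proof.
apply: (@riso (cj 1%g N) N (idm (N : C))); last exact: (is_iso_id hL).
by rewrite /rl /= c1l (wl_id hM) c1r (tu1 hM hG) c1r.
Qed.
Lemma cjM g h N : cj h (cj g N) ~= cj (g * h)%g N.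
Proof.
apply: (@riso (cj h (cj g N)) (cj (g * h)%g N) (idm (N : C))); last exact: (is_iso_id hL).
by rewrite /rl /= c1l (wl_id hM) c1r cA (tuM hL hM hG).
Qed.

Lemma weight_cj g N : W (cj g N) = W N. Proof. by []. Qed.

(* For i : V -> N, the maps r (x) v |-> tau_g(r) i(v) on R (x) V are jointly monic. *)
Lemma free_constituent N (V : C) K (h : mor C K (R \ox V)) : rbrick N -> brick V -> rbrick K ->
  (0 < hdim V N)%N -> @rl _ _ _ _ _ K (rten Rm V) h -> h <> 0 -> exists g, K ~= cj g N.
Proof.
move=> Nb Vb Kb /hdim_ex[i i0] hl h0; have [p' pE] := fus_regular hC i.
have [p pi] : exists p : mor C N V, p \oc i = idm V.
  have [_ /(_ (p' \oc i))[a aE]] := Vb.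
  have a0 : a != 0 by apply/eqP => a0; apply: i0; rewrite -pE aE a0 scale0r (comp0r hL).
  by exists (a^-1 *: p'); rewrite (compZl hL) aE scalerA mulVf // scale1r.
pose f g := mact N \oc tu g N \oc 'R i.
have fl g : @rl _ _ _ _ _ (rten Rm V) (cj g N) (f g).
  have [a1 _] := cj_act g N.
  rewrite /rl /f /= -!cA (cA (_ \oc _)) -(h2n hL hM) -cA -a1.
  by rewrite !cA -!wM !cA.
(* An explicit left inverse of the family f: translating back by g^-1 and summing over g recombines
   the f g into the identity, by [sum_tu]. *)
have sumE : \sum_g ('R p \oc tu g^-1%g N \oc 'R mact N \oc ep N \oc f g) = idm _.
  rewrite -[RHS](wl_id hM) -pi wM -(c1l i) -[X in X \oc i](ractP hL hM N).2 !wM -(sum_tu hL hM hG).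
  rewrite !(comp_sumr hL, comp_suml hL); apply: eq_bigr => g _.
  have -> : 'R mact N \oc ep N \oc f g = 'R (mact N) \oc sg N \oc tu g N \oc 'R i.
    rewrite /f (p2 (hcn hL hM _ _)) !cA -(cA _ _ (ep _ \oc _)) -wM (ractP hL hM N).1 wM cA.
    by rewrite (p2 (E2 hL hM hG N)).
  rewrite (p2 (h1n hL hM (tau g^-1%g) _)) !cA (p2 (sg_tu hL hM hG _ _)) !cA.
  by rewrite (p2 (tuVK hL hM hG _ _)) c1l.
have [g fh] : exists g, f g \oc h <> 0.
  case: (excluded_middle_informative (exists g, f g \oc h <> 0)) => // nex; case: h0.
  rewrite -(c1l h) -sumE (comp_suml hL) big1 // => g _.
  have fh : f g \oc h = 0 by apply/eqP/negPn/negP => /eqP e; apply: nex; exists g.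
  by move: (f g) fh => fg fh; rewrite !cA fh !(comp0r hL).
exists g; have fhl := rl_comp hL hM (fl g) hl.
exists (@tof _ _ _ _ _ _ _ _ hG K (cj g N) (f g \oc h)); apply: TS => //; first exact: cj_brick.
by move=> e; apply: fh; rewrite -(tofK hL hM hG fhl) e.
Qed.

Lemma free_decomp N (V : C) (I : finType) (S : I -> rmod) : rbrick N -> brick V ->
  (0 < hdim V N)%N -> (forall a, rbrick (S a)) -> rfsum S (rten Rm V) ->
  forall a, exists g, S a ~= cj g N.
Proof.
move=> Nb Vb VN Sb [i [p [pi _ _]]] a.
apply: (free_constituent (h := tval (i a)) Nb Vb (Sb a) VN); first exact: (tvalP hL hM).
move=> i0; have [S0 _] := Sb a; apply: S0; rewrite -pi; apply: tval_inj.
by rewrite (tval_comp hL hM) i0 (comp0r hL).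
Qed.

Lemma brick_in_free N : rbrick N -> exists V : C, brick V /\ (0 < hdim V N)%N.
Proof.
by move/rbrickP=> [N0 _]; have [a aP] := mult_ex hC N0; exists (simp a); split=> //; apply: simp_brick.
Qed.

Definition tr K N N' (f : mor C N N') := tp K N' \oc (idm (K : C) \om f) \oc ti K N.

Lemma tr_tp K N N' (f : mor C N N') : rl f -> tr K f \oc tp K N = tp K N' \oc (idm (K : C) \om f).
Proof.
move=> fl; rewrite /tr -[RHS](tip_id hL hM hB hG sp) ?cA //.
rewrite -(h2n hL hM) -cA (tp_n12 hL hM hB hG sp) !n2D !cA; congr (_ \oc _).
by rewrite -(cA _ _ (ch _ _ _)) -wM fl wM !cA (chn hL hM).
Qed.

Lemma tr_rl K N N' (f : mor C N N') : rl f -> rl (tr K f).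
Proof.
move=> fl; rewrite /rl /tr !wM -!cA (tp_n1 hL hM hB hG sp) !cA.
by rewrite (ti_n1 hL hM hB hG sp) -!(cA (na K N')) (h2n hL hM) !cA.
Qed.

Lemma fsum_tens (I : finType) (S : I -> rmod) K N :
  rfsum S N -> rfsum (fun a => tens K (S a)) (tens K N).
Proof.
case=> i [p [pi p0 ip]].
have il a := tvalP hL hM (i a); have pl a := tvalP hL hM (p a).
exists (fun a => tof hG (tr K (tval (i a)))), (fun a => tof hG (tr K (tval (p a)))); split.
- move=> a; apply: tval_inj; rewrite (tval_comp hL hM) (tval_id hL hM) !(tofK hL hM); try exact: tr_rl.
  apply: tp_epi; rewrite cA !tr_tp // -cA tr_tp // cA -wM -(tval_comp hL hM) pi.
  by rewrite (tval_id hL hM) (wl_id hM) c1l c1r.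
- move=> a b ab; apply: tval_inj; rewrite (tval_comp hL hM) tval0 !(tofK hL hM); try exact: tr_rl.
  apply: tp_epi; rewrite cA !tr_tp // -cA tr_tp // cA -wM -(tval_comp hL hM) p0 //.
  by rewrite tval0 (tenm0r hM) (comp0r hL) (comp0l hL).
apply: tval_inj.
rewrite tval_sum (eq_bigr (fun a => tr K (tval (i a)) \oc tr K (tval (p a)))); last first.
  by move=> a _; rewrite (tval_comp hL hM) !(tofK hL hM) //; apply: tr_rl.
apply: tp_epi; rewrite (comp_suml hL) (tval_id hL hM) c1l.
rewrite (eq_bigr (fun a => tp K N \oc (idm (K : C) \om tval (i a \oc p a)))); last first.
  by move=> a _; rewrite cA tr_tp // -cA tr_tp // cA -wM -(tval_comp hL hM).
rewrite -(comp_sumr hL) -(tenm_sumr hM).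
by rewrite -tval_sum ip (tval_id hL hM) (wl_id hM) c1r.
Qed.
End Weights.

(** * The degree of an R-module *)

Section Sectors.
Local Open Scope cat_scope.
Context (k : closedFieldType) (C : bmcat k) (hC : braided_fusion C).
Local Notation hL := (bf_linear hC).
Local Notation hM := (bf_monoidal hC).
Local Notation hB := (bf_braided hC).
Context (H : finGroupType) (R : C) (m : mor C (R \ox R) R) (u : mor C (one C) R)
  (tau : H -> mor C R R) (s : mor C R (R \ox R)) (hG : galois_alg m u tau s).
Let cA := comp_assoc hL.
Let c1l := comp_idl hL.
Let c1r := comp_idr hL.
Let wM := wlM hL hM.
Let p2 := post2 hL.
Let p3 := post3 hL.
Local Notation "''R' f" := (idm R \om f) (at level 30, f at level 30).
Local Notation mu := (h2 m).
Local Notation eta := (h0 u).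
Local Notation sg := (hd s).
Local Notation tu g := (h1 (tau g)).
Local Notation cc := (ch R R).
Local Notation is_act := (is_act m u).
Local Notation rmod := (rmod m u).
Local Notation na N := (h2 (mact N)).
Local Notation T := (T hG).
Local Notation Rm := (Rm hL hM hG).
Local Notation rten := (rten hL hM).
Local Notation "K ~= N" := (@isomorphic k T K N) (at level 70).
Local Notation rbrick N := (@brick k T N).
Implicit Types K N L M : rmod.
Local Notation cj := (cj hC hG).
Local Notation W := (@weight k C R m u).

Lemma ybe X Y Z (Q : C) : (idm Z \om ch X Y Q) \oc ch X Z (Y \ox Q) \oc (idm X \om ch Y Z Q)
  = ch Y Z (X \ox Q) \oc (idm Y \om ch X Z Q) \oc ch X Y (Z \ox Q).
Proof. by have := chRp hL hM hB X (braid Y Z) Q; rewrite !hp_braid. Qed.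

Lemma dbl_move X Y Z (Q : C) : ch X Z (Y \ox Q) \oc (idm X \om ch Y Z Q) \oc dbl X Y (Z \ox Q)
  = (idm Z \om dbl X Y Q) \oc ch X Z (Y \ox Q) \oc (idm X \om ch Y Z Q).
Proof.
by rewrite !dblE wM (p3 (esym (ybe Y X Z Q))) !cA -(ybe X Y Z Q).
Qed.

(* K lies in the component of x in the G-crossed category of R-modules; the
   local modules are those with sec 1. *)
Definition sec x K := mact K \oc braid K R \oc braid R K = mact K \oc tu x K.

Lemma secP x K : sec x K <-> forall Z, na K Z \oc dbl R K Z = na K Z \oc tu x (K \ox Z).
Proof.
split=> [E Z|E].
  rewrite -(hp_dbl hL hM) -(h2_hp hL hM) E.
  exact: (h2_tenl hL hM).
apply: (h2_inj hL hM); rewrite (h2_hp hL hM) (hp_dbl hL hM) E.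
by rewrite -(h2_tenl hL hM).
Qed.

Lemma sec_ret x K N (i : mor C K N) (p : mor C N K) : rl p -> rl i -> p \oc i = idm (K : C) ->
  sec x N -> sec x K.
Proof.
move=> pl il pi E; have e : mact K = p \oc mact N \oc 'R i.
  by rewrite -cA pl cA -wM pi (wl_id hM) c1r.
rewrite /sec e !cA.
rewrite (p2 (esym (braid_nat hB i (idm R)))) cA -(braid_nat hB (idm R) i) (p3 E) !cA.
by rewrite (h1n hL hM).
Qed.

Lemma sec_cj x g K : sec x K -> sec (g^-1 * x * g)%g (cj g K).
Proof.
move/secP=> E; apply/secP=> Z; rewrite !na_cj !cA -(dbl_l hL hM hB) (p2 (E Z)) !cA.
by rewrite !(tuM hL hM hG) mulgA mulgA mulgV mul1g.
Qed.

Lemma Rm_sec : sec 1%g Rm.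
Proof. by rewrite /sec /= (ga_sym hG) (tu1 hM hG). Qed.

Lemma na_act N Z W' (h : mor C W' _) : na N Z \oc 'R (na N Z) \oc h = na N Z \oc mu (N \ox Z) \oc h.
Proof. by rewrite (p2 (act_hat hL hM N Z)) cA. Qed.

Section SecExists.
Context (K : rmod).
Local Notation Y := (K \ox one C).
Local Notation n1 := (na K (one C)).
Local Notation D := (dbl R K (one C)).
Local Notation n2 := (n1 \oc D).

Lemma D_na : D \oc 'R n1 = 'R n1 \oc cc Y \oc 'R D \oc cc Y.
Proof. exact: (dblR2 hL hM hB). Qed.

Lemma na_cc (V' : C) (h : mor C V' _) : n1 \oc 'R n1 \oc cc Y \oc h = n1 \oc mu Y \oc h.
Proof. by rewrite na_act (p2 (mu_cc hL hM hG _)). Qed.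

(** Carrying R once around K before it acts gives a second action of R on the same object, and by
    [n12_dbl] it commutes with the first. A module has degree x when the two differ by the
    translation by x. *)
Lemma act_dbl : is_act n2.
Proof.
split.
  rewrite !wM !cA (p2 D_na) !cA na_cc (dblL2 hL hM hB) -na_act na_act.
  have cK := cc_cc hL hM hG.
  have E : cc Y \oc 'R D \oc cc Y \oc 'R D = (idm R \om ch K R (one C)) \oc dbl R K (R \ox one C) \oc (idm R \om ch R K (one C)).
    rewrite !(dblE R K (one C)) !wM !cA (p3 (ybe R K R (one C))) !cA.
    rewrite (p3 (ybe K R R (one C))) !cA (p2 (cK _)) c1l.
    by rewrite dblE !cA.
  by rewrite -E; rewrite (p2 (mu_cc hL hM hG _)).
rewrite cA dblE cA (chL0 hL hM hB) (chR0 hL hM hB).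
exact: (act_hatu hL hM).
Qed.

Lemma n12_dbl : n1 \oc 'R n2 = n2 \oc 'R n1 \oc cc Y.
Proof.
rewrite cA (p2 D_na) !cA (cc_cc hL hM hG) c1r na_cc wM.
by rewrite na_act.
Qed.

(** For each g let [pi g] be the idempotent onto the coequalizer of the action translated by g and
    the action carried around K. These idempotents are R-linear and sum to 1, so on a brick they are
    scalars and one of them is the identity; for that g the two actions coincide. *)
Lemma sec_exists : rbrick K -> exists x, sec x K.
Proof.
move=> Kb; pose K1 : rmod := rten K (one C).
have K1b : rbrick K1.
  by apply: (brick_iso (TL hC hG) Kb); apply: (isomorphic_sym); apply: rten_one.
have a1 g : is_act (n1 \oc tu g Y) := cj_act hC hG g K1.
have comm g : (n1 \oc tu g Y) \oc 'R n2 = n2 \oc 'R (n1 \oc tu g Y) \oc cc Y.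
  rewrite cA (h1n hL hM) -cA n12_dbl wM !cA; congr (_ \oc _ \oc _ \oc _).
  exact: (ch_l hL hM hB).
pose pi g := bipi u s (n1 \oc tu g Y) n2.
have sumE : \sum_g pi g = idm Y.
  transitivity (n1 \oc 'R n2 \oc cc Y \oc (\sum_g ('R (tu g Y) \oc sg Y)) \oc eta Y).
    rewrite (comp_suml hL) !(comp_sumr hL); apply: eq_bigr => g _.
    rewrite /pi bipiE.
    rewrite !cA (p2 (h1n hL hM (tau g) n2)) !cA; congr (_ \oc _ \oc _).
    have e : tu g (R \ox Y) \oc sg Y = cc Y \oc 'R (tu g Y) \oc sg Y.
      by rewrite -(cA (cc Y)) (ch_r hL hM hB) cA (cc_sg hL hM hG).
    by rewrite (epE hL hM) -(cA (tu g _)) e !cA.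
  rewrite (sum_tu hL hM hG) -(cA (cc _)) (chR0 hL hM hB).
  by rewrite (p2 (esym (h0n hL hM u n2))) !cA (p2 (act_hatu hL hM K (one C))) c1l -cA act_dbl.2.
have pirl g : @rl _ _ _ _ _ K1 K1 (pi g).
  have [b1 _ b3 _] := bipi_comm hL hM hB hG (a1 g) act_dbl (comm g).
  apply/esym; rewrite /pi; apply: (ret_inj hL (f := tu g Y) (g := tu g^-1%g Y)); first exact: (tuKV hL hM hG).
  by rewrite !cA -(h1n hL hM) -!cA b1 -b3 !cA.
have pia g : {a | pi g = a *: idm Y}.
  have [_ K1e] := (rbrickP hC hG K1).1 K1b.
  exact: (constructive_indefinite_description _ (K1e _ (pirl g))).
have Y0 : idm Y <> 0 := ((rbrickP hC hG K1).1 K1b).1.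
have [g a0] : exists g, sval (pia g) != 0.
  apply/existsP; apply: contra_notT Y0 => /existsPn h; rewrite -sumE big1 // => g _.
  have := h g; rewrite negbK; case: (pia g) => a /= -> /eqP->; exact: scale0r.
exists g; have [_ _ b3 b4] := bipi_comm hL hM hB hG (a1 g) act_dbl (comm g).
(* A non-zero scalar that is idempotent equals 1. *)
have pg1 : pi g = idm Y.
  case: (pia g) a0 => a /= aE a0; have := bipi_idem hL hM hB hG (a1 g) act_dbl (comm g).
  rewrite -/(pi g) aE (compZl hL) c1l scalerA => /eqP; rewrite -subr_eq0 -scalerBl scaler_eq0.
  by rewrite -[X in _ - X]mulr1 -mulrBr mulf_eq0 (negPf a0) subr_eq0 => /orP[/eqP->|/eqP/Y0//]; rewrite scale1r.
have e : n1 \oc tu g Y = n2 by rewrite -[LHS]c1l -[RHS]c1l -pg1 /pi b3 b4.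
apply: (h2_inj hL hM); rewrite (h2_hp hL hM) (hp_dbl hL hM) -e.
exact/esym/(h2_tenl hL hM).
Qed.
End SecExists.
End Sectors.

(** Bernoulli's inequality together with the archimedean property. *)
Lemma algC_pow_bound (x c : algC) : 1 < x -> (forall j : nat, x ^+ j <= c) -> False.
Proof.
move=> x1; have [y y0 ->] : exists2 y, 0 < y & x = 1 + y.
  by exists (x - 1); rewrite ?subr_gt0 // addrC subrK.
move=> le.
have bern j : 1 + j%:R * y <= (1 + y) ^+ j.
  elim: j => [|j IH]; first by rewrite mul0r addr0 expr0.
  rewrite exprS; apply: le_trans (ler_wpM2l _ IH); last by rewrite addr_ge0 ?ler01 // ltW.
  rewrite -natr1 -subr_ge0; have -> : (1 + y) * (1 + j%:R * y) - (1 + (j%:R + 1) * y) = j%:R * y ^+ 2 by ring.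
  by rewrite mulr_ge0 // exprn_ge0 // ltW.
have c0 : 0 <= c / y by rewrite divr_ge0 ?(ltW y0) // (le_trans _ (le 0)) // expr0 ler01.
have := archi_boundP c0; set b := Num.bound _; rewrite ltr_pdivrMr // => cb.
have := lt_le_trans cb (le_trans _ (bern b)); rewrite lerDr ler01 => /(_ isT) cb'.
by have := lt_le_trans cb' (le b); rewrite ltxx.
Qed.

(** * Multiplicativity of weights *)

Section TensorWeights.
Local Open Scope cat_scope.
Context (k : closedFieldType) (C : bmcat k) (hC : braided_fusion C).
Local Notation hL := (bf_linear hC).
Local Notation hM := (bf_monoidal hC).
Local Notation hB := (bf_braided hC).
Local Notation sp := (fus_split hC).
Context (H : finGroupType) (R : C) (m : mor C (R \ox R) R) (u : mor C (one C) R)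
  (tau : H -> mor C R R) (s : mor C R (R \ox R)) (hG : galois_alg m u tau s).
Let cA := comp_assoc hL.
Let c1l := comp_idl hL.
Let c1r := comp_idr hL.
Let wM := wlM hL hM.
Let wR := wrM hL hM.
Let p2 := post2 hL.
Let p3 := post3 hL.
Local Notation "''R' f" := (idm R \om f) (at level 30, f at level 30).
Local Notation mu := (h2 m).
Local Notation eta := (h0 u).
Local Notation tu g := (h1 (tau g)).
Local Notation cc := (ch R R).
Local Notation rmod := (rmod m u).
Local Notation na N := (h2 (mact N)).
Local Notation T := (T hG).
Local Notation Rm := (Rm hL hM hG).
Local Notation rten := (rten hL hM).
Local Notation tens := (tens hL hM hB hG sp).
Local Notation tp := (tp hL hM hB hG sp).
Local Notation ti := (ti hL hM hB hG sp).
Local Notation "K ~= N" := (@isomorphic k T K N) (at level 70).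
Local Notation rbrick N := (@brick k T N).
Local Notation rhdim := (@hdim k T).
Local Notation rfsum := (@fsum k T).
Implicit Types K N L M : rmod.
Local Notation cj := (cj hC hG).
Local Notation W := (@weight k C R m u).
Local Notation gam := (FPdim R).
Local Notation sec := (sec tau).
Local Notation rl := (@rl k C R m u).

(** The complementary summand Z of Y in X has dimension 0, and a non-zero object has positive
    dimension. *)
Lemma retraction_iso X Y (f : mor C X Y) g : f \oc g = idm Y -> FPdim X = FPdim Y -> is_iso f.
Proof.
move=> fg XY; have ee : (idm X - g \oc f) \oc (idm X - g \oc f) = idm X - g \oc f.
  rewrite (compBl hL) !(compBr hL) c1l c1r cA (p2 fg) !c1l subrr subr0.
  by [].
have [Z [i [p [pi ip]]]] := sp ee.
have fi : f \oc i = 0.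
  by rewrite -(c1r i) -pi -(cA i) ip (compBl hL) c1l (compBr hL) cA (p2 fg) c1l subrr.
have pg : p \oc g = 0.
  have e : p = p \oc (idm X - g \oc f) by rewrite -ip -cA pi c1l.
  by rewrite e cA (compBl hL) c1l cA fg c1r subrr (comp0r hL).
have dX : fsum (fun b : bool => if b then Y else Z) X.
  exists (fun b => if b return mor C (if b then Y else Z) X then g else i),
         (fun b => if b return mor C X (if b then Y else Z) then f else p).
  split; [by case| by do 2!case |].
  by rewrite big_bool /= ip addrC subrK.
have Z0 : idm Z = 0.
  apply/eqP/negPn/negP => /eqP Z0; have := FPdim_gt0 hC Z0.
  have := FPdim_fsum hC dX; rewrite big_bool /= XY -{1}(addr0 (FPdim Y)) => /addrI <-.
  by rewrite ltxx.
exists g; split=> //; apply/eqP; rewrite eq_sym -subr_eq0 -ip; apply/eqP.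
by rewrite -(c1l p) Z0 (comp0l hL) (comp0r hL).
Qed.

Lemma epi_weight_iso K N (f : mor C K N) (g : mor C N K) :
  rl f -> f \oc g = idm (N : C) -> W K = W N -> K ~= N.
Proof. by move=> fl fg KN; apply: (riso hC hG fl); apply: retraction_iso fg KN. Qed.

(** The crossed braiding of modules. Only a split epimorphism is claimed here; it becomes an
    isomorphism in [tens_swap], once both sides are known to have equal weight. *)
Lemma swap_epi x K N : sec x K -> exists (f : mor C (tens K N) (tens (cj x N) K)) g,
  rl f /\ f \oc g = idm (tens (cj x N) K : C).
Proof.
move=> /(secP hC) E; set N' := cj x N.
have bal Z : h2 (tp N' K) Z \oc na N' (K \ox Z)
    = h2 (tp N' K) Z \oc (idm (N : C) \om na K Z) \oc ch R N (K \ox Z).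
  exact: (tp_bal hL hM hB hG sp N' K Z).
have e1 Z : h2 (tp N' K \oc braid K N) Z \oc na K (N \ox Z)
    = h2 (tp N' K) Z \oc na N' (K \ox Z) \oc 'R (ch K N Z).
  by rewrite (h2_braid hL hM) cA (chL2 hL hM hB) (p2 (bal Z)) !cA.
have e2 Z : h2 (tp N' K \oc braid K N) Z \oc na K (N \ox Z)
    = h2 (tp N' K \oc braid K N) Z \oc (idm (K : C) \om na N Z) \oc ch R K (N \ox Z).
  rewrite e1 (h2_braid hL hM) !cA (p2 (chR2 hL hM hB _ _ _)) !cA -(dblE R K).
  rewrite (na_cjV hC hG x N) !cA (p2 (h1n hL hM _ _)) !cA -(dbl_l hL hM hB).
  rewrite !(p2 (bal Z)) !cA (p3 (dbl_move hC R K N Z)) !cA.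
  have E' : (idm (N : C) \om na K Z) \oc (idm (N : C) \om dbl R K Z)
      = (idm (N : C) \om na K Z) \oc (idm (N : C) \om tu x (K \ox Z)) by rewrite -!wM E.
  rewrite (p2 E') !cA (p2 (esym (ch_l hL hM hB _ _ _))) !cA.
  by rewrite (p2 (h1n hL hM _ _)) !cA (tuM hL hM hG) mulgV (tu1 hM hG) c1r.
have e3 Z : na (tens N' K) Z \oc 'R (h2 (tp N' K \oc braid K N) Z)
    = h2 (tp N' K \oc braid K N) Z \oc na K (N \ox Z).
  by rewrite e1 (h2_braid hL hM) wM (p2 (tp_lin hL hM hB hG sp N' K Z)) !cA.
have [f' [fl f'E]] := tens_ind hL hM hB hG sp (bal_plain hL hM e2) (lin_plain hL hM e3).
have [b [bb b'b]] := braid_iso hB K N.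
exists f', (tp K N \oc b \oc ti N' K); split=> //.
by rewrite -!cA f'E !cA (p2 b'b) c1l (tp_ti hL hM hB hG sp).
Qed.

(** Gives the inequality between the weights of [tens K Rm] and K that [weight_tens] takes from
    it. *)
Lemma tens_unitr_epi K : exists (f : mor C (tens K Rm) K) g, rl f /\ f \oc g = idm (K : C).
Proof.
have [b [bb b'b]] := braid_iso hB R K.
pose f := mact K \oc b.
have fE : f \oc braid R K = mact K by rewrite /f cA bb c1r.
have hf Z : h2 f Z \oc ch R K Z = na K Z by rewrite -(h2_braid hL hM) fE.
clearbody f.
have cK := cc_cc hL hM hG; have m1 := mu_cc hL hM hG.
have e0 Z : na K (R \ox Z) \oc 'R (ch R K Z) = ch R K Z \oc 'R (na K Z) \oc cc (K \ox Z).
  by rewrite -(cA (ch _ _ _)) (chR2 hL hM hB) !cA cK c1r.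
have e1 Z : h2 f Z \oc na K (R \ox Z) \oc 'R (ch R K Z) = na K Z \oc mu (K \ox Z).
  by rewrite e0 -cA hf -cA (act_hat hL hM) cA m1.
have e2 Z : h2 f Z \oc na K (R \ox Z) = h2 f Z \oc (idm (K : C) \om na Rm Z) \oc ch R K (R \ox Z).
  apply: (iso_cancel_r hL (wl_iso hL hM R (ch_iso hL hM hB R K Z))).
  by rewrite !cA e1 -(chL2 hL hM hB) -cA hf.
have e3 Z : na K Z \oc 'R (h2 f Z) = h2 f Z \oc na K (R \ox Z).
  apply: (iso_cancel_r hL (wl_iso hL hM R (ch_iso hL hM hB R K Z))).
  by rewrite !cA e1 -wM hf (act_hat hL hM).
have e2' : f \oc na K Rm = f \oc n2 K Rm by apply: (bal_plain hL hM).
have e3' : mact K \oc 'R f = f \oc na K Rm by apply: (lin_plain hL hM).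
have [f' [fl f'E]] := tens_ind hL hM hB hG sp e2' e3'.
exists f', (tp K Rm \oc braid R K \oc eta K); split=> //.
by rewrite -!cA f'E fE (ractP hL hM K).2.
Qed.

Lemma sec_tens x y K N : sec x K -> sec y N -> sec (y * x)%g (tens K N).
Proof.
move=> /(secP hC) xK /(secP hC) yN; apply/(secP hC) => Z.
have epi := h2_epi hL hM (tp_ti hL hM hB hG sp K N).
have [ic [ic1 ic2]] := ch_iso hL hM hB R K (N \ox Z).
have bal := tp_bal hL hM hB hG sp K N Z; have lin := tp_lin hL hM hB hG sp K N Z.
have jP : 'R (h2 (tp K N) Z) \oc 'R (assoc K N Z \oc (ti K N \om idm Z)) = idm _.
  rewrite -wM h2E cA (p2 (ai_as hM _ _ _)) c1l -wR.
  by rewrite (tp_ti hL hM hB hG sp) !(wl_id hM).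
apply: (ret_inj hL jP); rewrite cA (dblR2 hL hM hB) -!cA lin !cA.
have e1 : na K (N \ox Z) \oc ch K R (N \ox Z) = na K (N \ox Z) \oc tu x _ \oc ic.
  by rewrite (p2 (esym (xK _))) dblE !cA ic2 c1r.
have e2 : (idm (K : C) \om na N Z) \oc (idm (K : C) \om tu x (N \ox Z)) \oc (idm (K : C) \om dbl R N Z)
    = (idm (K : C) \om na N Z) \oc (idm (K : C) \om tu (y * x)%g (N \ox Z)).
  by rewrite -!wM -(dbl_l hL hM hB) -(cA (na N Z)) yN cA (tuM hL hM hG).
rewrite (p2 e1) !cA (p2 bal) !cA (p2 (ch_l hL hM hB _ _ _)) !cA (p2 ic2) c1l (p3 e2) !cA.
by rewrite -(ch_l hL hM hB) (p3 (esym bal)) !cA (p2 (esym lin)) !cA (h1n hL hM).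
Qed.

Let WT N : 0 <= W N := weight_ge0 hC N.

Lemma hdim_ex_summand N K (I : finType) (S : I -> rmod) : rfsum S N ->
  (0 < rhdim K N)%N -> exists a, (0 < rhdim K (S a))%N.
Proof.
move=> dN; rewrite (hdim_sumr (TL hC hG) K dN) => h; apply/existsP.
apply: contraLR h => /existsPn h; rewrite big1 // => a _.
by apply/eqP; have := h a; rewrite lt0n negbK.
Qed.

(** By the adjunction every brick occurs in the free module on some simple object of C, so finitely
    many bricks suffice. *)
Lemma brick_enum : exists (I : finType) (S : I -> rmod),
  (forall i, rbrick (S i)) /\ forall N, rbrick N -> exists i, N ~= S i.
Proof.
have dec a := constructive_indefinite_description _ (TD hC hG (rten Rm (simp (C := C) a))).
have decS a := constructive_indefinite_description _ (proj2_sig (dec a)).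
pose I : finType := {a : 'I_(nsimples C) & sval (dec a)}.
pose mkI a j : I := existT (fun a => Finite.sort (sval (dec a))) a j.
pose S (i : I) : rmod := sval (decS (tag i)) (tagged i).
have Sb i : rbrick (S i) by rewrite /S; case: (svalP (decS (tag i))) => h _; apply: h.
have Sd a : rfsum (fun j => S (mkI a j)) (rten Rm (simp (C := C) a)).
  by case: (svalP (decS a)).
exists I, S; split=> // N' N'b.
have [V [Vb VN]] := brick_in_free hC N'b.
have [a /(isomorphic_sym) aV] := simp_of hC Vb.
have : (0 < rhdim N' (rten Rm (simp (C := C) a)))%N.
  by rewrite TH // hdim_free (hdim_isol hL _ aV).
move/(hdim_ex_summand (Sd a)) => [j jP]; exists (mkI a j).
exact: (brick_hdimE (TL hC hG) (@TS _ _ hC _ _ _ _ _ _ hG) N'b (Sb _) jP).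
Qed.

(* Maximum principle: rho = r0 W - gam W(K (x) -) is nonnegative on simple
   modules, multiplicative for - (x) S with S in C, and vanishes somewhere. *)
Lemma weight_tens K N : W (tens K N) * gam = W K * W N.
Proof.
have [I [S [Sb Sall]]] := brick_enum.
pose r N' := W (tens K N') * gam / W N'.
have [i0 _] := Sall _ (Rm_brick hC hG).
have rr i : r (S i) \is Num.real.
  by rewrite realE /r divr_ge0 // mulr_ge0 // FPdim_ge0.
have [i1 i1P] := exists_max i0 rr; set r0 := r (S i1) in i1P.
pose rho N' := r0 * W N' - W (tens K N') * gam.
have rho_iso N1 N2 : N1 ~= N2 -> rho N1 = rho N2.
  move=> e; have e1 : W N1 = W N2 := weight_iso hC e.
  have e2 : W (tens K N1) = W (tens K N2).
    exact: (weight_iso hC (tens_iso hL hM hB sp (isomorphic_refl (TL hC hG) K) e)).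
  by rewrite /rho e1 e2.
have rho_sum (J : finType) (S' : J -> rmod) N' : rfsum S' N' -> rho N' = \sum_j rho (S' j).
  move=> dN; rewrite /rho (weight_fsum hC dN) (weight_fsum hC (fsum_tens hC K dN)).
  by rewrite sumrB mulr_sumr mulr_suml.
have rho_rten N' V : rho (rten N' V) = rho N' * FPdim V.
  rewrite /rho weight_rten // (weight_iso hC (tens_rten hL hM hB hG sp K N' V)) weight_rten //; ring.
have rho_ge0 N' : rbrick N' -> 0 <= rho N'.
  move=> /Sall[i /rho_iso ->]; rewrite subr_ge0.
  by have := i1P i; rewrite /r ler_pdivrMr // (weight_gt0 hC (Sb i)).
(* The zero of [rho] spreads: [rho] of N' (x) V is 0 and is the sum of its nonnegative values on the
   simple summands. *)
have step N' V N'' : rbrick N'' -> rho N' = 0 -> (0 < rhdim N'' (rten N' V))%N -> rho N'' = 0.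
  move=> N''b N'0 h; have [J [S' [S'b dS']]] := TD hC hG (rten N' V).
  have [j jP] := hdim_ex_summand dS' h.
  rewrite (rho_iso _ _ (brick_hdimE (TL hC hG) (@TS _ _ hC _ _ _ _ _ _ hG) N''b (S'b j) jP)).
  have := rho_sum _ _ _ dS'; rewrite rho_rten N'0 mul0r => /esym e.
  by apply: (psumr_eq0P _ e) => // l _; apply: rho_ge0.
have rho1 : rho (S i1) = 0.
  by rewrite /rho /r0 /r divfK ?subrr // gt_eqF // (weight_gt0 hC (Sb i1)).
(* R occurs in S (x) S* for the module S where the maximum is attained; from R the zero then reaches
   every simple module, since each occurs in a free one. *)
have rhoR : rho Rm = 0.
  have S1 := ((rbrickP hC hG _).1 (Sb i1)).1.
  have [_ [Z ZS]] := bf_rigid hC (S i1 : C); have [Z' SZ] := (bf_rigid hC (S i1 : C)).1.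
  have [c [g gc]] := one_retract hC SZ S1.
  apply: (step (S i1) Z' _ (Rm_brick hC hG) rho1).
  rewrite -(hdim_isol (TL hC hG) _ (rten_one hC hG Rm)) hdim_free.
  apply: (hdim_gt0 (f := c)) => c0; apply: (bf_one hC).1.
  by rewrite -gc c0 (comp0r hL).
have rhoall N' : rho N' = 0.
  have [J [S' [S'b dS']]] := TD hC hG N'.
  have e : rho N' = \sum_j rho (S' j) := rho_sum _ _ _ dS'.
  rewrite e big1 // => j _.
  have [V [Vb VS]] := brick_in_free hC (S'b j).
  apply: (step Rm V _ (S'b j) rhoR); by rewrite TH // hdim_free.
(* Evaluating at N = R determines r0. The weight of [tens K Rm] is at most that of K by the crossed
   braiding with the unit module, and at least that of K by [tens_unitr_epi]. *)
have r0E : r0 * gam = W K * gam.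
  have := rhoall Rm; rewrite /rho => /eqP; rewrite subr_eq0 => /eqP ->; congr (_ * _).
  apply/eqP; rewrite eq_le; apply/andP; split.
    have [f [g [_ fg]]] := swap_epi K (Rm_sec hC hG).
    have := FPdim_retract hC fg; rewrite -/(W (tens (cj 1%g K) Rm)) -/(W (tens Rm K)).
    have e1 := tens_iso hL hM hB sp (cj1 hC hG K) (isomorphic_refl (TL hC hG) Rm).
    by rewrite (weight_iso hC e1) (weight_iso hC (tens_unitl hL hM hB hG sp K)).
  by have [f [g [_ fg]]] := tens_unitr_epi K; apply: (FPdim_retract hC fg).
have g0 : gam != 0 by rewrite gt_eqF // (gam_gt0 hC hG).
have := rhoall N; rewrite /rho => /eqP; rewrite subr_eq0 => /eqP <-.
by have /(mulIf g0) -> := r0E.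
Qed.

Lemma weight_tensE K N : W (tens K N) = W K * W N / gam.
Proof. by rewrite -weight_tens mulfK // gt_eqF // (gam_gt0 hC hG). Qed.

(** Otherwise the weights of the tensor powers of N would tend to 0, while each power is non-zero
    and so has dimension at least 1. *)
Lemma gam_le N : idm (N : C) <> 0 -> gam <= W N.
Proof.
have g0 := gam_gt0 hC hG; move=> N0; have W0 : 0 < W N := FPdim_gt0 hC N0.
have wr : W N \is Num.real by rewrite realE ltW.
have gr : gam \is Num.real by rewrite realE ltW.
rewrite real_leNgt //; apply/negP => lt.
apply: (@algC_pow_bound (gam / W N) gam) => [|j]; first by rewrite ltr_pdivlMr // mul1r.
pose P := iter j (tens N) Rm.
have wP : W P = gam * (W N / gam) ^+ j.
  rewrite /P; elim: (j) => [|l IH]; first by rewrite expr0 mulr1.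
  by rewrite iterS weight_tensE IH exprS; ring.
have x0 : 0 < W N / gam by rewrite divr_gt0.
have : 1 <= W P.
  apply: (FPdim_ge1 hC) => P0; have : 0 < W P by rewrite wP mulr_gt0 // exprn_gt0.
  have [I [S [Sb dS]]] := fus_decomp hC (P : C).
  rewrite /weight (FPdim_fsum hC dS) big1 ?ltxx // => i _.
  have [i' [p' [pi _ _]]] := dS; have [S0 _] := Sb i; case: S0.
  exact: (idm_retract hC (pi i) P0).
rewrite wP -ler_pdivrMr ?exprn_gt0 // mul1r -exprVn invf_div //.
Qed.

(** Each non-zero summand has weight at least that of R, which leaves room for only one. *)
Lemma gam_brick N : W N = gam -> rbrick N.
Proof.
move=> Ng; have g0 := gam_gt0 hC hG; have [I [S [Sb dS]]] := TD hC hG N.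
have le a : gam <= W (S a) by apply: gam_le; have [] := (rbrickP hC hG (S a)).1 (Sb a).
have := weight_fsum hC dS; rewrite Ng => e.
have [a0 _|I0] := pickP (@predT I); last first.
  by move: e; rewrite big_pred0 // => e; move: g0; rewrite e ltxx.
have a0P a : (a == a0).
  apply/negPn/negP => aa0; have : gam + gam <= gam.
    rewrite [X in _ <= X]e (bigD1 a0) //= (bigD1 a) //=; apply: lerD => //.
    by rewrite -[X in X <= _]addr0; apply: lerD => //; apply: sumr_ge0 => l _; exact: WT.
  by rewrite gerDl => /(lt_le_trans g0); rewrite ltxx.
have bp (F : I -> nat) : (\sum_a F a)%N = F a0.
  by rewrite (bigD1 a0) //= big1 ?addn0 // => a; rewrite a0P.
apply: (hdim_brick (TL hC hG)); rewrite (hdim_suml (TL hC hG) _ dS) bp (hdim_sumr (TL hC hG) _ dS) bp.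
exact: brick_hdim.
Qed.

(** Here and for [tens_assoc] and [tens_cj] a split epimorphism is written down, and equality of
    weights makes it an isomorphism. *)
Lemma tens_swap x K N : sec x K -> tens K N ~= tens (cj x N) K.
Proof.
by move=> /(swap_epi N)[f [g [fl fg]]]; apply: (epi_weight_iso fl fg); rewrite !weight_tensE; congr (_ / _); exact: mulrC.
Qed.

Lemma tens_comm K N : sec 1%g K -> tens K N ~= tens N K.
Proof.
move=> K1; apply: (isomorphic_trans (TL hC hG) (tens_swap N K1)).
exact: (tens_iso hL hM hB sp (cj1 hC hG N) (isomorphic_refl (TL hC hG) K)).
Qed.

Lemma tens_assoc A B N : tens A (tens B N) ~= tens (tens A B) N.
Proof.
pose f := tp (tens A B) N \oc h2 (tp A B) N.
have bal := tp_bal hL hM hB hG sp A B N; have lin := tp_lin hL hM hB hG sp A B N.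
have e1 := tp_n12 hL hM hB hG sp (tens A B) N.
have E1 : f \oc (idm (A : C) \om na B N) = f \oc (idm (A : C) \om n2 B N).
  apply: (iso_cancel_r hL (ch_iso hL hM hB R A (B \ox N))).
  rewrite /f !cA -bal -lin (p2 e1) !n2D wM !cA.
  by rewrite (chR2 hL hM hB) (p2 (h2n hL hM _ _)) !cA.
have E2 : f \oc na A (B \ox N) = f \oc (idm (A : C) \om na B N) \oc ch R A (B \ox N).
  by rewrite /f !cA bal.
have E3 : mact (tens (tens A B) N) \oc 'R f = f \oc na A (B \ox N).
  by rewrite /f wM -cA (tp_n1 hL hM hB hG sp) !cA lin.
have [f' [fl f'E]] := tens_ind3 hL hM hB hG sp E1 E2 E3.
apply: (epi_weight_iso fl (g := tp A (tens B N) \oc (idm (A : C) \om tp B N)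
   \oc (assoc A B N \oc (ti A B \om idm (N : C))) \oc ti (tens A B) N)).
  rewrite (p3 f'E) /f !cA h2E !cA (p2 (ai_as hM _ _ _)) c1l -(cA (_ \om _)) -wR.
  by rewrite (tp_ti hL hM hB hG sp) (wl_id hM) c1l (tp_ti hL hM hB hG sp).
rewrite !weight_tensE; ring.
Qed.

Lemma tens_cj_map g K N : exists f : mor C (tens (cj g K) (cj g N)) (cj g (tens K N)),
  rl f /\ f \oc tp (cj g K) (cj g N) = tp K N.
Proof.
have E1 : tp K N \oc na (cj g K) N = tp K N \oc n2 (cj g K) (cj g N).
  rewrite na_cj -cA (tp_n12 hL hM hB hG sp) !n2D /= wM !cA.
  by rewrite (ch_l hL hM hB).
have E2 : mact (cj g (tens K N)) \oc 'R (tp K N) = tp K N \oc na (cj g K) N.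
  by rewrite na_cj /= cA (h1n hL hM) -cA (tp_n1 hL hM hB hG sp) cA.
exact: (tens_ind hL hM hB hG sp (K := cj g K) (N := cj g N) (L := cj g (tens K N)) E1 E2).
Qed.

Lemma tens_cj g K N : tens (cj g K) (cj g N) ~= cj g (tens K N).
Proof.
have [f' [fl f'E]] := tens_cj_map g K N.
have fg : f' \oc (tp (cj g K) (cj g N) \oc ti K N) = idm (tens K N : C).
  by rewrite -cA f'E (tp_ti hL hM hB hG sp).
have e : W (tens (cj g K) (cj g N)) = W (cj g (tens K N)).
  by rewrite weight_cj !weight_tensE !weight_cj.
exact: (@epi_weight_iso (tens (cj g K) (cj g N)) (cj g (tens K N)) f' _ fl fg e).
Qed.
End TensorWeights.

Definition asb (P : Prop) : bool := if excluded_middle_informative P then true else false.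
Lemma asbP (P : Prop) : reflect P (asb P).
Proof. by rewrite /asb; case: excluded_middle_informative => h; constructor. Qed.

(** * Non-degeneracy makes every component non-empty *)

Section AllSectors.
Local Open Scope cat_scope.
Context (k : closedFieldType) (C : bmcat k) (hC : braided_fusion C).
Local Notation hL := (bf_linear hC).
Local Notation hM := (bf_monoidal hC).
Local Notation hB := (bf_braided hC).
Local Notation sp := (fus_split hC).
Context (H : finGroupType) (R : C) (m : mor C (R \ox R) R) (u : mor C (one C) R)
  (tau : H -> mor C R R) (s : mor C R (R \ox R)) (hG : galois_alg m u tau s).
Let cA := comp_assoc hL.
Let c1l := comp_idl hL.
Let c1r := comp_idr hL.
Let wM := wlM hL hM.
Let wR := wrM hL hM.
Let p2 := post2 hL.
Let p3 := post3 hL.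
Local Notation "''R' f" := (idm R \om f) (at level 30, f at level 30).
Local Notation eta := (h0 u).
Local Notation rmod := (rmod m u).
Local Notation T := (T hG).
Local Notation Rm := (Rm hL hM hG).
Local Notation rten := (rten hL hM).
Local Notation tens := (tens hL hM hB hG sp).
Local Notation "K ~= N" := (@isomorphic k T K N) (at level 70).
Local Notation rbrick N := (@brick k T N).
Local Notation rfsum := (@fsum k T).
Implicit Types K N L M : rmod.
Local Notation W := (@weight k C R m u).
Local Notation sec := (sec tau).
Context (char_k : [pchar k] =i pred0) (nd : nondegenerate_cat C).

Lemma centralizes_sym (X Y : C) : centralizes X Y -> centralizes Y X.
Proof.
rewrite /centralizes => E; apply: (iso_cancel_r hL (braid_iso hB X Y)).
by rewrite cA E c1l c1r.
Qed.

Lemma centralizes_ret (X Y Y' : C) (i : mor C Y' Y) (p : mor C Y Y') : p \oc i = idm Y' ->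
  centralizes X Y -> centralizes X Y'.
Proof.
rewrite /centralizes => pi E.
have jP : (idm X \om p) \oc (idm X \om i) = idm _ by rewrite -wM pi (wl_id hM).
apply: (sec_inj hL jP); rewrite c1r -cA -(braid_nat hB i (idm X)) cA.
by rewrite -(braid_nat hB (idm X) i) -cA E c1l.
Qed.

Lemma brick_summand N : 0 < W N -> exists K (i : mor T K N) (p : mor T N K), rbrick K /\ p \oc i = @idm k T K.
Proof.
move=> W0; have [I [S [Sb dS]]] := TD hC hG N.
have [a _|I0] := pickP (@predT I).
  by have [i [p [pi _ _]]] := dS; exists (S a), (i a), (p a).
by move: W0; rewrite (weight_fsum hC dS) big_pred0 ?ltxx.
Qed.

Lemma u_line (f : mor C (one C) R) : exists a, f = a *: u.
Proof.
apply: (dim1_line (ga_dim hG)); apply/eqP => u0; apply: (R_nz hC hG).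
apply: (iso_cancel_r hL (lunit_iso hM R)).
by rewrite (comp0l hL) c1l -(ga_unit hG) u0 (tenm0l hM) (comp0r hL).
Qed.

(** The degrees that occur form a subgroup S. Each R (x) V is a sum of modules with degrees in S, so
    the S-invariants Y of R centralize every V. By non-degeneracy Y is a multiple of the unit; as
    Hom(1, R) is a line, S-invariant functions are constant, which is only possible if S is the
    whole group. *)
Lemma all_sectors x : exists N, rbrick N /\ sec x N.
Proof.
pose S := [set x | asb (exists N, rbrick N /\ sec x N)].
have SP y : reflect (exists N, rbrick N /\ sec y N) (y \in S) by rewrite inE; apply: asbP.
have S1 : 1%g \in S by apply/SP; exists Rm; split; [apply: Rm_brick | apply: (Rm_sec hC hG)].
have SM y z : y \in S -> z \in S -> (y * z)%g \in S.
  move=> /SP[K [Kb Ky]] /SP[N [Nb Nz]]; have KN := sec_tens hC hG Nz Ky.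
  have [|L [i [p [Lb pi]]]] := @brick_summand (tens N K).
    by rewrite weight_tensE divr_gt0 ?mulr_gt0 ?(weight_gt0 hC Kb) ?(weight_gt0 hC Nb) ?(gam_gt0 hC hG).
  apply/SP; exists L; split=> //.
  apply: (sec_ret hC (tvalP hL hM p) (tvalP hL hM i) _ KN).
  by rewrite -(tval_comp hL hM) pi (tval_id hL hM).
have gS : group_set S by apply/group_setP; split=> // y z; apply: SM.
pose G0 := Group gS.
suff : x^-1%g \in G0 by rewrite groupV => /SP.
have n0 : (#|S|%:R : k) != 0.
  have /pcharf0P -> := char_k; rewrite -lt0n; exact: (cardG_gt0 G0).
(* The projection of R onto its S-invariants. *)
pose e : mor C R R := (#|S|%:R)^-1 *: \sum_(y in G0) tau y.
have te y : y \in G0 -> tau y \oc e = e.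
  move=> yS; rewrite /e (compZr hL) (comp_sumr hL); congr (_ *: _).
  rewrite [RHS](reindex_inj (mulgI y)); apply: eq_big => [z|z _]; first by rewrite groupMl.
  exact: (ga_tauM hG).
have ee : e \oc e = e.
  rewrite {1}/e (compZl hL) (comp_suml hL) (eq_bigr (fun=> e)); last by move=> y /te.
  by rewrite sumr_const -scaler_nat scalerA mulVf // scale1r.
have [Y [i [p [pi ip]]]] := sp ee.
have ti' y : y \in G0 -> tau y \oc i = i.
  by move=> /te yE; rewrite -[i in LHS]c1r -pi -(cA i) ip -cA yE -ip cA pi c1r.
(* On invariants a translation by an element of S has no effect, so carrying Y around N is invisible
   to the action. This condition passes to direct sums, unlike having a degree. *)
pose fixed N := mact N \oc braid N R \oc braid R N \oc (i \om idm (N : C)) = mact N \oc (i \om idm (N : C)).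
have fix_sec N y : y \in G0 -> sec y N -> fixed N.
  by move=> yS yN; rewrite /fixed (p3 yN) cA /h1 -wR ti'.
have fix_sum (I : finType) (S' : I -> rmod) N : rfsum S' N -> (forall a, fixed (S' a)) -> fixed N.
  move=> dS fS; have [j [q [_ _ jq]]] := dS.
  have jl a := tvalP hL hM (j a).
  have jqE : \sum_a (tval (j a) \oc tval (q a)) = idm (N : C).
    rewrite -(tval_id hL hM hG) -jq tval_sum; apply: eq_bigr => a _.
    by rewrite (tval_comp hL hM).
  have ext (W' : C) (f g : mor C (Y \ox N) W') :
      (forall a, f \oc (idm Y \om tval (j a)) = g \oc (idm Y \om tval (j a))) -> f = g.
    move=> fg; rewrite -(c1r f) -(c1r g) -(wl_id hM) -jqE (tenm_sumr hM) !(comp_sumr hL).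
    by apply: eq_bigr => a _; rewrite wM -!cA fg.
  apply: ext => a; rewrite !cA !(xch hL hM).
  rewrite (p2 (braid_nat hB (idm R) (tval (j a)))) !cA (p2 (braid_nat hB (tval (j a)) (idm R))) !cA.
  rewrite !(p2 (esym (jl a))) !cA.
  congr (_ \oc _); exact: fS.
have cent V : brick V -> centralizes Y V.
  move=> Vb; pose N : rmod := rten Rm V.
  have [I [S' [Sb dS]]] := TD hC hG N.
  have : fixed N.
    apply: (fix_sum _ _ _ dS) => a; have [y ay] := sec_exists hC (Sb a).
    by apply: (fix_sec _ y) => //; apply/SP; exists (S' a).
  rewrite /fixed => E; have := congr1 (fun f => f \oc (idm Y \om eta V)) E.
  rewrite !cA !(xch hL hM).
  have NE : mact N \oc 'R (eta V) = idm _ := mu_etar hL hM hB hG V.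
  rewrite (p2 (braid_nat hB (idm R) (eta V))) !cA (p2 (braid_nat hB (eta V) (idm R))) !cA.
  rewrite !(p2 NE) !c1l (braid_nat hB) (p2 (braid_nat hB _ _)) cA => E'.
  have jP : (p \om idm V) \oc (i \om idm V) = idm _ by rewrite -wR pi (wl_id hM).
  by apply: (sec_inj hL jP); rewrite c1r.
have /nd[n [j [q [_ _ jq]]]] : centralizer (whole C) Y.
  have [n [S' [S's dS]]] := bf_semisimple hC Y.
  apply: (fsub_dsum (fsubP (centralizer (whole C)))) (dS) => a S'' S'P; apply: S'P.
  split=> // X _ /(simpleE hC) Xb; have [j [q [qj _ _]]] := dS.
  exact: (centralizes_ret (qj a) (centralizes_sym (cent _ Xb))).
(* The image of e consists of multiples of u, which every translation fixes. *)
have te' h : tau h \oc e = e.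
  rewrite -ip -(c1l p) -jq (comp_suml hL) !(comp_sumr hL); apply: eq_bigr => a _.
  have [c cE] := u_line (i \oc j a).
  by rewrite !cA -!(cA i) cE !(compZl hL) (compZr hL) -!cA (ga_tau_u hG).
(* A diagonal part: it sends [tau g] to the identity for g = 1 and to 0 otherwise. Applied to
   [tau x e = e] it produces y in S with x y = 1. *)
pose chi (f : mor C R R) := m \oc (f \om idm R) \oc s.
have chiZ c f : chi (c *: f) = c *: chi f by rewrite /chi (tenmZl hM) (compZl hL) (compZr hL).
have chi_sum (F : H -> mor C R R) (P : pred H) : chi (\sum_(y | P y) F y) = \sum_(y | P y) chi (F y).
  by rewrite /chi (tenm_suml hM) (comp_suml hL) (comp_sumr hL).
have chi_tau g : chi (tau g) = (g == 1%g)%:R *: idm R.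
  rewrite /chi; have [->|g1] := eqVneq g 1%g; first by rewrite (ga_tau1 hG) (wl_id hM) c1l (ga_ms hG) scale1r.
  by rewrite (ga_orth hG g1) scale0r.
have e1 : \sum_(y in G0) chi (tau y) = idm R.
  rewrite (bigD1 1%g) //= big1; first by rewrite chi_tau eqxx scale1r addr0.
  by move=> y /andP[_ y1]; rewrite chi_tau (negPf y1) scale0r.
have := congr1 chi (te' x); rewrite /e (compZr hL) (comp_sumr hL) !chiZ !chi_sum e1 => E.
apply/negPn/negP => xS; move: E; rewrite big1 => [|y yS]; last first.
  rewrite (ga_tauM hG) chi_tau; case: eqP => [xy|_]; last by rewrite scale0r.
  by case/negP: xS; move/eqP: xy; rewrite -eq_invg_mul => /eqP ->.
rewrite scaler0 => /esym/eqP; rewrite scaler_eq0 invr_eq0 (negPf n0) => /eqP.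
exact: (R_nz hC hG).
Qed.
End AllSectors.

(** * Scalar braidings of local modules *)

Section Balanced.
Local Open Scope cat_scope.
Context (k : closedFieldType) (C : bmcat k) (hC : braided_fusion C).
Local Notation hL := (bf_linear hC).
Local Notation hM := (bf_monoidal hC).
Local Notation hB := (bf_braided hC).
Local Notation sp := (fus_split hC).
Context (H : finGroupType) (R : C) (m : mor C (R \ox R) R) (u : mor C (one C) R)
  (tau : H -> mor C R R) (s : mor C R (R \ox R)) (hG : galois_alg m u tau s).
Let cA := comp_assoc hL.
Let c1l := comp_idl hL.
Let c1r := comp_idr hL.
Let wM := wlM hL hM.
Let wR := wrM hL hM.
Let p2 := post2 hL.
Let p3 := post3 hL.
Local Notation "''R' f" := (idm R \om f) (at level 30, f at level 30).
Local Notation mu := (h2 m).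
Local Notation eta := (h0 u).
Local Notation rmod := (rmod m u).
Local Notation na N := (h2 (mact N)).
Local Notation T := (T hG).
Local Notation Rm := (Rm hL hM hG).
Local Notation rten := (rten hL hM).
Local Notation tens := (tens hL hM hB hG sp).
Local Notation tp := (tp hL hM hB hG sp).
Local Notation ti := (ti hL hM hB hG sp).
Local Notation "K ~= N" := (@isomorphic k T K N) (at level 70).
Local Notation rbrick N := (@brick k T N).
Implicit Types K N L M : rmod.
Local Notation cj := (cj hC hG).
Local Notation W := (@weight k C R m u).
Local Notation loc := (sec tau 1%g).

Implicit Types A B : rmod.

Lemma locP B : loc B <-> forall Z, na B Z \oc dbl R B Z = na B Z.
Proof.
split=> [/(secP hC) E Z|E]; first by rewrite E (tu1 hM hG) c1r.
by apply/(secP hC) => Z; rewrite E (tu1 hM hG) c1r.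
Qed.

Record linear_endofunctor (Fo : C -> C) (F : forall X Y, mor C X Y -> mor C (Fo X) (Fo Y)) : Prop := {
  lef_comp : forall X Y Z (g : mor C Y Z) (f : mor C X Y), F _ _ (g \oc f) = F _ _ g \oc F _ _ f;
  lef_id : forall X, F _ _ (idm X) = idm (Fo X);
  lef_scale : forall X Y a (f : mor C X Y), F _ _ (a *: f) = a *: F _ _ f
}.

(* F is the identity or X (x) - in all uses. *)
Section Prefixed.
Context (Fo : C -> C) (F : forall X Y, mor C X Y -> mor C (Fo X) (Fo Y)).
Context (hF : linear_endofunctor F).
Let FM := lef_comp hF.
Let F1 := lef_id hF.

(** No iterated tensor products over R are formed in the calculations with scalars: a map out of A
    (x) (B (x) Z) that equalizes the two actions of R stands for a map out of the tensor product
    over R, and F allows further factors in front. *)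
Definition bal A B Z W' (g : mor C (Fo (A \ox (B \ox Z))) W') :=
  g \oc F (na A (B \ox Z)) = g \oc F ((idm (A : C) \om na B Z) \oc ch R A (B \ox Z)).

Lemma balE A B Z W' (g : mor C (Fo (A \ox (B \ox Z))) W') Y (f : mor C Y _) : bal g ->
  g \oc F (na A (B \ox Z) \oc f) = g \oc F ((idm (A : C) \om na B Z) \oc ch R A (B \ox Z) \oc f).
Proof. by move=> bg; rewrite -(cA _ _ f) !(FM _ f) -!cA bg. Qed.

(** R may be carried around the local module B at no cost. This is what keeps a map balanced after A
    and B have been exchanged by the braiding ([bal_swap]). *)
Lemma bal_key A B Z W' (g : mor C (Fo (A \ox (B \ox Z))) W') : loc B -> bal g ->
  g \oc F (na A (B \ox Z) \oc 'R (ch B A Z) \oc dbl R B (A \ox Z))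
    = g \oc F (na A (B \ox Z) \oc 'R (ch B A Z)).
Proof.
move=> /locP lB bg; rewrite !balE // (dbl_move hC R B A Z) -!(cA (idm (A : C) \om na B Z)) -wM lB.
by rewrite !cA.
Qed.

Lemma bal_swap A B Z W' (g : mor C (Fo (A \ox (B \ox Z))) W') : loc B -> bal g ->
  bal (g \oc F (ch B A Z)).
Proof.
move=> lB bg; rewrite /bal !cA -!FM (chL2 hL hM hB) -(balE _ bg) (p2 (chR2 hL hM hB _ _ _)) !cA.
by rewrite -(dblE R B) bal_key.
Qed.

Lemma bal_swap_lin A B Z W' (g : mor C (Fo (A \ox (B \ox Z))) W') : bal g ->
  g \oc F (ch B A Z \oc na B (A \ox Z)) = g \oc F (na A (B \ox Z) \oc 'R (ch B A Z)).
Proof. by move=> bg; rewrite (chL2 hL hM hB) -(balE _ bg). Qed.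

Lemma bal_id A B Z W' (g : mor C (Fo (A \ox (B \ox Z))) W') : bal g ->
  g = g \oc F (ti A (rten B Z)) \oc F (tp A (rten B Z)).
Proof.
move=> bg; rewrite -FM (q_ip (tensP hL hM hB hG sp A (rten B Z))) bipiE.
have [a1 a2] := act_n2 hL hM hB A (rten B Z).
rewrite (balE _ bg) -(cA _ (ch _ _ _)) -(n2D A (rten B Z)) (p2 a1) cA (mu_ep hL hM hG) a2.
by rewrite F1 c1r.
Qed.
End Prefixed.
Local Notation I0 := (fun X : C => X).
Local Notation I1 := (fun (X Y : C) (f : mor C X Y) => f).
Lemma lefI : @linear_endofunctor I0 I1. Proof. by []. Qed.
Lemma lef_wl (X : C) : @linear_endofunctor (ten X) (fun Y Y' f => idm X \om f).
Proof. by split=> *; [apply: wM | apply: (wl_id hM) | apply: (tenmZr hM)]. Qed.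
Lemma lef_wl2 (X : C) : @linear_endofunctor (fun Y => X \ox (X \ox Y)) (fun Y Y' f => idm X \om (idm X \om f)).
Proof. by split=> *; rewrite ?wM ?(wl_id hM) ?(tenmZr hM). Qed.

Definition bal1 A B Z W' (g : mor C (A \ox (B \ox Z)) W') : Prop := @bal I0 I1 A B Z W' g.
Arguments bal1 : clear implicits.

Lemma bal1P A B Z W' (g : mor C (A \ox (B \ox Z)) W') : bal1 A B Z W' g <->
  g \oc na A (B \ox Z) = g \oc (idm (A : C) \om na B Z) \oc ch R A (B \ox Z).
Proof. by []. Qed.

Lemma tp_bal1 A B Z : bal1 A B Z _ (h2 (tp A B) Z).
Proof. exact: (tp_bal hL hM hB hG sp). Qed.

Lemma bal_factor A B Z W' (g : mor C (A \ox (B \ox Z)) W') : bal1 A B Z W' g ->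
  exists g', g = g' \oc h2 (tp A B) Z.
Proof.
move/bal1P => bg; exists (g \oc assoc A B Z \oc (ti A B \om idm Z)).
have [f f0] : exists f, f = g \oc assoc A B Z by eexists.
have h2id : h2 (idm (A \ox B)) Z = ai A B Z by rewrite h2E (wl_id hM) c1l.
have fE : f \oc ai A B Z = g by rewrite f0 cA (as_ai hM) c1r.
have fb : f \oc (bipi u s (na A B) (n2 A B) \om idm Z) = f.
  apply: (bipi_wr hL hM hG); first exact: (act_n2 hL hM hB).
  rewrite n1E (n2E hL) !wR -!cA; congr (_ \oc _).
  apply: (iso_cancel_r hL (J3_iso hL hM R A B Z)).
  transitivity (g \oc na A (B \ox Z)).
    transitivity (f \oc ai A B Z \oc na A (B \ox Z)); last by rewrite -cA fE.
    rewrite cA; congr (_ \oc _); rewrite -h2id.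
    by etransitivity; last exact: (hat_l hL hM (idm (A \ox B)) (mact A) Z); rewrite c1l.
  symmetry; transitivity (f \oc ai A B Z \oc (idm (A : C) \om na B Z) \oc ch R A (B \ox Z)).
    rewrite !cA; congr (_ \oc _).
    rewrite -(J3_ch hL hM A B Z) -!cA; congr (_ \oc _); rewrite -h2id -wR.
    by etransitivity; last exact: (hat_r hL hM (idm (A \ox B)) (mact B) Z); rewrite c1l.
  by rewrite -cA fE bg.
have tt : (ti A B \om idm Z) \oc (tp A B \om idm Z) = bipi u s (na A B) (n2 A B) \om idm Z.
  by rewrite -wR (q_ip (tensP hL hM hB hG sp A B)).
by rewrite h2E !cA (p2 tt) -!cA -f0 fb fE.
Qed.

(* The double braiding of A and B, resp. the self-braiding of A, becomes the
   given scalar on the tensor product over R. *)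
Definition isb A B b := tp A B \oc braid B A \oc braid A B = b *: tp A B.
Definition isq A c := tp A A \oc braid A A = c *: tp A A.

Lemma h2Z (X Y V : C) (f : mor C (X \ox Y) V) a Z : h2 (a *: f) Z = a *: h2 f Z.
Proof. by rewrite !h2E (tenmZl hM) (compZl hL). Qed.

Lemma bal1_isb A B b Z W' (g : mor C (A \ox (B \ox Z)) W') : isb A B b -> bal1 A B Z W' g ->
  g \oc dbl A B Z = b *: g.
Proof.
move=> E /bal_factor[g' ->]; rewrite cA -(hp_dbl hL hM) -(h2_hp hL hM) E h2Z.
by rewrite (compZr hL).
Qed.

Lemma bal1_isq A c Z W' (g : mor C (A \ox (A \ox Z)) W') : isq A c -> bal1 A A Z W' g ->
  g \oc ch A A Z = c *: g.
Proof.
by move=> E /bal_factor[g' ->]; rewrite cA -(h2_braid hL hM) E h2Z (compZr hL).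
Qed.

Lemma tp_rten_bal1 A B Z : bal1 A B Z _ (tp A (rten B Z)).
Proof. by apply/bal1P; rewrite -(n2D A (rten B Z)); apply: (tp_n12 hL hM hB hG sp A (rten B Z)). Qed.

Section PrefixedScalars.
Context (Fo : C -> C) (F : forall X Y, mor C X Y -> mor C (Fo X) (Fo Y)).
Context (hF : linear_endofunctor F).
Let FM := lef_comp hF.
Let F1 := lef_id hF.
Let FZ := lef_scale hF.

Lemma bal_isb A B b Z W' (g : mor C (Fo (A \ox (B \ox Z))) W') : isb A B b -> bal F g ->
  g \oc F (dbl A B Z) = b *: g.
Proof.
move=> E bg; have [g' ->] : exists g', g = g' \oc F (tp A (rten B Z)).
  by exists (g \oc F (ti A (rten B Z))); rewrite cA; apply: bal_id.
rewrite cA -FM (bal1_isb E (tp_rten_bal1 A B Z)) FZ.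
by rewrite (compZr hL).
Qed.

Lemma bal_isq A c Z W' (g : mor C (Fo (A \ox (A \ox Z))) W') : isq A c -> bal F g ->
  g \oc F (ch A A Z) = c *: g.
Proof.
move=> E bg; have [g' ->] : exists g', g = g' \oc F (tp A (rten A Z)).
  by exists (g \oc F (ti A (rten A Z))); rewrite cA; apply: bal_id.
rewrite cA -FM (bal1_isq E (tp_rten_bal1 A A Z)) FZ.
by rewrite (compZr hL).
Qed.

(** For a map balanced between A and B and between B and N, exchanging A and B makes A and N
    neighbours, and the map is balanced between these as well since B is local. *)
Lemma bal_right A B N Z W' (g : mor C (Fo (A \ox (B \ox (N \ox Z)))) W') : loc B -> bal F g ->
  g \oc F (idm (A : C) \om na B (N \ox Z))
    = g \oc F (idm (A : C) \om ((idm (B : C) \om na N Z) \oc ch R B (N \ox Z))) ->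
  (g \oc F (ch B A (N \ox Z))) \oc F (idm (B : C) \om na A (N \ox Z))
  = (g \oc F (ch B A (N \ox Z))) \oc F (idm (B : C) \om ((idm (A : C) \om na N Z) \oc ch R A (N \ox Z))).
Proof.
move=> lB bg bBN.
have [ic [ic1 ic2]] := ch_iso hL hM hB R B (A \ox (N \ox Z)).
have FI : F (ch R B (A \ox (N \ox Z))) \oc F ic = idm _ by rewrite -FM ic2 F1.
apply: (ret_inj hL FI); rewrite !cA -!FM.
have -> : g \oc F (ch B A (N \ox Z) \oc (idm (B : C) \om na A (N \ox Z)) \oc ch R B (A \ox (N \ox Z)))
    = g \oc F (na A (B \ox (N \ox Z)) \oc 'R (ch B A (N \ox Z))).
  by rewrite (p2 (chR2 hL hM hB _ _ _)) !cA -(dblE R B) bal_key.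
have -> : ch B A (N \ox Z) \oc (idm (B : C) \om ((idm (A : C) \om na N Z) \oc ch R A (N \ox Z)))
    \oc ch R B (A \ox (N \ox Z))
  = (idm (A : C) \om ((idm (B : C) \om na N Z) \oc ch R B (N \ox Z)))
      \oc ch R A (B \ox (N \ox Z)) \oc 'R (ch B A (N \ox Z)).
  by rewrite !wM !cA (p2 (chn hL hM _ _ _)) !cA -(ybe hC R B A (N \ox Z)).
rewrite [RHS](_ : _ = g \oc F (idm (A : C) \om na B (N \ox Z)) \oc F (ch R A (B \ox (N \ox Z)) \oc 'R (ch B A (N \ox Z)))).
  by rewrite -FM (balE hF _ bg).
by rewrite (FM (_ \om _)) -!cA -bBN.
Qed.
End PrefixedScalars.

Lemma bal_left A B N Z W' (g : mor C (A \ox (B \ox (N \ox Z))) W') :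
  bal1 A B (N \ox Z) W' g ->
  g \oc (idm (A : C) \om na B (N \ox Z))
    = g \oc (idm (A : C) \om ((idm (B : C) \om na N Z) \oc ch R B (N \ox Z))) ->
  bal1 A N (B \ox Z) W' (g \oc (idm (A : C) \om ch N B Z)).
Proof.
move=> /bal1P bg bBN; apply/bal1P; rewrite !cA -(h2n hL hM) -(cA g) bg.
rewrite -(cA (idm (A : C) \om ch N B Z)) -wM (chL2 hL hM hB) -(cA (idm _ \om _) (ch _ _ _)).
by rewrite wM -!cA -bBN !cA (chn hL hM).
Qed.

(** A balanced R-linear map out of A (x) B is an endomorphism of the tensor product over R, hence a
    scalar when that is a brick. It is applied to braidings. *)
Lemma scalar_endo A B (f : mor C (A \ox B) (tens A B)) : rbrick (tens A B) ->
  (forall Z, bal1 A B Z _ (h2 f Z)) ->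
  (forall Z, na (tens A B) Z \oc 'R (h2 f Z) = h2 f Z \oc na A (B \ox Z)) ->
  exists b, f = b *: tp A B.
Proof.
move=> /(rbrickP hC hG)[_ Tb] fb fl.
have [f' [f'l f'E]] := tens_ind hL hM hB hG sp (bal_plain hL hM fb) (lin_plain hL hM fl).
have [b bE] := Tb _ f'l; exists b.
by rewrite -f'E bE (compZl hL) c1l.
Qed.

Lemma tp_neq0 A B : rbrick (tens A B) -> tp A B <> 0.
Proof.
move=> /(rbrickP hC hG)[T0 _] t0; apply: T0.
by rewrite -(tp_ti hL hM hB hG sp A B) t0 (comp0l hL).
Qed.

Lemma isb_ex A B : loc A -> loc B -> rbrick (tens A B) -> exists b, b != 0 /\ isb A B b.
Proof.
move=> lA lB Tb; have := @scalar_endo A B (tp A B \oc braid B A \oc braid A B) Tb.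
have h2f Z : h2 (tp A B \oc braid B A \oc braid A B) Z = h2 (tp A B) Z \oc ch B A Z \oc ch A B Z.
  by rewrite -cA !(h2_braid hL hM) cA.
have b1 Z := bal_swap lefI lB (tp_bal1 A B Z).
case=> [Z|Z|b bE].
- by rewrite h2f -cA; apply: (bal_swap lefI).
- rewrite h2f !wM -!cA (tp_lin hL hM hB hG sp) !cA.
  have e1 := bal_swap_lin lefI (tp_bal1 A B Z).
  have e2 := bal_swap_lin lefI (b1 Z).
  by rewrite !cA in e2; rewrite e2 (p3 (esym e1)) !cA.
exists b; split=> //; apply/eqP => b0; apply: (tp_neq0 Tb).
apply: (iso_cancel_r hL (is_iso_comp hL (braid_iso hB B A) (braid_iso hB A B))).
by rewrite bE b0 scale0r (comp0l hL).
Qed.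

Lemma isq_ex A : loc A -> rbrick (tens A A) -> exists c, c != 0 /\ isq A c.
Proof.
move=> lA Tb; have := @scalar_endo A A (tp A A \oc braid A A) Tb.
have h2f Z : h2 (tp A A \oc braid A A) Z = h2 (tp A A) Z \oc ch A A Z.
  by rewrite (h2_braid hL hM).
have b1 Z := bal_swap lefI lA (tp_bal1 A A Z).
case=> [Z|Z|c cE].
- by rewrite h2f; apply: b1.
- rewrite h2f !wM -!cA (tp_lin hL hM hB hG sp) !cA.
  by rewrite (bal_swap_lin lefI (tp_bal1 A A Z)).
exists c; split=> //; apply/eqP => c0; apply: (tp_neq0 Tb).
apply: (iso_cancel_r hL (braid_iso hB A A)).
by rewrite cE c0 scale0r (comp0l hL).
Qed.

Lemma isb_uniq A B b b' : rbrick (tens A B) -> isb A B b -> isb A B b' -> b = b'.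
Proof.
move=> /tp_neq0 t0; rewrite /isb => -> /eqP; rewrite -subr_eq0 -scalerBl scaler_eq0.
by rewrite subr_eq0 => /orP[/eqP//|/eqP/t0].
Qed.

Lemma isb_self A c : isq A c -> isb A A (c ^+ 2).
Proof. by move=> E; rewrite /isb -cA E (compZl hL) E scalerA. Qed.

Lemma isb_cj g A B b : isb A B b -> isb (cj g A) (cj g B) b.
Proof.
move=> E; apply: (h2_inj hL hM); rewrite (h2_hp hL hM) (hp_dbl hL hM) h2Z.
apply: (bal1_isb E); apply/bal1P; set Z := one C.
have := tp_bal hL hM hB hG sp (cj g A) (cj g B) Z; rewrite !na_cj wM !cA => e.
apply: (ret_inj hL (tuKV hL hM hG g _)); rewrite !cA e.
by rewrite (ch_l hL hM hB).
Qed.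

Lemma isq_cj g A c : isq A c -> isq (cj g A) c.
Proof.
move=> E; apply: (h2_inj hL hM); rewrite (h2_braid hL hM) h2Z.
apply: (bal1_isq E); apply/bal1P; set Z := one C.
have := tp_bal hL hM hB hG sp (cj g A) (cj g A) Z; rewrite !na_cj wM !cA => e.
apply: (ret_inj hL (tuKV hL hM hG g _)); rewrite !cA e.
by rewrite (ch_l hL hM hB).
Qed.

Lemma isb_iso A K K' b : K ~= K' -> isb A K b -> isb A K' b.
Proof.
move=> /(T_iso hL hM hG)[f [f' [fl _ [f'f ff']]]] E.
apply: (h2_inj hL hM); rewrite (h2_hp hL hM) (hp_dbl hL hM) h2Z; set Z := one C.
have jP : (idm (A : C) \om h1 f Z) \oc (idm (A : C) \om h1 f' Z) = idm _.
  by rewrite -wM -(h1M hL hM) ff' (h1_id hM) (wl_id hM).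
apply: (ret_inj hL jP); rewrite cA (dbl_r hL hM hB) -cA (compZl hL).
apply: (bal1_isb E); apply/bal1P; rewrite !cA -(h2n hL hM).
rewrite (p2 (tp_bal hL hM hB hG sp A K' Z)) !cA (chn hL hM) -!(cA (idm _ \om _) (idm _ \om _)) -!wM.
by rewrite (rl_hat hL hM Z fl).
Qed.

Lemma isb_sym A B b : loc A -> isb A B b -> isb B A b.
Proof.
move=> lA E; apply: (h2_inj hL hM); rewrite (h2_hp hL hM) (hp_dbl hL hM) h2Z dblE; set Z := one C.
have b1 := bal_swap lefI lA (tp_bal1 B A Z).
have := bal1_isb E b1; rewrite dblE !cA => e.
apply: (iso_cancel_r hL (ch_iso hL hM hB A B Z)).
by rewrite !cA e (compZl hL).
Qed.

Lemma isb_Rm A : loc A -> isb A Rm 1.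
Proof.
move=> /locP lA; apply: (h2_inj hL hM); rewrite (h2_hp hL hM) (hp_dbl hL hM) h2Z scale1r.
set Z := one C; set P := h2 (tp A Rm) Z.
have bal : P \oc na A (R \ox Z) = P \oc (idm (A : C) \om mu Z) \oc ch R A (R \ox Z).
  exact: (tp_bal hL hM hB hG sp A Rm Z).
have e1 : P \oc ch R A Z = P \oc na A (R \ox Z) \oc 'R (idm (A : C) \om eta Z).
  rewrite -!cA bal !cA (chn hL hM) -(cA (idm _ \om _) (idm _ \om _)) -wM (mu_etar hL hM hB hG) (wl_id hM) c1l.
  by [].
apply: (iso_cancel_r hL (ch_iso hL hM hB R A Z)); rewrite dblE !cA (p2 e1) !cA -dblE.
by rewrite -(dbln hL hM) (p2 (lA _)) e1.
Qed.

(** The hexagon over R: A goes around N and N' one after the other. The balanced map g plays the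
    role of the projection onto the threefold tensor product. *)
Lemma isb_tens A N N' b b' : loc N -> isb A N b -> isb A N' b' -> isb A (tens N N') (b * b').
Proof.
move=> lN E E'; apply: (h2_inj hL hM); rewrite (h2_hp hL hM) (hp_dbl hL hM) h2Z; set Z := one C.
set T0 := tens N N'; pose g := h2 (tp A T0) Z \oc (idm (A : C) \om h2 (tp N N') Z).
have jP : (idm (A : C) \om h2 (tp N N') Z) \oc (idm (A : C) \om (assoc N N' Z \oc (ti N N' \om idm Z))) = idm _.
  rewrite -wM h2E cA (p2 (ai_as hM _ _ _)) c1l -wR.
  by rewrite (tp_ti hL hM hB hG sp) !(wl_id hM).
apply: (ret_inj hL jP); rewrite (compZl hL) cA (dblR2 hL hM hB) -(cA (h2 (tp A T0) Z)) -/g.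
have lin := tp_lin hL hM hB hG sp N N' Z.
have g1 : bal1 A N (N' \ox Z) _ g.
  apply/bal1P; rewrite /g !cA -(h2n hL hM) (p2 (tp_bal hL hM hB hG sp A T0 Z)) !cA (chn hL hM).
  by rewrite -!(cA (idm _ \om _) (idm _ \om _)) -!wM lin.
have g2 : g \oc (idm (A : C) \om na N (N' \ox Z))
    = g \oc (idm (A : C) \om ((idm (N : C) \om na N' Z) \oc ch R N (N' \ox Z))).
  by rewrite /g ?cA -!wM (tp_bal hL hM hB hG sp N N' Z) ?cA.
have b1 := @bal_right I0 I1 lefI A N N' Z _ g lN g1 g2.
have b2 := @bal_isb _ _ (lef_wl N) A N' b' Z _ (g \oc ch N A (N' \ox Z)) E' b1.
rewrite -(cA g) -(cA (g \oc _)) b2 (compZl hL) cA -dblE (bal1_isb E g1) scalerA.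
by rewrite mulrC.
Qed.

(** The rule q(A K) = q(A) q(K) b(K, A) of a quadratic form. *)
Lemma isq_tens A K a c b : loc A -> isq A a -> isq K c -> isb K A b ->
  isq (tens A K) (a * c * b).
Proof.
move=> lA qA qK bKA; apply: (h2_inj hL hM); rewrite (h2_braid hL hM) h2Z; set Z := one C.
set T0 := tens A K; pose p Z := h2 (tp A K) Z.
pose g := h2 (tp T0 T0) Z \oc (idm (T0 : C) \om p Z) \oc p (A \ox (K \ox Z)).
have sP Y : p Y \oc (assoc A K Y \oc (ti A K \om idm Y)) = idm _.
  rewrite /p h2E cA (p2 (ai_as hM _ _ _)) c1l -wR.
  by rewrite (tp_ti hL hM hB hG sp) (wl_id hM).
have jP : (idm (T0 : C) \om p Z) \oc (idm (T0 : C) \om (assoc A K Z \oc (ti A K \om idm Z))) = idm _.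
  by rewrite -wM sP (wl_id hM).
apply: (ret_inj hL jP); apply: (ret_inj hL (sP _)).
have lin Y : na T0 Y \oc 'R (p Y) = p Y \oc na A (K \ox Y) := tp_lin hL hM hB hG sp A K Y.
have balp Y : p Y \oc na A (K \ox Y) = p Y \oc (idm (A : C) \om na K Y) \oc ch R A (K \ox Y).
  exact: (tp_bal hL hM hB hG sp A K Y).
have balT := tp_bal hL hM hB hG sp T0 T0 Z.
have g1 : bal1 A K (A \ox (K \ox Z)) _ g by apply/bal1P; rewrite /g !cA balp.
have pn := h2n hL hM (tp A K) (p Z).
have g2 : g \oc (idm (A : C) \om na K (A \ox (K \ox Z)))
    = g \oc (idm (A : C) \om ((idm (K : C) \om na A (K \ox Z)) \oc ch R K (A \ox (K \ox Z)))).
  apply: (iso_cancel_r hL (ch_iso hL hM hB R A (K \ox (A \ox (K \ox Z))))).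
  rewrite /g !cA -balp -lin (p2 (esym (h2n hL hM (mact T0) (p Z)))) !cA (p2 balT) !cA.
  rewrite (p2 (chn hL hM _ _ _)) !cA -(cA (idm _ \om _) (idm _ \om _)) -wM lin wM !cA.
  rewrite (chR2 hL hM hB) wM !cA (p2 (h2n hL hM (tp A K) _)) !cA.
  by [].
have g3 : g \oc (idm (A : C) \om (idm (K : C) \om na A (K \ox Z)))
    = g \oc (idm (A : C) \om (idm (K : C) \om ((idm (A : C) \om na K Z) \oc ch R A (K \ox Z)))).
  by rewrite /g !cA !(h2n hL hM) -!(cA (idm _ \om _) (idm _ \om _)) -!wM balp.
(* Crossing A K with itself is a product of four elementary crossings: A with A and K with K give a
   and c, the two mixed ones combine to the double braiding of K and A. *)
have E : h2 (tp T0 T0) Z \oc ch T0 T0 Z \oc (idm (T0 : C) \om p Z) \oc p (A \ox (K \ox Z))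
    = g \oc (idm (A : C) \om ch A K (K \ox Z)) \oc ch A A (K \ox (K \ox Z))
        \oc (idm (A : C) \om (idm (A : C) \om ch K K Z)) \oc (idm (A : C) \om ch K A (K \ox Z)).
  have e9 : (idm (A : C) \om ch K T0 Z) \oc (idm (A : C) \om (idm (K : C) \om p Z))
      = (idm (A : C) \om p (K \ox Z)) \oc (idm (A : C) \om (idm (A : C) \om ch K K Z))
          \oc (idm (A : C) \om ch K A (K \ox Z)) by rewrite -!wM (chR2 hL hM hB).
  transitivity (h2 (tp T0 T0) Z \oc ch T0 T0 Z \oc p (T0 \ox Z) \oc (idm (A : C) \om (idm (K : C) \om p Z))).
    by rewrite pn.
  rewrite (p2 (chL2 hL hM hB T0 (tp A K) Z)) !cA e9 (p2 (chR2 hL hM hB A (tp A K) (K \ox Z))) !cA.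
  by rewrite /g ?cA.
rewrite !cA E (compZl hL); set g' := g \oc (idm (A : C) \om ch A K (K \ox Z)).
have h1 : bal1 A A (K \ox (K \ox Z)) _ g' by apply: bal_left.
have h2' := @bal_right _ _ (lef_wl A) K A K Z _ g lA g2 g3.
have h3 := @bal_isq _ _ (lef_wl2 A) K c Z _ g' qK h2'.
rewrite -!cA -/g' (bal1_isq qA h1) !(compZl hL) h3 (compZl hL) /g' cA -wM -dblE.
have h4 := @bal_isb _ _ (lef_wl A) K A b (K \ox Z) _ g bKA g2.
by rewrite h4 !scalerA /g !cA.
Qed.
End Balanced.

(** For the smallest prime p dividing d, either [z ^+ (d %/ p)] has exact order p, or d can be
    replaced by d / p. *)
Lemma root_of_unity_prime (F : fieldType) (z : F) (d : nat) : (0 < d)%N -> z ^+ d = 1 -> z != 1 ->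
  exists p j, [/\ prime p, (p %| d)%N & p.-primitive_root (z ^+ j)].
Proof.
move: d {2}d (leqnn d) => d e; elim: e d => [|e IH] d; first by rewrite leqn0 => /eqP->.
move=> de d0 zd z1; have d1 : (1 < d)%N.
  by case: d d0 zd {de} => [|[|d]] //; rewrite expr1 => _ E; rewrite E eqxx in z1.
have pd := pdiv_prime d1; have pdv := pdiv_dvd d.
have [zj|zj] := eqVneq (z ^+ (d %/ pdiv d)) 1; last first.
  exists (pdiv d), (d %/ pdiv d)%N; split=> //.
  have zp : (z ^+ (d %/ pdiv d)) ^+ pdiv d = 1 by rewrite -exprM divnK.
  have [m mp mpd] := prim_order_exists (prime_gt0 pd) zp.
  have /primeP[_ /(_ m mpd)/pred2P[m1|mE]] := pd; last by rewrite -{1}mE.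
  by have := prim_expr_order mp; rewrite m1 expr1 => zj1; rewrite zj1 eqxx in zj.
have q0 : (0 < d %/ pdiv d)%N by rewrite divn_gt0 ?prime_gt0 // dvdn_leq.
have qd : (d %/ pdiv d < d)%N by rewrite ltn_Pdiv ?prime_gt1.
have [|p [j [pp pq pj]]] := IH (d %/ pdiv d)%N _ q0 zj z1; first by rewrite -ltnS (leq_trans qd).
by exists p, j; split=> //; apply: dvdn_trans pq (dvdn_div pdv).
Qed.

(** * The braiding of M does not change under conjugation *)

Section BraidingCharacter.
Local Open Scope cat_scope.
Context (k : closedFieldType) (C : bmcat k) (hC : braided_fusion C).
Local Notation hL := (bf_linear hC).
Local Notation hM := (bf_monoidal hC).
Local Notation hB := (bf_braided hC).
Local Notation sp := (fus_split hC).
Context (H : finGroupType) (R : C) (m : mor C (R \ox R) R) (u : mor C (one C) R)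
  (tau : H -> mor C R R) (s : mor C R (R \ox R)) (hG : galois_alg m u tau s).
Let cA := comp_assoc hL.
Local Notation "''R' f" := (idm R \om f) (at level 30, f at level 30).
Local Notation ep := (hc (s \oc u)).
Local Notation rmod := (rmod m u).
Local Notation T := (T hG).
Local Notation Rm := (Rm hL hM hG).
Local Notation rten := (rten hL hM).
Local Notation tens := (tens hL hM hB hG sp).
Local Notation "K ~= N" := (@isomorphic k T K N) (at level 70).
Local Notation rbrick N := (@brick k T N).
Local Notation rhdim := (@hdim k T).
Local Notation rfsum := (@fsum k T).
Implicit Types K N L M : rmod.
Local Notation cj := (cj hC hG).
Local Notation W := (@weight k C R m u).
Local Notation gam := (FPdim R).
Local Notation loc := (sec tau 1%g).
Local Notation isb := (isb hC hG).

Let TSg : brick_schur T := @TS _ _ hC _ _ _ _ _ _ hG.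
Let TLg : linear_category T := TL hC hG.

(** Krull-Schmidt in the form of sums: [mu'] is the number of summands isomorphic to K, the same for
    both decompositions, and dividing by it turns both sides into one sum over isomorphic pairs. *)
Lemma fsum_invariant (phi : rmod -> algC) (I J : finType) (S : I -> rmod) (S' : J -> rmod) N :
  (forall K K', rbrick K -> K ~= K' -> phi K = phi K') ->
  (forall i, rbrick (S i)) -> (forall j, rbrick (S' j)) -> rfsum S N -> rfsum S' N ->
  \sum_i phi (S i) = \sum_j phi (S' j).
Proof.
move=> phiI Sb S'b dS dS'; pose mu' K : algC := (rhdim K N)%:R.
have mS (I' : finType) (S'' : I' -> rmod) i : rbrick (S'' i) -> rfsum S'' N -> mu' (S'' i) != 0.
  move=> b dS''; rewrite pnatr_eq0 -lt0n (hdim_sumr TLg _ dS'') (bigD1 i) //= (brick_hdim b).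
  by rewrite addn_gt0.
have e1 i : phi (S i) = \sum_j phi (S i) / mu' (S i) * (rhdim (S i) (S' j))%:R.
  rewrite -mulr_sumr -natr_sum -(hdim_sumr TLg _ dS') mulfVK //; exact: (mS _ _ _ (Sb i)).
have e2 j : phi (S' j) = \sum_i phi (S' j) / mu' (S' j) * (rhdim (S i) (S' j))%:R.
  rewrite -mulr_sumr -natr_sum -(hdim_suml TLg _ dS) (TH hC hG) mulfVK //; exact: (mS _ _ _ (S'b j)).
rewrite (eq_bigr _ (fun i _ => e1 i)) (eq_bigr _ (fun j _ => e2 j)) exchange_big.
apply: eq_bigr => j _; apply: eq_bigr => i _ /=.
have [[ij ->]|[_ ->]] := brick_hom TLg TSg (Sb i) (S'b j); last by rewrite !mulr0.
by rewrite (phiI _ _ (Sb i) ij) /mu' (hdim_isol TLg _ ij).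
Qed.

Fixpoint pw M n : rmod := if n is n'.+1 then tens M (pw M n') else Rm.

Lemma pw_weight M n : W M = gam -> W (pw M n) = gam.
Proof.
move=> Mg; elim: n => [//|n IH]; rewrite /= weight_tensE Mg IH mulfK //.
by rewrite gt_eqF // (gam_gt0 hC hG).
Qed.

Lemma pw_inv M n K : loc M -> pw M n.+1 ~= Rm -> tens (pw M n) (tens M K) ~= K.
Proof.
move=> lM e; apply: (isomorphic_trans TLg (tens_assoc hC hG _ _ _)).
apply: (isomorphic_trans TLg) (tens_unitl hL hM hB hG sp K).
apply: (tens_iso hL hM hB sp) (isomorphic_refl TLg K).
apply: (isomorphic_trans TLg) e; apply: isomorphic_sym.
exact: (tens_comm hC hG (pw M n) lM).
Qed.

(** A decomposition of M K would give one of M' M K = K; two summands are impossible since each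
    contributes a non-zero piece to a brick. *)
Lemma tens_brick M M' K : tens M' (tens M K) ~= K -> rbrick K -> rbrick (tens M K).
Proof.
move=> e Kb; have [I [S [Sb dS]]] := TD hC hG (tens M K).
have dK : rfsum (fun a => tens M' (S a)) K := fsum_iso TLg (fsum_tens hC M' dS) e.
have nz a : (0 < rhdim (tens M' (S a)) K)%N.
  have W0 : 0 < W (tens M' (S a)).
    have K0 := weight_gt0 hC Kb; have Sa0 := weight_gt0 hC (Sb a).
    rewrite weight_tensE divr_gt0 ?(gam_gt0 hC hG) // mulr_gt0 //.
    have := weight_iso hC e; rewrite weight_tensE => E; move: K0; rewrite -E => K0.
    rewrite lt0r (weight_ge0 hC) andbT; apply: contraTneq K0 => ->.
    by rewrite mul0r mul0r ltxx.
  have [i [p [pi _ _]]] := dK.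
  apply: (hdim_gt0 (f := i a)) => i0; have [L [j [q [Lb qj]]]] := brick_summand hC hG W0.
  apply: Lb.1; rewrite -qj -(comp_idl TLg j) -(pi a) i0 (comp0r TLg) (comp0l TLg) (comp0r TLg).
  by [].
have [a0 _|I0] := pickP (@predT I); last first.
  have := brick_hdim Kb; rewrite (hdim_suml TLg _ dK) big_pred0 //.
have a0P a : a == a0.
  apply/negPn/negP => aa0; have := brick_hdim Kb.
  rewrite (hdim_suml TLg _ dK) (bigD1 a0) //= (bigD1 a) //=.
  apply/eqP; rewrite gtn_eqF // -(addn1 1) leq_add ?nz //.
  by rewrite (leq_trans (nz a)) // leq_addr.
have bp (F : I -> nat) : (\sum_a F a)%N = F a0.
  by rewrite (bigD1 a0) //= big1 ?addn0 // => a; rewrite a0P.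
apply: (hdim_brick TLg); rewrite (hdim_suml TLg _ dS) bp (hdim_sumr TLg _ dS) bp.
exact: brick_hdim.
Qed.

(** The weights of the simple modules form an eigenvector of the integer matrix of K (x) - over R,
    with this quotient as eigenvalue. *)
Lemma weight_Aint K : W K / gam \in Aint.
Proof.
have [I [S [Sb Sall]]] := brick_enum hC hG.
have dec i := constructive_indefinite_description _ (TD hC hG (tens K (S i))).
have decS i := constructive_indefinite_description _ (proj2_sig (dec i)).
have cl i l : {j | sval (decS i) l ~= S j}.
  apply/constructive_indefinite_description/Sall.
  by case: (svalP (decS i)) => h _; apply: h.
have [i0 _] := Sall _ (Rm_brick hC hG).
pose A : 'M[int]_#|I| := \matrix_(a, b) (#|[pred l | sval (cl (enum_val b) l) == enum_val a]|)%:Z.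
pose x : 'rV[algC]_#|I| := \row_a W (S (enum_val a)).
have xA : x *m map_mx intr A = (W K / gam) *: x.
  apply/rowP => b; rewrite !mxE.
  transitivity (W (tens K (S (enum_val b)))); last by rewrite weight_tensE; ring.
  have [_ dS] := svalP (decS (enum_val b)); rewrite (weight_fsum hC dS).
  rewrite [RHS](eq_bigr (fun l => W (S (sval (cl (enum_val b) l))))); last first.
    by move=> l _; exact: (weight_iso hC (svalP (cl (enum_val b) l))).
  rewrite [RHS](partition_big (fun l => enum_rank (sval (cl (enum_val b) l))) xpredT) //=.
  apply: eq_bigr => a _; rewrite !mxE.
  rewrite [RHS](eq_bigr (fun=> W (S (enum_val a)))); last by move=> l /eqP <-; rewrite enum_rankK.
  rewrite sumr_const mulr_natr; congr (_ *+ _).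
  have e l : (sval (cl (enum_val b) l) == enum_val a) = (enum_rank (sval (cl (enum_val b) l)) == a).
    by rewrite -(inj_eq enum_val_inj) enum_rankK.
  by apply: eq_card => l; rewrite inE e.
apply: (root_monic_Aint (p := char_poly (map_mx intr A))); last 2 first.
- exact: char_poly_monic.
- by apply/polyOverP=> i; rewrite -map_char_poly coef_map intr_int.
rewrite -eigenvalue_root_char; apply/eigenvalueP; exists x => //; apply/eqP => x00.
have := weight_gt0 hC (Sb i0); have /rowP/(_ (enum_rank i0)) := x00.
by rewrite !mxE enum_rankK => ->; rewrite ltxx.
Qed.

(** The summands of R (x) V are all conjugate to N, hence of the same weight. *)
Lemma free_weight N (V : C) : rbrick N -> brick V -> (0 < hdim V N)%N ->
  exists n : nat, FPdim V = n%:R * (W N / gam).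
Proof.
move=> Nb Vb VN; have [J [S [Sb dS]]] := TD hC hG (rten Rm V); exists #|J|.
have := weight_fsum hC dS; rewrite weight_rten // (eq_bigr (fun=> W N)) => [|a _]; last first.
  have [g /(weight_iso hC) ->] := free_decomp Nb Vb VN Sb dS a; exact: weight_cj.
rewrite sumr_const => e; have g0 : gam != 0 by rewrite gt_eqF // (gam_gt0 hC hG).
apply: (mulfI g0); rewrite -[gam * FPdim V]/(W Rm * FPdim V) e -(mulr_natl (W N)).
by rewrite mulrCA [gam * _]mulrC divfK.
Qed.

Lemma cj_Rm g : cj g Rm ~= Rm.
Proof.
apply: isomorphic_sym; apply: (@riso _ _ hC _ _ _ _ _ _ hG Rm (cj g Rm) (tau g)).
  rewrite /rl /= (ga_tau_m hG) (tenm_wrl hL hM (tau g)) !cA.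
  by [].
exists (tau g^-1%g); split; rewrite (ga_tauM hG) ?mulVg ?mulgV; exact: (ga_tau1 hG).
Qed.

Lemma pw_cj g M n : pw (cj g M) n ~= cj g (pw M n).
Proof.
elim: n => [|n IH] /=; first exact/isomorphic_sym/cj_Rm.
apply: (isomorphic_trans TLg) (tens_cj hC hG g M (pw M n)).
exact: (tens_iso hL hM hB sp (isomorphic_refl TLg _) IH).
Qed.

Lemma isb_pw A M b n : loc A -> loc M -> isb A M b -> isb A (pw M n) (b ^+ n).
Proof.
move=> lA lM E; elim: n => [|n IH]; first by rewrite expr0; apply: isb_Rm.
by rewrite exprS; apply: isb_tens.
Qed.
Context (char_k : [pchar k] =i pred0) (nd : nondegenerate_cat C).
Context (d D : nat) (d_gt0 : (0 < d)%N) (CD : FPdim_cat C = D%:R).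
Context (co : forall V : C, simple_obj V -> forall n : nat, FPdim V ^+ 2 = n%:R -> coprime n d).

(** The only place where the coprimality of dimensions is turned into a statement on scalars: both
    scalars are d-th roots of unity, and a non-trivial quotient would make a prime divisor of d
    divide the product of two squared dimensions of simple objects. *)
Lemma braiding_conj M b x bx : loc M -> W M = gam -> pw M d ~= Rm ->
  isb M M b -> isb M (cj x M) bx -> b = bx.
Proof.
move=> lM Mg Md Eb Ebx.
have gn0 : gam != 0 by rewrite gt_eqF // (gam_gt0 hC hG).
have lMx : loc (cj x M) by have := sec_cj hC hG x lM; rewrite mulg1 mulVg.
have brk K : W K = gam -> rbrick (tens M K).
  by move=> Kg; apply: (gam_brick hC); rewrite weight_tensE Mg Kg mulfK.
have WR : W Rm = gam by [].
have MRb := brk _ WR.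
have pwd K n c : loc K -> W K = gam -> pw K n ~= Rm -> isb M K c -> c ^+ n = 1.
  move=> lK Kg e E; have E1 := isb_iso e (isb_pw n lM lK E).
  exact: (isb_uniq MRb E1 (isb_Rm hC hG lM)).
have b1 := pwd _ _ _ lM Mg Md Eb.
have bx1 : bx ^+ d = 1.
  apply: (pwd _ _ _ lMx _ _ Ebx); first by rewrite weight_cj.
  apply: (isomorphic_trans TLg (pw_cj x M d)).
  exact: (isomorphic_trans TLg (cj_iso hC x Md) (cj_Rm x)).
have b0 : b != 0 by apply/eqP => b0; move/eqP: b1; rewrite b0 expr0n (gtn_eqF d_gt0) eq_sym oner_eq0.
have bx0 : bx != 0 by apply/eqP => b0'; move/eqP: bx1; rewrite b0' expr0n (gtn_eqF d_gt0) eq_sym oner_eq0.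
apply/eqP/negPn/negP => bbx.
have z1 : (b / bx) != 1 by apply: contra bbx => /eqP e; rewrite -(divfK bx0 b) e mul1r.
have [|p [j [pp pd pj]]] := root_of_unity_prime d_gt0 _ z1; first by rewrite expr_div_n b1 bx1 divr1.
set e := (b / bx) ^+ j in pj.
have [N [Nb Nx]] := all_sectors hC hG char_k nd x.
have [N' [N'b N'x]] := all_sectors hC hG char_k nd x^-1%g.
pose X := tens N N'.
have lX : loc X by have := sec_tens hC hG Nx N'x; rewrite mulVg.
have MX : tens M X ~= tens (cj x M) X.
  apply: (isomorphic_trans TLg (tens_assoc hC hG M N N')).
  apply: (isomorphic_trans TLg); last exact: (isomorphic_sym (tens_assoc hC hG (cj x M) N N')).
  apply: (tens_iso hL hM hB sp) (isomorphic_refl TLg N').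
  apply: (isomorphic_trans TLg (tens_comm hC hG N lM)).
  exact: (tens_swap hC hG M Nx).
have [I [S [Sb dS]]] := TD hC hG X.
have lS i : loc (S i).
  have [ii [pi [pi1 _ _]]] := dS.
  apply: (sec_ret hC (tvalP hL hM (pi i)) (tvalP hL hM (ii i)) _ lX).
  by rewrite -(tval_comp hL hM) pi1 (tval_id hL hM).
have dn : d = d.-1.+1 by rewrite prednK.
have Mb K : rbrick K -> rbrick (tens M K).
  by move=> Kb; apply: (tens_brick (pw_inv (n := d.-1) K lM _) Kb); rewrite -dn.
have Mxb K : rbrick K -> rbrick (tens (cj x M) K).
  move=> Kb; apply: (tens_brick (pw_inv (n := d.-1) K lMx _) Kb); rewrite -dn.
  apply: (isomorphic_trans TLg (pw_cj x M d)).
  exact: (isomorphic_trans TLg (cj_iso hC x Md) (cj_Rm x)).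
have /choice [chi chiP] := fun i => isb_ex lM (lS i) (Mb _ (Sb i)).
have chi0 i : chi i != 0 by have [] := chiP i.
have chiE i : isb M (S i) (chi i) by have [] := chiP i.
(* X is graded by its braiding with M, and f measures the graded pieces. *)
pose f c : algC := \sum_i (chi i == c)%:R * W (S i).
pose phi c K : algC := (asb (isb M K c))%:R * W K.
have phiE c c' K : rbrick K -> isb M K c' -> phi c K = (c' == c)%:R * W K.
  move=> Kb Kc; rewrite /phi; congr (_%:R * _); congr nat_of_bool.
  apply/asbP/eqP => [h|<- //]; exact: (isb_uniq (Mb _ Kb) Kc h).
have phiI c K K' : rbrick K -> K ~= K' -> phi c K = phi c K'.
  move=> Kb KK; rewrite /phi (weight_iso hC KK); congr (_%:R * _); congr nat_of_bool.
  by apply/asbP/asbP; apply: isb_iso => //; apply: isomorphic_sym.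
have wM' K : W (tens M K) = W K by rewrite weight_tensE Mg mulrAC divff ?mul1r.
have wMx K : W (tens (cj x M) K) = W K by rewrite weight_tensE weight_cj Mg mulrAC divff ?mul1r.
(* Compare the pieces of degree c b bx in M X and in M^x X: the first module has its degrees
   multiplied by b, the second by bx, and the two modules are isomorphic. *)
have fbx c : f (c * b) = f (c * bx).
  have d1 := fsum_tens hC M dS; have d2 := fsum_iso TLg (fsum_tens hC (cj x M) dS) (isomorphic_sym MX).
  have l1 : \sum_i phi (c * b * bx) (tens M (S i)) = f (c * bx).
    apply: eq_bigr => i _; rewrite (phiE _ _ _ (Mb _ (Sb i)) (isb_tens lM Eb (chiE i))) wM'.
    by congr (_%:R * _); rewrite mulrAC [b * _]mulrC (inj_eq (mulIf b0)).
  have l2 : \sum_i phi (c * b * bx) (tens (cj x M) (S i)) = f (c * b).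
    apply: eq_bigr => i _; rewrite (phiE _ _ _ (Mxb _ (Sb i)) (isb_tens lMx Ebx (chiE i))) wMx.
    by congr (_%:R * _); rewrite [bx * _]mulrC (inj_eq (mulIf bx0)).
  rewrite -l1 -l2; apply/esym.
  exact: (fsum_invariant (phi := phi (c * b * bx)) (phiI _) (fun i => Mb _ (Sb i)) (fun i => Mxb _ (Sb i)) d1 d2).
have fe l c : f (e ^+ l * c) = f c.
  have f1 n c' : f ((b / bx) ^+ n * c') = f c'.
    elim: n c' => [|n IH] c'; first by rewrite mul1r.
    rewrite exprSr -mulrA IH; have := fbx (c' / bx); rewrite divfK // => <-.
    by congr f; ring.
  by rewrite /e -exprM f1.
(* Chooses one degree in each coset of the p-th roots of unity: two degrees with the same p-th power
   differ by a power of e, under which f is invariant. *)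
pose rt v : k := epsilon (inhabits 0) (fun z => z ^+ p = v).
have rtP i : rt (chi i ^+ p) ^+ p = chi i ^+ p.
  exact: (epsilon_spec (inhabits 0) (fun z => z ^+ p = chi i ^+ p) (ex_intro _ (chi i) erefl)).
have p_gt0 := prime_gt0 pp.
have ep : e ^+ p = 1 := prim_expr_order pj.
pose Vs := undup [seq chi i ^+ p | i <- enum I].
have VsP v : v \in Vs -> rt v ^+ p = v.
  by rewrite mem_undup => /mapP[i _ ->]; apply: rtP.
pose S0 := \sum_(v <- Vs) f (rt v).
have WX : W X = p%:R * S0.
  rewrite (weight_fsum hC dS).
  transitivity (\sum_(l < p) \sum_i (chi i == e ^+ l * rt (chi i ^+ p))%:R * W (S i)).
    rewrite exchange_big; apply: eq_bigr => i _ /=; rewrite -mulr_suml.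
    have rt0 : rt (chi i ^+ p) != 0.
      apply: contra (chi0 i) => /eqP h; have := rtP i.
      by rewrite h expr0n (gtn_eqF p_gt0) => /esym/eqP; rewrite expf_eq0 => /andP[].
    have [l lE] : {l : 'I_p | chi i / rt (chi i ^+ p) = e ^+ l}.
      by apply: (prim_rootP pj); rewrite expr_div_n rtP divff // expf_neq0.
    rewrite (bigD1 l) //= -lE divfK // eqxx big1 ?addr0 ?mul1r // => l' l'l.
    case: eqP => // h; case/eqP: l'l; apply/val_inj/eqP.
    move/(congr1 (fun z => z / rt (chi i ^+ p))): h; rewrite lE mulfK // => /eqP.
    by rewrite (eq_prim_root_expr pj) !modn_small // eq_sym.
  rewrite (eq_bigr (fun=> S0)) ?sumr_const ?card_ord ?mulr_natl // => l _.
  rewrite /S0 (eq_bigr (fun v => f (e ^+ l * rt v))) => [|v _]; last by rewrite fe.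
  rewrite /f exchange_big; apply: eq_bigr => i _ /=; rewrite -mulr_suml; congr (_ * _).
  have vi : chi i ^+ p \in Vs by rewrite mem_undup; apply/mapP; exists i; rewrite ?mem_enum.
  rewrite (bigD1_seq _ vi) ?undup_uniq //= big_seq_cond big1 ?addr0 // => v /andP[vV vn].
  case: eqP => // h; case/eqP: vn; rewrite h exprMn -exprM mulnC exprM ep expr1n mul1r.
  exact/esym/VsP.
(* Hence the dimension of X over R is p times an algebraic integer. *)
have S0A : S0 / gam \in Aint.
  rewrite /S0 mulr_suml rpred_sum // => v _; rewrite /f mulr_suml rpred_sum // => i _.
  by rewrite -mulrA rpredM ?weight_Aint //; apply: Aint_Cnat; rewrite natr_nat.
have [V [Vb VN]] := brick_in_free hC Nb; have [V' [V'b VN']] := brick_in_free hC N'b.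
have [n1 e1] := free_weight Nb Vb VN; have [n2 e2] := free_weight N'b V'b VN'.
have Vs' := (simpleE hC V).2 Vb; have V's := (simpleE hC V').2 V'b.
have [m1 m1E] := FPdim_sq_nat hC CD Vs'; have [m2 m2E] := FPdim_sq_nat hC CD V's.
pose al := n1%:R * n2%:R * (S0 / gam).
have alA : al ^+ 2 \in Aint by rewrite rpredX // /al rpredM // -natrM rpred_nat.
(* The factors n1 and n2 replace the dimensions of N and N' over R by those of simple objects V and
   V' of C, whose squares are the integers m1 and m2. *)
have mE : (m1 * m2)%:R = p%:R ^+ 2 * al ^+ 2 :> algC.
  rewrite natrM -m1E -m2E e1 e2 /al -!exprMn; congr (_ ^+ 2).
  have : W N * W N' / gam = p%:R * S0 by rewrite -WX /X weight_tensE.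
  move=> h; transitivity (n1%:R * n2%:R * (W N * W N' / gam) / gam); first by ring.
  by rewrite h; ring.
have p0 : (p%:R : algC) != 0 by rewrite pnatr_eq0 -lt0n.
have alZ : al ^+ 2 \is a Num.nat.
  have alE : al ^+ 2 = (m1 * m2)%:R / p%:R ^+ 2 by rewrite mE mulrC mulKf // expf_neq0.
  rewrite natrEint; apply/andP; split.
    by apply: Cint_rat_Aint alA; rewrite alE rpred_div ?rpredX ?rpred_nat.
  by rewrite alE divr_ge0 // exprn_ge0.
have [l lE] := natrP alZ; move: mE; rewrite lE -natrX -natrM => /eqP; rewrite eqr_nat => /eqP mE.
have : (p %| m1 * m2)%N by rewrite mE expnS -mulnA dvdn_mulr.
have cop n (V0 : C) : simple_obj V0 -> FPdim V0 ^+ 2 = n%:R -> (p %| n)%N -> False.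
  move=> V0s nE pn; have := co V0s nE; rewrite /coprime => /eqP cd.
  have : (p %| 1)%N by rewrite -cd dvdn_gcd pn.
  by rewrite dvdn1 => /eqP p1; rewrite p1 in pp.
by rewrite Euclid_dvdM // => /orP[/(cop _ _ Vs' m1E)|/(cop _ _ V's m2E)].
Qed.
End BraidingCharacter.

(** * Descent of invariant invertible modules *)

Section Descent.
Local Open Scope cat_scope.
Context (k : closedFieldType) (C : bmcat k) (hC : braided_fusion C).
Local Notation hL := (bf_linear hC).
Local Notation hM := (bf_monoidal hC).
Local Notation hB := (bf_braided hC).
Local Notation sp := (fus_split hC).
Context (H : finGroupType) (R : C) (m : mor C (R \ox R) R) (u : mor C (one C) R)
  (tau : H -> mor C R R) (s : mor C R (R \ox R)) (hG : galois_alg m u tau s).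
Let cA := comp_assoc hL.
Let c1l := comp_idl hL.
Let c1r := comp_idr hL.
Let wM := wlM hL hM.
Let p2 := post2 hL.
Let p3 := post3 hL.
Local Notation "''R' f" := (idm R \om f) (at level 30, f at level 30).
Local Notation mu := (h2 m).
Local Notation eta := (h0 u).
Local Notation sg := (hd s).
Local Notation tu g := (h1 (tau g)).
Local Notation ep := (hc (s \oc u)).
Local Notation cc := (ch R R).
Local Notation is_act := (is_act m u).
Local Notation rmod := (rmod m u).
Local Notation T := (T hG).
Local Notation Rm := (Rm hL hM hG).
Local Notation rten := (rten hL hM).
Local Notation tens := (tens hL hM hB hG sp).
Local Notation tp := (tp hL hM hB hG sp).
Local Notation ti := (ti hL hM hB hG sp).
Local Notation "K ~= N" := (@isomorphic k T K N) (at level 70).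
Implicit Types K N L M : rmod.
Local Notation cj := (cj hC hG).
Local Notation W := (@weight k C R m u).
Local Notation gam := (FPdim R).
Local Notation isq := (isq hC hG).
Local Notation rl := (@rl k C R m u).

Lemma isq_Rm : isq Rm 1.
Proof.
apply: (h2_inj hL hM); rewrite (h2_braid hL hM) (h2Z hC) scale1r.
set Z := one C; set P := h2 (tp Rm Rm) Z.
have bal : P \oc mu (R \ox Z) = P \oc 'R (mu Z) \oc cc (R \ox Z).
  exact: (tp_bal hL hM hB hG sp Rm Rm Z).
have e1 : P \oc cc Z = P \oc mu (R \ox Z) \oc 'R ('R (eta Z)).
  by rewrite -!cA bal !cA (chn hL hM) -(cA ('R _) ('R _)) -wM (mu_etar hL hM hB hG) (wl_id hM) c1l.
have e2 : P \oc cc Z \oc cc Z = P \oc cc Z.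
  by rewrite -cA {1}e1 !cA -(chn hL hM) (p2 (mu_cc hL hM hG _)) e1.
by rewrite -e2 (cc_cc hL hM hG) c1r.
Qed.

(* Semilinear maps: R-linear maps from K to K^x. *)
Definition sl x K (f : mor C K K) := rl (f : mor C (K : C) (cj x K : C)).
Definition stens K N (f : mor C K K) (g : mor C N N) : mor C (tens K N) (tens K N) :=
  tp K N \oc (f \om g) \oc ti K N.

Lemma slE x K (f : mor C K K) : sl x f <-> f \oc mact K = mact K \oc tu x K \oc 'R f.
Proof. by rewrite /sl /rl /= cA. Qed.

Lemma stensP x K N (f : mor C K K) (g : mor C N N) : sl x f -> sl x g ->
  sl x (stens f g) /\ stens f g \oc tp K N = tp K N \oc (f \om g).
Proof.
move=> fl gl; have [h [hl hp]] := tens_map hL hM hB hG sp (K2 := cj x K) (N2 := cj x N) fl gl.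
have [h' [h'l h'p]] := tens_cj_map hC hG x K N.
have e : (h' \oc h) \oc tp K N = tp K N \oc (f \om g) by rewrite cA hp -cA h'p.
have <- : h' \oc h = stens f g by rewrite /stens -(cA (tp K N)) -e !cA (tp_ti hL hM hB hG sp) c1r.
by split=> //; apply: (rl_comp hL hM) h'l hl.
Qed.

Lemma sl_comp x y K (f g : mor C K K) : sl x f -> sl y g -> sl (x * y)%g (f \oc g).
Proof.
move=> fl gl; apply/slE; move/slE: fl => fl; move/slE: gl => gl.
rewrite cA gl -cA fl !cA wM -(tuM hL hM hG) !cA; congr (_ \oc _).
by rewrite (p2 (esym (h1n hL hM (tau y) f))) !cA.
Qed.

Lemma stensM x y K N (f f' : mor C K K) (g g' : mor C N N) :
  sl x f -> sl x g -> sl y f' -> sl y g' -> stens f g \oc stens f' g' = stens (f \oc f') (g \oc g').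
Proof.
move=> fl gl f'l g'l; have [_ e] := stensP fl gl; have [_ e'] := stensP f'l g'l.
have [_ e2] := stensP (sl_comp fl f'l) (sl_comp gl g'l).
apply: (@tp_epi _ _ hL hM hB _ _ _ _ _ _ hG sp K N); rewrite cA e' -cA e cA e2.
by rewrite -(tenm_comp hM).
Qed.

Lemma sl_scale x K (f : mor C K K) a : sl x f -> sl x (a *: f).
Proof.
move=> /slE fl; apply/slE.
by rewrite (compZl hL) fl (tenmZr hM) !(compZr hL).
Qed.

Lemma sl_Rm x : sl x (tau x : mor C Rm Rm).
Proof.
apply/slE => /=; by rewrite (ga_tau_m hG) (tenm_wlr hL hM) -(h1n hL hM (tau x)).
Qed.

Context (char_k : [pchar k] =i pred0).

(* A simultaneous lift of all tau_x to an invertible semilinear action lets P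
   descend to the object X of invariants. *)
Lemma descent K (c : H -> mor C K K) : W K = gam ->
  (forall x, sl x (c x)) -> (forall x y, c x \oc c y = c (x * y)%g) -> c 1%g = idm (K : C) ->
  exists (X : C) (i : mor C X K), FPdim X = 1 /\ is_iso (mact K \oc 'R i).
Proof.
move=> Kg cl cM c1.
pose S := \sum_x c x.
have H0 : (#|H|%:R : k) != 0 by rewrite ((pcharf0P _).1 char_k) -lt0n; apply/card_gt0P; exists 1%g.
have SS y : c y \oc S = S.
  rewrite (comp_sumr hL) [RHS](reindex_inj (mulgI y)) /=.
  by apply: eq_bigr => x _; rewrite cM.
(* The projection of K onto the invariants X. *)
pose a := #|H|%:R^-1 *: S.
have aa : a \oc a = a.
  rewrite /a (compZl hL) (compZr hL) {1}/S (comp_suml hL) (eq_bigr (fun=> S)) => [|y _]; last exact: SS.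
  by rewrite sumr_const -(scaler_nat _ S) !scalerA -mulrA mulVf // mulr1.
have [X [i [p [pi ip]]]] := sp aa.
have ci y : c y \oc i = i.
  by rewrite -[in LHS](c1r i) -pi -(cA i) ip -!(cA (c y)) /a (compZr hL) SS -/a -ip cA pi c1r.
have pS : p \oc S = #|H|%:R *: p.
  have -> : S = #|H|%:R *: a by rewrite /a scalerA mulfV // scale1r.
  by rewrite (compZr hL) -ip -cA pi c1l.
exists X, i.
pose f := mact K \oc 'R i.
(* The inverse of f: it sends v to the sum over y of delta_y (x) p S (delta_y v). *)
pose g := 'R (p \oc S \oc mact K) \oc ep K.
have nK : is_act (mact K) := ractP hL hM K.
have cK x : c x \oc mact K = mact K \oc tu x K \oc 'R (c x) by apply/slE/cl.
have cKV x : mact K \oc 'R (c x) = c x \oc mact K \oc tu x^-1%g K.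
  by rewrite (p2 (cK x)) !cA -(h1n hL hM (tau x^-1%g)) (p2 (tuKV hL hM hG x K)) c1l.
have eK Y (h : mor C K Y) : 'R (h \oc mact K) \oc ep K \oc mact K = 'R (h \oc mact K) \oc sg K.
  rewrite !wM !cA (hcn hL hM); congr (_ \oc _).
  by rewrite -(cA ('R (mact K))) -wM nK.1 wM !cA (E2 hL hM hG).
have gf : g \oc f = idm _.
  rewrite /g /f -(cA p S) (cA ('R _)) (p3 (eK X (p \oc S))) (cA ('R _) (sg K)) (hdn hL hM) -(cA ('R _)) -wM.
  have -> : ((p \oc S) \oc mact K) \oc 'R i = \sum_x ((p \oc mact K \oc 'R i) \oc tu x X).
    rewrite !cA (comp_suml hL) (comp_sumr hL); apply: eq_bigr => x _.
    by rewrite (p2 (cK x)) !cA -wM ci (h1n hL hM).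
  rewrite -(comp_sumr hL) wM !cA (tenm_sumr hM) (comp_suml hL) (sum_tu hL hM hG) -wM !cA.
  by rewrite -(h0n hL hM) (p2 nK.2) c1l pi (wl_id hM).
have fg : f \oc g = idm _.
  rewrite /g /f cA -(cA ('R i)) -wM (p2 pS) (compZl hL) (compZr hL) -(cA i) ip -(compZl hL).
  have -> : #|H|%:R *: a = S by rewrite /a scalerA mulfV // scale1r.
  (* Only the term x = 1 of S survives, because delta_y is orthogonal to its translates. *)
  have e1 x : mact K \oc 'R (c x \oc mact K) \oc ep K = if x == 1%g then idm (K : C) else 0.
    rewrite wM cA (p2 (cKV x)) !cA (p2 (h1n hL hM (tau x^-1%g) (mact K))) !cA (p2 nK.1) !cA (epE hL hM).
    case: eqP => [->|/eqP x1]; last first.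
      by rewrite (p3 (orth hL hM hG (g := x^-1%g) _ _)) ?eq_invg1 // !(comp0l hL) !(comp0r hL).
    by rewrite invg1 (tu1 hM hG) c1l (p2 (mu_sg hL hM hG _)) c1l nK.2 c1 c1r.
  rewrite (comp_suml hL) (tenm_sumr hM) (comp_suml hL) (comp_sumr hL).
  by rewrite (eq_bigr _ (fun x _ => e1 x)) -big_mkcond big_pred1_eq.
have fi : is_iso f by exists g.
split=> //.
have e : W (rten Rm X) = W K.
  apply: (weight_iso hC (hG := hG)); apply: (@riso _ _ hC _ _ _ _ _ _ hG (rten Rm X) K f); last exact: fi.
  by rewrite /rl /f -[mact (rten Rm X)]/(mu X) cA wM (p2 nK.1) !cA (h2n hL hM).
apply: (mulfI (lt0r_neq0 (gam_gt0 hC hG))); rewrite mulr1 -[in RHS]Kg -e.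
by rewrite (weight_rten hC).
Qed.
End Descent.

(** The determinant of f acting on Hom(V, K) by composition. Its homogeneity degree [hdim V K] is
    the exponent that kills the obstruction in [invariant_descent]. *)
Lemma det_char (k : fieldType) (C : bmcat k) (hL : linear_category C) (V K : C) :
  exists D : mor C K K -> k, [/\ forall f g, D (comp f g) = D f * D g, D (idm K) = 1
    & forall a f, D (a *: f) = a ^+ hdim V K * D f].
Proof.
pose e := vbasis {:mor C V K}.
pose A (f : mor C K K) : 'M_(hdim V K) := \matrix_(a, b) coord e b (comp f e`_a).
have Ae f (a : 'I_(hdim V K)) : comp f e`_a = \sum_b A f a b *: e`_b.
  rewrite {1}(coord_vbasis (memvf (comp f e`_a))).
  by apply: eq_bigr => b _; rewrite mxE.
exists (fun f => \det (A f)); split=> [f g||a f].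
- rewrite mulrC -det_mulmx; congr (\det _); apply/matrixP=> a b; rewrite !mxE.
  rewrite (comp_assoc hL) Ae (comp_sumr hL) linear_sum; apply: eq_bigr => c _.
  by rewrite (compZr hL) linearZ /= [A f c b]mxE.
- rewrite -[RHS](det1 _ (hdim V K)); congr (\det _); apply/matrixP=> a b; rewrite !mxE.
  by rewrite (comp_idl hL) (coord_free _ _ (basis_free (vbasisP _))) eq_sym.
rewrite -detZ; congr (\det _); apply/matrixP=> i j; rewrite !mxE.
by rewrite (compZl hL) linearZ.
Qed.

(** * Killing the obstruction to an equivariant structure *)

Section Descent2.
Local Open Scope cat_scope.
Context (k : closedFieldType) (C : bmcat k) (hC : braided_fusion C).
Local Notation hL := (bf_linear hC).
Local Notation hM := (bf_monoidal hC).
Local Notation hB := (bf_braided hC).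
Local Notation sp := (fus_split hC).
Context (H : finGroupType) (R : C) (m : mor C (R \ox R) R) (u : mor C (one C) R)
  (tau : H -> mor C R R) (s : mor C R (R \ox R)) (hG : galois_alg m u tau s).
Let cA := comp_assoc hL.
Let c1l := comp_idl hL.
Let c1r := comp_idr hL.
Let wM := wlM hL hM.
Let p2 := post2 hL.
Local Notation "''R' f" := (idm R \om f) (at level 30, f at level 30).
Local Notation rmod := (rmod m u).
Local Notation T := (T hG).
Local Notation tens := (tens hL hM hB hG sp).
Local Notation tp := (tp hL hM hB hG sp).
Local Notation "K ~= N" := (@isomorphic k T K N) (at level 70).
Local Notation rbrick N := (@brick k T N).
Implicit Types K N L M : rmod.
Local Notation cj := (cj hC hG).
Local Notation W := (@weight k C R m u).
Local Notation gam := (FPdim R).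
Local Notation isq := (isq hC hG).
Local Notation pw := (pw hC hG).
Local Notation rl := (@rl k C R m u).
Local Notation sl := (sl hC hG).
Local Notation stens := (stens hC hG).
Context (char_k : [pchar k] =i pred0).

Lemma stensZ K N a b (f : mor C K K) (g : mor C N N) :
  stens (a *: f) (b *: g) = (a * b) *: stens f g.
Proof.
by rewrite /stens (tenmZl hM) (tenmZr hM) scalerA (compZl hL) (compZr hL).
Qed.

Lemma stens_id K N : stens (idm (K : C)) (idm (N : C)) = idm (tens K N : C).
Proof. by rewrite /stens (wl_id hM) c1l (tp_ti hL hM hB hG sp). Qed.

Lemma sl1_scalar K (f : mor C K K) : rbrick K -> sl 1%g f -> exists a, f = a *: idm (K : C).
Proof.
move=> /(rbrickP hC hG)[_ Kb] /slE fl; apply: Kb.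
by rewrite /rl fl (tu1 hM hG) c1l.
Qed.

(** The isomorphisms between K and its conjugates compose up to a 2-cocycle [al]. Taking
    determinants on Hom(V, K) shows that the power of [al] with exponent [hdim V K] is a coboundary,
    so that tensor power of K carries a genuine equivariant structure and descends. *)
Lemma invariant_descent K (V : C) : rbrick K -> W K = gam -> (forall x, cj x K ~= K) ->
  exists (X : C) (i : mor C X (pw K (hdim V K))), FPdim X = 1 /\ is_iso (mact (pw K (hdim V K)) \oc 'R i).
Proof.
move=> Kb Kg Kx; set mm := hdim V K.
have phi_ex x : exists f : mor C K K, sl x f /\ is_iso f.
  have /isomorphic_sym/(T_iso hL hM)[f [g [fl _ fg]]] := Kx x.
  by exists f; split=> //; exists g.
pose phi x := proj1_sig (constructive_indefinite_description _ (phi_ex x)).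
have phiP x : sl x (phi x) /\ is_iso (phi x).
  exact: (proj2_sig (constructive_indefinite_description _ (phi_ex x))).
clearbody phi.
have phil x := (phiP x).1.
have al_ex x y : exists a, phi x \oc phi y = a *: phi (x * y)%g.
  have [f [fp pf]] := (phiP (x * y)%g).2.
  have fl : sl (x * y)^-1%g f.
    apply/slE; have /slE e := phil (x * y)%g.
    apply: (iso_cancel_l hL (phiP (x * y)%g).2).
    rewrite (p2 pf) c1l (p2 e) !cA (p2 (esym (h1n hL hM (tau (x * y)^-1%g) (phi (x * y)%g)))).
    by rewrite !cA -wM pf (wl_id hM) c1r (tuKV hL hM hG) c1r.
  have [a e] := sl1_scalar Kb (eq_ind _ (fun z => sl z _) (sl_comp fl (sl_comp (phil x) (phil y))) _ (mulVg (x * y)%g)).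
  by exists a; rewrite -[LHS]c1l -pf cA e (compZr hL) c1r.
pose al x y := proj1_sig (constructive_indefinite_description _ (al_ex x y)).
have alP x y : phi x \oc phi y = al x y *: phi (x * y)%g.
  exact: (proj2_sig (constructive_indefinite_description _ (al_ex x y))).
clearbody al.
have [D [DM D1 DZ]] := det_char hL V (K : C).
have D0 x : D (phi x) != 0.
  have [g [gf _]] := (phiP x).2; apply/eqP=> e0.
  by have := DM g (phi x); rewrite gf e0 mulr0 D1 => /eqP; rewrite oner_eq0.
(* The semilinear map induced on the n-th tensor power, where the cocycle appears to the power n. *)
pose psi x := fix psi n : mor C (pw K n) (pw K n) :=
  if n is n'.+1 then stens (phi x) (psi n') else tau x.
have psil x n : sl x (psi x n).
  elim: n => [|n IH]; first exact: sl_Rm.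
  exact: (stensP (phil x) IH).1.
have psiM x y n : psi x n \oc psi y n = al x y ^+ n *: psi (x * y)%g n.
  elim: n => [|n IH]; first by rewrite expr0 scale1r; apply: (ga_tauM hG).
  rewrite [LHS](stensM (phil x) (psil x n) (phil y) (psil y n)) alP IH.
  by rewrite stensZ -exprS.
(* Division by the determinant cancels the cocycle. *)
pose c x := (D (phi x))^-1 *: psi x mm.
have [a1 e1] := sl1_scalar Kb (phil 1%g).
have psi1 n : psi 1%g n = a1 ^+ n *: idm _.
  elim: n => [|n IH]; first by rewrite expr0 scale1r; apply: (ga_tau1 hG).
  by rewrite [LHS]/= e1 IH stensZ -exprS stens_id.
have Pg := pw_weight hC hG mm Kg.
apply: (@descent _ _ hC _ _ _ _ _ _ hG char_k (pw K mm) c Pg) => [x|x y|].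
- exact: sl_scale.
- rewrite /c (compZl hL) (compZr hL) psiM !scalerA; congr (_ *: _).
  have := DM (phi x) (phi y); rewrite alP DZ -/mm => e; apply: (mulIf (D0 (x * y)%g)).
  rewrite [RHS]mulVf //; transitivity ((D (phi x))^-1 / D (phi y) * (D (phi x) * D (phi y))).
    by rewrite -e mulrA.
  by rewrite mulrACA !mulVf // mulr1.
rewrite /c psi1 scalerA e1 DZ D1 mulr1 mulVf ?scale1r //.
by have := D0 1%g; rewrite e1 DZ D1 mulr1.
Qed.

Lemma FPdim1_brick (X : C) : FPdim X = 1 -> brick X.
Proof.
move=> X1; have [n [S [Sb dS]]] := bf_semisimple hC X.
have /dsum_fsum fS := dS; have := FPdim_fsum hC fS; rewrite X1 => e.
have n1 : n%:R <= 1 :> algC.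
  have -> : n%:R = \sum_(a < n) 1 :> algC by rewrite sumr_const card_ord.
  rewrite [leRHS]e; apply: ler_sum => a _.
  by apply: (FPdim_ge1 hC); have [] := Sb a.
case: n S Sb dS fS e n1 => [|[|n]] S Sb dS fS e n1; last by rewrite -[1 in X in _ <= X]/(1%:R) ler_nat in n1.
  by move: e; rewrite big_ord0 => /eqP; rewrite oner_eq0.
apply: (hdim_brick hL); rewrite (hdim_suml hL _ fS) big_ord1 (hdim_sumr hL _ fS) big_ord1.
by apply: brick_hdim; apply/(simpleE hC).
Qed.

(** By naturality the self-braiding of X can be computed after mapping X (x) X to the tensor product
    over R. The composite j is non-zero: as i generates K over R, j = 0 would make the projection
    [tp K K] vanish. *)
Lemma descent_braid K (X : C) (i : mor C X K) c : isq K c -> rbrick (tens K K) ->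
  FPdim X = 1 -> is_iso (mact K \oc 'R i) -> braid X X = c *: idm (X \ox X).
Proof.
move=> Kc Kb X1 fi; have Xb : brick (X \ox X).
  by apply: FPdim1_brick; rewrite (FPdim_ten hC) X1 mulr1.
have [l brE] : exists l, braid X X = l *: idm (X \ox X).
  have [_ Xl] := Xb; exact: Xl.
pose j := tp K K \oc (i \om i).
have jE : l *: j = c *: j.
  rewrite -[j in LHS]c1r -(compZr hL) -brE /j cA -(braid_nat hB) -cA.
  by rewrite [X in X \oc _]Kc (compZl hL).
rewrite brE; congr (_ *: _); apply/eqP; rewrite -subr_eq0.
have : (l - c) *: j == 0 by rewrite scalerBl jE subrr.
rewrite scaler_eq0 => /orP[//|/eqP j0]; case: (tp_neq0 Kb).
have e1 : tp K K \oc (i \om idm (K : C)) = 0.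
  apply: (iso_cancel_r hL (f := (idm X \om (mact K \oc 'R i)) \oc ch R X X)).
    by apply: (is_iso_comp hL) (ch_iso hL hM hB _ _ _); apply: (wl_iso hL hM).
  rewrite (comp0l hL) !cA -(cA (i \om _)) -(tenm_comp hM) c1l c1r.
  have -> : i \om (mact K \oc 'R i) = (idm (K : C) \om mact K) \oc (i \om 'R i).
    by rewrite -(tenm_comp hM) c1l.
  have chN : (i \om 'R i) \oc ch R X X = ch R K K \oc 'R (i \om i).
    rewrite (tenm_wrl hL hM i ('R i)) cA -(chn hL hM) -cA -(ch_r hL hM hB) !cA -wM.
    by rewrite -(tenm_wrl hL hM i i).
  rewrite cA chN -(cA (_ \om mact K)) -n2D -cA -(tp_n12 hL hM hB hG sp) -(tp_n1 hL hM hB hG sp) cA -wM.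
  by rewrite -/j j0 (tenm0r hM) (comp0r hL).
apply: (iso_cancel_r hL (f := h2 (mact K \oc 'R i) K)).
  rewrite h2E; apply: (is_iso_comp hL) (ai_iso hM _ _ _); exact: (wr_iso hL hM).
rewrite (comp0l hL) (h2_tenr hL hM) -cA -(tp_n1 hL hM hB hG sp) cA -wM e1.
by rewrite (tenm0r hM) (comp0r hL).
Qed.
End Descent2.

(** * An invertible object of C from the orbit of M *)

Section Equivariant.
Local Open Scope cat_scope.
Context (k : closedFieldType) (C : bmcat k) (hC : braided_fusion C).
Local Notation hL := (bf_linear hC).
Local Notation hM := (bf_monoidal hC).
Local Notation hB := (bf_braided hC).
Local Notation sp := (fus_split hC).
Context (H : finGroupType) (R : C) (m : mor C (R \ox R) R) (u : mor C (one C) R)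
  (tau : H -> mor C R R) (s : mor C R (R \ox R)) (hG : galois_alg m u tau s).
Local Notation "''R' f" := (idm R \om f) (at level 30, f at level 30).
Local Notation rmod := (rmod m u).
Local Notation T := (T hG).
Local Notation Rm := (Rm hL hM hG).
Local Notation rten := (rten hL hM).
Local Notation tens := (tens hL hM hB hG sp).
Local Notation "K ~= N" := (@isomorphic k T K N) (at level 70).
Local Notation rbrick N := (@brick k T N).
Local Notation rhdim := (@hdim k T).
Implicit Types K N L M : rmod.
Local Notation cj := (cj hC hG).
Local Notation W := (@weight k C R m u).
Local Notation gam := (FPdim R).
Local Notation loc := (sec tau 1%g).
Local Notation isb := (isb hC hG).
Local Notation isq := (isq hC hG).
Local Notation pw := (pw hC hG).
Let TLg : linear_category T := TL hC hG.
Let TSg : brick_schur T := @TS _ _ hC _ _ _ _ _ _ hG.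
Context (char_k : [pchar k] =i pred0) (nd : nondegenerate_cat C).
Context (d D : nat) (d_gt0 : (0 < d)%N) (CD : FPdim_cat C = D%:R).
Context (co : forall V : C, simple_obj V -> forall n : nat, FPdim V ^+ 2 = n%:R -> coprime n d).

Let isot := isomorphic_trans TLg.
Let isos K N : K ~= N -> N ~= K. Proof. exact: isomorphic_sym. Qed.
Let isor K : K ~= K. Proof. exact: isomorphic_refl TLg K. Qed.
Let ten_iso K K' N N' : K ~= K' -> N ~= N' -> tens K N ~= tens K' N'.
Proof. exact: (tens_iso hL hM hB sp). Qed.

Lemma coprime_FPdim (V : C) n : brick V -> FPdim V = n%:R -> coprime n d.
Proof.
move=> /(simpleE hC) Vs Vn; have := co Vs (n := n ^ 2).
by rewrite Vn -natrX coprime_pexpl // => /(_ erefl).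
Qed.

(* R (x) V is a sum of conjugates of N, and each of the classes in l occurs
   hdim V N times. *)
Lemma free_count K (V : C) (l : seq H) : rbrick K -> W K = gam -> brick V -> (0 < hdim V K)%N ->
  (forall g, exists2 h, h \in l & cj g K ~= cj h K) ->
  {in l &, forall g h, cj g K ~= cj h K -> g = h} -> uniq l ->
  FPdim V = (size l * hdim V K)%:R.
Proof.
move=> Kb Kg Vb VK lfull linj lu.
have [I [S [Sb dS]]] := TD hC hG (rten Rm V).
have cb g : rbrick (cj g K) by apply: cj_brick.
have Sg i : W (S i) = gam.
  have [g /(weight_iso hC) ->] := free_decomp Kb Vb VK Sb dS i.
  by rewrite -Kg weight_cj.
have FI : FPdim V = #|I|%:R.
  apply: (mulfI (lt0r_neq0 (gam_gt0 hC hG))).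
  rewrite -[LHS](weight_rten hC Rm) (weight_fsum hC dS) (eq_bigr (fun=> gam)) //.
  by rewrite sumr_const mulr_natr.
rewrite FI -sum1_card; congr (_%:R).
transitivity (\sum_(i : I) \sum_(g <- l) rhdim (S i) (cj g K))%N.
  apply: eq_bigr => i _; have [g0 e0] := free_decomp Kb Vb VK Sb dS i.
  have [g gl e] := lfull g0; have Sig := isot e0 e.
  rewrite (bigD1_seq g) //= big1_seq.
    by rewrite addn0 (hdim_isol TLg _ Sig) brick_hdim.
  move=> h /andP[hg hl]; apply/eqP; rewrite -leqn0 leqNgt; apply/negP=> pos.
  have := brick_hdimE TLg TSg (Sb i) (cb h) pos => Sih.
  by rewrite (linj h g hl gl (isot (isos Sih) Sig)) eqxx in hg.
rewrite exchange_big /= -sum1_size big_distrl /=; apply: eq_bigr => g _.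
by rewrite mul1n -(hdim_suml TLg _ dS) (hdim_free hC hG).
Qed.

Section Orbit.
Context (M : rmod) (q1 : k) (lM : loc M) (Mg : W M = gam) (Md : pw M d ~= Rm) (Mq : isq M q1).
Local Notation b := (q1 ^+ 2).

Fixpoint pl (l : seq H) : rmod := if l is g :: l' then tens (cj g M) (pl l') else Rm.

Let cjl g : loc (cj g M). Proof. by have := sec_cj hC hG g lM; rewrite mulg1 mulVg. Qed.
Let cjg g : W (cj g M) = gam. Proof. by rewrite weight_cj. Qed.

Lemma tens_gam_brick K N : W K = gam -> W N = gam -> rbrick (tens K N).
Proof.
move=> Kg Ng; apply: (gam_brick hC); rewrite (weight_tensE hC hG) Kg Ng mulfK //.
exact: lt0r_neq0 (gam_gt0 hC hG).
Qed.

(** Conjugating both modules leaves the scalar unchanged, so one of them may be taken to be M, and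
    [braiding_conj] applies. *)
Lemma isb_orbit g h : isb (cj g M) (cj h M) b.
Proof.
have e x : isb M (cj x M) b.
  have [bx [_ ex]] := isb_ex lM (cjl x) (tens_gam_brick Mg (cjg x)).
  by rewrite (braiding_conj char_k nd d_gt0 CD co lM Mg Md (isb_self Mq) ex).
apply: (isb_iso (K := cj g (cj (h * g^-1)%g M))); last exact/isb_cj/e.
by have := cjM hC hG (h * g^-1)%g g M; rewrite mulgKV.
Qed.

Lemma pl_loc l : loc (pl l).
Proof.
elim: l => [|g l IH] /=; first exact: Rm_sec.
by have := sec_tens hC hG (cjl g) IH; rewrite mulg1.
Qed.
Lemma pl_weight l : W (pl l) = gam.
Proof.
elim: l => [|g l IH] //=; rewrite (weight_tensE hC hG) IH cjg mulfK //.
exact: lt0r_neq0 (gam_gt0 hC hG).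
Qed.
Lemma pl_isb g l : isb (cj g M) (pl l) (b ^+ size l).
Proof.
elim: l => [|h l IH] /=; first by rewrite expr0; apply: isb_Rm; apply: cjl.
by rewrite exprS; apply: isb_tens; [exact: cjl | exact: isb_orbit | exact: IH].
Qed.
(** A product of r conjugates has r self-braidings q1 and r (r - 1) / 2 double braidings q1^2, which
    makes q1^(r^2). *)
Lemma pl_isq l : isq (pl l) (q1 ^+ (size l ^ 2)).
Proof.
elim: l => [|g l IH] /=; first by rewrite expr0; apply: isq_Rm.
have -> : q1 ^+ ((size l).+1 ^ 2) = q1 * q1 ^+ (size l ^ 2) * b ^+ size l.
  by rewrite -exprM -exprS -exprD; congr (_ ^+ _); rewrite -addn1 sqrnD; lia.
exact: (isq_tens (cjl g) (isq_cj g Mq) IH (isb_sym (cjl g) (pl_isb g l))).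
Qed.

Lemma pl_map (f g : H -> H) l : (forall x, cj (f x) M ~= cj (g x) M) ->
  pl (map f l) ~= pl (map g l).
Proof. by move=> fg; elim: l => [|x l IH] //=; apply: ten_iso. Qed.

Lemma pl_rem g l : g \in l -> pl l ~= tens (cj g M) (pl (rem g l)).
Proof.
elim: l => [|h l IH] //=; rewrite inE eq_sym; case: eqP => [<- _|/eqP hg /= gl] //=.
apply: isot (ten_iso (isor _) (IH gl)) _.
apply: isot (tens_assoc hC hG _ _ _) _; apply: isot _ (isos (tens_assoc hC hG _ _ _)).
by apply: ten_iso => //; apply: tens_comm; apply: cjl.
Qed.

Lemma pl_perm l l' : perm_eq l l' -> pl l ~= pl l'.
Proof.
elim: l l' => [|g l IH] l' ll'.
  by have /perm_nilP -> : perm_eq l' [::] by rewrite perm_sym.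
have gl' : g \in l' by rewrite -(perm_mem ll') mem_head.
apply: isot _ (isos (pl_rem gl')); apply: ten_iso => //; apply: IH.
by rewrite -(perm_cons g); apply: (perm_trans ll' (perm_to_rem gl')).
Qed.

Lemma pl_cj x l : cj x (pl l) ~= pl (map (fun g => g * x)%g l).
Proof.
elim: l => [|g l IH] /=; first exact: cj_Rm.
apply: isot (isos (tens_cj hC hG x _ _)) _.
by apply: ten_iso => //; apply: cjM.
Qed.

(** N is the length of the orbit of M times the exponent that kills the obstruction of the orbit
    product. By [free_count] the first factor divides the dimension of a simple constituent of M and
    the second is the dimension of a simple constituent of the orbit product, so both are prime to
    d. *)
Lemma invertible_object : exists (X : C) (N : nat),
  [/\ coprime N d, FPdim X = 1 & braid X X = (q1 ^+ (N ^ 2)) *: idm (X \ox X)].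
Proof.
(* A canonical conjugator for each isomorphism class of conjugates; the list l of its fixed points
   meets every class once. *)
pose rep g := odflt g [pick h | asb (cj h M ~= cj g M)].
have repP g : cj (rep g) M ~= cj g M.
  by rewrite /rep; case: pickP => [h /asbP|_] //=.
have rep_eq g h : cj g M ~= cj h M -> rep g = rep h.
  move=> gh; rewrite /rep (eq_pick (Q := fun x => asb (cj x M ~= cj h M))).
    by case: pickP => [//|/(_ g)/asbP[]].
  by move=> x; apply/asbP/asbP => xg; [apply: isot xg gh | apply: isot xg (isos gh)].
have repK g : rep (rep g) = rep g by apply: rep_eq.
pose l := [seq g <- enum H | rep g == g].
have lu : uniq l by rewrite filter_uniq ?enum_uniq.
have lP g : (g \in l) = (rep g == g) by rewrite mem_filter mem_enum andbT.
have linj : {in l &, forall g h, cj g M ~= cj h M -> g = h}.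
  by move=> g h; rewrite !lP => /eqP eg /eqP eh e; rewrite -eg -eh; apply: rep_eq.
have lfull g : exists2 h, h \in l & cj g M ~= cj h M.
  by exists (rep g); [rewrite lP repK | apply/isos].
(* Conjugation by x permutes the classes, and the order of local factors does not matter. *)
have Lx x : cj x (pl l) ~= pl l.
  apply: isot (pl_cj x l) _.
  apply: (isot (Y := pl (map (fun g => rep (g * x)%g) l))).
    by apply: pl_map => g; apply/isos.
  apply: pl_perm; have mu' : uniq (map (fun g => rep (g * x)%g) l).
    rewrite map_inj_in_uniq // => g h gl hl e; apply: linj => //.
    have : cj (g * x)%g M ~= cj (h * x)%g M by apply: isot (isos (repP _)) _; rewrite e.
    move=> /(cj_iso hC x^-1%g) e'.
    apply: isot _ (isot e' _).
      by apply/isos; have := cjM hC hG (g * x)%g x^-1%g M; rewrite mulgK.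
    by have := cjM hC hG (h * x)%g x^-1%g M; rewrite mulgK.
  have sub : {subset map (fun g => rep (g * x)%g) l <= l}.
    by move=> _ /mapP[g _ ->]; rewrite lP repK.
  by apply: uniq_perm => //; apply: (uniq_min_size mu' sub _).2; rewrite size_map.
have Mb := gam_brick hC hG Mg; have Lb := gam_brick hC hG (pl_weight l).
have [V [Vb VM]] := brick_in_free hC Mb; have [V' [V'b V'L]] := brick_in_free hC Lb.
have VF := free_count Mb Mg Vb VM lfull linj lu.
(* The orbit product is its own only conjugate, so its multiplicity is the full dimension of V'. *)
have V'F : FPdim V' = (hdim V' (pl l))%:R.
  rewrite -[hdim V' _]mul1n; apply: (free_count (l := [:: 1%g]) Lb (pl_weight l) V'b V'L) => //.
    by move=> g; exists 1%g; rewrite ?mem_head //; apply: isot (Lx g) (isos (Lx _)).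
  by move=> g h; rewrite !inE => /eqP -> /eqP ->.
have [X [i [X1 fi]]] := invariant_descent char_k V' Lb (pl_weight l) Lx.
exists X, (size l * hdim V' (pl l))%N; split=> //.
  rewrite coprimeMl (coprime_FPdim V'b V'F) andbT.
  by have := coprime_FPdim Vb VF; rewrite coprimeMl => /andP[].
have Pq j : isq (pw (pl l) j) (q1 ^+ ((size l * j) ^ 2)).
  have Lbb := isb_self (pl_isq l).
  elim: j => [|j IH]; first by rewrite muln0 expr0; apply: isq_Rm.
  have -> : q1 ^+ ((size l * j.+1) ^ 2)
      = q1 ^+ (size l ^ 2) * q1 ^+ ((size l * j) ^ 2) * (q1 ^+ (size l ^ 2)) ^+ 2 ^+ j.
    by rewrite -!exprM -!exprD; congr (_ ^+ _); rewrite mulnS sqrnD -mulnn; lia.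
  apply: (isq_tens (pl_loc l) (pl_isq l) IH); apply: isb_sym; first exact: pl_loc.
  exact: (isb_pw j (pl_loc l) (pl_loc l) Lbb).
have Pg := pw_weight hC hG (hdim V' (pl l)) (pl_weight l).
exact: (descent_braid (Pq _) (tens_gam_brick Pg Pg) X1 fi).
Qed.
End Orbit.
End Equivariant.

(** * Invertible objects and their monodromy *)

Section Monodromy.
Local Open Scope cat_scope.
Context (k : closedFieldType) (C : bmcat k) (hC : braided_fusion C).
Local Notation hL := (bf_linear hC).
Local Notation hM := (bf_monoidal hC).
Local Notation hB := (bf_braided hC).
Let cA := comp_assoc hL.
Let c1l := comp_idl hL.
Let c1r := comp_idr hL.
Let wM := wlM hL hM.
Let p2 := post2 hL.
Implicit Types X Y Z A K : C.

Definition mon X Y a := braid Y X \oc braid X Y = a *: idm (X \ox Y).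
Definition sbr X c := braid X X = c *: idm (X \ox X).

Lemma hpZ X Y X' Y' (f : mor C (X \ox Y) (X' \ox Y')) a Z : hp (a *: f) Z = a *: hp f Z.
Proof. by rewrite !hpE !h2E (tenmZl hM) (compZl hL) (compZr hL). Qed.

Lemma monP X Y a : mon X Y a <-> forall Z, dbl X Y Z = a *: idm _.
Proof.
split=> [E Z|E]; first by rewrite -(hp_dbl hL hM) E hpZ (hp_id hL hM).
by apply: (hp_inj hL hM); rewrite (hp_dbl hL hM) E hpZ (hp_id hL hM).
Qed.

Lemma sbrP X c : sbr X c <-> forall Z, ch X X Z = c *: idm _.
Proof.
split=> [E Z|E]; first by rewrite -hp_braid E hpZ (hp_id hL hM).
by apply: (hp_inj hL hM); rewrite hp_braid E hpZ (hp_id hL hM).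
Qed.

Lemma mon_sym X Y a : mon X Y a -> mon Y X a.
Proof.
move=> E; apply: (iso_cancel_l hL (braid_iso hB Y X)).
by rewrite -cA E (compZl hL) (compZr hL) c1l c1r.
Qed.

Lemma mon_ret X Y Y' a (i : mor C Y' Y) (p : mor C Y Y') : p \oc i = idm Y' ->
  mon X Y a -> mon X Y' a.
Proof.
rewrite /mon => pi E.
have jP : (idm X \om p) \oc (idm X \om i) = idm _ by rewrite -wM pi (wl_id hM).
apply: (sec_inj hL jP); rewrite -cA -(braid_nat hB i (idm X)) cA.
by rewrite -(braid_nat hB (idm X) i) -cA E (compZl hL) (compZr hL) c1l c1r.
Qed.

Lemma mon_iso X Y Y' a : isomorphic Y Y' -> mon X Y a -> mon X Y' a.
Proof. by case=> f [g [gf fg]]; apply: mon_ret fg. Qed.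

Lemma mon_tenr A X Y a b : mon A X a -> mon A Y b -> mon A (X \ox Y) (a * b).
Proof.
move=> /monP Ea /monP Eb; apply/monP=> Z; set p := idm (X \ox Y).
have pe : is_iso (idm A \om h2 p Z).
  apply: (wl_iso hL hM); rewrite h2E; apply: (is_iso_comp hL) (ai_iso hM _ _ _).
  by rewrite /p (tenm_id hM); apply: (is_iso_id hL).
apply: (iso_cancel_r hL pe); rewrite (dblR2 hL hM hB) Eb (tenmZr hM) (compZl hL) !(compZr hL).
by rewrite (wl_id hM) c1l -dblE Ea (compZr hL) c1r scalerA (compZl hL) c1l mulrC.
Qed.

Lemma mon_uniq X Y a b : idm (X \ox Y) <> 0 -> mon X Y a -> mon X Y b -> a = b.
Proof.
move=> /eqP XY; rewrite /mon => -> /eqP; rewrite -subr_eq0 -scalerBl scaler_eq0 (negPf XY) orbF.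
by rewrite subr_eq0 => /eqP.
Qed.

Lemma sbr_ten A K a c b : sbr A a -> sbr K c -> mon A K b -> sbr (A \ox K) (a * c * b).
Proof.
move=> /sbrP Ea /sbrP Ec /mon_sym/monP Eb; apply/sbrP=> Z; set p := idm (A \ox K).
have pe Y : is_iso (h2 p Y).
  rewrite h2E; apply: (is_iso_comp hL) (ai_iso hM _ _ _).
  by rewrite /p (tenm_id hM); apply: (is_iso_id hL).
apply: (iso_cancel_r hL (wl_iso hL hM (A \ox K) (pe Z))).
apply: (iso_cancel_r hL (pe (A \ox (K \ox Z)))).
rewrite !cA -(h2n hL hM p (h2 p Z)) (p2 (chL2 hL hM hB (A \ox K) p Z)) !cA.
rewrite -wM (chR2 hL hM hB) !wM ?cA (p2 (chR2 hL hM hB A p (K \ox Z))) ?cA Ea Ec.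
rewrite !(tenmZr hM) !(wl_id hM).
do 6! rewrite ?(compZl hL) ?(compZr hL) ?c1l.
rewrite -wM -dblE Eb.
rewrite (tenmZr hM) (wl_id hM); do 6! rewrite ?(compZl hL) ?(compZr hL) ?c1l ?c1r.
by rewrite !scalerA (h2n hL hM).
Qed.

Lemma sbr_iso X Y c : isomorphic X Y -> sbr X c -> sbr Y c.
Proof.
case=> f [g [gf fg]] E; apply: (iso_cancel_r hL (f := f \om f)).
  by apply: (tenm_iso hM); exists g.
by rewrite (braid_nat hB) E (compZl hL) (compZr hL) c1l c1r.
Qed.

Lemma one_brick : brick (one C). Proof. exact/(simpleE hC)/(bf_one hC). Qed.
Lemma nz_brick X : brick X -> idm X <> 0. Proof. by case. Qed.

Lemma one_iso X (c : mor C (one C) X) (g : mor C X (one C)) : brick X -> g \oc c = idm _ ->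
  isomorphic (one C) X.
Proof.
move=> Xb gc; exists c; apply: (fus_schur hC one_brick Xb) => c0.
by case: one_brick; rewrite -gc c0 (comp0r hL).
Qed.

Lemma invertible_cancel A : FPdim A = 1 ->
  exists A', left_dual A' A /\ forall S, isomorphic (A' \ox (A \ox S)) S.
Proof.
move=> A1; have [_ [A' dA]] := bf_rigid hC A; exists A'; split=> // S.
have A0 : idm A <> 0 by have := FPdim1_brick hC A1 => -[].
have A'1 : FPdim A' = 1 by rewrite -(FPdim_dual hC dA).
have A'0 : idm A' <> 0 by have := FPdim1_brick hC A'1 => -[].
have [c [g gc]] := one_retract hC dA A'0.
have AA : brick (A' \ox A) by apply: (FPdim1_brick hC); rewrite (FPdim_ten hC) A1 A'1 mulr1.
apply: (isomorphic_trans hL); first exact/isomorphic_sym/(isomorphic_assoc hC).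
apply: (isomorphic_trans hL (Y := one C \ox S)); last by exists (lunit S); apply: (lunit_iso hM).
by apply: (isomorphic_ten hM) (isomorphic_refl hL S); apply: isomorphic_sym; apply: one_iso AA gc.
Qed.

Lemma invertible_brick A S : FPdim A = 1 -> brick S -> brick (A \ox S).
Proof.
move=> A1 Sb; apply: (hdim_brick hL); have [A' [dA e]] := invertible_cancel A1.
by rewrite (hdim_adj hL hM _ _ dA) (hdim_isor hL _ (e S)) brick_hdim.
Qed.

Lemma mon_ex A S : FPdim A = 1 -> brick S -> exists2 a, a != 0 & mon A S a.
Proof.
move=> A1 Sb; have [AS0 AS] := invertible_brick A1 Sb.
have [a E] := AS (braid S A \oc braid A S); exists a => //; apply/eqP=> a0.
have [f [_ fE]] := is_iso_comp hL (braid_iso hB S A) (braid_iso hB A S).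
by case: AS0; rewrite -fE E a0 scale0r (comp0l hL).
Qed.

Lemma FPdim1_nz A : FPdim A = 1 -> idm A <> 0.
Proof. by move=> /(FPdim1_brick hC)[]. Qed.

(** From 1 (x) 1 = 1 the scalar equals its own square, and it is non-zero. *)
Lemma mon_one A : FPdim A = 1 -> mon A (one C) 1.
Proof.
move=> A1; have [a a0 E] := mon_ex A1 one_brick.
have o1 : isomorphic (one C \ox one C) (one C) by exists (lunit _); apply: (lunit_iso hM).
have AA : idm (A \ox one C) <> 0 by apply: FPdim1_nz; rewrite (FPdim_ten hC) (FPdim_one hC) A1 mulr1.
have := mon_uniq AA E (mon_iso o1 (mon_tenr E E)) => /(congr1 (fun x => x / a)).
by rewrite mulfK // mulfV // => e; move: E; rewrite -e.
Qed.

Lemma sbr_ex A : FPdim A = 1 -> exists2 c, c != 0 & sbr A c.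
Proof.
move=> A1; have [AA0 AA] := invertible_brick A1 (FPdim1_brick hC A1).
have [c E] := AA (braid A A); exists c => //; apply/eqP=> c0.
have [f [_ fE]] := braid_iso hB A A.
by case: AA0; rewrite -fE E c0 scale0r (comp0l hL).
Qed.

Lemma sbr_uniq X a b : idm (X \ox X) <> 0 -> sbr X a -> sbr X b -> a = b.
Proof.
move=> /eqP XX; rewrite /sbr => -> /eqP; rewrite -subr_eq0 -scalerBl scaler_eq0 (negPf XX) orbF.
by rewrite subr_eq0 => /eqP.
Qed.

Lemma sbr_one : sbr (one C) 1.
Proof.
have [c c0 E] := sbr_ex (FPdim_one hC).
have o1 : isomorphic (one C \ox one C) (one C) by exists (lunit _); apply: (lunit_iso hM).
have AA : idm (one C \ox one C) <> 0 by apply: FPdim1_nz; rewrite (FPdim_ten hC) (FPdim_one hC) mulr1.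
have := sbr_uniq AA E (sbr_iso o1 (sbr_ten E E (mon_one (FPdim_one hC)))) => /(congr1 (fun x => x / c)).
by rewrite mulr1 mulfK // mulfV // => e; move: E; rewrite -e.
Qed.

Fixpoint tpw X n : C := if n is n'.+1 then X \ox tpw X n' else one C.

Lemma FPdim_tpw X n : FPdim X = 1 -> FPdim (tpw X n) = 1.
Proof.
by move=> X1; elim: n => [|n IH] /=; rewrite ?(FPdim_one hC) ?(FPdim_ten hC) ?X1 ?IH ?mulr1.
Qed.

Lemma mon_tpw X Y a n : FPdim Y = 1 \/ brick Y -> FPdim X = 1 -> mon X Y a -> mon (tpw X n) Y (a ^+ n).
Proof.
move=> Y1 X1 E; elim: n => [|n IH] /=; last by rewrite exprS; apply/mon_sym/mon_tenr; apply: mon_sym.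
have Yb : brick Y by case: Y1 => // /(FPdim1_brick hC).
have [a' a'0 E'] := mon_ex (FPdim_one hC) Yb.
have o1 : isomorphic (one C \ox one C) (one C) by exists (lunit _); apply: (lunit_iso hM).
have AA : idm (one C \ox Y) <> 0 by apply/nz_brick/invertible_brick => //; apply: (FPdim_one hC).
have E2 := mon_sym (mon_iso o1 (mon_tenr (mon_sym E') (mon_sym E'))).
have := mon_uniq AA E' E2 => /(congr1 (fun x => x / a')).
by rewrite mulfK // mulfV // expr0 => ->.
Qed.

Lemma sbr_tpw X q n : FPdim X = 1 -> sbr X q -> sbr (tpw X n) (q ^+ (n ^ 2)).
Proof.
move=> X1 E; elim: n => [|n IH] /=; first by rewrite expr0; apply: sbr_one.
have EE : mon X X (q ^+ 2) by rewrite /mon E (compZl hL) (compZr hL) c1l scalerA.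
have -> : q ^+ (n.+1 ^ 2) = q * q ^+ (n ^ 2) * (q ^+ 2) ^+ n.
  by rewrite -exprM -exprS -exprD; congr (_ ^+ _); rewrite -addn1 sqrnD; lia.
apply: sbr_ten => //; apply: mon_sym; apply: mon_tpw => //; by left.
Qed.
End Monodromy.

(** * The grading of C by the monodromy with X *)

Section PointedGenerator.
Local Open Scope cat_scope.
Context (k : closedFieldType) (C : bmcat k) (hC : braided_fusion C) (nd : nondegenerate_cat C).
Local Notation hL := (bf_linear hC).
Local Notation hM := (bf_monoidal hC).
Implicit Types X Y Z A K : C.
Local Notation "''I'" := 'I_(nsimples C) (at level 0).
Local Notation F a := (FPdim (simp (C := C) a)).

(** Non-degeneracy: an invertible object that centralizes all simple objects is a sum of units,
    hence the unit. *)
Lemma transparent_one X : FPdim X = 1 -> (forall a, mon X (simp (C := C) a) 1) -> isomorphic (one C) X.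
Proof.
move=> X1 tX; have Xb := FPdim1_brick hC X1.
have /nd[n [i [p [pi _ ip]]]] : centralizer (whole C) X.
  move=> S SP; apply: SP; split; first exact/(simpleE hC).
  move=> Y _ /(simpleE hC)/(simp_of hC)[a Ya].
  have := mon_iso hC (isomorphic_sym Ya) (tX a).
  by rewrite /mon scale1r => /centralizes_sym; apply.
case: n i p pi ip => [|n] i p pi ip; first by case: Xb; rewrite -ip big_ord0.
exact: (one_iso hC Xb (pi ord0)).
Qed.

Context (X : C) (X1 : FPdim X = 1) (D : nat) (CD : FPdim_cat C = D%:R).

Lemma lam_ex (a : 'I) : exists l, l != 0 /\ mon X (simp a) l.
Proof. by have [l l0 E] := mon_ex hC X1 (simp_brick hC a); exists l. Qed.
Let lam a := proj1_sig (constructive_indefinite_description _ (lam_ex a)).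
Lemma lam0 a : lam a != 0. Proof. exact: (proj2_sig (constructive_indefinite_description _ (lam_ex a))).1. Qed.
Lemma lamP a : mon X (simp a) (lam a).
Proof. exact: (proj2_sig (constructive_indefinite_description _ (lam_ex a))).2. Qed.
Let Lam : seq k := undup (map lam (enum 'I)).
Lemma LamP l : reflect (exists a, l = lam a) (l \in Lam).
Proof.
rewrite mem_undup; apply: (iffP mapP) => [[a _ ->]|[a ->]]; first by exists a.
by exists a; rewrite ?mem_enum.
Qed.

Lemma Fa0 (a : 'I) : 0 < F a.
Proof. by apply: (FPdim_gt0 hC); have [] := simp_brick hC a. Qed.

(** Monodromy with X grades C by scalars; this is the dimension of the component of degree l. *)
Let DL (l : k) : algC := \sum_(a : 'I | lam a == l) F a ^+ 2.

Lemma mult_grade (a b c : 'I) : (0 < hdim (simp c) (simp a \ox simp b))%N -> lam c = lam a * lam b.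
Proof.
move=> pos; have [f f0] := hdim_ex pos; have [g gf] := fus_regular hC f.
have [l lE] := (simp_brick hC c).2 (g \oc f).
have l0 : l != 0.
  apply/eqP=> l0; case: f0; by rewrite -gf lE l0 scale0r (comp0r hL).
have gf1 : (l^-1 *: g) \oc f = idm _ by rewrite (compZl hL) lE scalerA mulVf // scale1r.
apply: (mon_uniq _ (lamP c) (mon_ret hC gf1 (mon_tenr hC (lamP a) (lamP b)))).
by have [] := invertible_brick hC X1 (simp_brick hC c).
Qed.

(** Components of a faithful grading have equal dimension: count the occurrences of c in a (x) b,
    weighted by dimensions, once over c and once over b. *)
Lemma DL_shift a l : DL (lam a * l) = DL l.
Proof.
apply: (mulfI (lt0r_neq0 (Fa0 a))).
have [[Y dY] _] := bf_rigid hC (simp (C := C) a).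
pose T b c : algC := F b * (hdim (simp c) (simp a \ox simp b))%:R * F c.
transitivity (\sum_(c | lam c == lam a * l) \sum_(b : 'I) T b c).
  rewrite big_distrr; apply: eq_bigr => c _ /=; rewrite expr2 mulrA -big_distrl /=; congr (_ * _).
  rewrite -(FPdim_dual hC dY) -(FPdim_ten hC) (FPdim_expand hC); apply: eq_bigr => b _.
  rewrite mulrC -(hdim_adj hL hM _ _ dY); congr (_ * _%:R).
  by apply: (hdim_sym hL (fus_schur hC)); apply: fus_decomp.
transitivity (\sum_(b | lam b == l) \sum_(c : 'I) T b c).
  rewrite exchange_big [RHS]big_mkcond; apply: eq_bigr => b _ /=.
  case: eqP => [bl|bl].
    rewrite big_mkcond; apply: eq_bigr => c _; case: ifP => // /negP cl; rewrite /T.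
    have [->|/mult_grade e] := posnP (hdim (simp (C := C) c) (simp a \ox simp b)); first by rewrite mulr0 mul0r.
    by case: cl; rewrite e bl.
  apply: big1 => c /eqP cl; rewrite /T; have [->|/mult_grade e] := posnP (hdim (simp (C := C) c) (simp a \ox simp b)); first by rewrite mulr0 mul0r.
  by case: bl; apply: (mulfI (lam0 a)); rewrite -e.
rewrite big_distrr; apply: eq_bigr => b _ /=; rewrite expr2 mulrCA -(FPdim_ten hC) (FPdim_expand hC (_ \ox _)) big_distrr.
by apply: eq_bigr => c _; rewrite /T -mulrA.
Qed.

Lemma lam_one : exists a, lam a = 1.
Proof.
have [a e] := simp_of hC (one_brick hC); exists a.
apply: (mon_uniq _ (lamP a) (mon_iso hC e (mon_one hC X1))).
by have [] := invertible_brick hC X1 (simp_brick hC a).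
Qed.

Lemma DL_gt0 l : 0 < DL l -> l \in Lam.
Proof.
move=> l0; apply/LamP; have [a /eqP <-|h] := pickP (fun a => lam a == l); first by exists a.
by rewrite /DL big_pred0 ?ltxx in l0.
Qed.

Lemma DL_lam a : 0 < DL (lam a).
Proof.
rewrite /DL (bigD1 a) //= ltr_wpDr ?exprn_gt0 ?Fa0 //.
by apply: sumr_ge0 => b _; rewrite exprn_ge0 // ltW // Fa0.
Qed.

Lemma LamM a l : l \in Lam -> lam a * l \in Lam.
Proof. by move=> /LamP[b ->]; apply: DL_gt0; rewrite DL_shift DL_lam. Qed.

(** All components have the same dimension, an integer because squared dimensions are, and they add
    up to D. *)
Lemma Lam_card : (size Lam %| D)%N.
Proof.
have [a0 a01] := lam_one.
have DLn l : exists e : nat, DL l = e%:R.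
  pose ee a := proj1_sig (constructive_indefinite_description _ (FPdim_sq_nat hC CD ((simpleE hC _).2 (simp_brick hC a)))).
  exists (\sum_(a | lam a == l) ee a)%N; rewrite natr_sum; apply: eq_bigr => a _.
  exact: (proj2_sig (constructive_indefinite_description _ (FPdim_sq_nat hC CD _))).
have [e E] := DLn 1; apply/dvdnP; exists e; apply/eqP; rewrite mulnC -(eqr_nat algC) -CD natrM -E.
apply/eqP; transitivity (\sum_(l <- Lam) DL l); last first.
  rewrite big_seq (eq_bigr (fun=> DL 1)).
    by rewrite -big_seq big_const_seq count_predT iter_addr addr0 mulr_natl.
  by move=> l /LamP[a ->]; rewrite -(DL_shift a 1) mulr1.
rewrite /FPdim_cat /DL (exchange_big_dep predT) //=; apply: eq_bigr => a _.
rewrite -big_filter (_ : [seq l <- Lam | lam a == l] = [:: lam a]) ?big_seq1 //.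
have := filter_pred1_uniq (undup_uniq _ : uniq Lam) (introT (LamP (lam a)) (ex_intro _ a erefl)).
by move=> <-; apply: eq_filter => l; rewrite /= eq_sym.
Qed.

(** Multiplication by a scalar of the grading permutes [Lam]; compare the products of all its
    elements. *)
Lemma Lam_exp a : lam a ^+ size Lam = 1.
Proof.
have P0 : \prod_(l <- Lam) l != 0.
  by rewrite prodf_seq_neq0; apply/allP=> l /LamP[b ->]; rewrite lam0.
have pe : perm_eq (map (fun l => lam a * l) Lam) Lam.
  have u : uniq (map (fun l => lam a * l) Lam).
    by rewrite map_inj_uniq ?undup_uniq //; apply: mulfI; apply: lam0.
  apply: uniq_perm => //; first exact: undup_uniq.
  apply: (uniq_min_size u _ _).2; last by rewrite size_map.
  by move=> _ /mapP[l /LamM lL ->].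
apply: (mulIf P0); rewrite mul1r -[in RHS](perm_big _ pe) big_map big_split /=.
by rewrite big_const_seq count_predT iter_mulr mulr1.
Qed.

(** A suitable power of X is taken: its exponent must make the d-th power transparent and undo the
    exponent N^2 of q1. *)
Lemma pointed_generator (n d N : nat) (q1 : k) : D = (n * d)%N -> (0 < D)%N -> coprime n d -> coprime N d ->
  sbr X (q1 ^+ (N ^ 2)) -> d.-primitive_root (q1 ^+ 2) -> q1 ^+ (d ^ 2) = 1 ->
  exists X', [/\ FPdim X' = 1, isomorphic (one C) (tpw X' d) & sbr X' q1].
Proof.
move=> Dnd D0 co_nd co_Nd sX pr qd.
have d0 : (0 < d)%N by move: D0; rewrite Dnd muln_gt0 => /andP[].
set o := size Lam.
have o0 : (0 < o)%N by apply: dvdn_gt0 Lam_card.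
(* The monodromy of X with itself is q1^(2 N^2), of exact order d because N is prime to d. *)
have d_o : (d %| o)%N.
  have [a Xa] := simp_of hC (FPdim1_brick hC X1).
  have EE : mon X X ((q1 ^+ (N ^ 2)) ^+ 2) by rewrite /mon sX (compZl hL) (compZr hL) (comp_idl hL) scalerA.
  have la : lam a = (q1 ^+ (N ^ 2)) ^+ 2.
    apply: (mon_uniq _ (lamP a) (mon_iso hC Xa EE)).
    by have [] := invertible_brick hC X1 (simp_brick hC a).
  have e1 : (q1 ^+ 2) ^+ (N ^ 2 * o) = 1.
    by rewrite -(Lam_exp a) la -!exprM; congr (_ ^+ _); rewrite -/o; lia.
  have : (d %| N ^ 2 * o)%N by rewrite (prim_order_dvd pr) e1.
  by rewrite Gauss_dvdr // coprime_sym coprimeXl.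
have [e oE] := dvdnP d_o.
(* Since o = e d divides n d, the quotient e divides n. *)
have co_ed : coprime e d.
  have /dvdnP[x E] := Lam_card; apply: coprime_dvdl co_nd.
  apply/dvdnP; exists x; apply/eqP; rewrite -(eqn_pmul2r d0) -Dnd E -/o oE; apply/eqP; lia.
have e0 : (0 < e)%N by move: o0; rewrite oE muln_gt0 => /andP[].
(* Divisibility by e makes o divide r d, so that the d-th power of X^r is transparent; the
   congruence restores the self-braiding. *)
have [r [er rN]] : exists r, (e %| r)%N /\ (r * N = 1 %[mod d])%N.
  have [N0|N0] := posnP N.
    by exists e; rewrite dvdnn; move: co_Nd; rewrite N0 /coprime gcd0n => /eqP ->; rewrite !modn1.
  have eN0 : (0 < e * N)%N by rewrite muln_gt0 e0.
  have /(coprimeP _ eN0)[[x y] /= xy] : coprime (e * N) d by rewrite coprimeMl co_ed.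
  exists (x * e)%N; rewrite dvdn_mull //; split=> //.
  have -> : (x * e * N = y * d + 1)%N by lia.
  by rewrite modnMDl.
exists (tpw X r); have Xr := FPdim_tpw hC r X1; split=> //.
  apply: transparent_one => [|a]; first exact: (FPdim_tpw hC).
  have := mon_tpw hC d (or_intror (simp_brick hC a)) Xr (mon_tpw hC r (or_intror (simp_brick hC a)) X1 (lamP a)).
  have [j ->] := dvdnP er.
  have -> : lam a ^+ (j * e) ^+ d = (lam a ^+ o) ^+ j.
    by rewrite -!exprM oE; congr (_ ^+ _); lia.
  by rewrite Lam_exp expr1n.
have := sbr_tpw hC r X1 sX.
suff -> : q1 ^+ (N ^ 2) ^+ (r ^ 2) = q1 by [].
have [d1|d1] := leqP d 1.
  have d1' : d = 1%N by lia.
  by move: qd; rewrite d1' expr1 => ->; rewrite !expr1n.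
move: rN; rewrite [RHS]modn_small // => rN.
have E := divn_eq (r * N) d; rewrite rN in E; set y := (_ %/ d)%N in E.
(* The square of r N = y d + 1 is y^2 d^2 + 2 d y + 1. *)
have -> : q1 ^+ (N ^ 2) ^+ (r ^ 2) = (q1 ^+ (d ^ 2)) ^+ (y ^ 2) * ((q1 ^+ 2) ^+ d) ^+ y * q1.
  rewrite -!exprM -exprD -exprSr; congr (_ ^+ _); rewrite mulnC -expnMn E sqrnD expnMn; lia.
by rewrite qd (prim_expr_order pr) !expr1n !mul1r.
Qed.
End PointedGenerator.

(** * Functors defined on a generating family *)

(* What the extension of functors below needs; unlike the axioms of a monoidal
   category it is immediate for the Deligne product. *)
Record premonoidal (k : fieldType) (C : bmcat k) : Prop := {
  pm_linear : linear_category C;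
  pm_id : forall X Y : C, tenm (idm X) (idm Y) = idm (ten X Y);
  pm_comp : forall (X X' X'' Y Y' Y'' : C)
    (f' : mor C X' X'') (f : mor C X X') (g' : mor C Y' Y'') (g : mor C Y Y'),
    tenm (comp f' f) (comp g' g) = comp (tenm f' g') (tenm f g);
  pm_linl : forall (X X' Y Y' : C) (a : k) (f f' : mor C X X') (g : mor C Y Y'),
    tenm (a *: f + f') g = a *: tenm f g + tenm f' g;
  pm_linr : forall (X X' Y Y' : C) (a : k) (f : mor C X X') (g g' : mor C Y Y'),
    tenm f (a *: g + g') = a *: tenm f g + tenm f g';
  pm_assoc : forall (X X' Y Y' Z Z' : C) (f : mor C X X') (g : mor C Y Y') (h : mor C Z Z'),
    comp (assoc X' Y' Z') (tenm (tenm f g) h) = comp (tenm f (tenm g h)) (assoc X Y Z);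
  pm_lunit : forall (X X' : C) (f : mor C X X'),
    comp (lunit X') (tenm (idm (one C)) f) = comp f (lunit X);
  pm_runit : forall (X X' : C) (f : mor C X X'),
    comp (runit X') (tenm f (idm (one C))) = comp f (runit X);
  pm_braid : forall (X X' Y Y' : C) (f : mor C X X') (g : mor C Y Y'),
    comp (braid X' Y') (tenm f g) = comp (tenm g f) (braid X Y)
}.

Lemma monoidal_pre (k : fieldType) (C : bmcat k) :
  linear_category C -> monoidal C -> braided C -> premonoidal C.
Proof.
move=> hL hM hB; split=> //.
- exact: tenm_id hM.
- exact: tenm_comp hM.
- exact: tenm_linl hM.
- exact: tenm_linr hM.
- exact: assoc_nat hM.
- exact: lunit_nat hM.
- exact: runit_nat hM.
- exact: braid_nat hB.
Qed.

Section PreTheory.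
Local Open Scope cat_scope.
Context (k : fieldType) (C : bmcat k) (hC : premonoidal C).
Implicit Types X Y Z : C.
Lemma pm_suml X X' Y Y' (I : finType) (f : I -> mor C X X') (g : mor C Y Y') :
  (\sum_i f i) \om g = \sum_i (f i \om g).
Proof.
elim/big_rec2: _ => [|i y x _ <-]; last by rewrite -[f i]scale1r (pm_linl hC) !scale1r.
by have := pm_linl hC (-1) (0 : mor C X X') 0 g; rewrite scaler0 addr0 scaleN1r addNr.
Qed.
Lemma pm_sumr X X' Y Y' (I : finType) (f : I -> mor C X X') (g : mor C Y Y') :
  g \om (\sum_i f i) = \sum_i (g \om f i).
Proof.
elim/big_rec2: _ => [|i y x _ <-]; last by rewrite -[f i]scale1r (pm_linr hC) !scale1r.
by have := pm_linr hC (-1) g (0 : mor C X X') 0; rewrite scaler0 addr0 scaleN1r addNr.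
Qed.
Lemma pm_iso X X' Y Y' (f : mor C X X') f' (g : mor C Y Y') g' :
  inverse_of f f' -> inverse_of g g' -> inverse_of (f \om g) (f' \om g').
Proof.
by move=> [f1 f2] [g1 g2]; split; rewrite -(pm_comp hC) ?f1 ?f2 ?g1 ?g2 (pm_id hC).
Qed.
End PreTheory.

Section Extension.
Local Open Scope cat_scope.
Context (k : fieldType) (Q C : bmcat k) (hQ : premonoidal Q) (hC : premonoidal C).
Context (B : Type) (e : B) (op : B -> B -> B) (L : B -> Q) (X : B -> C).
Context (T : forall a b, mor Q (L a) (L b) -> mor C (X a) (X b)).
Context (J : forall a b, mor Q (L a \ox L b) (L (op a b))) (Ji : forall a b, mor Q (L (op a b)) (L a \ox L b)).
Context (J' : forall a b, mor C (X a \ox X b) (X (op a b))) (J'i : forall a b, mor C (X (op a b)) (X a \ox X b)).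
Context (u : mor Q (one Q) (L e)) (ui : mor Q (L e) (one Q)) (u' : mor C (one C) (X e)) (u'i : mor C (X e) (one C)).

(* A fully faithful braided monoidal functor on the objects L b only.  When every
   object is a direct sum of such, it extends to an equivalence. *)
Record label_functor : Prop := {
  lf_linear : forall a b (c : k) (f g : mor Q (L a) (L b)), T (c *: f + g) = c *: T f + T g;
  lf_id : forall a, T (idm (L a)) = idm (X a);
  lf_comp : forall a b c (g : mor Q (L b) (L c)) (f : mor Q (L a) (L b)), T (g \oc f) = T g \oc T f;
  lf_bij : forall a b, bijective (@T a b);
  lf_J : forall a b, inverse_of (J a b) (Ji a b);
  lf_J' : forall a b, inverse_of (J' a b) (J'i a b);
  lf_u : inverse_of u ui;
  lf_u' : inverse_of u' u'i;
  lf_ten : forall a a' b b' (f : mor Q (L a) (L a')) (g : mor Q (L b) (L b')),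
    T (J a' b' \oc (f \om g) \oc Ji a b) = J' a' b' \oc (T f \om T g) \oc J'i a b;
  lf_assoc : forall a b c,
    T (J a (op b c) \oc (idm _ \om J b c) \oc assoc _ _ _ \oc (Ji a b \om idm _) \oc Ji (op a b) c)
    = J' a (op b c) \oc (idm _ \om J' b c) \oc assoc _ _ _ \oc (J'i a b \om idm _) \oc J'i (op a b) c;
  lf_lunit : forall a, T (lunit _ \oc (ui \om idm _) \oc Ji e a) = lunit _ \oc (u'i \om idm _) \oc J'i e a;
  lf_runit : forall a, T (runit _ \oc (idm _ \om ui) \oc Ji a e) = runit _ \oc (idm _ \om u'i) \oc J'i a e;
  lf_braid : forall a b, T (J b a \oc braid _ _ \oc Ji a b) = J' b a \oc braid _ _ \oc J'i a b
}.

Context (lf : label_functor).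
Let qL := pm_linear hQ.
Let cL := pm_linear hC.
Let qA := comp_assoc qL.
Let q1l := comp_idl qL.
Let q1r := comp_idr qL.
Let cA := comp_assoc cL.
Let c1l := comp_idl cL.
Let c1r := comp_idr cL.
Let p2 := post2 cL.

Lemma label0 a b : T (0 : mor Q (L a) (L b)) = 0.
Proof. by have := lf_linear lf (-1) (0 : mor Q (L a) (L b)) 0; rewrite scaler0 addr0 scaleN1r addNr. Qed.
Lemma labelD a b (f g : mor Q (L a) (L b)) : T (f + g) = T f + T g.
Proof. by rewrite -[f]scale1r (lf_linear lf) !scale1r. Qed.
Lemma label_sum a b (I : finType) (f : I -> mor Q (L a) (L b)) : T (\sum_i f i) = \sum_i T (f i).
Proof. by elim/big_rec2: _ => [|i y x _ <-]; rewrite ?label0 ?labelD. Qed.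

(** A decomposition of q into labelled objects, together with an object of C that is the sum of the
    objects with the same labels: the value of the functor at q. *)
Record dec q := Dec {
  dn : nat; db : 'I_dn -> B;
  di : forall i, mor Q (L (db i)) q; dp : forall i, mor Q q (L (db i));
  dz : C; dj : forall i, mor C (X (db i)) dz; dq : forall i, mor C dz (X (db i));
  decQ : fdsum di dp; decC : fdsum dj dq }.

Context (dQ : forall q, exists n (b : 'I_n -> B), is_dsum (fun i => L (b i)) q).
Context (sC : forall n (b : 'I_n -> B), exists Z, is_dsum (fun i => X (b i)) Z).

Lemma dec_ex q : exists _ : dec q, True.
Proof.
have [n [b /dsum_fsum[i [p ip]]]] := dQ q; have [Z /dsum_fsum[j [r jr]]] := sC b.
by exists (Dec ip jr).
Qed.
Definition dc q := proj1_sig (constructive_indefinite_description _ (dec_ex q)).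
Definition Fo q : C := dz (dc q).
Local Notation din := (di (d := dc _)).
Local Notation dpr := (dp (d := dc _)).
Local Notation djn := (dj (d := dc _)).
Local Notation drn := (dq (d := dc _)).

(** The image of a map L a -> q under the functor to be built; [kt] is the image of a map q -> L a.
    Both are given by their components in the chosen decomposition. *)
Definition br q a (x : mor Q (L a) q) : mor C (X a) (Fo q) := \sum_i (djn i \oc T (dpr i \oc x)).
Definition kt q a (y : mor Q q (L a)) : mor C (Fo q) (X a) := \sum_i (T (y \oc din i) \oc drn i).

Lemma dr_br q a (x : mor Q (L a) q) i : drn i \oc br x = T (dpr i \oc x).
Proof.
rewrite /br (comp_sumr cL) (bigD1 i) //= -cA (fds_id (decC (dc q))) c1l big1 ?addr0 // => j ji.
by rewrite -cA (fds_0 (decC (dc q))) ?(comp0l cL).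
Qed.
Lemma br_T q a b (x : mor Q (L a) q) (h : mor Q (L b) (L a)) : br x \oc T h = br (x \oc h).
Proof.
by rewrite /br (comp_suml cL); apply: eq_bigr => i _; rewrite cA -(lf_comp lf) qA.
Qed.
Lemma br_sum q a (I : finType) (x : I -> mor Q (L a) q) : br (\sum_i x i) = \sum_i br (x i).
Proof.
rewrite /br exchange_big; apply: eq_bigr => j _ /=.
by rewrite (comp_sumr qL) label_sum (comp_sumr cL).
Qed.
Lemma br_in q i : br (din i : mor Q _ q) = djn i.
Proof.
rewrite /br (bigD1 i) //= (fds_id (decQ (dc q))) (lf_id lf) c1r big1 ?addr0 // => j ji.
by rewrite (fds_0 (decQ (dc q))) 1?eq_sym // label0 (comp0r cL).
Qed.
Lemma kt_br q a b (y : mor Q q (L b)) (x : mor Q (L a) q) : kt y \oc br x = T (y \oc x).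
Proof.
rewrite /kt (comp_suml cL) (eq_bigr (fun i => T (y \oc din i \oc dpr i \oc x))) => [|i _]; last first.
  by rewrite cA dr_br -(lf_comp lf) qA.
by rewrite -label_sum -(comp_sumr qL) (eq_bigr _ (fun i _ => esym (qA _ _ x))) -(comp_suml qL) (fds_sum (decQ (dc q))) q1l.
Qed.
(** Maps out of the value at q are determined by their composites with the [br x]. So each axiom of
    a braided functor reduces to labelled objects, where it is a field of [label_functor]. *)
Lemma br_ext q Z (g g' : mor C (Fo q) Z) : (forall a (x : mor Q (L a) q), g \oc br x = g' \oc br x) -> g = g'.
Proof.
move=> E; rewrite -[g]c1r -[g']c1r -(fds_sum (decC (dc q))) !(comp_sumr cL).
by apply: eq_bigr => i _; rewrite -br_in -!cA E.
Qed.
Lemma br_ext2 q q' Z (g g' : mor C (Fo q \ox Fo q') Z) :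
  (forall a b (x : mor Q (L a) q) (y : mor Q (L b) q'), g \oc (br x \om br y) = g' \oc (br x \om br y)) -> g = g'.
Proof.
move=> E; rewrite -[g]c1r -[g']c1r -(pm_id hC) -(fds_sum (decC (dc q))) -(fds_sum (decC (dc q'))).
rewrite (pm_suml hC) !(comp_sumr cL); apply: eq_bigr => i _.
rewrite (pm_sumr hC) !(comp_sumr cL); apply: eq_bigr => j _.
by rewrite (pm_comp hC) -!br_in -!cA E.
Qed.
Lemma br_ext3 q q' q'' Z (g g' : mor C (Fo q \ox Fo q' \ox Fo q'') Z) :
  (forall a b c (x : mor Q (L a) q) (y : mor Q (L b) q') (z : mor Q (L c) q''),
    g \oc (br x \om br y \om br z) = g' \oc (br x \om br y \om br z)) -> g = g'.
Proof.
move=> E; rewrite -[g]c1r -[g']c1r -!(pm_id hC) -(fds_sum (decC (dc q))) -(fds_sum (decC (dc q'))) -(fds_sum (decC (dc q''))).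
rewrite !(pm_suml hC) !(comp_sumr cL); apply: eq_bigr => i _.
rewrite (pm_sumr hC) !(comp_sumr cL); apply: eq_bigr => l _.
rewrite (pm_sumr hC) (pm_suml hC) !(comp_sumr cL); apply: eq_bigr => j _.
by rewrite !(pm_comp hC) -!br_in -!cA E.
Qed.

Definition fm q q' (f : mor Q q q') : mor C (Fo q) (Fo q') := \sum_i (br (f \oc din i) \oc drn i).
Lemma fm_br q q' (f : mor Q q q') a (x : mor Q (L a) q) : fm f \oc br x = br (f \oc x).
Proof.
rewrite /fm (comp_suml cL) (eq_bigr (fun i => br (f \oc din i \oc dpr i \oc x))) => [|i _]; last first.
  by rewrite cA dr_br br_T !qA.
by rewrite -br_sum -(comp_sumr qL) (eq_bigr _ (fun i _ => esym (qA _ _ x))) -(comp_suml qL) (fds_sum (decQ (dc q))) q1l.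
Qed.

Definition fmuE q q' : mor C (Fo q \ox Fo q') (Fo (q \ox q')) :=
  \sum_i \sum_j (br ((din i \om din j) \oc Ji _ _) \oc J' _ _ \oc (drn i \om drn j)).
Definition fmuV q q' : mor C (Fo (q \ox q')) (Fo q \ox Fo q') :=
  \sum_i \sum_j ((djn i \om djn j) \oc J'i _ _ \oc kt (J _ _ \oc (dpr i \om dpr j))).

Lemma sum2_id q q' : \sum_i \sum_j (din i \oc dpr i) \om (din j \oc dpr j) = idm (q \ox q').
Proof.
rewrite -(pm_id hQ) -(fds_sum (decQ (dc q))) -(fds_sum (decQ (dc q'))) (pm_suml hQ).
by apply: eq_bigr => i _; rewrite (pm_sumr hQ).
Qed.
Lemma J'T a a' b b' (f : mor Q (L a) (L a')) (g : mor Q (L b) (L b')) :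
  J' a' b' \oc (T f \om T g) = T (J a' b' \oc (f \om g) \oc Ji a b) \oc J' a b.
Proof. by rewrite (lf_ten lf) !cA (lf_J' lf a b).1 c1r. Qed.

Lemma fmu_br q q' a b (x : mor Q (L a) q) (y : mor Q (L b) q') :
  fmuE q q' \oc (br x \om br y) = br ((x \om y) \oc Ji a b) \oc J' a b.
Proof.
rewrite -[x \om y]q1l -sum2_id (comp_suml qL) (comp_suml qL) br_sum !(comp_suml cL).
apply: eq_bigr => i _; rewrite (comp_suml qL) (comp_suml qL) br_sum !(comp_suml cL).
apply: eq_bigr => j _; rewrite !cA -(pm_comp hC) !dr_br J'T -!cA br_T; congr (br _ \oc _).
by rewrite -!qA (qA _ (Ji _ _) (J _ _)) (lf_J lf _ _).1 q1r -!(pm_comp hQ) !qA.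
Qed.

Lemma fmu_inv q q' : inverse_of (fmuE q q') (fmuV q q').
Proof.
split.
  apply: br_ext2 => a b x y; rewrite cA fmu_br c1l -cA /fmuV (comp_suml cL) (comp_suml cL).
  rewrite -[in RHS](q1l x) -[in RHS](q1l y).
  have brE r c (z : mor Q (L c) r) : br z = \sum_i (djn i \oc T (dpr i \oc z)) by [].
  rewrite (q1l x) (q1l y) (brE _ _ x) (brE _ _ y) (pm_suml hC); apply: eq_bigr => i _.
  rewrite (pm_sumr hC) !(comp_suml cL); apply: eq_bigr => j _.
  rewrite !cA (p2 (kt_br _ _)) (pm_comp hC); congr (_ \oc _).
  rewrite -!qA (qA (J _ _)) -(pm_comp hQ) qA (lf_ten lf) !cA (lf_J' lf a b).1 c1r.
  by rewrite (p2 (lf_J' lf _ _).1) c1l.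
apply: br_ext => c z; rewrite cA c1l.
have -> : fmuV q q' \oc br z
    = \sum_i \sum_j ((djn i \om djn j) \oc J'i _ _ \oc T (J _ _ \oc (dpr i \om dpr j) \oc z)).
  rewrite /fmuV (comp_suml cL); apply: eq_bigr => i _; rewrite (comp_suml cL); apply: eq_bigr => j _.
  by rewrite !cA kt_br qA.
rewrite (comp_sumr cL) -[z in RHS]q1l -sum2_id (comp_suml qL) br_sum; apply: eq_bigr => i _.
rewrite (comp_sumr cL) (comp_suml qL) br_sum; apply: eq_bigr => j _.
rewrite -!br_in (p2 (fmu_br _ _)) !cA (p2 (lf_J' lf _ _).2) c1l br_T.
by congr (br _); rewrite !qA (post2 qL (lf_J lf _ _).1) q1l (pm_comp hQ) !qA.
Qed.

Definition feE : mor C (one C) (Fo (one Q)) := br ui \oc u'.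
Lemma fe_inv : inverse_of feE (u'i \oc kt u).
Proof.
split; first by rewrite cA /feE (p2 (kt_br _ _)) (lf_u lf).2 (lf_id lf) c1l (lf_u' lf).1.
apply: br_ext => a x; rewrite /feE !cA kt_br (p2 (lf_u' lf).2) c1l br_T -qA (lf_u lf).1 q1l.
by rewrite c1l.
Qed.

Lemma fmE_linear q q' (c : k) (f g : mor Q q q') : fm (c *: f + g) = c *: fm f + fm g.
Proof.
apply: br_ext => a x; rewrite (comp_linl cL) !fm_br (comp_linl qL) /br scaler_sumr -big_split.
by apply: eq_bigr => i _; rewrite (comp_linr qL) (lf_linear lf) (comp_linr cL).
Qed.
Lemma fmE_id q : fm (idm q) = idm (Fo q).
Proof. by apply: br_ext => a x; rewrite fm_br q1l c1l. Qed.
Lemma fmE_comp q q' q'' (g : mor Q q' q'') (f : mor Q q q') : fm (g \oc f) = fm g \oc fm f.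
Proof. by apply: br_ext => a x; rewrite cA !fm_br qA. Qed.
Lemma fmuE_nat q r q' r' (f : mor Q q r) (g : mor Q q' r') :
  fm (f \om g) \oc fmuE q q' = fmuE r r' \oc (fm f \om fm g).
Proof.
apply: br_ext2 => a b x y; rewrite !cA -(pm_comp hC) !fm_br !fmu_br -cA fm_br.
by rewrite -qA -(pm_comp hQ).
Qed.
Lemma fmuE_assoc q r s : fm (assoc q r s) \oc fmuE (q \ox r) s \oc (fmuE q r \om idm (Fo s))
  = fmuE q (r \ox s) \oc (idm (Fo q) \om fmuE r s) \oc assoc (Fo q) (Fo r) (Fo s).
Proof.
apply: br_ext3 => a b c x y z; rewrite !cA (pm_assoc hC) -(cA (idm _ \om _)) -!(pm_comp hC).
rewrite !c1l !fmu_br.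
have -> : (br ((x \om y) \oc Ji a b) \oc J' a b) \om br z
    = (br ((x \om y) \oc Ji a b) \om br z) \oc (J' a b \om idm _) by rewrite -(pm_comp hC) c1r.
have -> : br x \om (br ((y \om z) \oc Ji b c) \oc J' b c)
    = (br x \om br ((y \om z) \oc Ji b c)) \oc (idm _ \om J' b c) by rewrite -(pm_comp hC) c1r.
rewrite !cA (p2 (fmu_br _ _)) (p2 (fmu_br _ _)) !cA (p2 (fm_br _ _)).
have -> : assoc q r s \oc (((x \om y) \oc Ji a b) \om z) \oc Ji (op a b) c
  = ((x \om ((y \om z) \oc Ji b c)) \oc Ji a (op b c)) \oc
    (J a (op b c) \oc (idm _ \om J b c) \oc assoc _ _ _ \oc (Ji a b \om idm _) \oc Ji (op a b) c).
  rewrite !qA (post2 qL (lf_J lf _ _).1) q1l -(qA (_ \om _) (_ \om _)) -(pm_comp hQ) q1r qA (lf_J lf b c).1 q1r.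
  rewrite -(qA _ (assoc _ _ _)) -(pm_assoc hQ) !qA; congr (_ \oc _).
  by rewrite -(qA (_ \om _) (_ \om _)) -(pm_comp hQ) q1r.
rewrite -br_T (lf_assoc lf) !cA (p2 (lf_J' lf _ _).1) c1l -(pm_comp hC) (lf_J' lf a b).1 c1l (pm_id hC) c1r.
by [].
Qed.
Lemma fmuE_lunit q : fm (lunit q) \oc fmuE (one Q) q \oc (feE \om idm (Fo q)) = lunit (Fo q).
Proof.
have ex Z (g g' : mor C (one C \ox Fo q) Z) :
    (forall a (x : mor Q (L a) q), g \oc (idm _ \om br x) = g' \oc (idm _ \om br x)) -> g = g'.
  move=> E; rewrite -[g]c1r -[g']c1r -(pm_id hC) -(fds_sum (decC (dc q))) (pm_sumr hC) !(comp_sumr cL).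
  by apply: eq_bigr => i _; rewrite -(c1l (idm (one C))) (pm_comp hC) -br_in -!cA E.
apply: ex => a x; rewrite !cA -(pm_comp hC) c1l c1r /feE.
have -> : (br ui \oc u') \om br x = (br ui \om br x) \oc (u' \om idm _) by rewrite -(pm_comp hC) c1r.
rewrite (p2 (fmu_br _ _)) (pm_lunit hC) !cA (p2 (fm_br _ _)).
have -> : lunit q \oc (ui \om x) \oc Ji e a = x \oc (lunit _ \oc (ui \om idm _) \oc Ji e a).
  by rewrite -(qA x) -(pm_lunit hQ) !qA -(qA (_ \om _) (_ \om _)) -(pm_comp hQ) q1l q1r.
by rewrite -br_T (lf_lunit lf) !cA (p2 (lf_J' lf _ _).1) c1l -(pm_comp hC) (lf_u' lf).1 c1l (pm_id hC) c1r.
Qed.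
Lemma fmuE_runit q : fm (runit q) \oc fmuE q (one Q) \oc (idm (Fo q) \om feE) = runit (Fo q).
Proof.
have ex Z (g g' : mor C (Fo q \ox one C) Z) :
    (forall a (x : mor Q (L a) q), g \oc (br x \om idm _) = g' \oc (br x \om idm _)) -> g = g'.
  move=> E; rewrite -[g]c1r -[g']c1r -(pm_id hC) -(fds_sum (decC (dc q))) (pm_suml hC) !(comp_sumr cL).
  by apply: eq_bigr => i _; rewrite -(c1l (idm (one C))) (pm_comp hC) -br_in -!cA E.
apply: ex => a x; rewrite !cA -(pm_comp hC) c1l c1r /feE.
have -> : br x \om (br ui \oc u') = (br x \om br ui) \oc (idm _ \om u') by rewrite -(pm_comp hC) c1r.
rewrite (p2 (fmu_br _ _)) (pm_runit hC) !cA (p2 (fm_br _ _)).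
have -> : runit q \oc (x \om ui) \oc Ji a e = x \oc (runit _ \oc (idm _ \om ui) \oc Ji a e).
  by rewrite -(qA x) -(pm_runit hQ) !qA -(qA (_ \om _) (_ \om _)) -(pm_comp hQ) q1l q1r.
by rewrite -br_T (lf_runit lf) !cA (p2 (lf_J' lf _ _).1) c1l -(pm_comp hC) (lf_u' lf).1 c1l (pm_id hC) c1r.
Qed.
Lemma fmuE_braid q r : fm (braid q r) \oc fmuE q r = fmuE r q \oc braid (Fo q) (Fo r).
Proof.
apply: br_ext2 => a b x y; rewrite !cA (pm_braid hC) fmu_br (p2 (fmu_br _ _)) !cA (p2 (fm_br _ _)).
have -> : braid q r \oc (x \om y) \oc Ji a b = ((y \om x) \oc Ji b a) \oc (J b a \oc braid _ _ \oc Ji a b).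
  by rewrite !qA (post2 qL (lf_J lf _ _).1) q1l -qA (pm_braid hQ) qA.
by rewrite -br_T (lf_braid lf) !cA (lf_J' lf _ _).1 c1r.
Qed.

Lemma fmuE_iso q q' : is_iso (fmuE q q'). Proof. by exists (fmuV q q'); apply: fmu_inv. Qed.
Lemma feE_iso : is_iso feE. Proof. by exists (u'i \oc kt u); apply: fe_inv. Qed.

Definition extF : bfunctor Q C := BFunctor fmE_linear fmE_id fmE_comp fmuE_iso feE_iso
  fmuE_nat fmuE_assoc fmuE_lunit fmuE_runit fmuE_braid.

Context (sQ : forall n (b : 'I_n -> B), exists Z, is_dsum (fun i => L (b i)) Z).
Context (dC : forall Z, exists n (b : 'I_n -> B), is_dsum (fun i => X (b i)) Z).

Lemma label_equivalence : exists F : bfunctor Q C, is_equivalence F.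
Proof.
exists extF; split=> [q q'|Z].
  have tb a b : exists Ti : mor C (X a) (X b) -> mor Q (L a) (L b), cancel (@T a b) Ti /\ cancel Ti (@T a b).
    by have [Ti TK KT] := lf_bij lf a b; exists Ti.
  pose Ti a b := proj1_sig (constructive_indefinite_description _ (tb a b)).
  have [TK KT] : (forall a b, cancel (@T a b) (Ti a b)) /\ (forall a b, cancel (Ti a b) (@T a b)).
    by split=> a b; have [] := proj2_sig (constructive_indefinite_description _ (tb a b)).
  exists (fun g => \sum_i \sum_j (din j \oc Ti _ _ (drn j \oc g \oc djn i) \oc dpr i)) => [f|g] /=.
    transitivity (\sum_i \sum_j ((din j \oc dpr j) \oc (f \oc din i \oc dpr i))).
      apply: eq_bigr => i _; apply: eq_bigr => j _.
      by rewrite -br_in fm_br dr_br TK !qA.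
    rewrite -[RHS]q1r -(fds_sum (decQ (dc q))) (comp_sumr qL); apply: eq_bigr => i _.
    by rewrite -(comp_suml qL) (fds_sum (decQ (dc q'))) q1l.
  rewrite -[RHS]c1r -(fds_sum (decC (dc q))) (comp_sumr cL) -[LHS]c1r -(fds_sum (decC (dc q))) (comp_sumr cL).
  apply: eq_bigr => i _; rewrite -!cA; congr (_ \oc _); rewrite -br_in fm_br (comp_suml qL).
  rewrite (bigD1 i) //= [X in _ + X]big1 ?addr0; last first.
    move=> i' ii'; rewrite (comp_suml qL) big1 // => j _.
    by rewrite !qA (fds_0 (decQ (dc q))) 1?eq_sym // !(comp0r qL).
  rewrite (comp_suml qL) br_sum -[RHS]c1l -(fds_sum (decC (dc q'))) (comp_suml cL); apply: eq_bigr => j _.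
  by rewrite !qA (fds_id (decQ (dc q))) q1r -br_T KT !br_in !cA.
have [n [b /dsum_fsum[i [p ip]]]] := dC Z; have [q /dsum_fsum[i' [p' ip']]] := sQ b.
exists q; exists (\sum_a (i a \oc kt (p' a))); exists (\sum_a (br (i' a) \oc p a)); split.
  apply: br_ext => a x; rewrite c1l !(comp_suml cL).
  rewrite (eq_bigr (fun l => br ((i' l \oc p' l) \oc x))) => [|l _].
    by rewrite -br_sum -(comp_suml qL) (fds_sum ip') q1l.
  rewrite cA (comp_suml cL) (comp_sumr cL) (bigD1 l) //= big1 ?addr0 => [|l' ll'].
    by rewrite !cA (p2 (fds_id ip l)) c1l kt_br br_T qA.
  by rewrite !cA (p2 (fds_0 ip ll')) (comp0l cL) (comp0r cL).
rewrite -(fds_sum ip) (comp_suml cL); apply: eq_bigr => l _.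
rewrite cA (comp_sumr cL) (bigD1 l) //= -(cA (kt _)) kt_br (fds_id ip') (lf_id lf) c1l big1 ?addr0 // => l' ll'.
by rewrite -(cA (kt _)) kt_br (fds_0 ip') // label0 (comp0l cL).
Qed.
End Extension.

(** * Deligne products *)

Section TensorSpaces.
Context (k : fieldType).
Implicit Types V W : vectType k.

Lemma tpure_sumr V W (v : V) (I : finType) (w : I -> W) : tpure v (\sum_i w i) = \sum_i tpure v (w i).
Proof. by apply/matrixP=> i j; rewrite mxE summxE linear_sum mulr_sumr; apply: eq_bigr => l _; rewrite mxE. Qed.
Lemma tpure_suml V W (w : W) (I : finType) (v : I -> V) : tpure (\sum_i v i) w = \sum_i tpure (v i) w.
Proof. by apply/matrixP=> i j; rewrite mxE summxE linear_sum mulr_suml; apply: eq_bigr => l _; rewrite mxE. Qed.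
Lemma tpureZl V W (a : k) (v : V) (w : W) : tpure (a *: v) w = a *: tpure v w.
Proof. by apply/matrixP=> i j; rewrite !mxE linearZ mulrA. Qed.
Lemma tpureZr V W (a : k) (v : V) (w : W) : tpure v (a *: w) = a *: tpure v w.
Proof. by apply/matrixP=> i j; rewrite !mxE linearZ mulrCA. Qed.

Lemma bvec_coord V (v : V) : v = \sum_a coord (vbasis {:V}) a v *: bvec a.
Proof. exact: coord_vbasis (memvf v). Qed.
Lemma coord_bvec V (a b : 'I_(\dim {:V})) : coord (vbasis {:V}) a (bvec b) = (a == b)%:R.
Proof. by rewrite coord_free ?(basis_free (vbasisP _)) // eq_sym. Qed.

Lemma tsp_expand V W (s : tsp V W) : s = \sum_a \sum_b s a b *: tpure (bvec a) (bvec b).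
Proof.
apply/matrixP=> i j; rewrite summxE (bigD1 i) //= summxE (bigD1 j) //= !mxE !coord_bvec !eqxx !mulr1.
rewrite big1 ?addr0 => [|b bj]; last by rewrite !mxE !coord_bvec (eq_sym j) (negPf bj) !mulr0.
rewrite big1 ?addr0 // => a ai; rewrite summxE big1 // => b _.
by rewrite !mxE !coord_bvec (eq_sym i) (negPf ai) mul0r mulr0.
Qed.

Lemma tsp_ext V W (U : lmodType k) (f g : tsp V W -> U) :
  (forall a x y, f (a *: x + y) = a *: f x + f y) -> (forall a x y, g (a *: x + y) = a *: g x + g y) ->
  (forall v w, f (tpure v w) = g (tpure v w)) -> f =1 g.
Proof.
move=> fL gL fg s.
pose fM := GRing.isLinear.Build k _ _ _ f fL; pose f' : {linear tsp V W -> U} := HB.pack f fM.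
pose gM := GRing.isLinear.Build k _ _ _ g gL; pose g' : {linear tsp V W -> U} := HB.pack g gM.
rewrite -[f s]/(f' s) -[g s]/(g' s) (tsp_expand s) !linear_sum; apply: eq_bigr => a _.
by rewrite !linear_sum; apply: eq_bigr => b _; rewrite !linearZ /= fg.
Qed.

Section Bilinear.
Context (V1 V2 V3 W1 W2 W3 : vectType k) (f : V1 -> V2 -> V3) (g : W1 -> W2 -> W3).
Hypothesis fl : forall a x y z, f (a *: x + y) z = a *: f x z + f y z.
Hypothesis fr : forall a x y z, f z (a *: x + y) = a *: f z x + f z y.
Hypothesis gl : forall a x y z, g (a *: x + y) z = a *: g x z + g y z.
Hypothesis gr : forall a x y z, g z (a *: x + y) = a *: g z x + g z y.

Lemma tbil_linl a s s' t : tbil f g (a *: s + s') t = a *: tbil f g s t + tbil f g s' t.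
Proof.
rewrite /tbil scaler_sumr -big_split; apply: eq_bigr => i _; rewrite scaler_sumr -big_split; apply: eq_bigr => j _.
rewrite scaler_sumr -big_split; apply: eq_bigr => c _; rewrite scaler_sumr -big_split; apply: eq_bigr => e _ /=.
by rewrite !mxE mulrDl scalerDl -mulrA scalerA.
Qed.
Lemma tbil_linr a s t t' : tbil f g s (a *: t + t') = a *: tbil f g s t + tbil f g s t'.
Proof.
rewrite /tbil scaler_sumr -big_split; apply: eq_bigr => i _; rewrite scaler_sumr -big_split; apply: eq_bigr => j _.
rewrite scaler_sumr -big_split; apply: eq_bigr => c _; rewrite scaler_sumr -big_split; apply: eq_bigr => e _ /=.
by rewrite !mxE mulrDr scalerDl mulrCA scalerA.
Qed.

Lemma bilin_expand (U V W : vectType k) (h : U -> V -> W) x y :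
  (forall a x y z, h (a *: x + y) z = a *: h x z + h y z) ->
  (forall a x y z, h z (a *: x + y) = a *: h z x + h z y) ->
  h x y = \sum_i \sum_j (coord (vbasis {:U}) i x * coord (vbasis {:V}) j y) *: h (bvec i) (bvec j).
Proof.
move=> hl hr; pose lM z := GRing.isLinear.Build k _ _ _ (h^~ z) (fun a x y => hl a x y z).
pose l z : {linear U -> W} := HB.pack (h^~ z) (lM z).
pose rM z := GRing.isLinear.Build k _ _ _ (h z) (fun a x y => hr a x y z).
pose r z : {linear V -> W} := HB.pack (h z) (rM z).
rewrite -[LHS]/(l y x) {1}(bvec_coord x) linear_sum; apply: eq_bigr => i _.
rewrite linearZ /= -[h _ y]/(r (bvec i) y) {1}(bvec_coord y) linear_sum scaler_sumr; apply: eq_bigr => j _.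
by rewrite linearZ scalerA.
Qed.

Lemma tbil_pure v1 w1 v2 w2 : tbil f g (tpure v1 w1) (tpure v2 w2) = tpure (f v1 v2) (g w1 w2).
Proof.
rewrite (bilin_expand v1 v2 fl fr) tpure_suml /tbil; apply: eq_bigr => a _; rewrite tpure_suml exchange_big.
apply: eq_bigr => c _; rewrite (bilin_expand w1 w2 gl gr) tpure_sumr; apply: eq_bigr => b _.
rewrite tpure_sumr; apply: eq_bigr => e _; rewrite tpureZl tpureZr scalerA !mxE.
by congr (_ *: _); rewrite mulrACA.
Qed.
End Bilinear.
End TensorSpaces.

Section DeligneProduct.
Local Open Scope cat_scope.
Context (k : fieldType) (C D : bmcat k) (hC : premonoidal C) (hD : premonoidal D).
Local Notation Del := (deligne C D).
Implicit Types U V W : dobj C D.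
Let CL := pm_linear hC.
Let DL := pm_linear hD.

Lemma dmor_ext U V (f g : dmor U V) : (forall i j, f (i, j) = g (i, j)) -> f = g.
Proof. by move=> fg; apply/ffunP=> -[i j]; apply: fg. Qed.

Lemma dgraph_on U V (s : didx U -> didx V) (t : forall i, dentry i (s i)) i : dgraph t (i, s i) = t i.
Proof.
rewrite /dgraph ffunE /=; case: eqP => // e.
by rewrite (eq_irrelevance e erefl).
Qed.
Lemma dgraph_off U V (s : didx U -> didx V) (t : forall i, dentry i (s i)) i j : s i != j -> dgraph t (i, j) = 0.
Proof. by move=> sij; rewrite /dgraph ffunE /=; case: eqP => // e; rewrite e eqxx in sij. Qed.

Local Notation cb := (tbil (@comp k C _ _ _) (@comp k D _ _ _)).
Lemma cb_linl (X Y Z : C) (X' Y' Z' : D) a (s s' : tsp (mor C Y Z) (mor D Y' Z')) (t : tsp (mor C X Y) (mor D X' Y')) :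
  cb (a *: s + s') t = a *: cb s t + cb s' t.
Proof. exact: tbil_linl. Qed.
Lemma cb_linr (X Y Z : C) (X' Y' Z' : D) a (s : tsp (mor C Y Z) (mor D Y' Z')) (t t' : tsp (mor C X Y) (mor D X' Y')) :
  cb s (a *: t + t') = a *: cb s t + cb s t'.
Proof. exact: tbil_linr. Qed.
Lemma cb_pure (X Y Z : C) (X' Y' Z' : D) (f : mor C Y Z) (f' : mor D Y' Z') (g : mor C X Y) (g' : mor D X' Y') :
  cb (tpure f f') (tpure g g') = tpure (f \oc g) (f' \oc g').
Proof.
apply: tbil_pure => a x y z; rewrite ?(comp_linl CL) ?(comp_linr CL) ?(comp_linl DL) ?(comp_linr DL) //.
Qed.
Lemma cb0l (X Y Z : C) (X' Y' Z' : D) (t : tsp (mor C X Y) (mor D X' Y')) :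
  cb (0 : tsp (mor C Y Z) (mor D Y' Z')) t = 0.
Proof. by have := cb_linl (-1) (0 : tsp (mor C Y Z) (mor D Y' Z')) 0 t; rewrite scaler0 addr0 scaleN1r addNr. Qed.
Lemma cb0r (X Y Z : C) (X' Y' Z' : D) (s : tsp (mor C Y Z) (mor D Y' Z')) :
  cb s (0 : tsp (mor C X Y) (mor D X' Y')) = 0.
Proof. by have := cb_linr (-1) s (0 : tsp (mor C X Y) (mor D X' Y')) 0; rewrite scaler0 addr0 scaleN1r addNr. Qed.
Lemma cb_sumr (X Y Z : C) (X' Y' Z' : D) (s : tsp (mor C Y Z) (mor D Y' Z')) (I : finType) (t : I -> tsp (mor C X Y) (mor D X' Y')) :
  cb s (\sum_i t i) = \sum_i cb s (t i).
Proof.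
elim/big_rec2: _ => [|i y x _ <-]; first exact: cb0r.
by rewrite -[t i]scale1r cb_linr !scale1r.
Qed.
Lemma cb_suml (X Y Z : C) (X' Y' Z' : D) (t : tsp (mor C X Y) (mor D X' Y')) (I : finType) (s : I -> tsp (mor C Y Z) (mor D Y' Z')) :
  cb (\sum_i s i) t = \sum_i cb (s i) t.
Proof.
elim/big_rec2: _ => [|i y x _ <-]; first exact: cb0l.
by rewrite -[s i]scale1r cb_linl !scale1r.
Qed.
Lemma cb_assoc (X Y Z T : C) (X' Y' Z' T' : D) (r : tsp (mor C Z T) (mor D Z' T'))
   (s : tsp (mor C Y Z) (mor D Y' Z')) (t : tsp (mor C X Y) (mor D X' Y')) : cb (cb r s) t = cb r (cb s t).
Proof.
move: r; apply: tsp_ext => [a x y|a x y|f f']; rewrite ?cb_linl //.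
move: s; apply: tsp_ext => [a x y|a x y|g g']; rewrite ?cb_linr ?cb_linl ?cb_linr //.
move: t; apply: tsp_ext => [a x y|a x y|h h']; rewrite ?cb_linr //.
by rewrite !cb_pure (comp_assoc CL) (comp_assoc DL).
Qed.
Lemma cb_idl (X Y : C) (X' Y' : D) (t : tsp (mor C X Y) (mor D X' Y')) : cb (tpure (idm Y) (idm Y')) t = t.
Proof.
move: t; apply: tsp_ext => [a x y|a x y|h h']; rewrite ?cb_linr //.
by rewrite !cb_pure (comp_idl CL) (comp_idl DL).
Qed.
Lemma cb_idr (X Y : C) (X' Y' : D) (t : tsp (mor C X Y) (mor D X' Y')) : cb t (tpure (idm X) (idm X')) = t.
Proof.
move: t; apply: tsp_ext => [a x y|a x y|h h']; rewrite ?cb_linl //.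
by rewrite !cb_pure (comp_idr CL) (comp_idr DL).
Qed.

Lemma dcompE U V W (g : dmor V W) (f : dmor U V) i l :
  (comp (g : mor Del V W) (f : mor Del U V) : dmor U W) (i, l)
    = \sum_j cb (g (j, l) : dentry j l) (f (i, j) : dentry i j).
Proof. by rewrite /= /dcomp ffunE. Qed.

Lemma dcomp_graphl U V W (s : didx V -> didx W) (t : forall j, dentry j (s j)) (f : dmor U V) :
  injective s -> forall i j, (comp (dgraph t : mor Del V W) (f : mor Del U V) : dmor U W) (i, s j)
    = cb (t j) (f (i, j) : dentry i j).
Proof.
move=> si i j; rewrite dcompE (bigD1 j) //= dgraph_on big1 ?addr0 // => j' jj'.
by rewrite dgraph_off ?cb0l // (inj_eq si).
Qed.
Lemma dcomp_graphr U V W (s : didx U -> didx V) (t : forall i, dentry i (s i)) (g : dmor V W) i l :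
  (comp (g : mor Del V W) (dgraph t : mor Del U V) : dmor U W) (i, l) = cb (g (s i, l) : dentry (s i) l) (t i).
Proof.
rewrite dcompE (bigD1 (s i)) //= dgraph_on big1 ?addr0 // => j ji.
by rewrite dgraph_off ?cb0r // eq_sym.
Qed.

Lemma deligne_linear : linear_category Del.
Proof.
split.
- move=> U V f; apply: dmor_ext => i j.
  by have := @dcomp_graphl U V V id (fun i => tpure (idm (dl i)) (idm (dr i))) f (fun _ _ => id) i j; rewrite cb_idl.
- move=> U V f; apply: dmor_ext => i j.
  by have := @dcomp_graphr U U V id (fun i => tpure (idm (dl i)) (idm (dr i))) f i j; rewrite cb_idr.
- move=> U V W Z h g f; apply: dmor_ext => i l; rewrite !dcompE.
  rewrite (eq_bigr (fun j => \sum_j' cb (h (j', l) : dentry j' l) (cb (g (j, j') : dentry j j') (f (i, j) : dentry i j)))).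
    rewrite exchange_big; apply: eq_bigr => j' _; rewrite dcompE cb_sumr //.
  by move=> j _; rewrite dcompE cb_suml; apply: eq_bigr => j' _; rewrite cb_assoc.
- move=> U V W a g g' f; apply: dmor_ext => i l; rewrite /= /dcomp !ffunE scaler_sumr -big_split /=.
  by apply: eq_bigr => j _; rewrite !ffunE cb_linl.
move=> U V W a g f f'; apply: dmor_ext => i l; rewrite /= /dcomp !ffunE scaler_sumr -big_split /=.
by apply: eq_bigr => j _; rewrite !ffunE cb_linr.
Qed.

Local Notation tb := (tbil (@tenm k C _ _ _ _) (@tenm k D _ _ _ _)).
Lemma tb_linl (X X' Y Y' : C) (Z Z' T T' : D) a (s s' : tsp (mor C X X') (mor D Z Z')) (t : tsp (mor C Y Y') (mor D T T')) :
  tb (a *: s + s') t = a *: tb s t + tb s' t.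
Proof. exact: tbil_linl. Qed.
Lemma tb_linr (X X' Y Y' : C) (Z Z' T T' : D) a (s : tsp (mor C X X') (mor D Z Z')) (t t' : tsp (mor C Y Y') (mor D T T')) :
  tb s (a *: t + t') = a *: tb s t + tb s t'.
Proof. exact: tbil_linr. Qed.
Lemma tb_pure (X X' Y Y' : C) (Z Z' T T' : D) (f : mor C X X') (f' : mor D Z Z') (g : mor C Y Y') (g' : mor D T T') :
  tb (tpure f f') (tpure g g') = tpure (f \om g) (f' \om g').
Proof.
apply: tbil_pure => a x y z; rewrite ?(pm_linl hC) ?(pm_linr hC) ?(pm_linl hD) ?(pm_linr hD) //.
Qed.
Lemma tb0l (X X' Y Y' : C) (Z Z' T T' : D) (t : tsp (mor C Y Y') (mor D T T')) :
  tb (0 : tsp (mor C X X') (mor D Z Z')) t = 0.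
Proof. by have := tb_linl (-1) (0 : tsp (mor C X X') (mor D Z Z')) 0 t; rewrite scaler0 addr0 scaleN1r addNr. Qed.
Lemma tb0r (X X' Y Y' : C) (Z Z' T T' : D) (s : tsp (mor C X X') (mor D Z Z')) :
  tb s (0 : tsp (mor C Y Y') (mor D T T')) = 0.
Proof. by have := tb_linr (-1) s (0 : tsp (mor C Y Y') (mor D T T')) 0; rewrite scaler0 addr0 scaleN1r addNr. Qed.
Lemma tb_sumr (X X' Y Y' : C) (Z Z' T T' : D) (s : tsp (mor C X X') (mor D Z Z')) (I : finType)
  (t : I -> tsp (mor C Y Y') (mor D T T')) : tb s (\sum_i t i) = \sum_i tb s (t i).
Proof.
elim/big_rec2: _ => [|i y x _ <-]; first exact: tb0r.
by rewrite -[t i]scale1r tb_linr !scale1r.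
Qed.
Lemma tb_suml (X X' Y Y' : C) (Z Z' T T' : D) (t : tsp (mor C Y Y') (mor D T T')) (I : finType)
  (s : I -> tsp (mor C X X') (mor D Z Z')) : tb (\sum_i s i) t = \sum_i tb (s i) t.
Proof.
elim/big_rec2: _ => [|i y x _ <-]; first exact: tb0l.
by rewrite -[s i]scale1r tb_linl !scale1r.
Qed.
Lemma tb_cb (X X' X'' Y Y' Y'' : C) (Z Z' Z'' T T' T'' : D)
  (s' : tsp (mor C X' X'') (mor D Z' Z'')) (s : tsp (mor C X X') (mor D Z Z'))
  (t' : tsp (mor C Y' Y'') (mor D T' T'')) (t : tsp (mor C Y Y') (mor D T T')) :
  tb (cb s' s) (cb t' t) = cb (tb s' t') (tb s t).
Proof.
move: s'; apply: tsp_ext => [a x y|a x y|f f']; rewrite ?(cb_linl, tb_linl) //.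
move: s; apply: tsp_ext => [a x y|a x y|g g']; rewrite ?(cb_linr, tb_linl) ?cb_linr //.
move: t'; apply: tsp_ext => [a x y|a x y|h h']; rewrite ?(cb_linl, tb_linr) ?cb_linl //.
move: t; apply: tsp_ext => [a x y|a x y|l l']; rewrite ?(cb_linr, tb_linr) ?cb_linr //.
by rewrite !(cb_pure, tb_pure) (pm_comp hC) (pm_comp hD).
Qed.
Lemma dtenmE (U U' V V' : dobj C D) (f : dmor U U') (g : dmor V V') i i' j j' :
  (tenm (f : mor Del U U') (g : mor Del V V') : dmor (dten U V) (dten U' V')) ((i, j), (i', j'))
    = tb (f (i, i') : dentry i i') (g (j, j') : dentry j j').
Proof. by rewrite /= /dtenm ffunE. Qed.

Lemma deligne_pre : premonoidal Del.
Proof.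
split.
- exact: deligne_linear.
- move=> U V; apply: dmor_ext => -[i j] [i' j']; rewrite dtenmE.
  have [->|ii'] := eqVneq i i'; last first.
    rewrite (@dgraph_off U U id) // tb0l (@dgraph_off (dten U V) (dten U V) id) //.
    by apply: contra ii' => /eqP[-> _].
  have [->|jj'] := eqVneq j j'; last first.
    rewrite (@dgraph_off V V id) // tb0r (@dgraph_off (dten U V) (dten U V) id) //.
    by apply: contra jj' => /eqP[->].
  by rewrite !(@dgraph_on _ _ id) tb_pure (pm_id hC) (pm_id hD).
- move=> U U' U'' V V' V'' f' f g' g; apply: dmor_ext => -[i j] [i' j'].
  rewrite dtenmE !dcompE tb_suml (eq_bigr _ (fun a _ => tb_sumr _ _)) pair_bigA.
  by apply: eq_bigr => -[a b] _; rewrite tb_cb -!dtenmE.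
- move=> U U' V V' a f f' g; apply: dmor_ext => -[i j] [i' j'].
  by rewrite /= /dtenm !ffunE tb_linl.
- move=> U U' V V' a f g g'; apply: dmor_ext => -[i j] [i' j'].
  by rewrite /= /dtenm !ffunE tb_linr.
- move=> U U' V V' W W' f g h; apply: dmor_ext => -[[i j] l] [i' [j' l']].
  have as_inj (A B E : finType) : injective (fun p : A * B * E => (p.1.1, (p.1.2, p.2))).
    by move=> [[a b] c] [[a' b'] c'] [-> -> ->].
  rewrite (@dcomp_graphl (dten (dten U V) W) (dten (dten U' V') W') (dten U' (dten V' W')) (fun p => (p.1.1, (p.1.2, p.2)))
    (fun p => tpure (assoc (dl p.1.1) (dl p.1.2) (dl p.2)) (assoc (dr p.1.1) (dr p.1.2) (dr p.2))) _
    (@as_inj _ _ _) ((i, j), l) ((i', j'), l')).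
  rewrite (@dcomp_graphr (dten (dten U V) W) (dten U (dten V W)) (dten U' (dten V' W'))).
  rewrite !dtenmE; move: (f (i, i') : dentry i i') (g (j, j') : dentry j j') (h (l, l') : dentry l l') => F G H.
  move: F; apply: tsp_ext => [a x y|a x y|v v']; rewrite ?(tb_linl, cb_linl, cb_linr) //.
  move: G; apply: tsp_ext => [a x y|a x y|w w']; rewrite ?(tb_linr, tb_linl, cb_linl, cb_linr) //.
  move: H; apply: tsp_ext => [a x y|a x y|z z']; rewrite ?(tb_linr, tb_linl, cb_linl, cb_linr) //.
  by rewrite !(tb_pure, cb_pure) (pm_assoc hC) (pm_assoc hD).
- move=> U U' f; apply: dmor_ext => -[[] i] i'.
  have l_inj (A : finType) : injective (fun p : unit * A => p.2) by move=> [[] a] [[] b] /= ->.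
  rewrite (@dcomp_graphl (dten (done C D) U) (dten (done C D) U') U' (fun p => p.2)
    (fun p => tpure (lunit (dl p.2)) (lunit (dr p.2))) _ (@l_inj _) (tt, i) (tt, i')).
  rewrite (@dcomp_graphr (dten (done C D) U) U U') dtenmE (@dgraph_on (done C D) (done C D) id).
  move: (f (i, i') : dentry i i').
  apply: tsp_ext => [a x y|a x y|v v']; rewrite ?(tb_linr, cb_linl, cb_linr) //.
  by rewrite !(tb_pure, cb_pure) (pm_lunit hC) (pm_lunit hD).
- move=> U U' f; apply: dmor_ext => -[i []] i'.
  have r_inj (A : finType) : injective (fun p : A * unit => p.1) by move=> [a []] [b []] /= ->.
  rewrite (@dcomp_graphl (dten U (done C D)) (dten U' (done C D)) U' (fun p => p.1)
    (fun p => tpure (runit (dl p.1)) (runit (dr p.1))) _ (@r_inj _) (i, tt) (i', tt)).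
  rewrite (@dcomp_graphr (dten U (done C D)) U U') dtenmE (@dgraph_on (done C D) (done C D) id).
  move: (f (i, i') : dentry i i').
  apply: tsp_ext => [a x y|a x y|v v']; rewrite ?(tb_linl, cb_linl, cb_linr) //.
  by rewrite !(tb_pure, cb_pure) (pm_runit hC) (pm_runit hD).
move=> U U' V V' f g; apply: dmor_ext => -[i j] [j' i'].
have b_inj (A B : finType) : injective (fun p : A * B => (p.2, p.1)) by move=> [a b] [a' b'] [-> ->].
rewrite (@dcomp_graphl (dten U V) (dten U' V') (dten V' U') (fun p => (p.2, p.1))
  (fun p => tpure (braid (dl p.1) (dl p.2)) (braid (dr p.1) (dr p.2))) _ (@b_inj _ _) (i, j) (i', j')).
rewrite (@dcomp_graphr (dten U V) (dten V U) (dten V' U')) !dtenmE.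
move: (f (i, i') : dentry i i') (g (j, j') : dentry j j') => F G.
move: F; apply: tsp_ext => [a x y|a x y|v v']; rewrite ?(tb_linr, tb_linl, cb_linl, cb_linr) //.
move: G; apply: tsp_ext => [a x y|a x y|w w']; rewrite ?(tb_linr, tb_linl, cb_linl, cb_linr) //.
by rewrite !(tb_pure, cb_pure) (pm_braid hC) (pm_braid hD).
Qed.
End DeligneProduct.

(** * Powers of an invertible object *)

Section Powers.
Local Open Scope cat_scope.
Context (k : closedFieldType) (C : bmcat k) (hC : braided_fusion C).
Local Notation hL := (bf_linear hC).
Local Notation hM := (bf_monoidal hC).
Local Notation hB := (bf_braided hC).
Let cA := comp_assoc hL.
Let c1l := comp_idl hL.
Let c1r := comp_idr hL.
Let wM := wlM hL hM.
Let wR := wrM hL hM.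
Let p2 := post2 hL.
Context (d' : nat) (X : C) (X1 : FPdim X = 1) (q : k).
Local Notation d := d'.+1.
Context (sX : sbr X q) (prq : d.-primitive_root (q ^+ 2)) (Xd : isomorphic (one C) (tpw X d)).
Local Notation P := (tpw X).

(** The residue of n, obtained by iterating the cyclic successor so that [rho n.+1] is convertible
    to [ordS (rho n)]; the types of [step] and [gr] rely on this. *)
Definition rho n : 'I_d := iter n (@ordS _) ord0.
Lemma rhoE n : rho n = (n %% d)%N :> nat.
Proof. by elim: n => [|n IH] //=; rewrite IH -[in LHS]addn1 modnDml addn1. Qed.
Lemma rhoS n m : (rho n.+1 == rho m.+1) = (rho n == rho m).
Proof. by rewrite /= (inj_eq (@ordS_inj _)). Qed.

Lemma pow_brick n : brick (P n). Proof. exact: (FPdim1_brick hC (FPdim_tpw hC n X1)). Qed.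

(** The identity except at the last residue, where the chosen isomorphism 1 -> X^d closes the
    cycle. *)
Lemma step_ex (i : 'I_d) : exists f : mor C (X \ox P i) (P (ordS i)), is_iso f.
Proof.
have [id|id] := ltnP i.+1 d.
  by rewrite /= modn_small //; exists (idm _); apply: (is_iso_id hL).
have -> : (ordS i : nat) = 0%N by rewrite /= (_ : i.+1 = d) ?modnn //; apply/eqP; rewrite eqn_leq id andbT ltn_ord.
have -> : (i : nat) = d' by apply/eqP; rewrite eqn_leq -ltnS ltn_ord /= -ltnS.
by have [f fi] := isomorphic_sym Xd; exists f.
Qed.
Definition step i := proj1_sig (constructive_indefinite_description _ (step_ex i)).
Lemma step_iso i : is_iso (step i).
Proof. exact: (proj2_sig (constructive_indefinite_description _ (step_ex i))). Qed.

Fixpoint gr n : mor C (P n) (P (rho n)) :=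
  if n is n'.+1 then step (rho n') \oc (idm X \om gr n') else idm (one C).
Lemma gr_iso n : is_iso (gr n).
Proof.
elim: n => [|n IH] /=; first exact: (is_iso_id hL).
by apply: (is_iso_comp hL) (step_iso _) _; apply: (wl_iso hL hM).
Qed.
Definition gri n := proj1_sig (constructive_indefinite_description _ (gr_iso n)).
Lemma griP n : inverse_of (gr n) (gri n).
Proof. exact: (proj2_sig (constructive_indefinite_description _ (gr_iso n))). Qed.

Definition castP (i j : 'I_d) (e : i = j) : mor C (P i) (P j) := ecast j (mor C (P i) (P j)) e (idm (P i)).
(* A coherent choice of isomorphisms X^n -> X^m for n = m mod d (and 0
   otherwise), all built from one isomorphism 1 -> X^d. *)
Definition K n m : mor C (P n) (P m) :=
  match rho n =P rho m with
  | ReflectT e => gri m \oc castP e \oc gr n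
  | ReflectF _ => 0
  end.

Lemma KE n m (e : rho n = rho m) : K n m = gri m \oc castP e \oc gr n.
Proof. by rewrite /K; case: eqP => // e'; rewrite (eq_irrelevance e' e). Qed.
Lemma K_off n m : rho n <> rho m -> K n m = 0.
Proof. by rewrite /K; case: eqP. Qed.
Lemma K_id n : K n n = idm _.
Proof. by rewrite (KE (erefl (rho n))) /castP /= c1l (griP n).1. Qed.
Lemma K_comp n m l : rho n = rho m -> K m l \oc K n m = K n l.
Proof.
move=> e; case: (rho m =P rho l) => e'; last by rewrite (K_off e') (comp0l hL) K_off ?e.
rewrite (KE e) (KE e') (KE (etrans e e')) !cA (p2 (griP m).2) c1l; congr (_ \oc _).
by rewrite -cA; congr (_ \oc _); rewrite /castP; case: _ / e'; case: _ / e => /=; rewrite c1l.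
Qed.
Lemma K_S n m : idm X \om K n m = K n.+1 m.+1.
Proof.
case: (rho n =P rho m) => e; last first.
  by rewrite !K_off ?(tenm0r hM) // => /eqP; rewrite rhoS => /eqP.
have e' : ordS (rho n) = ordS (rho m) by rewrite e.
rewrite (KE e) (@KE n.+1 m.+1 e'); apply: (iso_cancel_l hL (gr_iso m.+1)).
rewrite (p2 (griP m.+1).2) c1l /= cA -wM (p2 (griP m).2) c1l wM -!cA.
congr (_ \oc _); move: (rho n) (rho m) e e' => i j e e'.
case: j / e e' => e'; rewrite (eq_irrelevance e' erefl) /castP /=.
by rewrite (wl_id hM) c1r c1l.
Qed.
Lemma K_iso n m : rho n = rho m -> is_iso (K n m).
Proof. by move=> e; exists (K m n); split; rewrite K_comp ?K_id. Qed.
Lemma K_nz n m : rho n = rho m -> K n m != 0.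
Proof.
move=> e; apply/eqP=> K0; have [g [gK _]] := K_iso e.
by case: (pow_brick n); rewrite -gK K0 (comp0r hL).
Qed.

Lemma mon_pow n : mon X (P n) ((q ^+ 2) ^+ n).
Proof.
have EE : mon X X (q ^+ 2) by rewrite /mon sX (compZl hL) (compZr hL) c1l scalerA.
exact: (mon_sym hC (mon_tpw hC n (or_introl X1) X1 EE)).
Qed.
(** The powers of X are bricks, and X^n has monodromy (q^2)^n with X; as q^2 is a primitive d-th
    root of unity, no non-zero map joins powers with different residues. *)
Lemma hom_line n m (f : mor C (P n) (P m)) : exists c, f = c *: K n m.
Proof.
case: (rho n =P rho m) => e.
  have [g [gK Kg]] := K_iso e; have [c E] := (pow_brick n).2 (g \oc f).
  by exists c; rewrite -[f]c1l -Kg cA E (compZr hL) c1r.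
exists 0; rewrite scale0r; have [//|/eqP f0] := eqVneq f 0; case: e.
have [g [gf fg]] := fus_schur hC (pow_brick n) (pow_brick m) f0.
have := mon_uniq _ (mon_pow m) (mon_iso hC (ex_intro _ f (ex_intro _ g (conj gf fg))) (mon_pow n)).
move=> /(_ (nz_brick (pow_brick m.+1)))/eqP; rewrite (eq_prim_root_expr prq) => /eqP e.
by apply: ord_inj; rewrite !rhoE.
Qed.
(** The coordinate of f with respect to [K n m], by convention 0 where the Hom space vanishes. *)
Definition num n m (f : mor C (P n) (P m)) : k :=
  if rho n == rho m then proj1_sig (constructive_indefinite_description _ (hom_line f)) else 0.
Lemma numK n m (f : mor C (P n) (P m)) : f = num f *: K n m.
Proof.
rewrite /num; case: eqP => [e|e]; first exact: (proj2_sig (constructive_indefinite_description _ (hom_line f))).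
by have [c ->] := hom_line f; rewrite K_off // !scaler0.
Qed.
Lemma num_uniq n m (f : mor C (P n) (P m)) c : rho n = rho m -> f = c *: K n m -> num f = c.
Proof.
move=> e E; have := numK f; rewrite {1}E => /eqP; rewrite -subr_eq0 -scalerBl scaler_eq0.
by rewrite (negPf (K_nz e)) orbF subr_eq0 => /eqP.
Qed.
Lemma num_off n m (f : mor C (P n) (P m)) : rho n <> rho m -> num f = 0.
Proof. by rewrite /num => /eqP/negPf ->. Qed.

Fixpoint cat n m : mor C (P n \ox P m) (P (n + m)) :=
  if n is n'.+1 then (idm X \om cat n' m) \oc assoc X (P n') (P m) else lunit (P m).
Lemma cat_iso n m : is_iso (cat n m).
Proof.
elim: n => [|n IH] /=; first exact: (lunit_iso hM).
by apply: (is_iso_comp hL) (assoc_iso hM _ _ _); apply: (wl_iso hL hM).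
Qed.
Definition cati n m := proj1_sig (constructive_indefinite_description _ (cat_iso n m)).
Lemma catiP n m : inverse_of (cat n m) (cati n m).
Proof. exact: (proj2_sig (constructive_indefinite_description _ (cat_iso n m))). Qed.

Lemma cat_assoc n m l : cat n (m + l) \oc (idm _ \om cat m l) \oc assoc _ _ _
  = K (n + m + l) (n + (m + l)) \oc cat (n + m) l \oc (cat n m \om idm _).
Proof.
elim: n => [|n IH] /=.
  by rewrite K_id c1l -cA (lunit_nat hM) cA (lunit_ten hL hM).
have IH' := congr1 (fun f => idm X \om f) IH; rewrite !wM in IH'.
rewrite !cA -[idm (X \ox P n)](tenm_id hM) (p2 (assoc_nat hM _ _ _)) !cA (pentagon hM) (post3 hL IH') -K_S !cA.
by do 2!congr (_ \oc _); rewrite wR (p2 (assoc_nat hM _ _ _)) !cA.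
Qed.
Lemma cat_runit n : runit (P n) = K (n + 0) n \oc cat n 0.
Proof.
elim: n => [|n IH]; first by rewrite K_id c1l /= (lunit1_runit1 hL hM).
by rewrite /= -K_S -(cA (idm X \om _)) -wM -IH (runit_ten hL hM).
Qed.
Lemma cat_wl n m m' (f : mor C (P m) (P m')) :
  cat n m' \oc (idm _ \om f) = num f *: (K (n + m) (n + m') \oc cat n m).
Proof.
elim: n => [|n IH]; first by rewrite [LHS](lunit_nat hM) {1}(numK f) (compZl hL).
rewrite /= cA -[idm (X \ox P n)](tenm_id hM) (assoc_nat hM) -cA -wM IH (tenmZr hM) (compZl hL).
by rewrite -K_S wM !cA.
Qed.
Lemma cat_K_wr n n' m : n = n' -> cat n' m \oc (K n n' \om idm _) = K (n + m) (n' + m) \oc cat n m.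
Proof. by move=> <-; rewrite !K_id (wl_id hM) c1l c1r. Qed.

Lemma rho_addC n m : rho (n + m) = rho (m + n). Proof. by rewrite addnC. Qed.
(** The scalar of the braiding of X^n and X^m in the coordinates [cat] and [K]. *)
Definition cb n m := num (cat m n \oc braid (P n) (P m) \oc cati n m).
Lemma cbE n m : cat m n \oc braid (P n) (P m) = cb n m *: (K (n + m) (m + n) \oc cat n m).
Proof. by rewrite -(compZl hL) -numK !cA (catiP n m).1 c1r. Qed.

Lemma cat_K_wl n m m' : rho m = rho m' ->
  cat n m' \oc (idm _ \om K m m') = K (n + m) (n + m') \oc cat n m.
Proof. by move=> e; rewrite cat_wl (num_uniq e (esym (scale1r _))) scale1r. Qed.

Lemma cb_addr n m l : cb n (m + l) = cb n m * cb n l.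
Proof.
apply: num_uniq; first exact: rho_addC.
apply: (iso_cancel_r hL (cat_iso n (m + l))); rewrite !cA (catiP _ _).1 c1r.
apply: (iso_cancel_r hL (f := (idm (P n) \om cat m l) \oc assoc (P n) (P m) (P l))).
  by apply: (is_iso_comp hL) (assoc_iso hM _ _ _); apply/(wl_iso hL hM)/cat_iso.
have E : cat (m + l) n \oc (cat m l \om idm _) = K (m + (l + n)) (m + l + n) \oc
    cat m (l + n) \oc (idm _ \om cat l n) \oc assoc _ _ _.
  by rewrite cat_assoc -cA K_comp ?addnA // K_id c1l.
have E2 : (idm (P m) \om cat l n) \oc (idm _ \om braid (P n) (P l))
    = cb n l *: ((idm _ \om K (n + l) (l + n)) \oc (idm _ \om cat n l)).
  by rewrite -!wM cbE (tenmZr hM).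
have E4 : (cat m n \om idm (P l)) \oc (braid (P n) (P m) \om idm _)
    = cb n m *: ((K (n + m) (m + n) \om idm _) \oc (cat n m \om idm _)).
  by rewrite -!wR cbE (tenmZl hM).
rewrite (cA (cat _ _)) (p2 (braid_nat hB (idm (P n)) (cat m l))) !(compZl hL) (cA (K _ _)) cat_assoc.
rewrite (cA (cat m l \om _)) (p2 E) !cA (hexagon hB) (p2 E2) (compZl hL) !(compZr hL).
rewrite [in RHS]mulrC -scalerA; congr (_ *: _).
rewrite cA (p2 (cat_K_wl _ (rho_addC n l))) !cA (post3 hL (cat_assoc _ _ _)) !cA E4 !(compZr hL); congr (_ *: _).
rewrite (p2 (cat_K_wr _ (addnC n m))) !cA.
by do 4?[rewrite (p2 (K_comp _ _)); last by congr (rho _); lia]; congr (K _ _ \oc _).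
Qed.

Lemma cb_mul n m : cb n m * cb m n = (q ^+ 2) ^+ (n * m).
Proof.
have E : mon (P n) (P m) ((q ^+ 2) ^+ (n * m)).
  rewrite mulnC exprM; apply: (mon_tpw hC n (or_introl (FPdim_tpw hC m X1)) X1); exact: mon_pow.
have [f [_ fE]] := is_iso_comp hL (cat_iso n m) (is_iso_id hL (P n \ox P m)).
have : cat n m \oc braid (P m) (P n) \oc braid (P n) (P m) = (cb n m * cb m n) *: cat n m.
  rewrite -cA cbE (compZl hL) cA cbE (compZr hL) scalerA mulrC -cA K_comp ?K_id ?c1l //; exact: rho_addC.
rewrite E (compZr hL) c1r => /eqP; rewrite eq_sym -subr_eq0 -scalerBl scaler_eq0 subr_eq0 => /orP[/eqP //|/eqP c0].
by move: fE; rewrite c0 !(comp0l hL) => /esym; case: (pow_brick (n + m)) => h _ /h.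
Qed.

Lemma cb_nz n m : cb n m != 0.
Proof.
apply/eqP=> c0; have := cbE n m; rewrite c0 scale0r.
have [g [gf fg]] := is_iso_comp hL (cat_iso m n) (braid_iso hB (P n) (P m)).
move=> e; move: fg; rewrite e (comp0l hL) => /esym; case: (pow_brick (m + n)) => h _; exact: h.
Qed.

(** Follows from additivity in the second argument, because [cb n m * cb m n] is the monodromy,
    which is additive in both. *)
Lemma cb_addl n m l : cb (n + m) l = cb n l * cb m l.
Proof.
apply: (mulIf (cb_nz l (n + m))); rewrite cb_mul [in RHS]cb_addr mulrACA !cb_mul -exprD.
by rewrite mulnDl.
Qed.

Lemma cb_val n m : cb n m = q ^+ (n * m).
Proof.
have c0l l : cb 0 l = 1.
  by have := cb_addl 0 0 l => /(congr1 (fun x => x / cb 0 l)); rewrite mulfK ?cb_nz // mulfV ?cb_nz.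
have c0r l : cb l 0 = 1.
  by have := cb_addr l 0 0 => /(congr1 (fun x => x / cb l 0)); rewrite mulfK ?cb_nz // mulfV ?cb_nz.
have c11 : cb 1 1 = q.
  apply: num_uniq => //; have o1 : isomorphic X (P 1).
    by apply: isomorphic_sym; exists (runit X); apply: (runit_iso hM).
  by rewrite (sbr_iso hC o1 sX) (compZl hL) c1l (compZr hL) (catiP 1 1).2 K_id.
have c1 l : cb 1 l = q ^+ l.
  elim: l => [|l IH]; first by rewrite c0r expr0.
  by rewrite -[l.+1]add1n cb_addr IH c11 -exprS.
elim: n => [|n IH]; first by rewrite c0l.
by rewrite -[n.+1]add1n cb_addl IH c1 -exprD.
Qed.

(** On the right factor f commutes with [cat] up to its coordinate alone ([cat_wl]); on the left
    factor a power of q appears, since f is carried there by the braiding. The factor q^(m (n' - n))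
    is written without division, and it can be -1 even when n and n' are congruent. *)
Lemma cat_wr n n' m (f : mor C (P n) (P n')) :
  q ^+ (m * n) *: (cat n' m \oc (f \om idm _)) = (q ^+ (m * n') * num f) *: (K (n + m) (n' + m) \oc cat n m).
Proof.
apply: (iso_cancel_r hL (braid_iso hB (P m) (P n))).
rewrite !(compZl hL) !cA -(braid_nat hB) -cA !cbE !cb_val (compZl hL) (compZr hL) !cA cat_wl.
rewrite !(compZr hL) !scalerA [in RHS]mulrC mulrA; congr (_ *: _).
have E1 : K (n + m) (n' + m) \oc K (m + n) (n + m) = K (m + n) (n' + m).
  by apply: K_comp; apply: rho_addC.
rewrite (p2 E1) -cA; congr (_ \oc _).
have [h|/eqP h] := eqVneq (rho (m + n)) (rho (m + n')); first exact: K_comp.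
by rewrite (K_off h) (comp0r hL) K_off // -(rho_addC m n').
Qed.
End Powers.

(** * The regular algebra *)

Section FunctorGalois.
Local Open Scope cat_scope.
Context (k : fieldType) (B D : bmcat k) (F : bfunctor B D) (hL : linear_category D) (hM : monoidal D).
Context (H : finGroupType) (R : B) (m : mor B (R \ox R) R) (u : mor B (one B) R)
  (tau : H -> mor B R R) (s : mor B R (R \ox R)).
Let cA := comp_assoc hL.
Let c1l := comp_idl hL.
Let c1r := comp_idr hL.
Let p2 := post2 hL.
Let p3 := post3 hL.

(** [fmu] is invertible, so the splitting s is transported by following [fmap F s] with the inverse
    [si]. *)
Lemma functor_galois (si : mor D (F (R \ox R)) (F R \ox F R)) : inverse_of (fmu F R R) si ->
  galois_alg m u tau s -> bijective (@fmap k B D F (one B) R) ->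
  galois_alg (fmap F m \oc fmu F R R) (fmap F u \oc feps F) (fun g => fmap F (tau g)) (si \oc fmap F s).
Proof.
move=> [s1 s2] hG Fb; have [ax ua] := @functor_algebra k B D F hL hM R m u (ga_assoc hG) (ga_unit hG).
have nat (f g : mor B R R) : fmu F R R \oc (fmap F f \om fmap F g) = fmap F (f \om g) \oc fmu F R R.
  by rewrite (fmu_nat F).
have natV (f g : mor B R R) : (fmap F f \om fmap F g) \oc si = si \oc fmap F (f \om g).
  by rewrite -[LHS]c1l -s1 !cA (p2 (nat _ _)) !cA s2 c1r.
have F0 : fmap F (0 : mor B R R) = 0.
  by have := fmap_linear F (-1) (0 : mor B R R) 0; rewrite scaler0 addr0 scaleN1r addNr.
split.
- exact: ax.
- exact: ua.
- by rewrite cA -(fmu_braid F) -cA -(fmap_comp F) (ga_comm hG).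
- rewrite /centralizes; apply: (sec_inj hL s1); rewrite c1r -cA -(fmu_braid F) cA -(fmu_braid F) -cA -(fmap_comp F).
  by rewrite (ga_sym hG) (fmap_id F) c1l.
- by rewrite (ga_tau1 hG) (fmap_id F).
- by move=> g h; rewrite -(fmap_comp F) (ga_tauM hG).
- by move=> g; rewrite -cA -(fmap_comp F) (ga_tau_m hG) (fmap_comp F) !cA nat.
- by move=> g; rewrite -cA -(fmap_comp F) (ga_tau_u hG).
- by rewrite cA (p2 s2) c1l -(fmap_comp F) (ga_ms hG) (fmap_id F).
- by apply: (sec_inj hL s1); rewrite -cA -(fmu_braid F) !cA (p2 s2) c1l -(fmap_comp F) (ga_cs hG).
- apply: (sec_inj hL s1); rewrite !cA (p2 s2) c1l -cA -(fmap_comp F) (ga_sm hG).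
  have e1 : fmu F R R \oc (idm (F R) \om (fmap F m \oc fmu F R R))
      = fmap F (idm R \om m) \oc fmu F R (R \ox R) \oc (idm (F R) \om fmu F R R).
    by rewrite (wlM hL hM) -[X in X \om fmap F m](fmap_id F) -cA -(fmu_nat F) cA.
  rewrite (p2 e1) !cA (p3 (esym (fmu_assoc F R R R))) !(fmap_comp F) !cA; do 2!congr (_ \oc _).
  have e2 : (fmu F R R \om idm (F R)) \oc ((si \oc fmap F s) \om idm (F R)) = fmap F s \om fmap F (idm R).
    by rewrite -(wrM hL hM) -cA s2 c1l (fmap_id F).
  by rewrite e2 -(fmu_nat F).
- by move=> g; rewrite cA -(fmap_comp F) (ga_stau hG) (fmap_comp F) -!cA natV.
- move=> g g1; rewrite cA -[X in _ \om X](fmap_id F) -(cA (_ \om _)) natV cA (p2 s2) c1l -!(fmap_comp F).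
  by rewrite (ga_orth hG g1) F0.
- have e1 : \sum_g ((idm (F R) \om fmap F (tau g)) \oc si \oc fmap F s) = si \oc fmap F (\sum_g ((idm R \om tau g) \oc s)).
    have Fs : fmap F (\sum_g ((idm R \om tau g) \oc s)) = \sum_g fmap F ((idm R \om tau g) \oc s).
      have FD : {morph (@fmap k B D F R (R \ox R)) : x y / x + y >-> x + y}.
        by move=> x y; have := fmap_linear F 1 x y; rewrite !scale1r.
      apply: (big_morph _ FD); by have := fmap_linear F (-1) (0 : mor B R (R \ox R)) 0; rewrite scaler0 addr0 scaleN1r addNr.
    rewrite Fs (comp_sumr hL); apply: eq_bigr => g _.
    by rewrite -cA -[X in X \om _](fmap_id F) natV cA -(fmap_comp F).
  rewrite e1 -(fmu_runit F) !cA -(cA (fmap F _)) -(fmap_comp F) (ga_sum hG).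
  rewrite (wlM hL hM) -[X in X \om fmap F u](fmap_id F) -[RHS]c1l -s1 !cA; congr (_ \oc _).
  by rewrite -cA (fmu_nat F) cA.
rewrite -(ga_dim hG); symmetry.
have [f [g [gf fg]]] : isomorphic (one D) (F (one B)) by exists (feps F); apply: (feps_iso F).
transitivity (hdim (F (one B)) (F R)).
  by apply: (dim_eq_bij (f := @fmap k B D F (one B) R)) Fb => a x y; apply: (fmap_linear F).
by apply: (hdim_isol hL); apply: isomorphic_sym; exists f, g.
Qed.
End FunctorGalois.

Section FunGalois.
Local Open Scope cat_scope.
Context (k : fieldType) (gT : finGroupType) (G : {group gT}).
Local Notation n := #|G|.
Local Notation ix a b := (mxtens_index (a, b)).
Local Notation d a b := (((a == b)%:R) : k).
Local Notation FG := (FunG k G).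

(** Left translation, which commutes with the action of G on Fun(G) by right translation. The acting
    group is the type [[subg G]], as [galois_alg] asks for a whole [finGroupType]. *)
Definition tr_ix (h : [subg G]) (i : 'I_n) : 'I_n := gring_index G (sgval h * enum_val i)%g.
Lemma tr_ix_val h i : enum_val (tr_ix h i) = (sgval h * enum_val i)%g.
Proof. by rewrite gring_indexK // groupM ?subgP ?enum_valP. Qed.
Lemma tr_ix1 i : tr_ix 1%g i = i.
Proof. by apply: enum_val_inj; rewrite tr_ix_val mul1g. Qed.
Lemma tr_ixM g h i : tr_ix g (tr_ix h i) = tr_ix (g * h)%g i.
Proof. by apply: enum_val_inj; rewrite !tr_ix_val mulgA. Qed.
Lemma tr_ixK g : cancel (tr_ix g) (tr_ix g^-1%g).
Proof. by move=> i; rewrite tr_ixM mulVg tr_ix1. Qed.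
Lemma tr_ix_inj g : injective (tr_ix g). Proof. exact: can_inj (tr_ixK g). Qed.

Definition tau_mx (h : [subg G]) : 'M[k]_n := \matrix_(i, j) d (tr_ix h i) j.
Lemma tau_mxl h p (A : 'M[k]_(n, p)) i j : (tau_mx h *m A) i j = A (tr_ix h i) j.
Proof. by rewrite mxE; under eq_bigr do rewrite mxE; rewrite sum_deltal. Qed.
Lemma tau_mxr h p (A : 'M[k]_(p, n)) i j : (A *m tau_mx h) i (tr_ix h j) = A i j.
Proof.
by rewrite mxE; under eq_bigr do rewrite mxE (inj_eq (@tr_ix_inj h)); rewrite sum_deltar.
Qed.
Lemma FunG_E g a b : (FG : rep k G) g a b = d b (gring_index G (enum_val a * g)%g).
Proof. by rewrite /= !mxE !eqxx /=. Qed.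
Lemma tr_ix_mulg h g a : g \in G -> gring_index G (enum_val (tr_ix h a) * g)%g = tr_ix h (gring_index G (enum_val a * g)%g).
Proof.
by move=> Gg; apply: enum_val_inj; rewrite !tr_ix_val !gring_indexK ?groupM ?subgP ?enum_valP // mulgA.
Qed.
Lemma tau_mxP h : tau_mx h \in intertw (FunG k G) (FunG k G).
Proof.
apply/intertwP => g Gg; apply/matrixP => i j; rewrite tau_mxl -[j](@tr_ixK h^-1%g) invgK tau_mxr.
by rewrite !FunG_E tr_ix_mulg // (inj_eq (@tr_ix_inj h)).
Qed.
Definition s_mx : 'M[k]_(n, n * n) := \matrix_(i, j) d (ix i i) j.
Lemma s_mxl p (A : 'M[k]_(n * n, p)) i j : (s_mx *m A) i j = A (ix i i) j.
Proof. by rewrite mxE; under eq_bigr do rewrite mxE; rewrite sum_deltal. Qed.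
Lemma s_mxE i a b : s_mx i (ix a b) = d i a * d i b.
Proof. by rewrite mxE (can_eq (@mxtens_indexK _ _)) xpair_eqE -natrM mulnb. Qed.
Lemma s_mxr p (A : 'M[k]_(p, n)) i a b : (A *m s_mx) i (ix a b) = A i a * d a b.
Proof.
rewrite mxE; under eq_bigr do rewrite s_mxE mulrA.
rewrite sum_deltar; case: (a =P b) => [->|/eqP ab]; first by rewrite eqxx.
by rewrite eq_sym (negPf ab) !mulr0.
Qed.
Lemma s_tensl p q (A : 'M[k]_(n * n * q, p)) a b j : ((s_mx *t 1%:M) *m A) (ix a b) j = A (ix (ix a a) b) j.
Proof.
rewrite mxE sum_mxtens; transitivity (\sum_c d (ix a a) c * \sum_e d b e * A (ix c e) j).
  apply: eq_bigr => c _; rewrite mulr_sumr; apply: eq_bigr => e _.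
  by rewrite tensmxE !mxE mulrA.
by rewrite !sum_deltal.
Qed.
Lemma runit_mxl p m (A : 'M[k]_(m, p)) a o j : (runit_mx k m *m A) (ix a o) j = A a j.
Proof. by rewrite mxE; under eq_bigr do rewrite runit_mxE; rewrite sum_deltal. Qed.
Lemma s_mxP : s_mx \in intertw (FunG k G) (rep_ten (FunG k G) (FunG k G)).
Proof.
apply/intertwP => g Gg; apply/matrixP => i j; case: j / (mxtens_indexP j) => a b.
rewrite s_mxr s_mxl [RHS]tensmxE !FunG_E -!natrM !mulnb; congr (_%:R).
by case: eqP => [->|] //=; rewrite eq_sym.
Qed.
Definition tauF h : mor (RepG k G) FG FG := vsproj (intertw FG FG) (tau_mx h).
Definition sF : mor (RepG k G) FG (FG \ox FG) := vsproj (intertw FG (rep_ten FG FG)) s_mx.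
Lemma vsval_tau h : vsval (tauF h) = tau_mx h. Proof. exact: vsprojK (tau_mxP h). Qed.
Lemma vsval_s : vsval sF = s_mx. Proof. exact: vsprojK s_mxP. Qed.

Lemma vsval_sum (U V : RepG k G) (I : finType) (f : I -> mor (RepG k G) U V) : vsval (\sum_i f i) = \sum_i vsval (f i).
Proof. exact: linear_sum. Qed.

Lemma FunG_galois : galois_alg (FunG_mul k G) (FunG_unit k G) tauF sF.
Proof.
have [As Al] := @assoc_mx_bij k n n n; have [Br Bl] := @braid_mx_bij k n n.
split.
- exact: FunG_assoc.
- exact: FunG_lunit.
- apply: val_inj; rewrite [LHS]vsval_comp [RHS]vsval_mul vsval_mul vsval_braid; apply/matrixP=> i j.
  by case: i / (mxtens_indexP i) => a b; rewrite Bl !mul_mxE mulrC.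
- exact: RepG_symmetric.
- by apply: val_inj; rewrite [LHS]vsval_tau [RHS]vsval_id; apply/matrixP=> i j; rewrite !mxE tr_ix1.
- move=> g h; apply: val_inj; rewrite [LHS]vsval_comp [RHS]vsval_tau !vsval_tau; apply/matrixP=> i j.
  by rewrite tau_mxl !mxE tr_ixM.
- move=> g; apply: val_inj; rewrite [LHS]vsval_comp [RHS]vsval_comp vsval_tenm vsval_mul vsval_tau.
  apply/matrixP=> i j; case: i / (mxtens_indexP i) => a b; rewrite mul_mxl mul_mxr tensmxE !mxE.
  rewrite -!natrM !mulnb; congr (_%:R); case: (a =P b) => [->|ab] /=; first by rewrite andbb.
  by rewrite (_ : _ && _ = false) //; apply/negbTE/negP=> /andP[/eqP <- /eqP/tr_ix_inj/esym].
- move=> g; apply: val_inj; rewrite [LHS]vsval_comp [RHS]vsval_unit vsval_unit vsval_tau; apply/matrixP=> i j.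
  by rewrite -[j](tr_ixK g^-1%g) invgK tau_mxr !mxE.
- apply: val_inj; rewrite [LHS]vsval_comp [RHS]vsval_id vsval_mul vsval_s; apply/matrixP=> i j.
  by rewrite s_mxl mul_mxE mxE -natrM mulnb andbb.
- apply: val_inj; rewrite [LHS]vsval_comp [RHS]vsval_s vsval_s vsval_braid; apply/matrixP=> i j.
  by case: j / (mxtens_indexP j) => a b; rewrite Br !s_mxE mulrC.
- apply: val_inj; rewrite [LHS]vsval_comp [RHS]vsval_comp !vsval_comp !vsval_tenm vsval_id vsval_mul vsval_s vsval_assoc.
  apply/matrixP=> i j; case: i / (mxtens_indexP i) => a b; case: j / (mxtens_indexP j) => x y.
  rewrite mul_mxl s_mxE -mulmxA s_tensl Al tensmxE mul_mxE [_%:M _ _]mxE -!natrM !mulnb; congr (_%:R).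
  case: (a =P b) => [->|/eqP ab] /=; first by rewrite andbb.
  by case: (a =P y) => [<-|_]; rewrite ?andbF //= [b == a]eq_sym (negPf ab) andbF.
- move=> g; apply: val_inj; rewrite [LHS]vsval_comp [RHS]vsval_comp vsval_tenm vsval_s vsval_tau.
  apply/matrixP=> i j; case: j / (mxtens_indexP j) => x y.
  by rewrite tau_mxl s_mxl tensmxE s_mxE !mxE.
- move=> g g1; apply: val_inj; rewrite [LHS]vsval_comp vsval_comp vsval_tenm vsval_s vsval_tau vsval_mul vsval_id.
  rewrite [RHS]linear0; apply/matrixP=> i j; rewrite -mulmxA s_mxl mul_mxr tensmxE !mxE -natrM mulnb.
  case: (tr_ix g i =P j) => //= e1; case: (i =P j) => //= e2; case/eqP: g1; apply: val_inj => /=.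
  by apply: (mulIg (enum_val i)); rewrite mul1g -tr_ix_val e1 e2.
- apply: val_inj; rewrite [LHS]vsval_comp [RHS]vsval_tenm vsval_sum vsval_id vsval_unit.
  have -> : vsval (runit FG) = runit_mx k n by exact: vsprojK (runit_mxP FG).
  apply/matrixP=> i j; case: i / (mxtens_indexP i) => a o; case: j / (mxtens_indexP j) => x y.
  (* The only translation that takes a to y. *)
  rewrite runit_mxl summxE tensmxE !mxE mulr1 (bigD1 (subg G (enum_val y * (enum_val a)^-1)%g)) //.
  have e0 : tr_ix (subg G (enum_val y * (enum_val a)^-1)%g) a = y.
    apply: enum_val_inj; rewrite tr_ix_val subgK ?mulgKV //.
    by rewrite groupM ?groupV ?enum_valP.
  rewrite vsval_comp vsval_tenm vsval_s vsval_tau vsval_id s_mxl tensmxE !mxE e0 eqxx mulr1.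
  rewrite big1 => [|g /andP[_ gn]]; first by rewrite /= addr0.
  rewrite vsval_comp vsval_tenm vsval_s vsval_tau vsval_id s_mxl tensmxE !mxE.
  case: (tr_ix g a =P y) => e; last by rewrite mulr0.
  case/eqP: gn; apply: val_inj; rewrite /= subgK ?groupM ?groupV ?enum_valP //.
  by rewrite -e tr_ix_val mulgK.
apply: (vect_line (v := FunG_unit k G)).
  apply/eqP=> e; have := congr1 (fun w : mor (RepG k G) (one _) FG => vsval w ord0 (gring_index G 1%g)) e.
  by rewrite vsval_unit [vsval 0]linear0 !mxE => /eqP; rewrite oner_eq0.
(* An invariant function is determined by its value at the identity. *)
move=> w; exists (vsval w ord0 (gring_index G 1%g)); apply: val_inj; rewrite /= -[val (FunG_unit k G)]/(vsval _) vsval_unit.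
apply/matrixP=> i j; rewrite ord1 !mxE mulr1.
have /intertwP/(_ _ (enum_valP j))/matrixP/(_ ord0 j) := subvsP w.
rewrite /= mul1mx => ->; rewrite mxE (bigD1 (gring_index G 1%g)) //= big1 ?addr0 => [|a an].
  by rewrite FunG_E gring_indexK // mul1g gring_valK eqxx mulr1.
rewrite FunG_E; case: eqP => [e|]; last by rewrite mulr0.
case/eqP: an; apply: enum_val_inj; rewrite gring_indexK //.
move/(congr1 enum_val): e; rewrite gring_indexK ?groupM ?enum_valP // => /(canLR (mulgK _)).
by rewrite mulgV.
Qed.
End FunGalois.

(** * Centralizers as fusion subcategories *)

Section CentralizerSubcat.
Local Open Scope cat_scope.
Context (k : closedFieldType) (C : bmcat k) (hC : braided_fusion C).
Local Notation hL := (bf_linear hC).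
Local Notation hM := (bf_monoidal hC).
Local Notation hB := (bf_braided hC).
Let cA := comp_assoc hL.
Let c1l := comp_idl hL.
Let c1r := comp_idr hL.
Let wM := wlM hL hM.
Let p2 := post2 hL.
Let p3 := post3 hL.
Implicit Types X Y Z A : C.

Lemma ch_cancel A X Z : centralizes A X -> ch X A Z \oc ch A X Z = idm _.
Proof. by move=> AX; rewrite -dblE; apply: (dbl_centralizes hL hM). Qed.

Lemma centralizes_one A : centralizes A (one C).
Proof.
apply: (centralizes_dbl hL hM); apply: (iso_cancel_l hL (wl_iso hL hM A (lunit_iso hM (one C)))).
by rewrite dblE -cA (chL_lunit hL hM hB) (chR_lunit hL hM hB) c1r.
Qed.

(* The braiding and its inverse carry the zigzag of X and Y past A, so the
   double braiding of A with one of them is the identity as soon as the other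
   one is. *)
Lemma centralizes_dual A X Y : left_dual X Y -> (centralizes A X <-> centralizes A Y).
Proof.
move=> /(dual_zigzag hL hM)[ev [coev [z1 z2]]]; split=> AX.
  have chAX Z : ch A X Z \oc ch X A Z = idm _ := ch_cancel Z (centralizes_sym hC AX).
  apply: (centralizes_dbl hL hM); set Z := one C.
  pose ga := ch A X (Y \ox Z) \oc (idm A \om hc coev Z).
  have ga1 : ga = (idm X \om ch Y A Z) \oc hc coev (A \ox Z).
    by rewrite /ga -(chLc hL hM hB) (p2 (chAX _)) c1l.
  have ga2 : (idm X \om dbl A Y Z) \oc ga = ga by rewrite dblE wM cA (chRc hL hM hB) -ga1.
  have ga3 : he ev (A \ox (Y \ox Z)) \oc (idm Y \om ga) = ch Y A Z.
    by rewrite ga1 wM (p2 (hen hL hM _ _)) cA z2 c1r.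
  apply: (iso_cancel_r hL (ch_iso hL hM hB Y A Z)); rewrite c1l -[in RHS]ga3 -ga2 wM.
  by rewrite (p2 (hen hL hM _ _)) cA ga3.
have chAY Z : ch Y A Z \oc ch A Y Z = idm _ := ch_cancel Z AX.
apply: (centralizes_dbl hL hM); set Z := one C.
pose de := (idm A \om he ev Z) \oc ch Y A (X \ox Z).
have de1 : de = he ev (A \ox Z) \oc (idm Y \om ch A X Z).
  have chYA Z' : ch A Y Z' \oc ch Y A Z' = idm _ := ch_cancel Z' (centralizes_sym hC AX).
  by rewrite /de -(chRe hL hM hB) !cA chYA c1r.
have de2 : de \oc (idm Y \om dbl A X Z) = de by rewrite dblE wM /de !cA (p3 (chLe hL hM hB _ _ _)) -de1.
have de3 : (idm X \om de) \oc hc coev (A \ox (X \ox Z)) = ch A X Z.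
  by rewrite de1 wM cA -(hcn hL hM) (p2 (z1 _)) c1l.
apply: (iso_cancel_l hL (ch_iso hL hM hB A X Z)); rewrite c1r -[in RHS]de3 -de2 wM cA -(hcn hL hM).
by rewrite -cA de3.
Qed.

Lemma centralizes_fsub A : is_fusion_subcat (fun X => centralizes A X).
Proof.
have mon1 X : centralizes A X <-> mon A X 1 by rewrite /mon scale1r.
split.
- exact: centralizes_one.
- move=> X Y /mon1 AX /mon1 AY; apply/mon1; rewrite -[1](mulr1 1); exact: (mon_tenr hC).
- move=> n T X AT [i [p [pi p0 ip]]]; rewrite /centralizes.
  rewrite -[LHS]c1r -(tenm_id hM) -ip (tenm_sumr hM) (comp_sumr hL); apply: eq_bigr => a _.
  rewrite wM !cA (p2 (braid_nat hB (idm A) (i a))) !cA (p2 (braid_nat hB (i a) (idm A))) !cA.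
  by rewrite (p2 (AT a)) c1l.
- by move=> X Y i p pi; apply: centralizes_ret pi.
exact: centralizes_dual.
Qed.

(** The centralizer is defined by generators, and the objects that centralize X form a fusion
    subcategory containing them. *)
Lemma centralizer_centralizes (E : fusion_subcat C) X Y : simple_obj X -> E X -> centralizer E Y -> centralizes X Y.
Proof.
move=> Xs EX /(_ (FusionSubcat (centralizes_fsub X))) /=; apply=> Z [_ ZE].
exact: ZE.
Qed.
End CentralizerSubcat.

(** * External products of single objects in the Deligne product *)

Section Singletons.
Local Open Scope cat_scope.
Context (k : fieldType) (C D : bmcat k) (hC : premonoidal C) (hD : premonoidal D).
Local Notation Del := (deligne C D).
Local Notation cb := (tbil (@comp k C _ _ _) (@comp k D _ _ _)).
Local Notation tb := (tbil (@tenm k C _ _ _ _) (@tenm k D _ _ _ _)).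

(** The index type I is a parameter, always with one element in use, because tensor products of such
    objects are indexed by [unit * unit] and so on. *)
Definition sing (I : finType) (x : C) (y : D) : Del := @DObj k C D I (fun _ => x) (fun _ => y).
Definition smor (I J : finType) (j0 : J) x y x' y' (t : tsp (mor C x x') (mor D y y')) : mor Del (sing I x y) (sing J x' y') :=
  @dgraph k C D (sing I x y) (sing J x' y') (fun _ => j0) (fun _ => t).

Lemma smorE (I J : finType) (j0 : J) x y x' y' (t : tsp (mor C x x') (mor D y y')) i : (smor I j0 t : dmor _ _) (i, j0) = t.
Proof. exact: (@dgraph_on _ _ _ (sing I x y) (sing J x' y') (fun _ => j0) (fun _ => t) i). Qed.

Lemma smor_entry (I J : finType) (i0 : I) (j0 : J) (i1 : forall i, i = i0) (j1 : forall j, j = j0) x y x' y'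
    (f : mor Del (sing I x y) (sing J x' y')) : f = smor I j0 ((f : dmor _ _) (i0, j0)).
Proof. by apply/ffunP=> -[i j]; rewrite (i1 i) (j1 j) smorE. Qed.
Lemma smor_ext (I J : finType) (i0 : I) (j0 : J) (i1 : forall i, i = i0) (j1 : forall j, j = j0) x y x' y'
    (f g : mor Del (sing I x y) (sing J x' y')) : (f : dmor _ _) (i0, j0) = (g : dmor _ _) (i0, j0) -> f = g.
Proof. by move=> e; rewrite (smor_entry i1 j1 f) (smor_entry i1 j1 g) e. Qed.

Lemma smorZ (I J : finType) (j0 : J) x y x' y' a (t : tsp (mor C x x') (mor D y y')) :
  smor I j0 (a *: t) = a *: smor I j0 t.
Proof.
apply/ffunP=> -[i j]; rewrite -[a *: smor I j0 t]/(dp_scale a (smor I j0 t : dmor _ _)) /dp_scale [RHS]ffunE.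
have [->|jj] := eqVneq j j0; first by rewrite !smorE.
by rewrite !(@dgraph_off _ _ _ (sing I x y) (sing J x' y') (fun _ => j0)) ?scaler0 // eq_sym.
Qed.

Lemma smor_comp (I J L : finType) (i0 : I) (j0 : J) (l0 : L) (i1 : forall i, i = i0) (l1 : forall l, l = l0)
    x y x' y' x'' y'' (t : tsp (mor C x' x'') (mor D y' y'')) (t' : tsp (mor C x x') (mor D y y')) :
  smor J l0 t \oc smor I j0 t' = smor I l0 (cb t t').
Proof.
apply: (smor_ext i1 l1); rewrite smorE /smor.
rewrite (@dcomp_graphr _ _ _ (sing I x y) (sing J x' y') (sing L x'' y'') (fun _ => j0)).
by congr (tbil _ _ _ _); apply: (@smorE J L l0 x' y' x'' y'').
Qed.
Lemma smor_id (I : finType) (i0 : I) (i1 : forall i, i = i0) x y :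
  smor I i0 (tpure (idm x) (idm y)) = idm (sing I x y).
Proof.
apply: (smor_ext i1 i1); rewrite smorE /=.
by rewrite (@dgraph_on _ _ _ (sing I x y) (sing I x y) id).
Qed.
Lemma smor_ten (I J I' J' : finType) (i0 : I) (i0' : I') (j0 : J) (j0' : J')
    (i1 : forall i, i = i0) (j1 : forall j, j = j0) (i1' : forall i, i = i0') (j1' : forall j, j = j0')
    x y x' y' z w z' w'
    (t : tsp (mor C x x') (mor D y y')) (t' : tsp (mor C z z') (mor D w w')) :
  smor I j0 t \om smor I' j0' t' = smor (I * I')%type ((j0, j0') : (J * J')%type) (tb t t').
Proof.
have e1 (p : (I * I')%type) : p = (i0, i0') by case: p => a b; rewrite (i1 a) (i1' b).
have e2 (p : (J * J')%type) : p = (j0, j0') by case: p => a b; rewrite (j1 a) (j1' b).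
apply: (@smor_ext (I * I')%type (J * J')%type (i0, i0') (j0, j0') e1 e2 (x \ox z) (y \ox w) (x' \ox z') (y' \ox w')).
by rewrite smorE /= /dtenm ffunE /= !smorE.
Qed.
Lemma smor_braid (I J : finType) (i0 : I) (j0 : J) (i1 : forall i, i = i0) (j1 : forall j, j = j0) x y z w :
  braid (sing I x y) (sing J z w)
    = smor (I * J)%type ((j0, i0) : (J * I)%type) (tpure (braid x z) (braid y w)) :> mor Del (sing (I * J)%type (x \ox z) (y \ox w)) (sing (J * I)%type (z \ox x) (w \ox y)).
Proof.
have e1 (p : (I * J)%type) : p = (i0, j0) by case: p => a b; rewrite (i1 a) (j1 b).
have e2 (p : (J * I)%type) : p = (j0, i0) by case: p => a b; rewrite (j1 a) (i1 b).
apply: (@smor_ext (I * J)%type (J * I)%type (i0, j0) (j0, i0) e1 e2 (x \ox z) (y \ox w) (z \ox x) (w \ox y)).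
rewrite smorE.
exact: (@dgraph_on _ _ _ (dten (sing I x y) (sing J z w)) (dten (sing J z w) (sing I x y)) (fun p => (p.2, p.1)) (fun p => tpure (braid x z) (braid y w)) (i0, j0)).
Qed.
Lemma smor_assoc (I J L : finType) (i0 : I) (j0 : J) (l0 : L)
    (i1 : forall i, i = i0) (j1 : forall j, j = j0) (l1 : forall l, l = l0) x y x' y' x'' y'' :
  assoc (sing I x y) (sing J x' y') (sing L x'' y'')
    = smor (I * J * L)%type ((i0, (j0, l0)) : (I * (J * L))%type) (tpure (assoc x x' x'') (assoc y y' y''))
    :> mor Del (sing (I * J * L)%type (x \ox x' \ox x'') (y \ox y' \ox y''))
               (sing (I * (J * L))%type (x \ox (x' \ox x'')) (y \ox (y' \ox y''))).
Proof.
have e1 (p : (I * J * L)%type) : p = (i0, j0, l0) by case: p => [[a b] c]; rewrite (i1 a) (j1 b) (l1 c).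
have e2 (p : (I * (J * L))%type) : p = (i0, (j0, l0)) by case: p => [a [b c]]; rewrite (i1 a) (j1 b) (l1 c).
apply: (@smor_ext _ _ (i0, j0, l0) (i0, (j0, l0)) e1 e2); rewrite smorE.
exact: (@dgraph_on _ _ _ (dten (dten (sing I x y) (sing J x' y')) (sing L x'' y''))
  (dten (sing I x y) (dten (sing J x' y') (sing L x'' y''))) (fun p => (p.1.1, (p.1.2, p.2)))
  (fun p => tpure (assoc x x' x'') (assoc y y' y'')) (i0, j0, l0)).
Qed.
Lemma smor_lunit (I : finType) (i0 : I) (i1 : forall i, i = i0) x y :
  lunit (sing I x y) = smor (unit * I)%type i0 (tpure (lunit x) (lunit y))
    :> mor Del (sing (unit * I)%type (one C \ox x) (one D \ox y)) (sing I x y).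
Proof.
have e1 (p : (unit * I)%type) : p = (tt, i0) by case: p => -[] b; rewrite (i1 b).
apply: (@smor_ext _ _ (tt, i0) i0 e1 i1); rewrite smorE.
exact: (@dgraph_on _ _ _ (dten (done C D) (sing I x y)) (sing I x y) (fun p => p.2) (fun p => tpure (lunit x) (lunit y)) (tt, i0)).
Qed.
Lemma smor_runit (I : finType) (i0 : I) (i1 : forall i, i = i0) x y :
  runit (sing I x y) = smor (I * unit)%type i0 (tpure (runit x) (runit y))
    :> mor Del (sing (I * unit)%type (x \ox one C) (y \ox one D)) (sing I x y).
Proof.
have e1 (p : (I * unit)%type) : p = (i0, tt) by case: p => b -[]; rewrite (i1 b).
apply: (@smor_ext _ _ (i0, tt) i0 e1 i1); rewrite smorE.
exact: (@dgraph_on _ _ _ (dten (sing I x y) (done C D)) (sing I x y) (fun p => p.1) (fun p => tpure (runit x) (runit y)) (i0, tt)).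
Qed.

Lemma smor_inv (I J : finType) (i0 : I) (j0 : J) (i1 : forall i, i = i0) (j1 : forall j, j = j0)
    x y x' y' (f : mor C x x') f' (g : mor D y y') g' : inverse_of f f' -> inverse_of g g' ->
  inverse_of (smor I j0 (tpure f g)) (smor J i0 (tpure f' g')).
Proof.
move=> [f1 f2] [g1 g2]; split.
  by rewrite (smor_comp j0 i1 i1) (cb_pure hC hD) f1 g1 (smor_id i1).
by rewrite (smor_comp i0 j1 j1) (cb_pure hC hD) f2 g2 (smor_id j1).
Qed.
Lemma sing_iso (I J : finType) (i0 : I) (j0 : J) (i1 : forall i, i = i0) (j1 : forall j, j = j0) x y x' y' :
  isomorphic x x' -> isomorphic y y' -> isomorphic (sing I x y) (sing J x' y').
Proof.
move=> [f [f' ff]] [g [g' gg]]; exists (smor I j0 (tpure f g)), (smor J i0 (tpure f' g')).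
exact: smor_inv i1 j1 _ _ _ _ _ _ _ _ ff gg.
Qed.
End Singletons.

(** * The local module given by the pointed factor *)

Section LocalModules.
Local Open Scope cat_scope.
Context (k : closedFieldType) (C : bmcat k) (hC : braided_fusion C).
Local Notation hL := (bf_linear hC).
Local Notation hM := (bf_monoidal hC).
Local Notation hB := (bf_braided hC).
Local Notation sp := (fus_split hC).
Context (H : finGroupType) (R : C) (m : mor C (R \ox R) R) (u : mor C (one C) R)
  (tau : H -> mor C R R) (s : mor C R (R \ox R)) (hG : galois_alg m u tau s).
Let cA := comp_assoc hL.
Let c1l := comp_idl hL.
Let c1r := comp_idr hL.
Let wM := wlM hL hM.
Let wR := wrM hL hM.
Let p2 := post2 hL.
Local Notation "''R' f" := (idm R \om f) (at level 30, f at level 30).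
Local Notation rmod := (rmod m u).
Local Notation na N := (h2 (mact N)).
Local Notation T := (T hG).
Local Notation tens := (tens hL hM hB hG sp).
Local Notation tp := (tp hL hM hB hG sp).
Local Notation ti := (ti hL hM hB hG sp).
Local Notation "K ~= N" := (@isomorphic k T K N) (at level 70).
Local Notation rbrick N := (@brick k T N).
Implicit Types K N L M : rmod.
Local Notation loc := (sec tau 1%g).
Local Notation isq := (isq hC hG).
Context (S : fusion_subcat C) (R_in : S R) (R_mod : is_module m u m) (S_loc : forall X, S X -> centralizes R X).
Local Notation CG := (@modcat k C S R m u R_in R_mod).
Local Notation smod := (@amod k C S R m u).

Definition toT (M : smod) : rmod := @AMod k C (whole C) R m u (mcar M) (mact M) Logic.I (mactP M).

Lemma aval_comp (M N L : CG) (g : mor CG N L) (f : mor CG M N) : vsval (g \oc f) = vsval g \oc vsval f.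
Proof.
apply: vsprojK; apply/(amorP hL hM); have /(amorP hL hM) e1 := subvsP f; have /(amorP hL hM) e2 := subvsP g.
by rewrite cA e1 -cA e2 cA -wM.
Qed.
Lemma aval_id (M : CG) : vsval (idm M) = idm (mcar M).
Proof. by apply: vsprojK; apply/(amorP hL hM); rewrite c1l (wl_id hM) c1r. Qed.

Lemma toT_iso (M N : CG) : isomorphic M N -> toT M ~= toT N.
Proof.
case=> f [g [gf fg]]; apply/(T_iso hL hM); exists (vsval f), (vsval g); split.
- by apply/(amorP hL hM); apply: subvsP.
- by apply/(amorP hL hM); apply: subvsP.
by split; rewrite -aval_comp ?gf ?fg aval_id.
Qed.

Lemma toT_loc (M : smod) : loc (toT M).
Proof. by apply/(locP hC hG) => Z; rewrite (dbl_centralizes hL hM _ (S_loc (mcar_in M))) c1r. Qed.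

Lemma ract_braid (M : smod) : ract M \oc braid R M = mact M.
Proof. by rewrite /ract cA (S_loc (mcar_in M)) c1r. Qed.

Lemma bal_ract (M N : smod) (Z : C) (h : mor C (M \ox N) Z) :
  h \oc na (toT M) (toT N) = h \oc n2 (toT M) (toT N)
  <-> h \oc (ract M \om idm (N : C)) = h \oc (idm (M : C) \om mact N) \oc assoc M R N.
Proof.
have n1' : na (toT M) (toT N) = ((ract M \om idm (N : C)) \oc (braid R M \om idm (N : C))) \oc ai R M N.
  by rewrite n1E -wR ract_braid.
have n2' : n2 (toT M) (toT N) = ((idm (M : C) \om mact N) \oc assoc M R N \oc (braid R M \om idm (N : C))) \oc ai R M N.
  by rewrite (n2E hL).
rewrite n1' n2'; split=> [E|E]; last by rewrite !cA (p2 E) !cA.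
apply: (iso_cancel_r hL (wr_iso hL hM N (braid_iso hB R M))).
by apply: (iso_cancel_r hL (ai_iso hM R M N)); rewrite !cA in E *.
Qed.

(** The choice made by [epsilon] in [aten_data] is a correct one, since [tens] supplies a candidate,
    whose underlying object lies in S as a retract of M (x) N. *)
Lemma aten_spec (M N : smod) : is_tensor_over (aproj M N).
Proof.
have TP := tensP hL hM hB hG sp (toT M) (toT N).
have Tin : S (tens (toT M) (toT N)).
  exact: (fsub_retract (fsubP S) (q_pi TP) (fsub_ten (fsubP S) (mcar_in M) (mcar_in N))).
pose T0 : smod := @AMod k C S R m u (tens (toT M) (toT N) : C) (mact (tens (toT M) (toT N))) Tin (mactP (tens (toT M) (toT N))).
have := @epsilon_spec _ (inhabits (existT (fun T : smod => mor C (M \ox N) T) M 0)) (fun T => is_tensor_over (projT2 T)).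
apply; exists (existT (fun T : smod => mor C (M \ox N) T) T0 (tp (toT M) (toT N))); split; [split|] => /=.
- exact/(bal_ract (M := M) (N := N))/(tp_n12 hL hM hB hG sp (toT M) (toT N)).
- move=> Z h /bal_ract Eb.
  exists (h \oc ti (toT M) (toT N)); split; first by rewrite cA (tip_id hL hM hB hG sp Eb).
  by move=> g gE; apply: (@tp_epi _ _ hL hM hB _ _ _ _ _ _ hG sp (toT M) (toT N)); rewrite cA (tip_id hL hM hB hG sp Eb).
have := tp_n1 hL hM hB hG sp (toT M) (toT N); rewrite n1E => e.
by rewrite -[LHS]cA e !cA (ai_as hM) c1r.
Qed.

(** Both objects are coequalizers of the same pair of maps. *)
Lemma aten_tens (M N : smod) : exists f : mor C (tens (toT M) (toT N)) (aten M N),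
  [/\ @rl k C R m u (tens (toT M) (toT N)) (toT (aten M N)) f, f \oc tp (toT M) (toT N) = aproj M N & is_iso f].
Proof.
have [[Ec Eu] El] := aten_spec M N.
have Eb := (bal_ract (aproj M N)).2 Ec.
have Eln : mact (toT (aten M N)) \oc 'R (aproj M N) = aproj M N \oc na (toT M) (toT N).
  by apply: (iso_cancel_r hL (assoc_iso hM R M N)); rewrite n1E !cA [LHS]El (ai_as hM) c1r.
have [f [fl fp]] := tens_ind hL hM hB hG sp (L := toT (aten M N)) Eb Eln.
exists f; split=> //.
have Tc := (bal_ract (tp (toT M) (toT N))).1 (tp_n12 hL hM hB hG sp (toT M) (toT N)).
have [g [gp _]] := Eu _ _ Tc; exists g; split.
  by apply: (@tp_epi _ _ hL hM hB _ _ _ _ _ _ hG sp (toT M) (toT N)); rewrite cA fp gp c1l.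
have [h [_ hu]] := Eu _ _ Ec.
by rewrite -(hu (f \oc g)) ?(hu (idm _)) ?c1l // cA gp fp.
Qed.

Lemma ten_toT (M N : CG) : toT (M \ox N) ~= tens (toT M) (toT N).
Proof.
have [f [fl _ fi]] := aten_tens M N; apply: isomorphic_sym.
exact: (@riso _ _ hC _ _ _ _ _ _ hG (tens (toT M) (toT N)) (toT (aten M N)) f fl fi).
Qed.

Lemma braid_isq (M : CG) c : rbrick (tens (toT M) (toT M)) -> braid M M = c *: idm (M \ox M) -> isq (toT M) c.
Proof.
move=> Mb E; have [c' [_ E']] := isq_ex (toT_loc M) Mb.
have [f [fl fp fi]] := aten_tens M M.
have Ap : aproj M M \oc braid (mcar M) (mcar M) = c' *: aproj M M by rewrite -fp cA E' (compZr hL).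
pose Pb := fun h : mor C (aten M M) (aten M M) => h \oc aproj M M = aproj M M \oc braid (mcar M) (mcar M).
have hb : Pb (vsval (braid M M : mor CG (M \ox M) (M \ox M))).
  apply: (epsilon_spec (inhabits (0 : subvs_of (amor (aten M M) (aten M M)))) (fun f => Pb (vsval f))).
  exists (vsproj (amor (aten M M) (aten M M)) (c' *: idm (mcar (aten M M)))).
  rewrite vsprojK /Pb ?(compZl hL) ?c1l ?Ap //; apply/(amorP hL hM).
  by rewrite (compZl hL) (tenmZr hM) (wl_id hM) (compZr hL) c1l c1r.
have vE : vsval (braid M M : mor CG (M \ox M) (M \ox M)) = c *: idm (mcar (aten M M)).
  by rewrite E linearZ /= -[vsproj _ _]/(idm (M \ox M : CG)) aval_id.
move: hb; rewrite /Pb vE (compZl hL) c1l Ap => /eqP; rewrite -subr_eq0 -scalerBl scaler_eq0 subr_eq0.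
case/orP=> [/eqP -> //|/eqP p0]; case: (tp_neq0 Mb); rewrite -fp in p0.
by apply: (iso_cancel_l hL fi); rewrite (comp0r hL).
Qed.
End LocalModules.

Lemma reflect_iso (k : fieldType) (C D : bmcat k) (F : bfunctor C D) (X Y : C) : is_equivalence F ->
  isomorphic (F X) (F Y) -> isomorphic X Y.
Proof.
case=> Fb _ [f [g [gf fg]]].
have [f' ff'] : exists f', fmap F f' = f by have [Fi _ FK] := Fb X Y; exists (Fi f).
have [g' gg'] : exists g', fmap F g' = g by have [Fi _ FK] := Fb Y X; exists (Fi g).
exists f', g'; split.
  by apply: (bij_inj (Fb X X)); rewrite (fmap_comp F) (fmap_id F) ff' gg'.
by apply: (bij_inj (Fb Y Y)); rewrite (fmap_comp F) (fmap_id F) ff' gg'.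
Qed.

Section LocalModule.
Local Open Scope cat_scope.
Context (k : closedFieldType) (C : bmcat k) (hC : braided_fusion C).
Local Notation hL := (bf_linear hC).
Local Notation hM := (bf_monoidal hC).
Local Notation hB := (bf_braided hC).
Local Notation sp := (fus_split hC).
Context (H : finGroupType) (R : C) (m : mor C (R \ox R) R) (u : mor C (one C) R)
  (tau : H -> mor C R R) (s : mor C R (R \ox R)) (hG : galois_alg m u tau s).
Local Notation "''R' f" := (idm R \om f) (at level 30, f at level 30).
Local Notation rmod := (rmod m u).
Local Notation T := (T hG).
Local Notation Rm := (Rm hL hM hG).
Local Notation tens := (tens hL hM hB hG sp).
Local Notation "K ~= N" := (@isomorphic k T K N) (at level 70).
Implicit Types K N L M : rmod.
Local Notation loc := (sec tau 1%g).
Local Notation isq := (isq hC hG).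
Local Notation pw := (pw hC hG).
Local Notation W := (@weight k C R m u).
Local Notation gam := (FPdim R).
Context (S : fusion_subcat C) (R_in : S R) (R_mod : is_module m u m) (S_loc : forall X, S X -> centralizes R X).
Local Notation CG := (@modcat k C S R m u R_in R_mod).
Context (d : nat) (d_gt0 : (0 < d)%N) (q : Zmod d -> k) (P : bmcat k) (hP : is_CBq q P) (A : bmcat k) (hA : braided_fusion A).
Context (F : bfunctor CG (deligne P A)) (hF : is_equivalence F).

(** L 0 is isomorphic to its own tensor square, so it has dimension 1 and can be cancelled. *)
Lemma pointed_unit (L : Zmod d -> P) : braided_fusion P -> (forall b, simple_obj (L b)) ->
  (forall b b', isomorphic (L b \ox L b') (L (b + b'))) -> isomorphic (L 0) (one P).
Proof.
move=> bP Ls LM; have L0b := (simpleE bP (L 0)).1 (Ls 0).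
have e0 : isomorphic (L 0 \ox L 0) (L 0) by have := LM 0 0; rewrite addr0.
have F1 : FPdim (L 0) = 1.
  have /lt0r_neq0 F0 := FPdim_gt0 bP (nz_brick L0b).
  by apply: (mulfI F0); rewrite -(FPdim_ten bP) (FPdim_iso bP e0) mulr1.
have tr := isomorphic_trans (bf_linear bP).
have [A' [_ eA]] := invertible_cancel bP F1.
apply: (tr _ _ _ (isomorphic_sym (eA (L 0)))); apply: (tr _ _ _ _ (eA (one P))).
apply: (isomorphic_ten (bf_monoidal bP)); first exact: (isomorphic_refl (bf_linear bP)).
apply: (tr _ _ _ e0); apply: isomorphic_sym; exists (runit (L 0)); exact: (runit_iso (bf_monoidal bP)).
Qed.

(** M corresponds to the external product of L 1 with the unit of A; fusion rules and self-braiding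
    are carried back along the equivalence. *)
Lemma local_module : exists M : rmod, [/\ loc M, W M = gam, pw M d ~= Rm & isq M (q (inord 1))].
Proof.
have [bP [L [Ls Linj _ LM Lq]]] := hP.
have pP := monoidal_pre (bf_linear bP) (bf_monoidal bP) (bf_braided bP).
have pA := monoidal_pre (bf_linear hA) (bf_monoidal hA) (bf_braided hA).
have pD := deligne_pre pP pA; have DL := pm_linear pD.
have trD := isomorphic_trans DL; have tr := isomorphic_trans (TL hC hG).
pose e (I : finType) b := sing I (L b) (one A).
have eI (I J : finType) (i0 : I) (j0 : J) b : (forall i, i = i0) -> (forall j, j = j0) -> isomorphic (e I b) (e J b).
  by move=> i1 j1; apply: (sing_iso pP pA i1 j1); apply: isomorphic_refl; [apply: (bf_linear bP) | apply: (bf_linear hA)].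
have u1 (i : unit) : i = tt by case: i.
have u2 (i : (unit * unit)%type) : i = (tt, tt) by case: i => -[] [].
have Mex b : exists M : CG, isomorphic (F M) (e unit b) by apply: hF.2.
pose M b := proj1_sig (constructive_indefinite_description _ (Mex b)).
have Me b : isomorphic (F (M b)) (e unit b) := proj2_sig (constructive_indefinite_description _ (Mex b)).
have tenD (X X' Y Y' : deligne P A) : isomorphic X X' -> isomorphic Y Y' -> isomorphic (X \ox Y) (X' \ox Y').
  by move=> [f [f' ff]] [g [g' gg]]; exists (f \om g), (f' \om g'); apply: pm_iso.
have MM b b' : toT (M (b + b')) ~= tens (toT (M b)) (toT (M b')).
  have tT := ten_toT hC hG (R_in := R_in) (R_mod := R_mod) S_loc (M b) (M b').
  apply: (tr _ _ _ _ tT); apply: (toT_iso hC hG); apply: (reflect_iso hF).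
  apply: (trD _ _ _ (Me _)); apply: isomorphic_sym.
  apply: (trD _ (F (M b) \ox F (M b'))); first by apply: isomorphic_sym; exists (fmu F (M b) (M b')); apply: (fmu_iso F).
  apply: (trD _ _ _ (tenD _ _ _ _ (Me b) (Me b'))).
  have lA : isomorphic (one A \ox one A) (one A) by exists (lunit (one A)); apply: (lunit_iso (bf_monoidal hA)).
  exact: (@sing_iso k P A pP pA (unit * unit)%type unit (tt, tt) tt u2 u1 _ _ _ _ (LM b b') lA).
have M0 : toT (M 0) ~= Rm.
  apply: (@toT_iso _ _ hC _ _ _ _ _ _ hG _ R_in R_mod (M 0) (one CG)); apply: (reflect_iso hF).
  apply: (trD _ _ _ (Me 0)); apply: (trD _ (one (deligne P A))); last by exists (feps F); apply: (feps_iso F).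
  apply: (@sing_iso _ _ _ pP pA unit unit tt tt u1 u1); last exact: (isomorphic_refl (bf_linear hA)).
  exact: (pointed_unit bP Ls LM).
pose b1 : Zmod d := inord 1.
have Mj j : toT (M (b1 *+ j)) ~= pw (toT (M b1)) j.
  elim: j => [|j IH]; first by rewrite mulr0n.
  rewrite mulrS; apply: (tr _ _ _ (MM _ _)).
  exact: (tens_iso hL hM hB sp (isomorphic_refl (TL hC hG) _) IH).
have b1d : b1 *+ d = 0.
  by rewrite Zp_mulrn; apply: val_inj; rewrite /= -[X in (_ * X)%N](prednK d_gt0) modnMl.
have Md : pw (toT (M b1)) d ~= Rm.
  by apply: (tr _ _ _ _ M0); apply: isomorphic_sym; rewrite -b1d.
(* The dimension of M over R is a nonnegative real number whose d-th power is 1. *)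
have Mg : W (toT (M b1)) = gam.
  have g0 := gam_gt0 hC hG; have W0 : 0 <= W (toT (M b1)) by apply: (FPdim_ge0 hC).
  have Wj j : W (pw (toT (M b1)) j) = gam * (W (toT (M b1)) / gam) ^+ j.
    elim: j => [|j IH]; first by rewrite expr0 mulr1.
    rewrite /= (weight_tensE hC hG) IH exprS; rewrite [RHS]mulrCA -!mulrA; congr (_ * _).
    by rewrite (mulrC gam) divfK ?lt0r_neq0 // mulKf ?lt0r_neq0.
  have := Wj d; rewrite (weight_iso hC Md) => /(congr1 (fun x => gam^-1 * x)).
  rewrite mulKf ?lt0r_neq0 // mulVf ?lt0r_neq0 // => /esym/eqP; rewrite pexpr_eq1 // ?divr_ge0 ?(ltW g0) //.
  by move=> /eqP/(congr1 (fun x => x * gam)); rewrite mul1r mulfVK ?lt0r_neq0.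
exists (toT (M b1)); split=> //; first exact: (toT_loc hC hG S_loc).
apply: (@braid_isq _ _ hC _ _ _ _ _ _ hG S R_in R_mod S_loc (M b1)) => //.
  apply: (gam_brick hC); rewrite (weight_tensE hC hG) Mg mulfK //; exact: lt0r_neq0 (gam_gt0 hC hG).
have [f [f' ff]] := Me b1.
have eb : braid (e unit b1) (e unit b1) = q b1 *: idm (e unit b1 \ox e unit b1).
  rewrite (@smor_braid _ _ _ unit unit tt tt u1 u1) Lq (sbr_one hA) scale1r tpureZl smorZ; congr (_ *: _).
  exact: (@smor_id _ P A (unit * unit)%type (tt, tt) u2 (L b1 \ox L b1) (one A \ox one A)).
apply: (bij_inj (hF.1 _ _)).
apply: (iso_cancel_r DL (fmu_iso F (M b1) (M b1))); rewrite (fmu_braid F).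
have Z (V : lmodType k) a (v : V) : a *: v = (a - 1) *: v + v by rewrite scalerBl scale1r subrK.
rewrite (Z _ _ (idm _)) (fmap_linear F) -Z (fmap_id F).
have -> : braid (F (M b1)) (F (M b1)) = q b1 *: idm _.
  apply: (iso_cancel_l DL (f := f \om f)); first by exists (f' \om f'); apply: pm_iso.
  by rewrite -(pm_braid pD) eb (compZl DL) (compZr DL) (comp_idl DL) (comp_idr DL).
by rewrite (compZl DL) (compZr DL) (comp_idl DL) (comp_idr DL).
Qed.
End LocalModule.

(** * The fusion subcategory of powers of X *)

Section PointedSubcat.
Local Open Scope cat_scope.
Context (k : closedFieldType) (C : bmcat k) (hC : braided_fusion C).
Local Notation hL := (bf_linear hC).
Local Notation hM := (bf_monoidal hC).
Let cA := comp_assoc hL.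
Let c1l := comp_idl hL.
Context (d' : nat) (X : C) (X1 : FPdim X = 1) (q : k).
Local Notation d := d'.+1.
Context (sX : sbr X q) (prq : d.-primitive_root (q ^+ 2)) (Xd : isomorphic (one C) (tpw X d)).
Local Notation P := (tpw X).
Local Notation K := (@K k C hC d' X Xd).
Let tr := isomorphic_trans hL.

Lemma pow_iso n m : n = m %[mod d] -> isomorphic (P n) (P m).
Proof.
move=> e; exists (K n m); apply: K_iso; apply: ord_inj; by rewrite !rhoE.
Qed.
Lemma pow_add n m : isomorphic (P n \ox P m) (P (n + m)).
Proof. by exists (cat X n m); apply: cat_iso. Qed.

Definition Dmem Z := forall V, brick V -> (0 < hdim V Z)%N -> exists j, isomorphic V (P j).

Lemma Dmem_pow j : Dmem (P j).
Proof.
move=> V Vb pos; exists j.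
exact: (brick_hdimE hL (fus_schur hC) Vb (pow_brick hC X1 j) pos).
Qed.

Lemma fsum_pow Z : Dmem Z -> exists n (f : 'I_n -> nat), is_dsum (fun i => P (f i)) Z.
Proof.
move=> ZD; have [n [S [Ss dS]]] := bf_semisimple hC Z; have /dsum_fsum fS := dS.
have Sj i : exists j, isomorphic (S i) (P j).
  apply: ZD; first exact/(simpleE hC).
  rewrite (hdim_sumr hL _ fS) (bigD1 i) //= brick_hdim //; exact/(simpleE hC).
pose f i := proj1_sig (constructive_indefinite_description _ (Sj i)).
exists n, f; apply/dsum_fsum; apply: (fsum_map hL _ fS) => i.
exact: (proj2_sig (constructive_indefinite_description _ (Sj i))).
Qed.

Lemma fsum_pos (I : finType) (S : I -> C) V Z : fsum S Z -> (0 < hdim V Z)%N -> exists i, (0 < hdim V (S i))%N.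
Proof.
move=> fZ; rewrite (hdim_sumr hL _ fZ) => pos.
by apply/existsP; apply: contraTT pos => /existsPn h; rewrite -leqNgt leqn0 sum_nat_eq0; apply/forallP=> i; rewrite /= -leqn0 leqNgt h.
Qed.

Lemma pow_inv j : exists j', isomorphic (P j' \ox P j) (one C).
Proof.
exists (j * d')%N; apply: (tr (pow_add _ _)); apply: (pow_iso (m := 0)).
by rewrite -mulnSr modnMl mod0n.
Qed.

Lemma Dmem_unit Y V : Dmem Y -> brick V -> (0 < hdim (one C) (Y \ox V))%N -> exists j, isomorphic V (P j).
Proof.
move=> YD Vb pos; have [n [f /dsum_fsum fY]] := fsum_pow YD.
have [i ipos] := fsum_pos (fsum_tenl hL hM V fY) pos.
have e1 := brick_hdimE hL (fus_schur hC) (one_brick hC) (invertible_brick hC (FPdim_tpw hC (f i) X1) Vb) ipos.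
have [j jP] := pow_inv (f i); exists j.
have o1 : isomorphic (one C \ox V) V by exists (lunit V); apply: (lunit_iso hM).
apply: (tr (isomorphic_sym o1)).
apply: (tr (isomorphic_ten hM (isomorphic_sym jP) (isomorphic_refl hL V))).
apply: (tr (isomorphic_assoc hC _ _ _)).
apply: (tr (isomorphic_ten hM (isomorphic_refl hL (P j)) (isomorphic_sym e1))).
by exists (runit (P j)); apply: (runit_iso hM).
Qed.

(** For duals, a simple constituent V of the dual of Y satisfies Hom(1, Y (x) V) <> 0, so V is
    inverse to a power of X and hence itself a power. *)
Lemma Dmem_fsub : is_fusion_subcat Dmem.
Proof.
split.
- exact (Dmem_pow (j := 0%N)).
- move=> Y Z YD ZD V Vb pos.
  have [n [f /dsum_fsum fY]] := fsum_pow YD; have [l [g /dsum_fsum fZ]] := fsum_pow ZD.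
  have [i ipos] := fsum_pos (fsum_tenl hL hM Z fY) pos.
  have [j jpos] := fsum_pos (fsum_ten hL hM (P (f i)) fZ) ipos.
  exists (f i + g j)%N; rewrite (hdim_isor hL _ (pow_add _ _)) in jpos.
  exact: (brick_hdimE hL (fus_schur hC) Vb (pow_brick hC X1 _) jpos).
- move=> n T Z TD /dsum_fsum fZ V Vb pos; have [i ipos] := fsum_pos fZ pos.
  exact: TD ipos.
- move=> Y Z i p pi YD V Vb /hdim_ex[f f0]; apply: (YD V Vb); apply: (@hdim_gt0 _ _ _ _ (i \oc f)) => e.
  by apply: f0; rewrite -[f]c1l -pi cA e (comp0r hL).
move=> Y Z YZ; have adj := hdim_adj hL hM.
have ru A : isomorphic (A \ox one C) A by exists (runit A); apply: (runit_iso hM).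
split=> HD V Vb pos; apply: (Dmem_unit HD Vb).
  rewrite -(adj _ _ _ _ YZ) (hdim_isol hL _ (ru Z)).
  by rewrite (hdim_sym hL (fus_schur hC)) //; apply: (fus_decomp hC).
rewrite (hdim_sym hL (fus_schur hC)); last exact: (fus_decomp hC).
by rewrite (adj _ _ _ _ YZ) (hdim_isor hL _ (ru Y)).
Qed.

Definition Dsub : fusion_subcat C := FusionSubcat Dmem_fsub.
End PointedSubcat.

Section PowerCalculus.
Local Open Scope cat_scope.
Context (k : closedFieldType) (C : bmcat k) (hC : braided_fusion C).
Local Notation hL := (bf_linear hC).
Local Notation hM := (bf_monoidal hC).
Let cA := comp_assoc hL.
Let c1l := comp_idl hL.
Let c1r := comp_idr hL.
Let p2 := post2 hL.
Let p3 := post3 hL.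
Context (d' : nat) (X : C) (X1 : FPdim X = 1) (q : k).
Local Notation d := d'.+1.
Context (sX : sbr X q) (prq : d.-primitive_root (q ^+ 2)) (Xd : isomorphic (one C) (tpw X d)).
Local Notation P := (tpw X).
Local Notation K := (@K k C hC d' X Xd).
Local Notation num := (num hC X1 sX prq Xd).
Local Notation cat := (cat X).
Local Notation cati := (cati hC X).

Lemma num_K n m : rho d' n = rho d' m -> num (K n m) = 1.
Proof. by move=> e; apply: num_uniq => //; rewrite scale1r. Qed.

Lemma asc_K n m l : cat n (m + l) \oc (idm _ \om cat m l) \oc assoc _ _ _ \oc (cati n m \om idm _) \oc cati (n + m) l
  = K (n + m + l) (n + (m + l)).
Proof.
rewrite (p3 (cat_assoc hC Xd n m l)) !cA -(cA (cat n m \om _)) -(wrM hL hM) (catiP hC X n m).2.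
by rewrite (wl_id hM) c1l (catiP hC X _ _).2 c1r.
Qed.
Lemma lunit_K n : lunit (P n) \oc (idm _ \om idm _) \oc cati 0 n = K n n.
Proof. by rewrite (tenm_id hM) c1l -[lunit _]/(cat 0 n) (catiP hC X 0 n).2 K_id. Qed.
Lemma runit_K n : runit (P n) \oc (idm _ \om idm _) \oc cati n 0 = K (n + 0) n.
Proof. by rewrite (tenm_id hM) c1l (cat_runit hC Xd) cA (catiP hC X n 0).2 c1r. Qed.
Lemma braid_K n m : cat m n \oc braid (P n) (P m) \oc cati n m = q ^+ (n * m) *: K (n + m) (m + n).
Proof.
rewrite -cA (cbE hC X1 sX prq Xd) (cb_val hC X1 sX prq Xd) (compZl hL) cA (catiP hC X n m).2 c1r //.
Qed.
Lemma q_nz : q != 0.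
Proof.
apply/eqP=> q0; have := prim_expr_order prq; rewrite q0 expr0n /= expr0n /= => /eqP.
by rewrite eq_sym oner_eq0.
Qed.
Lemma ten_K n n' m m' (f : mor C (P n) (P n')) (g : mor C (P m) (P m')) :
  q ^+ (m' * n) *: (cat n' m' \oc (f \om g) \oc cati n m) = (q ^+ (m' * n') * num f * num g) *: K (n + m) (n' + m').
Proof.
rewrite (tenm_wrl hL hM f g) !cA -(cA (cat n' m')) -(compZl hL) (cat_wr hC X1 sX prq Xd) (compZl hL) !cA.
rewrite (p2 (cat_wl hC X1 sX prq Xd n g)) (compZl hL) !(compZr hL) scalerA !cA (catiP hC X n m).2 c1r.
have [e|/eqP e] := eqVneq (rho d' m) (rho d' m'); last by rewrite (num_off hC X1 sX prq Xd _ e) !mulr0 !scale0r.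
by congr (_ *: _); apply: K_comp; apply: ord_inj; rewrite !rhoE; apply/eqP; rewrite eqn_modDl -!rhoE e.
Qed.
End PowerCalculus.

Lemma subcat_pre (k : fieldType) (C : bmcat k) (E : fusion_subcat C) : premonoidal C -> premonoidal (subcat E).
Proof.
move=> pC; split.
- exact: (subcat_linear E (pm_linear pC)).
- by move=> X Y; apply: (pm_id pC).
- by move=> *; apply: (pm_comp pC).
- by move=> *; apply: (pm_linl pC).
- by move=> *; apply: (pm_linr pC).
- by move=> *; apply: (pm_assoc pC).
- by move=> *; apply: (pm_lunit pC).
- by move=> *; apply: (pm_runit pC).
by move=> *; apply: (pm_braid pC).
Qed.

Lemma fus_pre (k : closedFieldType) (C : bmcat k) : braided_fusion C -> premonoidal C.
Proof. by move=> hC; apply: monoidal_pre; [apply: bf_linear | apply: bf_monoidal | apply: bf_braided]. Qed.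

(** * Two generators with the same self-braiding generate equivalent categories *)

Section PointedEquivalence.
Local Open Scope cat_scope.
Context (k : closedFieldType) (A C : bmcat k) (hA : braided_fusion A) (hC : braided_fusion C).
Context (d' : nat) (q : k) (prq : d'.+1.-primitive_root (q ^+ 2)).
Context (L : A) (L1 : FPdim L = 1) (sL : sbr L q) (Ld : isomorphic (one A) (tpw L d'.+1)).
Context (X : C) (X1 : FPdim X = 1) (sX : sbr X q) (Xd : isomorphic (one C) (tpw X d'.+1)).
Local Notation KL := (@K k A hA d' L Ld).
Local Notation KX := (@K k C hC d' X Xd).
Local Notation numL := (num hA L1 sL prq Ld).
Local Notation numX := (num hC X1 sX prq Xd).
Local Notation D := (Dsub hC X1 Xd).
Definition powD n : subcat D := exist _ (tpw X n) (@Dmem_pow k C hC X X1 n).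
Definition tpT n m (f : mor A (tpw L n) (tpw L m)) : mor (subcat D) (powD n) (powD m) := numL f *: KX n m.

Lemma num_linear (c : k) n m (f g : mor A (tpw L n) (tpw L m)) : numL (c *: f + g) = c * numL f + numL g.
Proof.
have [e|/eqP e] := eqVneq (rho d' n) (rho d' m); last by rewrite !num_off // mulr0 addr0.
by apply: num_uniq => //; rewrite {1}(numK hA L1 sL prq Ld f) {1}(numK hA L1 sL prq Ld g) scalerA scalerDl.
Qed.
Lemma numZ (c : k) n m (f : mor A (tpw L n) (tpw L m)) : numL (c *: f) = c * numL f.
Proof.
have [e|/eqP e] := eqVneq (rho d' n) (rho d' m); last by rewrite !num_off // mulr0.
by apply: num_uniq => //; rewrite {1}(numK hA L1 sL prq Ld f) scalerA.
Qed.
Lemma num0 n m : numL (0 : mor A (tpw L n) (tpw L m)) = 0.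
Proof. by rewrite -(scale0r (0 : mor A (tpw L n) (tpw L m))) numZ mul0r. Qed.
Lemma tpT_K n m : tpT (KL n m) = KX n m.
Proof.
rewrite /tpT; have [e|/eqP e] := eqVneq (rho d' n) (rho d' m).
  by rewrite num_K // scale1r.
by rewrite num_off // scale0r [RHS]K_off.
Qed.
Lemma numX_T n m (f : mor A (tpw L n) (tpw L m)) : numX (tpT f : mor C (tpw X n) (tpw X m)) = numL f.
Proof.
have [e|/eqP e] := eqVneq (rho d' n) (rho d' m); last by rewrite !num_off.
exact: num_uniq.
Qed.

(** In the coordinates [K] every structure map on powers is a multiple of some [K] by a power of q,
    with the same factor for L and for X; so matching [K] with [K] respects everything. *)
Lemma pointed_label_functor : @label_functor k A (subcat D) nat 0%N addn (tpw L) powD tpT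
  (cat L) (cati hA L) (cat X) (cati hC X) (idm _) (idm _) (idm (one C)) (idm (one C)).
Proof.
have AL := bf_linear hA; have CL := bf_linear hC.
split=> /=.
- by move=> n m c f g; rewrite /tpT num_linear scalerDl scalerA.
- by move=> n; rewrite -[idm (tpw L n)](K_id hA Ld) tpT_K; apply: K_id.
- move=> n m l g f; rewrite /tpT /=.
  have [e|/eqP e] := eqVneq (rho d' n) (rho d' m); last first.
    have f0 : f = 0 by rewrite (numK hA L1 sL prq Ld f) (num_off hA L1 sL prq Ld f e) scale0r.
    by rewrite f0 (comp0r AL) !num0 !scale0r (comp0r CL).
  rewrite [LHS](_ : _ = (numL g * numL f) *: KX n l); last first.
    congr (_ *: _); have [e'|/eqP e'] := eqVneq (rho d' m) (rho d' l).
      apply: num_uniq; first by rewrite e.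
      rewrite {1}(numK hA L1 sL prq Ld f) {1}(numK hA L1 sL prq Ld g) (compZl AL) (compZr AL) scalerA.
      by rewrite K_comp.
    by rewrite num_off ?e // (num_off hA L1 sL prq Ld g e') mul0r.
  by rewrite (compZl CL) (compZr CL) scalerA K_comp.
- move=> n m; exists (fun g : mor C (tpw X n) (tpw X m) => numX g *: KL n m) => f.
    by rewrite numX_T -(numK hA L1 sL prq Ld).
  have [e|/eqP e] := eqVneq (rho d' n) (rho d' m).
    by rewrite /tpT numZ num_K // mulr1 -(numK hC X1 sX prq Xd).
  rewrite [RHS](numK hC X1 sX prq Xd) (num_off hC X1 sX prq Xd f e) /tpT num_off // !scale0r //.
- exact: (catiP hA L).
- exact: (catiP hC X).
- by split; rewrite (comp_idl AL).
- by split; apply: (comp_idl CL).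
- move=> n n' m m' f g.
  have Z c a b (h : mor A (tpw L a) (tpw L b)) : tpT (c *: h) = c *: tpT h by rewrite /tpT numZ scalerA.
  (* [ten_K] holds after multiplication by this power of q, which is non-zero. *)
  apply: (scalerI (expf_neq0 (m' * n) (q_nz prq))).
  rewrite -Z (ten_K hA L1 sL prq Ld) Z tpT_K; symmetry.
  by etransitivity; [exact: (ten_K hC X1 sX prq Xd (tpT f) (tpT g)) | rewrite !numX_T].
- by move=> n m l; rewrite (asc_K hA Ld) tpT_K; symmetry; apply: asc_K.
- by move=> n; rewrite (lunit_K hA Ld) tpT_K; symmetry; apply: lunit_K.
- by move=> n; rewrite (runit_K hA Ld) tpT_K; symmetry; apply: runit_K.
move=> n m; rewrite (braid_K hA L1 sL prq Ld); symmetry.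
etransitivity; first exact: (braid_K hC X1 sX prq Xd n m).
by rewrite /tpT numZ -scalerA -/(tpT _) tpT_K.
Qed.

Context (simpleL : forall V : A, brick V -> exists j, isomorphic V (tpw L j)).

Lemma powers_decompose (Z : A) : exists n (b : 'I_n -> nat), is_dsum (fun i => tpw L (b i)) Z.
Proof.
by apply: (fsum_pow hA) => V Vb _; apply: simpleL.
Qed.

Lemma pointed_equivalence : braided_equivalent A (subcat D).
Proof.
have sub n (b : 'I_n -> nat) (Z : C) : is_dsum (fun i => tpw X (b i)) Z -> Dmem X Z.
  by move=> dZ; apply: (fsub_dsum (Dmem_fsub hC X1 Xd) _ dZ) => i; apply: Dmem_pow.
apply: (label_equivalence (fus_pre hA) (subcat_pre D (fus_pre hC)) pointed_label_functor).
- exact: powers_decompose.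
- move=> n b; have [Z dZ] := has_dsums (bf_abelian hC) (fun i => tpw X (b i)).
  by exists (exist _ Z (sub _ _ _ dZ)).
- by move=> n b; apply: (has_dsums (bf_abelian hA)).
by case=> Z ZD; have [n [f dZ]] := fsum_pow hC ZD; exists n, f.
Qed.
End PointedEquivalence.

(** * Objects of the Deligne product as sums of external products *)

Section FormalSums.
Local Open Scope cat_scope.
Context (k : fieldType) (C D : bmcat k) (hC : premonoidal C) (hD : premonoidal D).
Local Notation Del := (deligne C D).
Implicit Types U : Del.
Local Notation sg1 U i := (@sing k C D unit (@dl k C D U i) (@dr k C D U i)).

Definition dinc U (i : didx U) : mor Del (sg1 U i) U :=
  @dgraph k C D (sg1 U i) U (fun _ => i) (fun _ => tpure (idm (dl i)) (idm (dr i))).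
Definition dpr U (i : didx U) : dmor U (sg1 U i) :=
  [ffun p => match i =P p.1 with
     | ReflectT e => ecast j (@dentry k C D U (sg1 U i) j p.2) e
         (tpure (idm (dl i)) (idm (dr i)) : @dentry k C D U (sg1 U i) i p.2)
     | ReflectF _ => 0
     end].

Lemma dpr_on U (i : didx U) : (dpr i : dmor _ _) (i, tt) = tpure (idm (dl i)) (idm (dr i)).
Proof. by rewrite /dpr ffunE /=; case: eqP => // e; rewrite (eq_irrelevance e erefl). Qed.
Lemma dpr_off U (i j : didx U) : i != j -> (dpr i : dmor _ _) (j, tt) = 0.
Proof. by move=> ij; rewrite /dpr ffunE /=; case: eqP => // e; rewrite e eqxx in ij. Qed.

Lemma dobj_fsum U : fsum (fun i : didx U => sg1 U i) U.
Proof.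
exists (@dinc U), (fun i => @dpr U i : mor Del U (sg1 U i)); split.
- move=> i; apply/ffunP=> -[[] []].
  rewrite (@dcomp_graphr _ _ _ (sg1 U i) U (sg1 U i) (fun _ => i)) dpr_on (cb_pure hC hD).
  rewrite (comp_idl (pm_linear hC)) (comp_idl (pm_linear hD)) /=.
  by rewrite (@dgraph_on _ _ _ (sg1 U i) (sg1 U i) id).
- move=> i j ij; apply/ffunP=> -[[] []].
  rewrite (@dcomp_graphr _ _ _ (sg1 U i) U (sg1 U j) (fun _ => i)) dpr_off 1?eq_sym // cb0l.
  by rewrite -[(0 : mor Del _ _)]/(dp_zero _) ffunE.
apply/ffunP=> -[i j].
have sumE (f : didx U -> mor Del U U) p : ((\sum_l f l : mor Del U U) : dmor U U) p = \sum_l (f l : dmor U U) p.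
  have h : {morph (fun g : mor Del U U => (g : dmor U U) p) : x y / x + y >-> x + y}.
    by move=> x y; rewrite -[x + y]/(dp_add (x : dmor U U) y) ffunE.
  by apply: (big_morph _ h); rewrite -[(0 : mor Del _ _)]/(dp_zero _) ffunE.
rewrite sumE (bigD1 j) //= big1 ?addr0 => [|l lj].
  rewrite (@dcomp_graphl _ _ _ U (sg1 U j) U (fun _ => j) _ _ _ i tt); last by case=> -[].
  rewrite (cb_idl hC hD); have [->|ij] := eqVneq i j; first by rewrite dpr_on (@dgraph_on _ _ _ U U id).
  by rewrite dpr_off 1?eq_sym // (@dgraph_off _ _ _ U U id).
rewrite dcompE big1 // => -[] _; rewrite (@dgraph_off _ _ _ (sg1 U l) U (fun _ => l)) ?cb0l //.
Qed.

Lemma sing_fsum (I : finType) (S : I -> C) x (y : D) : fsum S x ->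
  fsum (fun i => @sing k C D unit (S i) y) (@sing k C D unit x y).
Proof.
case=> i [p [pi p0 ip]]; have u1 (t : unit) : t = tt by case: t.
have tp0 (a b : C) (c e : D) (g : mor D c e) : tpure (0 : mor C a b) g = 0.
  by rewrite -(scale0r (0 : mor C a b)) tpureZl scale0r.
exists (fun a => smor unit tt (tpure (i a) (idm y))), (fun a => smor unit tt (tpure (p a) (idm y))); split.
- move=> a; rewrite (smor_comp tt u1 u1) (cb_pure hC hD) pi (comp_idl (pm_linear hD)).
  by rewrite (smor_id u1).
- move=> a b ab; rewrite (smor_comp tt u1 u1) (cb_pure hC hD) p0 // tp0.
  by have := smorZ unit tt 0 (0 : tsp (mor C (S a) (S b)) (mor D y y)); rewrite !scale0r.
rewrite (eq_bigr (fun a => smor unit tt (tpure (i a \oc p a) (idm y)))) => [|a _]; last first.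
  by rewrite (smor_comp tt u1 u1) (cb_pure hC hD) (comp_idl (pm_linear hD)).
rewrite -(smor_id u1) -ip tpure_suml.
have h : {morph (@smor k C D unit unit tt x y x y) : s t / s + t >-> s + t}.
  move=> s t; apply: (smor_ext u1 u1); rewrite smorE.
  by rewrite -[smor _ _ s + smor _ _ t]/(dp_add (smor unit tt s : dmor _ _) (smor unit tt t)) ffunE !smorE.
rewrite (big_morph _ h (id1 := 0)) //.
by have := smorZ unit tt 0 (0 : tsp (mor C x x) (mor D y y)); rewrite !scale0r.
Qed.
End FormalSums.

(** * The factorization *)

Section Interchange.
Local Open Scope cat_scope.
Context (k : fieldType) (C : bmcat k) (hL : linear_category C) (hM : monoidal C) (hB : braided C).
Implicit Types A B D r s t Z : C.
Let cA := comp_assoc hL.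
Let c1l := comp_idl hL.
Let c1r := comp_idr hL.
Let wM := wlM hL hM.
Let wR := wrM hL hM.
Let p2 := post2 hL.
Let p3 := post3 hL.

Definition swap A r B s : mor C ((A \ox r) \ox (B \ox s)) ((A \ox B) \ox (r \ox s)) :=
  locked (ai A B (r \ox s) \oc (idm A \om ch r B s) \oc assoc A r (B \ox s)).
Lemma swapE A r B s : swap A r B s = ai A B (r \ox s) \oc (idm A \om ch r B s) \oc assoc A r (B \ox s).
Proof. by rewrite /swap -lock. Qed.

Lemma swap_iso A r B s : is_iso (swap A r B s).
Proof.
rewrite swapE; apply: (is_iso_comp hL) (ai_iso hM _ _ _) _.
by apply: (is_iso_comp hL) (assoc_iso hM _ _ _); apply: (wl_iso hL hM); apply: ch_iso.
Qed.

Lemma as_swap A r B s : assoc A B (r \ox s) \oc swap A r B s = (idm A \om ch r B s) \oc assoc A r (B \ox s).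
Proof. by rewrite swapE -cA (as_ai hM) c1l. Qed.

Lemma swap_nat A A' r r' B B' s s' (a : mor C A A') (w : mor C r r') (b : mor C B B') (v : mor C s s') :
  swap A' r' B' s' \oc ((a \om w) \om (b \om v)) = ((a \om b) \om (w \om v)) \oc swap A r B s.
Proof.
apply: (iso_cancel_l hL (assoc_iso hM A' B' (r' \ox s'))).
rewrite (p2 (as_swap _ _ _ _)) !cA (assoc_nat hM) [RHS](p2 (assoc_nat hM _ _ _)) !cA as_swap -!cA; congr (_ \oc _).
rewrite -!(tenm_comp hM) c1l c1r; congr (_ \om _).
rewrite !chE !h2E !cA (ai_nat hL hM) -(cA (braid r' B' \om _)) -(tenm_comp hM) (braid_nat hB) c1l.
rewrite -[v in LHS]c1r (tenm_comp hM) !cA -(cA (assoc B' r' s')) (assoc_nat hM) !cA //.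
Qed.

Lemma ch_assoc r B s Z : (idm B \om assoc r s Z) \oc assoc B (r \ox s) Z \oc (ch r B s \om idm Z)
  = ch r B (s \ox Z) \oc (idm r \om assoc B s Z) \oc assoc r (B \ox s) Z.
Proof.
rewrite !chE !h2E !wR !cA (post3 hL (esym (pentagon hM B r s Z))) !cA.
rewrite (p2 (assoc_nat hM (braid r B) (idm s) (idm Z))) !cA (tenm_id hM); congr (_ \oc (_ \oc _)).
apply: (iso_cancel_r hL (wr_iso hL hM Z (assoc_iso hM r B s))).
rewrite !cA -wR (ai_as hM) (tenm_id hM) c1r -(pentagon hM) -cA (ai_as hM) c1l //.
Qed.

Lemma swap_assoc A r B s D t :
  (assoc A B D \om assoc r s t) \oc swap (A \ox B) (r \ox s) D t \oc (swap A r B s \om idm (D \ox t))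
  = swap A r (B \ox D) (s \ox t) \oc (idm (A \ox r) \om swap B s D t) \oc assoc (A \ox r) (B \ox s) (D \ox t).
Proof.
pose Z := D \ox t.
apply: (iso_cancel_l hL (is_iso_comp hL (wl_iso hL hM A (assoc_iso hM B D (r \ox (s \ox t)))) (assoc_iso hM A (B \ox D) _))).
have chl : (idm D \om assoc r s t) \oc ch (r \ox s) D t = (ch r D (s \ox t) \oc (idm r \om ch s D t)) \oc assoc r s Z.
  apply: (iso_cancel_r hL (ai_iso hM r s Z)); rewrite !cA (ch_tenl hL hM hB) -!cA -wM (as_ai hM) (tenm_id hM) c1l.
  by rewrite !cA (as_ai hM) c1r.
have chr : assoc B D (r \ox (s \ox t)) \oc ch r (B \ox D) (s \ox t)
    = (idm B \om ch r D (s \ox t)) \oc ch r B (D \ox (s \ox t)) \oc (idm r \om assoc B D (s \ox t)).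
  apply: (iso_cancel_r hL (wl_iso hL hM r (ai_iso hM B D (s \ox t)))).
  by rewrite !cA -wM (as_ai hM) (tenm_id hM) c1r (ch_tenr hL hM hB).
have N : ((idm A \om assoc B D (r \ox (s \ox t))) \oc assoc A (B \ox D) _) \oc (assoc A B D \om assoc r s t)
   = assoc A B _ \oc (idm (A \ox B) \om (idm D \om assoc r s t)) \oc assoc (A \ox B) D ((r \ox s) \ox t).
  rewrite (tenm_wrl hL hM (assoc A B D)) -(tenm_id hM (A \ox B) D) !cA (post3 hL (esym (pentagon hM A B D _))) !cA.
  by rewrite (tenm_id hM) -(assoc_nat hM) (tenm_id hM).
have last : (idm A \om (ch r B (s \ox Z) \oc (idm r \om assoc B s Z))) \oc assoc A r ((B \ox s) \ox Z) \oc assoc (A \ox r) (B \ox s) Z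
   = assoc A B (r \ox (s \ox Z)) \oc (idm (A \ox B) \om assoc r s Z) \oc assoc (A \ox B) (r \ox s) Z \oc (swap A r B s \om idm Z).
  rewrite (pentagon hM A r) -[in RHS](tenm_id hM) (p2 (assoc_nat hM (idm A) (idm B) _)) !cA (p2 (pentagon hM A B (r \ox s) Z)) !cA -wR as_swap wR.
  rewrite (p2 (assoc_nat hM (idm A) (ch r B s) (idm Z))) !cA.
  have h := congr1 (fun f => idm A \om f) (ch_assoc r B s Z); rewrite !wM in h; by rewrite (p3 h) wM !cA.
rewrite -cA N !cA.
rewrite (p2 (as_swap _ _ _ _)) !cA -(cA (idm _ \om (idm D \om _))) -wM chl wM !cA.
rewrite -(tenm_id hM A B) (p2 (assoc_nat hM _ _ _)) (tenm_id hM) !cA -last.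
rewrite (p2 (as_swap _ _ _ _)) !cA -[in RHS](tenm_id hM) (p2 (assoc_nat hM _ _ _)) !cA -!(cA (idm A \om _)) -!wM !cA.
rewrite -[in RHS](cA (idm A \om _)) -wM !cA; congr ((_ \om _) \oc _).
by rewrite wM (post2 hL chr) !cA -(wM r) as_swap wM (p2 (chn hL hM _ _ _)) !cA.
Qed.

Lemma swap_lunit A r : lunit (A \ox r) \oc (lunit (one C) \om idm _) = (lunit A \om lunit r) \oc swap (one C) (one C) A r.
Proof.
rewrite swapE (tenm_wlr hL hM (lunit A)) !cA -(lunit_ten hL hM A) !cA -!(cA (assoc (one C) A _)) (as_ai hM) c1l.
rewrite -(cA (idm A \om lunit r)) -(lunit_nat hM) !cA -(cA (idm (one C) \om _)) -wM (chL_lunit hL hM hB).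
by rewrite (triangle hM) (lunit1_runit1 hL hM).
Qed.
Lemma swap_runit A r : runit (A \ox r) \oc (idm _ \om lunit (one C)) = (runit A \om runit r) \oc swap A r (one C) (one C).
Proof.
rewrite swapE (tenm_wlr hL hM (runit A)) !cA -(triangle hM A) !cA -!(cA (assoc A (one C) _)) (as_ai hM) c1l.
rewrite -!(cA (idm A \om lunit _)) -wM (chR_lunit hL hM hB) -(assoc_nat hM) (tenm_id hM).
by rewrite -cA (runit_ten hL hM).
Qed.
(** The two sides differ by carrying A once around s, which centralization makes trivial. *)
Lemma swap_braid A r B s : centralizes A s ->
  (braid A B \om braid r s) \oc swap A r B s = swap B s A r \oc braid (A \ox r) (B \ox s).
Proof.
move=> cAs; apply: (iso_cancel_l hL (assoc_iso hM B A (s \ox r))).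
have hx U : assoc B s U \oc braid U (B \ox s) = (idm B \om braid U s) \oc ch U B s.
  apply: (iso_cancel_r hL (assoc_iso hM U B s)); rewrite cA (hexagon hB) chE h2E !cA (ai_as hM) c1r //.
have bx : braid (A \ox r) s = ch A s r \oc (idm A \om braid r s) \oc assoc A r s.
  by rewrite (hexagon_inv hB (aiP hM A s r)) chE h2E !cA.
have chl : (idm B \om assoc A r s) \oc ch (A \ox r) B s = ch A B (r \ox s) \oc (idm A \om ch r B s) \oc assoc A r (B \ox s).
  apply: (iso_cancel_r hL (ai_iso hM A r (B \ox s))); rewrite !cA (ch_tenl hL hM hB) -!cA -wM (as_ai hM) (tenm_id hM) c1l.
  by rewrite !cA (as_ai hM) c1r.
rewrite (p2 (as_swap _ _ _ _)) !cA hx -(cA (idm B \om _)) -wM bx -(cA (ch s A r)) -dblE (dbl_centralizes hL hM _ cAs) c1l.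
rewrite wM cA chl ?swapE (tenm_wlr hL hM (braid A B)) -!cA; congr ((_ \oc _) \oc _).
rewrite chE h2E !cA -(tenm_id hM B A).
by rewrite (p2 (assoc_nat hM _ _ _)).
Qed.
End Interchange.

Section LabelSym.
Local Open Scope cat_scope.
Context (k : fieldType) (Q C : bmcat k).
Context (B : Type) (e : B) (op : B -> B -> B) (L : B -> Q) (X : B -> C).
Context (T : forall a b, mor Q (L a) (L b) -> mor C (X a) (X b)).
Context (J : forall a b, mor Q (L a \ox L b) (L (op a b))) (Ji : forall a b, mor Q (L (op a b)) (L a \ox L b)).
Context (J' : forall a b, mor C (X a \ox X b) (X (op a b))) (J'i : forall a b, mor C (X (op a b)) (X a \ox X b)).
Context (u : mor Q (one Q) (L e)) (ui : mor Q (L e) (one Q)) (u' : mor C (one C) (X e)) (u'i : mor C (X e) (one C)).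
(** The comparison is constructed from the Deligne product to C, where it is defined on pure
    tensors, whereas the equivalence is asked from C. *)
Lemma label_functor_sym : @label_functor k Q C B e op L X T J Ji J' J'i u ui u' u'i ->
  exists T' : forall a b, mor C (X a) (X b) -> mor Q (L a) (L b),
  @label_functor k C Q B e op X L T' J' J'i J Ji u' u'i u ui.
Proof.
move=> lf.
have ex a b : exists T' : mor C (X a) (X b) -> mor Q (L a) (L b), cancel (@T a b) T' /\ cancel T' (@T a b).
  by have [T' h1 h2] := lf_bij lf a b; exists T'.
pose T' a b := proj1_sig (constructive_indefinite_description _ (ex a b)).
have TK a b : cancel (@T a b) (@T' a b) := (proj2_sig (constructive_indefinite_description _ (ex a b))).1.
have KT a b : cancel (@T' a b) (@T a b) := (proj2_sig (constructive_indefinite_description _ (ex a b))).2.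
exists T'; split.
- by move=> a b c f g; rewrite -{1}[f]KT -{1}[g]KT -(lf_linear lf) TK.
- by move=> a; rewrite -(lf_id lf) TK.
- by move=> a b c g f; rewrite -{1}[f]KT -{1}[g]KT -(lf_comp lf) TK.
- by move=> a b; exists (@T a b).
- exact: lf_J' lf.
- exact: lf_J lf.
- exact: lf_u' lf.
- exact: lf_u lf.
- by move=> a a' b b' f g; rewrite -{1}[f]KT -{1}[g]KT -(lf_ten lf) TK.
- by move=> a b c; rewrite -(lf_assoc lf) TK.
- by move=> a; rewrite -(lf_lunit lf) TK.
- by move=> a; rewrite -(lf_runit lf) TK.
by move=> a b; rewrite -(lf_braid lf) TK.
Qed.
End LabelSym.

(** * Objects X^n (x) r with r centralizing X *)

Section TwistedPowers.
Local Open Scope cat_scope.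
Context (k : closedFieldType) (C : bmcat k) (hC : braided_fusion C).
Local Notation hL := (bf_linear hC).
Local Notation hM := (bf_monoidal hC).
Local Notation hB := (bf_braided hC).
Let cA := comp_assoc hL.
Let c1l := comp_idl hL.
Let c1r := comp_idr hL.
Let wM := wlM hL hM.
Let wR := wrM hL hM.
Let p2 := post2 hL.
Implicit Types r s t Z : C.

Lemma wl_faithful X Y Z (f g : mor C Y Z) : FPdim X = 1 -> idm X \om f = idm X \om g -> f = g.
Proof.
move=> X1; have [X' [dX _]] := invertible_cancel hC X1.
have X'1 : FPdim X' = 1 by rewrite -(FPdim_dual hC dX).
have [c [e ec]] := one_retract hC dX (FPdim1_nz hC X'1) => E.
apply: (wl1_inj hL hM); rewrite -ec.
have h (u : mor C Y Z) : (e \oc c) \om u = (e \om idm Z) \oc (ai X' X Z \oc (idm X' \om (idm X \om u)) \oc assoc X' X Y) \oc (c \om idm Y).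
  by rewrite -(assoc_nat hM) (tenm_id hM) -(cA (ai X' X Z)) (ai_as hM) c1l -!(tenm_comp hM) !c1r !c1l.
by rewrite h [RHS]h E.
Qed.

(** Tensoring with the invertible X is injective on Hom spaces, and the adjunction with its inverse
    shows that the dimensions agree. *)
Lemma wl_full X Y Z (f : mor C (X \ox Y) (X \ox Z)) : FPdim X = 1 -> exists g, f = idm X \om g.
Proof.
move=> X1; have lin : forall a (u v : mor C Y Z), idm X \om (a *: u + v) = a *: (idm X \om u) + idm X \om v.
  by move=> a u v; apply: (tenm_linr hM).
pose phi0 : mor C Y Z -> mor C (X \ox Y) (X \ox Z) := fun u => idm X \om u.
pose phi : 'Hom(mor C Y Z, mor C (X \ox Y) (X \ox Z)) :=
  linfun (HB.pack phi0 (GRing.isLinear.Build _ _ _ _ phi0 lin) : {linear _ -> _}).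
have phiE u : phi u = idm X \om u by rewrite lfunE.
have ker0 : lker phi == 0%VS by apply/lker0P=> u v; rewrite !phiE; apply: wl_faithful.
have [X' [dX e]] := invertible_cancel hC X1.
have dims : \dim {: mor C (X \ox Y) (X \ox Z)} = \dim {: mor C Y Z}.
  have := hdim_adj hL hM Y (X \ox Z) dX; rewrite (hdim_isor hL _ (e Z)) => h.
  by rewrite -!/(hdim _ _) h.
have hd : \dim (limg phi) = \dim {: mor C Y Z} by apply: limg_dim_eq; rewrite (eqP ker0) capv0.
have : f \in limg phi.
  have /eqP -> : limg phi == fullv by apply/eqP/eqP; rewrite eqEdim subvf hd /= -dims leqnn.
  exact: memvf.
by case/memv_imgP=> u _ ->; exists u; rewrite phiE.
Qed.

Context (d' : nat) (X : C) (X1 : FPdim X = 1) (q : k).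
Context (sX : sbr X q) (prq : d'.+1.-primitive_root (q ^+ 2)) (Xd : isomorphic (one C) (tpw X d'.+1)).
Local Notation P := (tpw X).
Local Notation K := (@K k C hC d' X Xd).
Local Notation cat := (cat X).
Local Notation cati := (cati hC X).

(** As r centralizes X, the monodromy of X with X^n (x) r is (q^2)^n. For different residues this
    leaves only the zero map; for equal ones [K] is invertible and can be divided out. *)
Lemma hom_tpw n m r s (f : mor C (P n \ox r) (P m \ox s)) : centralizes X r -> centralizes X s ->
  exists g, f = K n m \om g.
Proof.
move=> cr cs; have [e|ne] := eqVneq (rho d' n) (rho d' m).
  have [g gE] := wl_full ((K m n \om idm s) \oc f) (FPdim_tpw hC n X1); exists g.
  have := congr1 (fun h => (K n m \om idm s) \oc h) gE; rewrite -cA -wR K_comp // K_id (wl_id hM) c1l => ->.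
  by rewrite -(tenm_comp hM) c1r c1l.
exists 0; rewrite (tenm0r hM); apply: (wl_faithful X1); rewrite (tenm0r hM).
have mX j t : centralizes X t -> mon X (P j \ox t) ((q ^+ 2) ^+ j).
  move=> ct; rewrite -[_ ^+ j]mulr1; apply: (mon_tenr hC); first exact: (mon_pow hC X1 sX).
  by rewrite /mon scale1r.
have := mX m s cs; have := mX n r cr; rewrite /mon => En Em.
have : (braid (P m \ox s) X \oc braid X (P m \ox s)) \oc (idm X \om f)
     = (idm X \om f) \oc (braid (P n \ox r) X \oc braid X (P n \ox r)).
  by rewrite cA (braid_nat hB) -cA (braid_nat hB) cA.
rewrite En Em (compZl hL) (compZr hL) c1l c1r => /eqP; rewrite -subr_eq0 -scalerBl scaler_eq0 subr_eq0.
case/orP=> [|/eqP //]; rewrite (eq_prim_root_expr prq) eq_sym => /eqP h.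
by case/eqP: ne; apply: ord_inj; rewrite !rhoE.
Qed.

Lemma ten_inj0 n m r s (g : mor C r s) : rho d' n = rho d' m -> K n m \om g = 0 -> g = 0.
Proof.
move=> e K0; apply: (wl_faithful (FPdim_tpw hC n X1)); rewrite (tenm0r hM).
have -> : idm (P n) \om g = (K m n \om idm s) \oc (K n m \om g) by rewrite -(tenm_comp hM) K_comp // K_id c1l.
by rewrite K0 (comp0r hL).
Qed.

Definition jx n r m s : mor C ((P n \ox r) \ox (P m \ox s)) (P (n + m) \ox (r \ox s)) :=
  locked ((cat n m \om idm _) \oc swap (P n) r (P m) s).
Lemma jxE n r m s : jx n r m s = (cat n m \om idm _) \oc swap (P n) r (P m) s.
Proof. by rewrite /jx -lock. Qed.
Definition jxi n r m s := inv (jx n r m s).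
Lemma jxP n r m s : inverse_of (jx n r m s) (jxi n r m s).
Proof.
rewrite /jxi; apply: invP; rewrite jxE; apply: (is_iso_comp hL); last exact: swap_iso hL hM hB _ _ _ _.
by apply: (wr_iso hL hM); apply: cat_iso.
Qed.
Lemma jx_iso n r m s : is_iso (jx n r m s).
Proof. by exists (jxi n r m s); apply: jxP. Qed.

Lemma jx_nat n n' m m' r r' s s' (a : mor C (P n) (P n')) (w : mor C r r') (b : mor C (P m) (P m')) (v : mor C s s') :
  jx n' r' m' s' \oc ((a \om w) \om (b \om v)) \oc jxi n r m s
    = (cat n' m' \oc (a \om b) \oc cati n m) \om (w \om v).
Proof.
apply: (iso_cancel_r hL (jx_iso n r m s)); rewrite !cA (jxP n r m s).1 c1r !jxE cA (swap_nat hL hM hB).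
rewrite -!cA -!(tenm_comp hM) !cA (catiP hC X n m).1 !c1r c1l //.
Qed.

Lemma jx_assoc n r m s l t :
  jx n r (m + l) (s \ox t) \oc (idm _ \om jx m s l t) \oc assoc _ _ _ \oc (jxi n r m s \om idm _)
      \oc jxi (n + m) (r \ox s) l t
  = K (n + m + l) (n + (m + l)) \om assoc r s t.
Proof.
apply: (iso_cancel_r hL (is_iso_comp hL (jx_iso (n + m) (r \ox s) l t) (wr_iso hL hM (P l \ox t) (jx_iso n r m s)))).
rewrite !cA (p2 (jxP _ _ _ _).1) c1l -wR (jxP _ _ _ _).1 (tenm_id hM) c1r !jxE wM wR !cA.
rewrite -(tenm_id hM (P l) t) (p2 (swap_nat hL hM hB _ _ _ _)) !cA.
rewrite -[idm (P n \ox r)](tenm_id hM) (p2 (swap_nat hL hM hB _ _ _ _)) !cA.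
rewrite (tenm_id hM (P n) r) (tenm_id hM (P l) t).
rewrite -!(cA _ (_ \om _) (swap _ _ _ _ \oc _)) -!(tenm_comp hM) !(tenm_id hM) !c1r ?c1l.
rewrite -(cA (K _ _ \om _)) -(tenm_comp hM) c1r -(cat_assoc hC Xd) -(cA (cat n (m + l))) -[assoc r s t]c1l.
by rewrite (tenm_comp hM _ (assoc _ _ _)) !cA (swap_assoc hL hM hB).
Qed.

Lemma jx_lunit n r : lunit (P n \ox r) \oc (lunit (one C) \om idm _) \oc jxi 0 (one C) n r = K n n \om lunit r.
Proof.
apply: (iso_cancel_r hL (jx_iso 0 (one C) n r)); rewrite !cA (jxP _ _ _ _).1 c1r (swap_lunit hL hM hB).
by rewrite K_id !jxE -cA -(tenm_comp hM) c1l c1r.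
Qed.
Lemma jx_runit n r : runit (P n \ox r) \oc (idm _ \om lunit (one C)) \oc jxi n r 0 (one C) = K (n + 0) n \om runit r.
Proof.
apply: (iso_cancel_r hL (jx_iso n r 0 (one C))); rewrite !cA (jxP _ _ _ _).1 c1r (swap_runit hL hM hB).
by rewrite !jxE -cA -(tenm_comp hM) c1r -(cat_runit hC Xd).
Qed.
Lemma jx_braid n r m s : centralizes (P n) s ->
  jx m s n r \oc braid _ _ \oc jxi n r m s = (q ^+ (n * m) *: K (n + m) (m + n)) \om braid r s.
Proof.
move=> cs; apply: (iso_cancel_r hL (jx_iso n r m s)); rewrite !cA (jxP _ _ _ _).1 c1r !jxE cA.
rewrite -(swap_braid hL hM hB _ _ cs) -!cA -!(tenm_comp hM) c1l c1r.
by rewrite (cbE hC X1 sX prq Xd) (cb_val hC X1 sX prq Xd) (compZl hL).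
Qed.
End TwistedPowers.

(** * Comparison of the Deligne product with C *)

Section Factorization.
Local Open Scope cat_scope.
Context (k : closedFieldType) (A C : bmcat k) (hA : braided_fusion A) (hC : braided_fusion C).
Context (d' : nat) (q : k) (prq : d'.+1.-primitive_root (q ^+ 2)).
Context (L : A) (L1 : FPdim L = 1) (sL : sbr L q) (Ld : isomorphic (one A) (tpw L d'.+1)).
Context (X : C) (X1 : FPdim X = 1) (sX : sbr X q) (Xd : isomorphic (one C) (tpw X d'.+1)).
Context (E : fusion_subcat C) (Ec : forall r, E r -> centralizes X r).
Local Notation S := (subcat E).
Local Notation Q := (deligne A S).
Local Notation KL := (@K k A hA d' L Ld).
Local Notation KX := (@K k C hC d' X Xd).
Local Notation numL := (num hA L1 sL prq Ld).
Local Notation sg I x y := (@sing k A S I x y).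
Local Notation sm I J j0 t := (@smor k A S I J j0 _ _ _ _ t).
Let AL := bf_linear hA.
Let CL := bf_linear hC.
Let CM := bf_monoidal hC.
Let pA := fus_pre hA.
Let pS := subcat_pre E (fus_pre hC).

Let sgl (I : finType) (i0 : I) := forall i, i = i0.
Let u1 : sgl tt. Proof. by case. Qed.
Let u2 : sgl (tt, tt). Proof. by case=> -[] []. Qed.
Let u3 : sgl (tt, tt, tt). Proof. by case=> [[[] []] []]. Qed.
Let u3' : sgl (tt, (tt, tt)). Proof. by case=> [[] [[] []]]. Qed.

Let pc (I J M : finType) (i0 : I) (j0 : J) (l0 : M) (si : sgl i0) (sl : sgl l0) x y x' y' x'' y''
  (f : mor Q (sg I x y) (sg J x' y')) (g : mor Q (sg J x' y') (sg M x'' y'')) a b a' b' :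
  f = sm I J j0 (tpure a b) -> g = sm J M l0 (tpure a' b') -> g \oc f = sm I M l0 (tpure (a' \oc a) (b' \oc b)).
Proof. by move=> -> ->; rewrite (smor_comp j0 si sl) (cb_pure pA pS). Qed.

Let pt (I J I' J' : finType) (i0 : I) (j0 : J) (i0' : I') (j0' : J') (si : sgl i0) (sj : sgl j0) (si' : sgl i0') (sj' : sgl j0')
  x y x' y' z w z' w' (f : mor Q (sg I x y) (sg J x' y')) (g : mor Q (sg I' z w) (sg J' z' w')) a b a' b' :
  f = sm I J j0 (tpure a b) -> g = sm I' J' j0' (tpure a' b') ->
  (f \om g : mor Q (sg (I * I')%type (x \ox z) (y \ox w)) (sg (J * J')%type (x' \ox z') (y' \ox w')))
    = @smor k A S (I * I')%type (J * J')%type (j0, j0') (x \ox z) (y \ox w) (x' \ox z') (y' \ox w') (tpure (a \om a') (b \om b')).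
Proof. by move=> -> ->; rewrite (smor_ten si sj si' sj') (tb_pure pA pS). Qed.

Definition labQ (b : nat * S) : Q := sg unit (tpw L b.1) b.2.
Definition labC (b : nat * S) : C := tpw X b.1 \ox sval b.2.
Definition labop (a b : nat * S) : nat * S := ((a.1 + b.1)%N, a.2 \ox b.2).
Definition labT a b (f : mor Q (labQ a) (labQ b)) : mor C (labC a) (labC b) :=
  \sum_i \sum_j ((f : dmor _ _) (tt, tt) i j) *: ((numL (bvec i) *: KX a.1 b.1) \om (bvec j : mor C (sval a.2) (sval b.2))).

Lemma labTE (a b : nat * S) (v : mor A (tpw L a.1) (tpw L b.1)) (w : mor S a.2 b.2) :
  @labT a b (smor unit tt (tpure v w)) = (numL v *: KX a.1 b.1) \om (w : mor C (sval a.2) (sval b.2)).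
Proof.
rewrite /labT smorE.
transitivity (\sum_i \sum_j ((coord (vbasis {: mor A (tpw L a.1) (tpw L b.1)}) i v *: (numL (bvec i) *: KX a.1 b.1))
    \om (coord (vbasis {: mor S a.2 b.2}) j w *: (bvec j : mor C (sval a.2) (sval b.2))))).
  by apply: eq_bigr => i _; apply: eq_bigr => j _; rewrite mxE [RHS](tenmZl CM) [in RHS](tenmZr CM) scalerA.
under eq_bigr => i _ do rewrite -(tenm_sumr CM).
rewrite -(tenm_suml CM); congr (_ \om _); last by symmetry; exact: (bvec_coord w).
under eq_bigr => i _ do rewrite scalerA; rewrite -scaler_suml; congr (_ *: _).
rewrite {2}(bvec_coord v); elim/big_rec2: _ => [|i y x _ IH]; first by rewrite num0.
by rewrite num_linear IH.
Qed.

(** The first Hom space is at most a line spanned by [K], so every element of the tensor product is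
    pure. *)
Lemma labT_repr (a b : nat * S) (f : mor Q (labQ a) (labQ b)) :
  exists w : mor S a.2 b.2, f = smor unit tt (tpure (KL a.1 b.1) w).
Proof.
rewrite (smor_entry u1 u1 f); move: ((f : dmor _ _) (tt, tt)) => /= t.
exists (\sum_i \sum_j (t i j * numL (bvec i)) *: bvec j); congr (smor _ _ _).
rewrite [LHS]tsp_expand tpure_sumr; apply: eq_bigr => i _; rewrite tpure_sumr; apply: eq_bigr => j _.
by rewrite {1}(numK hA L1 sL prq Ld (bvec i)) tpureZl tpureZr scalerA.
Qed.

Let tK n m (r s : S) (w : mor S r s) : (numL (KL n m) *: KX n m) \om (w : mor C (sval r) (sval s)) = KX n m \om (w : mor C (sval r) (sval s)).
Proof. by congr (_ \om _); apply: tpT_K. Qed.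

Let plf := pointed_label_functor hA hC prq L1 sL Ld X1 sX Xd.

Definition jQ a b : mor Q (labQ a \ox labQ b) (labQ (labop a b)) :=
  @smor k A S (unit * unit)%type unit tt (tpw L a.1 \ox tpw L b.1) (a.2 \ox b.2) (tpw L (a.1 + b.1)) (a.2 \ox b.2)
    (tpure (cat L a.1 b.1) (idm _)).
Definition jQi a b : mor Q (labQ (labop a b)) (labQ a \ox labQ b) :=
  @smor k A S unit (unit * unit)%type (tt, tt) (tpw L (a.1 + b.1)) (a.2 \ox b.2) (tpw L a.1 \ox tpw L b.1) (a.2 \ox b.2)
    (tpure (cati hA L a.1 b.1) (idm _)).
Definition lab1 : nat * S := (0%N, one S).
Definition uQ : mor Q (one Q) (labQ lab1) := @smor k A S unit unit tt (one A) (one S) (one A) (one S) (tpure (idm _) (idm _)).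
Definition uQi : mor Q (labQ lab1) (one Q) := @smor k A S unit unit tt (one A) (one S) (one A) (one S) (tpure (idm _) (idm _)).

Let eJ a b : jQ a b = @smor k A S (unit * unit)%type unit tt (tpw L a.1 \ox tpw L b.1) (a.2 \ox b.2) (tpw L (a.1 + b.1)) (a.2 \ox b.2)
    (tpure (cat L a.1 b.1) (idm _)) :> mor Q (sg (unit * unit)%type (tpw L a.1 \ox tpw L b.1) (a.2 \ox b.2)) (sg unit (tpw L (a.1 + b.1)) (a.2 \ox b.2)).
Proof. by []. Qed.
Let eJi a b : jQi a b = @smor k A S unit (unit * unit)%type (tt, tt) (tpw L (a.1 + b.1)) (a.2 \ox b.2) (tpw L a.1 \ox tpw L b.1) (a.2 \ox b.2)
    (tpure (cati hA L a.1 b.1) (idm _)) :> mor Q (sg unit (tpw L (a.1 + b.1)) (a.2 \ox b.2)) (sg (unit * unit)%type (tpw L a.1 \ox tpw L b.1) (a.2 \ox b.2)).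
Proof. by []. Qed.
Let eui : uQi = @smor k A S unit unit tt (one A) (one S) (one A) (one S) (tpure (idm _) (idm _)) :> mor Q (sg unit (one A) (one S)) (sg unit (one A) (one S)).
Proof. by []. Qed.
Let idQ (a : nat * S) : idm (labQ a) = smor unit tt (tpure (idm (tpw L a.1)) (idm a.2)).
Proof. by rewrite (smor_id u1). Qed.
Let SL := pm_linear pS.
Let T3 a b (f : mor Q (labQ a) (labQ b)) v w : f = smor unit tt (tpure v w) ->
  labT f = (numL v *: KX a.1 b.1) \om (w : mor C (sval a.2) (sval b.2)).
Proof. by move=> ->; apply: labTE. Qed.

(** Each axiom splits into a pointed component, supplied by the calculus of powers, and a component
    in E, where the functor is the inclusion. Centralization enters in the bijection on Hom spaces
    and in the braiding. *)
Lemma factor_label_functor : @label_functor k Q C (nat * S) lab1 labop labQ labC labT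
  jQ jQi (fun a b => jx X a.1 (sval a.2) b.1 (sval b.2)) (fun a b => jxi X a.1 (sval a.2) b.1 (sval b.2))
  uQ uQi (li (one C)) (lunit (one C)).
Proof.
split.
- move=> a b c f g; rewrite /labT scaler_sumr -big_split; apply: eq_bigr => i _ /=.
  rewrite scaler_sumr -big_split; apply: eq_bigr => j _ /=.
  rewrite -[c *: f + g]/(dp_add (dp_scale c (f : dmor _ _)) (g : dmor _ _)) /dp_add /dp_scale !ffunE !mxE.
  by rewrite scalerDl scalerA.
- move=> a; rewrite (T3 (idQ a)) -(tenm_id CM); congr (_ \om _).
  exact: (lf_id plf a.1).
- move=> a b c g f; have [w fE] := labT_repr f; have [v gE] := labT_repr g.
  rewrite (T3 (pc u1 u1 fE gE)) (T3 fE) (T3 gE) -(tenm_comp CM); congr (_ \om _).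
  exact: (lf_comp plf (KL b.1 c.1) (KL a.1 b.1)).
- move=> a b; have ex (g : mor C (labC a) (labC b)) : exists f : mor Q (labQ a) (labQ b), labT f = g.
    have [w ->] := hom_tpw hC X1 sX prq Xd g (Ec (svalP a.2)) (Ec (svalP b.2)).
    exists (smor unit tt (tpure (KL a.1 b.1) (w : mor S a.2 b.2))); rewrite labTE; exact: tK.
  pose G g := proj1_sig (constructive_indefinite_description _ (ex g)).
  have GK : cancel G (@labT a b) by move=> g; exact: (proj2_sig (constructive_indefinite_description _ (ex g))).
  have inj : injective (@labT a b).
    move=> f g; have [w ->] := labT_repr f; have [v ->] := labT_repr g; rewrite !labTE.
    rewrite (tK _ _ w) (tK _ _ v) => e; have [r|/eqP r] := eqVneq (rho d' a.1) (rho d' b.1); last first.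
      by rewrite (K_off hA Ld r) -(scale0r (0 : mor A _ _)) !tpureZl !scale0r.
    congr (smor _ _ (tpure _ _)); apply/eqP; rewrite -subr_eq0; apply/eqP.
    apply: (@ten_inj0 k C hC d' X X1 Xd a.1 b.1 (sval a.2) (sval b.2) (w - v) r).
    by rewrite (tenmDr CM) e -(tenmDr CM) subrr (tenm0r CM).
  by exists G => // f; apply: inj; rewrite GK.
- move=> a b; have idd : inverse_of (idm (a.2 \ox b.2)) (idm (a.2 \ox b.2)) by split; rewrite (comp_idl SL).
  exact: (smor_inv pA pS u2 u1 (catiP hA L a.1 b.1) idd).
- by move=> a b; apply: jxP.
- have i1 : inverse_of (idm (one A)) (idm (one A)) by split; rewrite (comp_idl AL).
  have i2 : inverse_of (idm (one S)) (idm (one S)) by split; rewrite (comp_idl SL).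
  exact: (smor_inv pA pS u1 u1 i1 i2).
- by have [h1 h2] := liP CM (one C); split.
- move=> a a' b b' f g; have [w fE] := labT_repr f; have [v gE] := labT_repr g.
  have h := pc u1 u1 (pc u1 u2 (eJi a b) (pt u1 u1 u1 u1 fE gE)) (eJ a' b').
  rewrite (T3 fE) (T3 gE) (jx_nat hC); etransitivity; first exact: (T3 (a := labop a b) (b := labop a' b') h).
  congr (_ \om _); last by rewrite (comp_idl SL) (comp_idr SL).
  exact: (lf_ten plf (KL a.1 a'.1) (KL b.1 b'.1)).
- move=> a b c.
  have h1 := pt u1 u2 u1 u1 (eJi a b) (idQ c).
  have h3 := smor_assoc u1 u1 u1 (tpw L a.1) a.2 (tpw L b.1) b.2 (tpw L c.1) c.2.
  have h4 := pt u1 u1 u2 u1 (idQ a) (eJ b c).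
  have h := pc u1 u1 (pc u1 u2 (pc u1 u3' (pc u1 u3 (eJi (labop a b) c) h1) h3) h4) (eJ a (labop b c)).
  rewrite [RHS](jx_assoc hC Xd a.1 (sval a.2) b.1 (sval b.2) c.1 (sval c.2)); etransitivity; first exact: (T3 (a := labop (labop a b) c) (b := labop a (labop b c)) h).
  congr (_ \om _); last by rewrite !(pm_id pS) !(comp_idl SL) !(comp_idr SL).
  by rewrite /= [X in numL X](asc_K hA Ld); apply: tpT_K.
- move=> a; have h1 := pt u1 u1 u1 u1 eui (idQ a).
  have h := pc u1 u1 (pc u1 u2 (eJi lab1 a) h1) (smor_lunit u1 (tpw L a.1) a.2).
  rewrite [RHS](jx_lunit hC Xd a.1 (sval a.2)); etransitivity; first exact: (T3 (a := labop lab1 a) (b := a) h).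
  congr (_ \om _); last by rewrite !(pm_id pS) !(comp_idl SL) !(comp_idr SL).
  by rewrite /= [X in numL X](lunit_K hA Ld); apply: tpT_K.
- move=> a; have h1 := pt u1 u1 u1 u1 (idQ a) eui.
  have h := pc u1 u1 (pc u1 u2 (eJi a lab1) h1) (smor_runit u1 (tpw L a.1) a.2).
  rewrite [RHS](jx_runit hC Xd a.1 (sval a.2)); etransitivity; first exact: (T3 (a := labop a lab1) (b := a) h).
  congr (_ \om _); last by rewrite !(pm_id pS) !(comp_idl SL) !(comp_idr SL).
  by rewrite /= [X in numL X](runit_K hA Ld); apply: tpT_K.
move=> a b; have h1 := smor_braid u1 u1 (tpw L a.1) a.2 (tpw L b.1) b.2.
have h := pc u1 u1 (pc u1 u2 (eJi a b) h1) (eJ b a).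
have cs : centralizes (tpw X a.1) (sval b.2).
  apply: (centralizes_sym hC); have cf := centralizes_fsub hC (sval b.2).
  elim: (a.1) => [|n IH] /=; first exact: (fsub_one cf).
  by apply: (fsub_ten cf) => //; apply: (centralizes_sym hC); apply: Ec (svalP b.2).
rewrite [RHS](jx_braid hC X1 sX prq Xd (sval a.2) b.1 cs); etransitivity; first exact: (T3 (a := labop a b) (b := labop b a) h).
congr (_ \om _); last by rewrite !(comp_idl SL) !(comp_idr SL).
rewrite /= [X in numL X](braid_K hA L1 sL prq Ld) numZ -scalerA; congr (_ *: _); exact: tpT_K.
Qed.

Context (simpleL : forall V : A, brick V -> exists j, isomorphic V (tpw L j)).
Context (simpleC : forall V : C, brick V -> exists b : nat * S, isomorphic V (labC b)).

Lemma factorization : braided_equivalent C Q.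
Proof.
have [T' lf] := label_functor_sym factor_label_functor.
have DL : linear_category Q := deligne_linear pA pS.
apply: (label_equivalence (fus_pre hC) (deligne_pre pA pS) lf).
- move=> Z; have [n [V [Vs /dsum_fsum fV]]] := bf_semisimple hC Z.
  have ex i : exists b : nat * S, isomorphic (V i) (labC b) by apply: simpleC; apply/(simpleE hC).
  exists n, (fun i => proj1_sig (constructive_indefinite_description _ (ex i))); apply/dsum_fsum.
  apply: (fsum_map CL _ fV) => i; exact: (proj2_sig (constructive_indefinite_description _ (ex i))).
- move=> n b; exists (@DObj k A S 'I_n (fun i => tpw L (b i).1) (fun i => (b i).2)).
  by apply/dsum_fsum; exact: (dobj_fsum pA pS (@DObj k A S 'I_n (fun i => tpw L (b i).1) (fun i => (b i).2))).
- by move=> n b; apply: (has_dsums (bf_abelian hC)).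
move=> U; have ex i : exists n (f : 'I_n -> nat), is_dsum (fun j => tpw L (f j)) (@dl k A S U i).
  exact: powers_decompose.
pose nn i := proj1_sig (constructive_indefinite_description _ (ex i)).
have exf i := proj2_sig (constructive_indefinite_description _ (ex i)).
pose f i : 'I_(nn i) -> nat := proj1_sig (constructive_indefinite_description _ (exf i)).
have fP i : fsum (fun j => tpw L (@f i j)) (@dl k A S U i).
  by apply/dsum_fsum; exact: (proj2_sig (constructive_indefinite_description _ (exf i))).
have h := fsum_dsum (fsum_sigma DL (fun i => sing_fsum pA pS (@dr k A S U i) (fP i)) (dobj_fsum pA pS U)).
eexists; exists (fun a : 'I_#|{: {i : didx U & 'I_(nn i)}}| => let s := enum_val a in (@f (tag s) (tagged s), @dr k A S U (tag s))).
exact: h.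
Qed.
End Factorization.

(** * Non-degenerate quadratic forms on a cyclic group *)

Section CyclicMetric.
Context (k : fieldType) (d' : nat).
Local Notation Z := (Zmod d'.+1).
Implicit Types x y : Z.
Local Notation b1 := (inord 1 : Z).

Lemma gen_val j : val (b1 *+ j) = (j %% d'.+1)%N.
Proof.
rewrite (Zp_mulrn b1) /=; case: d' => [|n]; first by rewrite !modn1.
by rewrite inordK // mul1n.
Qed.
Lemma gen_all x : x = b1 *+ val x.
Proof. by apply: val_inj; rewrite gen_val modn_small // (ltn_ord (x : 'I_d'.+1)). Qed.
Lemma gen_eq0 j : (b1 *+ j == 0) = (d'.+1 %| j)%N.
Proof. by rewrite -val_eqE gen_val. Qed.

Context (q : Z -> k) (hq : nondeg_quadratic q).
Local Notation q1 := (q b1).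
Let q0n := quad_neq0 hq.
Let bD := quad_bichar hq.

Lemma bichar_sym x y : bichar q x y = bichar q y x.
Proof. by rewrite /bichar addrC (mulrC (q x)). Qed.
Lemma bichar_nz x y : bichar q x y != 0.
Proof. by rewrite mulf_neq0 ?invr_eq0 ?mulf_neq0 ?q0n. Qed.
Lemma bichar0 y : bichar q 0 y = 1.
Proof. by apply: (mulfI (bichar_nz 0 y)); rewrite -bD addr0 mulr1. Qed.
Lemma quad0 : q 0 = 1.
Proof.
have := bichar0 0; rewrite /bichar addr0 invfM mulrA mulfV // mul1r => e.
by rewrite -[q 0]invrK e invr1.
Qed.
(** Bilinearity gives that the values at (x, x) and (-x, x) are inverse to each other, and the
    second is 1 / q(x)^2 because q is even. *)
Lemma bichar_diag x : bichar q x x = q x ^+ 2.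
Proof.
have : bichar q x x * bichar q (- x) x = 1 by rewrite -bD subrr bichar0.
rewrite [bichar q (- x) x]/bichar addNr quad0 (quad_opp hq) mul1r => /(canRL (mulfK _)) ->.
  by rewrite mul1r invrK expr2.
by rewrite invr_eq0 mulf_neq0.
Qed.
Lemma bichar_mulrn x y j : bichar q (x *+ j) y = bichar q x y ^+ j.
Proof. by elim: j => [|j IH]; rewrite ?mulr0n ?bichar0 // mulrS bD IH exprS. Qed.
Lemma quad_mulrn x j : q (x *+ j) = q x ^+ (j ^ 2).
Proof.
elim: j => [|j IH]; first by rewrite mulr0n quad0.
have := bichar_mulrn x x j; rewrite bichar_diag [LHS]/bichar -mulrSr => /(canRL (divfK _)) ->.
  by rewrite IH -exprM -exprSr -exprD; congr (_ ^+ _); rewrite -!mulnn mulSn mulnS; lia.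
by rewrite mulf_neq0.
Qed.
Lemma quad_gen_order : q1 ^+ (d'.+1 ^ 2) = 1.
Proof. by rewrite -quad_mulrn (eqP (_ : b1 *+ d'.+1 == 0)) ?quad0 // gen_eq0. Qed.
(** If q(1)^2 had order m, the element m would pair trivially with every multiple of 1, so
    non-degeneracy gives m = 0 in Z/d. *)
Lemma quad_gen_prim : d'.+1.-primitive_root (q1 ^+ 2).
Proof.
have e1 : (q1 ^+ 2) ^+ d'.+1 = 1.
  by rewrite -bichar_diag -bichar_mulrn (eqP (_ : b1 *+ d'.+1 == 0)) ?bichar0 // gen_eq0.
have [m prm md] := prim_order_exists (ltn0Sn d') e1.
suff dm : (d'.+1 %| m)%N.
  by move: prm; suff -> : m = d'.+1 by []; apply/eqP; rewrite eqn_dvd md dm.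
rewrite -gen_eq0; apply/eqP; apply: (quad_nondeg hq) => y; rewrite (gen_all y).
by rewrite bichar_mulrn bichar_sym bichar_mulrn bichar_diag -exprM mulnC exprM (prim_expr_order prm) expr1n.
Qed.
End CyclicMetric.

Section PointedCategory.
Local Open Scope cat_scope.
Context (k : closedFieldType) (d' : nat) (q : Zmod d'.+1 -> k) (P : bmcat k) (hP : is_CBq q P).
Lemma pointed_powers : exists hA : braided_fusion P, exists L : P,
  [/\ FPdim L = 1, sbr L (q (inord 1)), isomorphic (one P) (tpw L d'.+1)
    & forall V, brick V -> exists j, isomorphic V (tpw L j)].
Proof.
have [bP [L [Ls Linj Lall LM Lq]]] := hP; exists bP; pose b1 : Zmod d'.+1 := inord 1.
have tr (X Y Z : P) := @isomorphic_trans _ _ (bf_linear bP) X Y Z.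
have Lj j : isomorphic (tpw (L b1) j) (L (b1 *+ j)).
  elim: j => [|j IH]; first by rewrite mulr0n; apply/isomorphic_sym/(pointed_unit bP Ls LM).
  rewrite mulrS; apply: tr (LM _ _).
  exact: (isomorphic_ten (bf_monoidal bP) (isomorphic_refl (bf_linear bP) _) IH).
have Ld : isomorphic (one P) (tpw (L b1) d'.+1).
  apply: isomorphic_sym; apply: tr (Lj _) _; have /eqP -> : b1 *+ d'.+1 == 0 by rewrite gen_eq0.
  exact: (pointed_unit bP Ls LM).
exists (L b1); split=> //; first last.
- move=> V /(simpleE bP)/Lall[b Vb]; exists (val b); apply: (tr _ _ _ Vb).
  by apply: isomorphic_sym; rewrite {2}(gen_all b).
- have Fj j : FPdim (tpw (L b1) j) = FPdim (L b1) ^+ j.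
    by elim: j => [|j IH] /=; rewrite ?(FPdim_one bP) ?(FPdim_ten bP) ?IH ?exprS.
  have := Fj d'.+1; rewrite -(FPdim_iso bP Ld) (FPdim_one bP) => /esym/eqP.
  by rewrite pexpr_eq1 ?(FPdim_ge0 bP) // => /eqP.
Qed.
End PointedCategory.

(** * Splitting off the powers of X *)

Section Splitting.
Local Open Scope cat_scope.
Context (k : closedFieldType) (A C : bmcat k) (hA : braided_fusion A) (hC : braided_fusion C).
Context (d' : nat) (q : k) (prq : d'.+1.-primitive_root (q ^+ 2)).
Context (L : A) (L1 : FPdim L = 1) (sL : sbr L q) (Ld : isomorphic (one A) (tpw L d'.+1)).
Context (simpleL : forall V : A, brick V -> exists j, isomorphic V (tpw L j)).
Context (X : C) (X1 : FPdim X = 1) (sX : sbr X q) (Xd : isomorphic (one C) (tpw X d'.+1)).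
Local Notation d := d'.+1.
Local Notation D := (Dsub hC X1 Xd).
Local Notation hL := (bf_linear hC).
Local Notation hM := (bf_monoidal hC).
Let tr := isomorphic_trans hL.

Lemma centralizer_generator r : centralizer D r -> centralizes X r.
Proof.
have Xb := FPdim1_brick hC X1; apply: (centralizer_centralizes hC); first exact/(simpleE hC).
have [g [gr rg]] := runit_iso hM X.
apply: (fsub_retract (fsubP D) (i := g) (p := runit X)) => //.
exact: (@Dmem_pow k C hC X X1 1).
Qed.

Lemma centralizer_brick r : brick r -> centralizes X r -> centralizer D r.
Proof.
move=> rb cr S; apply; split=> [|Z ZD /(simpleE hC) Zb]; first exact/(simpleE hC).
have [j Zj] := ZD Z Zb (hdim_gt0 (nz_brick Zb)).
have cf := centralizes_fsub hC r; apply: (centralizes_sym hC).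
have [f [g [gf fg]]] := Zj; apply: (fsub_retract cf gf).
elim: j {Zj f g gf fg} => [|j IH] /=; first exact: (fsub_one cf).
by apply: (fsub_ten cf) => //; apply: (centralizes_sym hC).
Qed.

(** The monodromy of V with X is a d-th root of unity because X^d is the unit, hence equals (q^2)^j
    for some j. The twist r of V by X^(d - j) then centralizes X, and V is X^j (x) r. *)
Lemma simple_split (V : C) : brick V ->
  exists b : nat * subcat (centralizer D), isomorphic V (tpw X b.1 \ox sval b.2).
Proof.
move=> Vb; have [a a0 aE] := mon_ex hC X1 Vb.
have ad : a ^+ d = 1.
  have Ed : mon (tpw X d) V (a ^+ d) := mon_tpw hC d (or_intror Vb) X1 aE.
  have E1 : mon V (one C) (a ^+ d) := mon_iso hC (isomorphic_sym Xd) (mon_sym hC Ed).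
  apply: (mon_uniq _ E1); last by rewrite /mon scale1r; apply: (centralizes_one hC).
  by apply: (ten_nz hC); apply: nz_brick => //; apply: one_brick.
have [j aj] := prim_rootP prq ad; pose r := tpw X (d - j) \ox V.
have rb : brick r := invertible_brick hC (FPdim_tpw hC _ X1) Vb.
have cr : centralizes X r.
  have := mon_tenr hC (mon_pow hC X1 sX (d - j)) aE.
  by rewrite aj -exprD subnK ?(prim_expr_order prq) /mon ?scale1r //; apply: ltnW.
exists (j : nat, exist _ r (centralizer_brick rb cr)) => /=; apply: isomorphic_sym.
have o1 : isomorphic (one C \ox V) V by exists (lunit V); apply: (lunit_iso hM).
apply: (tr _ o1); apply: (tr (isomorphic_sym (isomorphic_assoc hC _ _ _))).
apply: (isomorphic_ten hM) (isomorphic_refl hL V).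
apply: (tr (pow_add hC X _ _)); rewrite subnKC; [exact: isomorphic_sym | exact: ltnW].
Qed.

Lemma pointed_splitting : exists D : fusion_subcat C,
  braided_equivalent A (subcat D) /\ braided_equivalent C (deligne A (subcat (centralizer D))).
Proof.
exists D; split; first exact: (pointed_equivalence hA hC prq L1 sL Ld X1 sX Xd simpleL).
exact: (factorization hA hC prq L1 sL Ld X1 sX Xd centralizer_generator simpleL simple_split).
Qed.
End Splitting.

Section RegularAlgebra.
Local Open Scope cat_scope.
Context (k : closedFieldType) (C : bmcat k) (hC : braided_fusion C) (gT : finGroupType) (G : {group gT})
  (E : fusion_subcat C) (F : bfunctor (RepG k G) (subcat E)) (hF : is_equivalence F).

Lemma regA_galois : exists tau s, @galois_alg k C [subg G] (regA F) (regA_mul F) (regA_unit F) tau s.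
Proof.
have [si siP] := fmu_iso F (FunG k G) (FunG k G).
have := functor_galois (subcat_linear E (bf_linear hC)) (subcat_monoidal E (bf_monoidal hC)) siP
  (FunG_galois k G) (hF.1 _ _).
move=> h; exists (fun g : [subg G] => fmap F (@tauF k gT G g)), (si \oc fmap F (sF k G)).
by case: h => *; split.
Qed.

Lemma regA_centralizes X : centralizer E X -> centralizes (regA F) X.
Proof.
move=> EX; have [n [S [Ss dS]]] := bf_semisimple hC (regA F).
apply: (centralizes_sym hC); apply: (fsub_dsum (fsubP (FusionSubcat (centralizes_fsub hC X))) _ dS) => a /=.
apply: (centralizes_sym hC); apply: (centralizer_centralizes hC (Ss a)) EX.
have [i [p [pi _ _]]] := dS.
exact: (fsub_retract (fsubP E) (pi a) (svalP (F (FunG k G)))).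
Qed.
End RegularAlgebra.

Theorem theorem1p3 (k : closedFieldType) (char_k : [pchar k] =i pred0)
    (n d : nat) (n_gt0 : (0 < n)%N) (d_gt0 : (0 < d)%N)
    (d_sqf : square_free d) (co_nd : coprime n d)
    (C : bmcat k) (hC : braided_fusion C) (C_nondeg : nondegenerate_cat C)
    (C_dim : FPdim_cat C = (n * d)%:R)
    (gT : finGroupType) (G : {group gT}) (E : fusion_subcat C)
    (F : bfunctor (RepG k G) (subcat E)) (hF : is_equivalence F)
    (q : Zmod d -> k) (hq : nondeg_quadratic q)
    (P : bmcat k) (hP : is_CBq q P) (A : bmcat k) (hA : braided_fusion A)
    (hCG : braided_equivalent (CG0 hC hF) (deligne P A))
    (co_simple : forall V : C, simple_obj V ->
       forall m : nat, FPdim V ^+ 2 = m%:R -> coprime m d) :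
  exists D : fusion_subcat C,
    braided_equivalent P (subcat D) /\
    braided_equivalent C (deligne P (subcat (centralizer D))).
Proof.
case: d d_gt0 d_sqf co_nd C_dim q hq hP co_simple => // d' d_gt0 _ co_nd C_dim q hq hP co_simple.
have [tau [s hG]] := regA_galois hC hF; have [F' hF'] := hCG.
have [M [lM Mg Md Mq]] := local_module hC hG (@regA_centralizes k C hC gT G E F) d_gt0 hP hA hF'.
have [X0 [N [co_N X01 X0q]]] := invertible_object char_k C_nondeg d_gt0 C_dim co_simple lM Mg Md Mq.
have nd_gt0 : (0 < n * d'.+1)%N by rewrite muln_gt0 n_gt0.
have [X [X1 Xd sX]] := pointed_generator hC C_nondeg X01 C_dim erefl nd_gt0 co_nd co_N X0q
  (quad_gen_prim hq) (quad_gen_order hq).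
have [bP [L [L1 sL Ld simpleL]]] := pointed_powers hP.
exact: (pointed_splitting bP hC (quad_gen_prim hq) L1 sL Ld simpleL X1 sX Xd).
Qed.
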